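(* Let $z_1=r_1e^{i\theta_1}$ ($r_1>0$, $0<\theta_1<\pi$) be the zero of $e^z-1-z$ in the open upper half-plane of smallest modulus. Then for every $s\in\mathbb{C}$ with $\Re(s)<0$, $$|\zeta_2(s)|<4\,r_1^{\Re(s)-1}\,|\Gamma(-s)|\,e^{|\Im(s)|(\pi-\theta_1)}\,\zeta(1-\Re(s)),$$ where $\zeta$ is the Riemann zeta function.
   Context: $\zeta_2$ is defined for $\Re(s)>1$ by $\zeta_2(s)=\frac{1}{\Gamma(s+1)}\int_0^\infty \frac{x^{s}}{e^x-1-x}\,dx$, and $\zeta_2$ also denotes its meromorphic continuation to $\mathbb{C}$. *)

(* Defs.v *)
From Stdlib Require Export Reals.
From Coquelicot Require Export Coquelicot.

Open Scope R_scope.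

Definition Cexp (z : C) : C :=
  (exp (Re z) * cos (Im z), exp (Re z) * sin (Im z)).

(* [x ^ s] for a positive real [x], with the real logarithm of [x]. *)
Definition Rcpow (x : R) (s : C) : C := Cexp (s * RtoC (ln x))%C.

(* Improper on both sides: for [zeta2_half_plane] with [1 < Re s < 2] the
   integrand is unbounded near 0. *)
Definition CInt_0_infty (f : R -> C) : C :=
  @RInt_gen C_R_CompleteNormedModule f (at_right 0) (Rbar_locally p_infty).

(* Euler's integral: this is the Gamma function only where [0 < Re s]. *)
Definition Gamma (s : C) : C :=
  CInt_0_infty (fun x => (Rcpow x (s - 1) * RtoC (exp (- x)))%C).

(* Dirichlet series: this is the Riemann zeta function only where [1 < x]. *)
Definition Rzeta (x : R) : R := Series (fun n => / Rpower (INR (S n)) x).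

(* Meaningful only where [1 < Re s]. *)
Definition zeta2_half_plane (s : C) : C :=
  (/ Gamma (s + 1) *
   CInt_0_infty (fun x => Rcpow x s / RtoC (exp x - 1 - x)))%C.

Definition C_differentiable (f : C -> C) (z : C) : Prop :=
  @ex_derive C_AbsRing C_NormedModule f z.

Definition holomorphic_at (f : C -> C) (z0 : C) : Prop :=
  exists r : R, 0 < r /\
    forall z : C, Cmod (z - z0)%C < r -> C_differentiable f z.

(* The value of [f] at the pole itself is unconstrained. *)
Definition pole_at (f : C -> C) (z0 : C) : Prop :=
  exists (n : nat) (g : C -> C) (r : R),
    (0 < n)%nat /\ 0 < r /\ holomorphic_at g z0 /\ g z0 <> RtoC 0 /\
    forall z : C, 0 < Cmod (z - z0)%C < r -> f z = (g z / (z - z0) ^ n)%C.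

(* Removable singularities are taken to be removed: away from its poles,
   a meromorphic function is holomorphic. *)
Definition meromorphic (f : C -> C) : Prop :=
  forall z : C, holomorphic_at f z \/ pole_at f z.

(* By the identity theorem, such an [f] is unique up to its values at poles. *)
Definition is_zeta2 (f : C -> C) : Prop :=
  meromorphic f /\ forall s : C, 1 < Re s -> f s = zeta2_half_plane s.

Definition upper_zero (z : C) : Prop :=
  0 < Im z /\ (Cexp z - 1 - z)%C = RtoC 0.

Definition smallest_upper_zero (z : C) : Prop :=
  upper_zero z /\ forall w : C, upper_zero w -> Cmod z <= Cmod w.

(* Main.v *)
(** For [Re s < 0] the continuation is
    [zeta2 s = Gamma (- s) * sum_a (- a)^s / a], over the nonzero zeros [a] of
    [e^z - 1 - z].  The partial fraction expansion of [1 / (e^z - 1 - z)] comes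
    from the maximum principle on strips whose edges avoid the zeros; integrated
    against [x^s] term by term, using the Stieltjes transform of a power, it gives
    the formula on a vertical strip, and the identity theorem does the rest.

    The zeros come in conjugate pairs, one in the upper half-plane for each
    [k >= 1], with [2 pi k < Im z < 2 pi k + pi / 2] and argument at least
    [theta1], so that [|(- a)^s| <= |a|^(Re s) e^(|Im s| (pi - theta1))].  As
    [r1 < 3 pi], the [k]-th modulus exceeds [2 pi k > (2 / 3) k r1], and is at
    least [ceil (k / 2) r1], for [k = 1] by the choice of [r1]: conjugation and
    the ceiling each cost a factor [2]. *)

Require Import Defs.
From Stdlib Require Import ssreflect.
From Stdlib Require Import Lra Lia Factorial Ranalysis5 List ClassicalEpsilon FunctionalExtensionality.
Local Open Scope general_if_scope.

(** * Limits and derivatives in the complex plane *)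

(** The double pole of [1 / (e^z - 1 - z)] at 0 separates the two regions: the defining integral
    needs [1 < Re s], termwise integration needs [-1 < Re s < 0]. The bridge is [kernel_mellin].
    Subtracting the polar part damped by [e^(-x)] leaves a kernel whose Mellin transform converges
    for [-1 < Re s]. The damped polar part on the right, and its difference with the true polar part
    on the strip, integrate to one and the same expression in [Gamma (s + 1)]. The fractions have
    the form [1 / (a (z - a))] because the derivative of [e^z - 1 - z] at a zero [a] is
    [e^a - 1 = a]. Complex analysis rests on Goursat's lemma for triangles in a half-plane. Pulling
    back by the exponential turns circles into vertical segments; the resulting circle means yield
    the mean value property, differentiability of derivatives, isolated zeros and the maximum
    principle, with no residue calculus. Exchanges of limit and integral are all made by explicit
    bounds, linear in the constant of a two-sided power domination. *)

Definition clim {T : Type} (f : T -> C) (F : (T -> Prop) -> Prop) (l : C) : Prop :=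
  forall eps : R, 0 < eps -> F (fun x => Cmod (f x - l)%C < eps).

Lemma C_eq (z w : C) : Re z = Re w -> Im z = Im w -> z = w.
Proof. destruct z, w; simpl; intros -> ->; reflexivity. Qed.

Lemma Cmod_sub_sym (a b : C) : Cmod (a - b)%C = Cmod (b - a)%C.
Proof. rewrite <- Cmod_opp. f_equal. ring. Qed.

Lemma Cmod_sub_0 (a b : C) : Cmod (a - b)%C = 0 -> a = b.
Proof.
  intros H. apply Cmod_eq_0 in H. replace a with ((a - b) + b)%C by ring.
  rewrite H. ring.
Qed.

Lemma Cmod_sub_triangle (a b c : C) :
  Cmod (a - c)%C <= Cmod (a - b)%C + Cmod (b - c)%C.
Proof.
  replace (a - c)%C with ((a - b) + (b - c))%C by ring. apply Cmod_triangle.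
Qed.

Lemma Cmod_triangle_sub (a b : C) : Cmod (a - b)%C <= Cmod a + Cmod b.
Proof.
  rewrite <- (Cmod_opp b). apply Cmod_triangle.
Qed.

Lemma Cmod_rev_triangle (a b : C) : Cmod a - Cmod b <= Cmod (a - b)%C.
Proof.
  pose proof (Cmod_triangle (a - b)%C b) as H.
  replace (a - b + b)%C with a in H by ring. lra.
Qed.

Lemma im_le_Cmod (c : C) : Rabs (Im c) <= Cmod c.
Proof.
  eapply Rle_trans; [| apply Rmax_Cmod]. apply Rmax_r.
Qed.

Lemma Cmod_le_re_im (c : C) : Cmod c <= Rabs (Re c) + Rabs (Im c).
Proof.
  destruct c as [x y]; simpl.
  replace (x, y) with (RtoC x + Ci * RtoC y)%C
    by (apply C_eq; simpl; ring).
  eapply Rle_trans; [apply Cmod_triangle|].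
  rewrite Cmod_mult Cmod_Ci !Cmod_R. lra.
Qed.

Lemma locally_C (z : C) (d : R) : 0 < d ->
  @locally C_UniformSpace z (fun w => Cmod (w - z)%C < d).
Proof.
  intros Hd.
  assert (H2 : 0 < d / 2) by lra.
  exists (mkposreal _ H2). intros w [H1 H3].
  eapply Rle_lt_trans; [apply Cmod_le_re_im|].
  change (Rabs (fst w - fst z) < d/2) in H1.
  change (Rabs (snd w - snd z) < d/2) in H3.
  destruct w as [a b], z as [a' b']; simpl in *. 
  unfold Rminus in *. lra.
Qed.

Lemma locally_C_inv (z : C) (P : C -> Prop) :
  @locally C_UniformSpace z P ->
  exists d, 0 < d /\ forall w, Cmod (w - z)%C < d -> P w.
Proof.
  intros [d H]. exists d. split; [apply cond_pos|].
  intros w Hw. apply H. now apply C_NormedModule_mixin_compat1.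
Qed.

Lemma locally_R (t d : R) : 0 < d -> locally t (fun u => Rabs (u - t) < d).
Proof. intros Hd. exists (mkposreal _ Hd). intros u Hu. exact Hu. Qed.

Section Clim.
Context {T : Type} (F : (T -> Prop) -> Prop) {FF : Filter F}.

Lemma clim_const (c : C) : clim (fun _ => c) F c.
Proof.
  intros e He. apply filter_forall. intros _. 
  replace (c - c)%C with (RtoC 0) by ring. now rewrite Cmod_0.
Qed.

Lemma clim_ext_loc (f g : T -> C) l :
  F (fun x => f x = g x) -> clim f F l -> clim g F l.
Proof.
  intros H Hf e He. generalize (filter_and _ _ H (Hf e He)).
  apply filter_imp. now intros x [<- ?].
Qed.

Lemma clim_ext (f g : T -> C) l :
  (forall x, f x = g x) -> clim f F l -> clim g F l.
Proof. intros H. apply clim_ext_loc. now apply filter_forall. Qed.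

Lemma clim_eq (f : T -> C) l m : l = m -> clim f F l -> clim f F m.
Proof. now intros ->. Qed.

Lemma clim_plus (f g : T -> C) l m :
  clim f F l -> clim g F m -> clim (fun x => f x + g x)%C F (l + m)%C.
Proof.
  intros Hf Hg e He.
  assert (He2 : 0 < e / 2) by lra.
  generalize (filter_and _ _ (Hf _ He2) (Hg _ He2)).
  apply filter_imp. intros x [H1 H2].
  replace (f x + g x - (l + m))%C with ((f x - l) + (g x - m))%C by ring.
  eapply Rle_lt_trans; [apply Cmod_triangle|]. lra.
Qed.

Lemma clim_scal (c : C) (f : T -> C) l :
  clim f F l -> clim (fun x => c * f x)%C F (c * l)%C.
Proof.
  intros Hf e He. pose proof (Cmod_ge_0 c) as Hc.
  assert (He2 : 0 < e / (Cmod c + 1)) by (apply Rdiv_lt_0_compat; lra).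
  generalize (Hf _ He2). apply filter_imp. intros x Hx.
  replace (c * f x - c * l)%C with (c * (f x - l))%C by ring.
  rewrite Cmod_mult.
  apply Rle_lt_trans with (Cmod c * (e / (Cmod c + 1))).
  - apply Rmult_le_compat_l; lra.
  - apply Rmult_lt_reg_r with (Cmod c + 1); [lra|]. 
    field_simplify; [|lra]. nra.
Qed.

Lemma clim_opp (f : T -> C) l : clim f F l -> clim (fun x => - f x)%C F (- l)%C.
Proof.
  intros H. replace (- l)%C with (- (1) * l)%C by ring.
  apply clim_ext with (fun x => - (1) * f x)%C; [intros; ring|].
  now apply clim_scal.
Qed.

Lemma clim_minus (f g : T -> C) l m :
  clim f F l -> clim g F m -> clim (fun x => f x - g x)%C F (l - m)%C.
Proof. intros Hf Hg. apply clim_plus; [exact Hf|]. now apply clim_opp. Qed.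

Lemma clim_0_mult_bounded (f g : T -> C) M :
  clim f F 0 -> F (fun x => Cmod (g x) <= M) -> clim (fun x => f x * g x)%C F 0.
Proof.
  intros Hf Hg e He.
  assert (HM : 0 < Rabs M + 1) by (pose proof (Rabs_pos M); lra).
  assert (He2 : 0 < e / (Rabs M + 1)) by (apply Rdiv_lt_0_compat; lra).
  generalize (filter_and _ _ (Hf _ He2) Hg). apply filter_imp. intros x [H1 H2].
  replace (f x - 0)%C with (f x) in H1 by ring.
  replace (f x * g x - 0)%C with (f x * g x)%C by ring.
  rewrite Cmod_mult.
  pose proof (Rle_abs M). pose proof (Cmod_ge_0 (f x)). pose proof (Cmod_ge_0 (g x)).
  replace e with (e / (Rabs M + 1) * (Rabs M + 1)) by (field; lra).
  apply Rle_lt_trans with (Cmod (f x) * (Rabs M + 1)).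
  - apply Rmult_le_compat_l; lra.
  - apply Rmult_lt_compat_r; lra.
Qed.

Lemma clim_0_iff (f : T -> C) l : clim f F l <-> clim (fun x => f x - l)%C F 0.
Proof.
  split; intros H e He; generalize (H e He); apply filter_imp; intros x.
  - now replace (f x - l - 0)%C with (f x - l)%C by ring.
  - now replace (f x - l - 0)%C with (f x - l)%C by ring.
Qed.

Lemma clim_bounded (f : T -> C) l :
  clim f F l -> F (fun x => Cmod (f x) <= Cmod l + 1).
Proof.
  intros Hf. generalize (Hf 1 Rlt_0_1). apply filter_imp. intros x Hx.
  pose proof (Cmod_rev_triangle (f x) l). lra.
Qed.

Lemma clim_mult (f g : T -> C) l m :
  clim f F l -> clim g F m -> clim (fun x => f x * g x)%C F (l * m)%C.
Proof.
  intros Hf Hg. apply clim_0_iff.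
  apply clim_ext with (fun x => (f x - l) * g x + l * (g x - m))%C;
    [intros; ring|].
  replace (RtoC 0) with (0 + l * 0)%C by ring.
  apply clim_plus.
  - apply clim_0_mult_bounded with (Cmod m + 1); [now apply clim_0_iff in Hf|].
    now apply clim_bounded.
  - apply clim_scal. now apply clim_0_iff in Hg.
Qed.

Lemma clim_away_0 (f : T -> C) l :
  clim f F l -> l <> 0 -> F (fun x => Cmod l / 2 <= Cmod (f x)).
Proof.
  intros Hf Hl. apply Cmod_gt_0 in Hl.
  assert (H2 : 0 < Cmod l / 2) by lra.
  generalize (Hf _ H2). apply filter_imp. intros x Hx.
  pose proof (Cmod_rev_triangle l (f x)). rewrite (Cmod_sub_sym l (f x)) in H. lra.
Qed.

Lemma clim_inv (f : T -> C) l :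
  clim f F l -> l <> 0 -> clim (fun x => / f x)%C F (/ l)%C.
Proof.
  intros Hf Hl. apply clim_0_iff.
  pose proof (clim_away_0 _ _ Hf Hl) as Ha.
  assert (Hl' := Hl). apply Cmod_gt_0 in Hl'.
  apply clim_ext_loc with (fun x => (f x - l) * (- / (f x * l)))%C.
  - generalize Ha. apply filter_imp. intros x Hx.
    assert (f x <> 0) by (apply Cmod_gt_0; lra). field. auto.
  - apply clim_0_mult_bounded with (/ (Cmod l / 2 * Cmod l)).
    + now apply clim_0_iff in Hf.
    + generalize Ha. apply filter_imp. intros x Hx.
      assert (f x <> 0) by (apply Cmod_gt_0; lra).
      rewrite Cmod_opp Cmod_inv. 2: now apply Cmult_neq_0.
      rewrite Cmod_mult. apply Rinv_le_contravar; [nra|].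
      apply Rmult_le_compat_r; lra.
Qed.

Lemma clim_div (f g : T -> C) l m :
  clim f F l -> clim g F m -> m <> 0 -> clim (fun x => f x / g x)%C F (l / m)%C.
Proof. intros. apply clim_mult; [assumption|]. now apply clim_inv. Qed.

Lemma clim_squeeze (f : T -> C) (g : T -> R) l :
  F (fun x => Cmod (f x - l)%C <= g x) ->
  (forall e, 0 < e -> F (fun x => g x < e)) -> clim f F l.
Proof.
  intros H1 H2 e He. generalize (filter_and _ _ H1 (H2 e He)).
  apply filter_imp. intros x []. lra.
Qed.

End Clim.

Lemma clim_unique {T} (F : (T -> Prop) -> Prop) {FF : ProperFilter' F} f l m :
  clim f F l -> clim f F m -> l = m.
Proof.
  intros Hf Hg. apply Cmod_sub_0.
  apply Rle_antisym; [|apply Cmod_ge_0]. apply Rnot_lt_le. intros He.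
  assert (He2 : 0 < Cmod (l - m)%C / 2) by lra.
  apply (@filter_not_empty T F _).
  generalize (filter_and _ _ (Hf _ He2) (Hg _ He2)). apply filter_imp. 
  intros x [H1 H2]. pose proof (Cmod_sub_triangle l (f x) m).
  rewrite (Cmod_sub_sym l (f x)) in H. lra.
Qed.

Lemma clim_le {T} (F : (T -> Prop) -> Prop) {FF : ProperFilter' F} f l B :
  clim f F l -> F (fun x => Cmod (f x) <= B) -> Cmod l <= B.
Proof.
  intros Hf HB. apply Rnot_lt_le. intros H.
  assert (He2 : 0 < Cmod l - B) by lra.
  apply (@filter_not_empty T F _).
  generalize (filter_and _ _ (Hf _ He2) HB). apply filter_imp. 
  intros x [H1 H2]. pose proof (Cmod_rev_triangle l (f x)).
  rewrite (Cmod_sub_sym l (f x)) in H0. lra.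
Qed.

Lemma clim_filterlim {T} (F : (T -> Prop) -> Prop) {FF : Filter F} (f : T -> C) l :
  clim f F l <-> filterlim f F (@locally C_UniformSpace l).
Proof.
  split.
  - intros H P HP. destruct (locally_C_inv _ _ HP) as [d [Hd HPd]].
    unfold filtermap. generalize (H d Hd). apply filter_imp. intros x. apply HPd.
  - intros H e He. apply (H _ (locally_C l e He)).
Qed.

Lemma clim_comp {T U} (F : (T -> Prop) -> Prop) (G : (U -> Prop) -> Prop)
  (g : T -> U) (f : U -> C) l :
  filterlim g F G -> clim f G l -> clim (fun x => f (g x)) F l.
Proof. intros Hg Hf e He. apply (Hg _ (Hf e He)). Qed.

Lemma clim_comp_C {T} (F : (T -> Prop) -> Prop) {FF : Filter F} (g : T -> C) (f : C -> C) m l :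
  clim g F m -> clim f (locally m) l -> clim (fun x => f (g x)) F l.
Proof.
  intros Hg. apply clim_comp. now apply clim_filterlim.
Qed.

Lemma clim_id (z : C) : clim (fun w => w) (@locally C_UniformSpace z) z.
Proof. intros e He. now apply locally_C. Qed.

Lemma clim_RtoC {T} (F : (T -> Prop) -> Prop) {FF : Filter F} (f : T -> R) l :
  filterlim f F (locally l) -> clim (fun x => RtoC (f x)) F (RtoC l).
Proof.
  intros H e He. generalize (H _ (locally_R l e He)). unfold filtermap. apply filter_imp.
  intros x Hx. rewrite <- RtoC_minus, Cmod_R. exact Hx.
Qed.

(** Carathéodory derivative along [iota]: [iota] is the identity of [C] for
    complex differentiation and [RtoC] for curves. *)
Definition diffg {X : UniformSpace} (iota : X -> C) (f : X -> C) (x : X) (l : C) : Prop :=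
  exists phi : X -> C,
    locally x (fun w => f w = f x + phi w * (iota w - iota x))%C /\
    clim phi (locally x) l.

Definition cdiff (f : C -> C) (z l : C) : Prop :=
  diffg (X := C_UniformSpace) (fun w => w) f z l.

Definition rdiff (f : R -> C) (t : R) (l : C) : Prop :=
  diffg (X := R_UniformSpace) RtoC f t l.

Section Diffg.
Context {X : UniformSpace} (iota : X -> C).
Implicit Types (f g : X -> C) (x : X).

Lemma diffg_const c x : diffg iota (fun _ => c) x 0.
Proof.
  exists (fun _ => RtoC 0). split; [|apply clim_const; try typeclasses eauto].
  apply filter_forall. intros; ring.
Qed.

Lemma diffg_iota x : diffg iota iota x 1.
Proof.
  exists (fun _ => RtoC 1). split; [|apply clim_const; try typeclasses eauto].
  apply filter_forall. intros; ring.
Qed.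

Lemma diffg_ext_loc f g x l :
  locally x (fun w => f w = g w) -> diffg iota f x l -> diffg iota g x l.
Proof.
  intros H [phi [H1 H2]]. exists phi. split; [|assumption].
  pose proof (locally_singleton _ _ H) as Hx.
  generalize (filter_and _ _ H H1). apply filter_imp.
  intros w [E1 E2]. now rewrite <- E1, <- Hx.
Qed.

Lemma diffg_ext f g x l :
  (forall w, f w = g w) -> diffg iota f x l -> diffg iota g x l.
Proof. intros H. apply diffg_ext_loc. now apply filter_forall. Qed.

Lemma diffg_eq f x l m : l = m -> diffg iota f x l -> diffg iota f x m.
Proof. now intros ->. Qed.

Lemma diffg_plus f g x l m :
  diffg iota f x l -> diffg iota g x m ->
  diffg iota (fun w => f w + g w)%C x (l + m)%C.
Proof.
  intros [p [H1 H2]] [q [H3 H4]]. exists (fun w => p w + q w)%C. split.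
  - generalize (filter_and _ _ H1 H3). apply filter_imp.
    intros w [-> ->]. ring.
  - apply clim_plus; auto; try typeclasses eauto.
Qed.

Hypothesis Hiota : forall x, clim iota (locally x) (iota x).

Lemma diffg_cont f x l : diffg iota f x l -> clim f (locally x) (f x).
Proof.
  intros [p [H1 H2]].
  apply clim_ext_loc with (fun w => f x + p w * (iota w - iota x))%C; try typeclasses eauto.
  - generalize H1. apply filter_imp. now intros w ->.
  - apply clim_eq with (f x + l * (iota x - iota x))%C; [ring|].
    apply clim_plus; try typeclasses eauto. apply clim_const; try typeclasses eauto.
    apply clim_mult; try typeclasses eauto; auto.
    apply clim_minus; try typeclasses eauto; auto. apply clim_const; try typeclasses eauto.
Qed.

Lemma diffg_mult f g x l m :
  diffg iota f x l -> diffg iota g x m ->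
  diffg iota (fun w => f w * g w)%C x (l * g x + f x * m)%C.
Proof.
  intros Hf Hg. pose proof (diffg_cont _ _ _ Hg) as Hc.
  destruct Hf as [p [H1 H2]], Hg as [q [H3 H4]].
  exists (fun w => p w * g w + f x * q w)%C. split.
  - generalize (filter_and _ _ H1 H3). apply filter_imp.
    intros w [E1 E2]. rewrite E1. rewrite E2. ring.
  - apply clim_plus; try typeclasses eauto.
    + apply clim_mult; auto; try typeclasses eauto.
    + apply clim_scal; auto; try typeclasses eauto.
Qed.

Lemma diffg_inv f x l :
  diffg iota f x l -> f x <> 0 ->
  diffg iota (fun w => / f w)%C x (- l / (f x * f x))%C.
Proof.
  intros Hf H0. pose proof (diffg_cont _ _ _ Hf) as Hc.
  destruct Hf as [p [H1 H2]].
  exists (fun w => - p w / (f w * f x))%C. split.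
  - pose proof (clim_away_0 _ _ _ Hc H0) as Ha.
    apply Cmod_gt_0 in H0.
    generalize (filter_and _ _ H1 Ha). apply filter_imp.
    intros w [E1 E2]. assert (f w <> 0) by (apply Cmod_gt_0; lra).
    assert (f x <> 0) by (apply Cmod_gt_0; lra).
    assert (E : (p w * (iota w - iota x) = f w - f x)%C) by (rewrite E1; ring).
    replace (- p w / (f w * f x) * (iota w - iota x))%C
      with (- (p w * (iota w - iota x)) / (f w * f x))%C by (field; auto).
    rewrite E. field; auto.
  - apply clim_div; try typeclasses eauto.
    + apply clim_opp; auto; try typeclasses eauto.
    + apply clim_mult; auto; try typeclasses eauto. apply clim_const; try typeclasses eauto.
    + now apply Cmult_neq_0.
Qed.

Lemma diffg_comp (h : C -> C) f x l m :
  cdiff h (f x) l -> diffg iota f x m ->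
  diffg iota (fun w => h (f w)) x (l * m)%C.
Proof.
  intros [p [H1 H2]] Hf. pose proof (diffg_cont _ _ _ Hf) as Hc.
  destruct Hf as [q [H3 H4]].
  exists (fun w => p (f w) * q w)%C. split.
  - apply clim_filterlim in Hc; [|try typeclasses eauto].
    assert (H5 : locally x (fun w => h (f w) = (h (f x) + p (f w) * (f w - f x))%C))
      by exact (Hc _ H1).
    generalize (filter_and _ _ H5 H3). apply filter_imp.
    intros w [E1 E2]. rewrite E1.
    replace (f w - f x)%C with (q w * (iota w - iota x))%C by (rewrite E2; ring).
    ring.
  - apply clim_mult; try typeclasses eauto; auto.
    now apply clim_comp_C with (f x); try typeclasses eauto.
Qed.

Lemma diffg_scal c f x l :
  diffg iota f x l -> diffg iota (fun w => c * f w)%C x (c * l)%C.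
Proof.
  intros H. eapply diffg_eq; [|apply diffg_mult; [apply diffg_const|exact H]].
  cbv beta. ring.
Qed.

Lemma diffg_minus f g x l m :
  diffg iota f x l -> diffg iota g x m ->
  diffg iota (fun w => f w - g w)%C x (l - m)%C.
Proof.
  intros Hf Hg. apply diffg_ext with (fun w => f w + - (1) * g w)%C.
  intros; ring. eapply diffg_eq; [|apply diffg_plus; [exact Hf|apply diffg_scal, Hg]].
  ring.
Qed.

Lemma diffg_div f g x l m :
  diffg iota f x l -> diffg iota g x m -> g x <> 0 ->
  diffg iota (fun w => f w / g w)%C x ((l * g x - f x * m) / (g x * g x))%C.
Proof.
  intros Hf Hg H0.
  eapply diffg_eq; [|apply diffg_mult; [exact Hf|apply diffg_inv; [exact Hg|exact H0]]].
  cbv beta. field; auto.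
Qed.

(** The slope function is the difference quotient, completed by [l] where [iota w = iota x]. *)
Lemma diffg_eps f x l :
  (forall e, 0 < e -> locally x (fun w =>
     Cmod (f w - f x - l * (iota w - iota x))%C <= e * Cmod (iota w - iota x)%C)) ->
  diffg iota f x l.
Proof.
  intros H.
  exists (fun w => if excluded_middle_informative ((iota w - iota x)%C = 0) then l
                   else (f w - f x) / (iota w - iota x))%C. split.
  - generalize (H 1 Rlt_0_1). apply filter_imp. intros w Hw.
    destruct (excluded_middle_informative _) as [E|E].
    + rewrite E in Hw. rewrite E. rewrite Cmod_0 in Hw.
      assert (E2 : Cmod (f w - f x - l * 0)%C = 0).
      { apply Rle_antisym; [lra|apply Cmod_ge_0]. }
      replace (f w - f x - l * 0)%C with (f w - f x)%C in E2 by ring.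
      apply Cmod_sub_0 in E2. rewrite E2. ring.
    + field. exact E.
  - intros e He. assert (He2 : 0 < e / 2) by lra.
    generalize (H _ He2). apply filter_imp. intros w Hw.
    destruct (excluded_middle_informative _) as [E|E].
    + replace (l - l)%C with (RtoC 0) by ring. now rewrite Cmod_0.
    + replace ((f w - f x) / (iota w - iota x) - l)%C with
        ((f w - f x - l * (iota w - iota x)) / (iota w - iota x))%C by (field; exact E).
      rewrite Cmod_div; [|exact E]. apply Cmod_gt_0 in E.
      apply Rle_lt_trans with (e / 2); [|lra].
      apply Rmult_le_reg_r with (Cmod (iota w - iota x)%C); [exact E|].
      unfold Rdiv at 1. rewrite Rmult_assoc Rinv_l; lra.
Qed.

Lemma diffg_eps_inv f x l : diffg iota f x l ->
  forall e, 0 < e -> locally x (fun w =>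
     Cmod (f w - f x - l * (iota w - iota x))%C <= e * Cmod (iota w - iota x)%C).
Proof.
  intros [p [H1 H2]] e He. generalize (filter_and _ _ H1 (H2 e He)).
  apply filter_imp. intros w [E1 E2].
  replace (f w - f x - l * (iota w - iota x))%C
    with ((p w - l) * (iota w - iota x))%C.
  - rewrite Cmod_mult. apply Rmult_le_compat_r; [apply Cmod_ge_0|lra].
  - rewrite E1. ring.
Qed.

(** The form in which Mellin transforms, Stieltjes transforms and the series over the zeros are
    differentiated: a quadratic bound on the Taylor remainder of the integrand or term passes
    directly to the integral or sum. *)
Lemma diffg_quad f x l K :
  locally x (fun w =>
     Cmod (f w - f x - l * (iota w - iota x))%C <= K * Cmod (iota w - iota x)%C ^ 2) ->
  diffg iota f x l.
Proof.
  intros H. apply diffg_eps. intros e He.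
  assert (HK : 0 < Rabs K + 1) by (pose proof (Rabs_pos K); lra).
  assert (He2 : 0 < e / (Rabs K + 1)) by (apply Rdiv_lt_0_compat; lra).
  generalize (filter_and _ _ H (Hiota x _ He2)). apply filter_imp. intros w [E1 E2].
  eapply Rle_trans; [exact E1|].
  pose proof (Cmod_ge_0 (iota w - iota x)%C). pose proof (Rle_abs K).
  replace (K * Cmod (iota w - iota x)%C ^ 2)
    with (K * Cmod (iota w - iota x)%C * Cmod (iota w - iota x)%C) by ring.
  apply Rmult_le_compat_r; [assumption|].
  apply Rle_trans with ((Rabs K + 1) * (e / (Rabs K + 1))).
  - nra.
  - right. field. lra.
Qed.

End Diffg.

Lemma cid_cont (z : C) : clim (fun w => w) (@locally C_UniformSpace z) z.
Proof. apply clim_id. Qed.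

Lemma RtoC_cont (t : R) : clim RtoC (@locally R_UniformSpace t) (RtoC t).
Proof. apply (clim_RtoC _ (fun u => u)). apply filterlim_id. Qed.

Lemma cdiff_cont f z l : cdiff f z l -> clim f (@locally C_UniformSpace z) (f z).
Proof. apply diffg_cont. apply cid_cont. Qed.

Lemma rdiff_cont f t l : rdiff f t l -> clim f (@locally R_UniformSpace t) (f t).
Proof. apply diffg_cont. apply RtoC_cont. Qed.

Lemma rdiff_is_derive (f : R -> C) t l : rdiff f t l ->
  is_derive (fun u => Re (f u)) t (Re l) /\ is_derive (fun u => Im (f u)) t (Im l).
Proof.
  intros H. pose proof (diffg_eps_inv _ _ _ _ H) as He.
  split; apply is_derive_Reals; intros e He0;
    assert (He1 : 0 < e / 2) by lra;
    destruct (He _ He1) as [d Hd]; exists d; intros h Hh0 Hh;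
    specialize (Hd (t + h));
    assert (Hb : ball t d (t + h))
      by (change (Rabs (t + h - t) < d); now replace (t + h - t) with h by ring);
    specialize (Hd Hb); rewrite <- RtoC_minus in Hd;
    replace (t + h - t) with h in Hd by ring; rewrite Cmod_R in Hd;
    apply Rabs_pos_lt in Hh0;
    apply Rle_lt_trans with (e / 2); try lra;
    apply Rmult_le_reg_r with (Rabs h); try lra;
    rewrite <- Rabs_mult; (eapply Rle_trans; [|exact Hd]).
  - eapply Rle_trans; [|apply re_le_Cmod]. right. f_equal.
    destruct (f (t + h)), (f t), l; simpl. field.
    intros ->. rewrite Rabs_R0 in Hh0. lra.
  - eapply Rle_trans; [|apply im_le_Cmod]. right. f_equal.
    destruct (f (t + h)), (f t), l; simpl. field.
    intros ->. rewrite Rabs_R0 in Hh0. lra.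
Qed.

Lemma is_derive_rdiff (f : R -> C) t l :
  is_derive (fun u => Re (f u)) t (Re l) -> is_derive (fun u => Im (f u)) t (Im l) ->
  rdiff f t l.
Proof.
  intros H1 H2. apply is_derive_Reals in H1, H2. apply diffg_eps. intros e He.
  assert (He1 : 0 < e / 2) by lra.
  destruct (H1 _ He1) as [d1 D1], (H2 _ He1) as [d2 D2].
  assert (Hd : 0 < Rmin d1 d2) by (apply Rmin_pos; apply cond_pos).
  exists (mkposreal _ Hd). intros u Hu. change R in u. change (Rabs (u - t) < Rmin d1 d2) in Hu.
  rewrite <- RtoC_minus. rewrite Cmod_R.
  destruct (Req_dec u t) as [->|Hne].
  - replace (f t - f t - l * RtoC (t - t))%C with (RtoC 0)
      by (replace (t - t) with 0 by ring; ring).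
    rewrite Cmod_0. replace (t - t) with 0 by ring. rewrite Rabs_R0. lra.
  - assert (Hh : u - t <> 0) by lra.
    specialize (D1 _ Hh (Rlt_le_trans _ _ _ Hu (Rmin_l _ _))).
    specialize (D2 _ Hh (Rlt_le_trans _ _ _ Hu (Rmin_r _ _))).
    replace (t + (u - t)) with u in D1, D2 by ring.
    apply Rabs_pos_lt in Hh.
    eapply Rle_trans; [apply Cmod_le_re_im|].
    replace (Re (f u - f t - l * RtoC (u - t))%C)
      with (((Re (f u) - Re (f t)) / (u - t) - Re l) * (u - t)).
    2:{ destruct (f u), (f t), l; simpl. field. lra. }
    replace (Im (f u - f t - l * RtoC (u - t))%C)
      with (((Im (f u) - Im (f t)) / (u - t) - Im l) * (u - t)).
    2:{ destruct (f u), (f t), l; simpl. field. lra. }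
    rewrite !Rabs_mult. nra.
Qed.

(** * The complex exponential and the mean value inequality *)

Lemma exp_le (x y : R) : x <= y -> exp x <= exp y.
Proof. intros [H| ->]; [left; now apply exp_increasing|lra]. Qed.

Lemma Cexp_plus (z w : C) : Cexp (z + w)%C = (Cexp z * Cexp w)%C.
Proof.
  destruct z as [a b], w as [c d]. unfold Cexp. apply C_eq; simpl;
  rewrite exp_plus ?cos_plus ?sin_plus; ring.
Qed.

Lemma Cexp_0 : Cexp 0 = 1.
Proof. unfold Cexp; apply C_eq; simpl; rewrite exp_0 ?cos_0 ?sin_0; ring. Qed.

Lemma Cexp_RtoC (x : R) : Cexp (RtoC x) = RtoC (exp x).
Proof. unfold Cexp; apply C_eq; simpl; rewrite ?cos_0 ?sin_0; ring. Qed.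

Lemma Cmod_Cexp (z : C) : Cmod (Cexp z) = exp (Re z).
Proof.
  destruct z as [a b]. unfold Cexp, Cmod; simpl.
  replace (_ + _) with (exp a ^ 2 * ((sin b)^2 + (cos b)^2)) by ring.
  pose proof (sin2_cos2 b) as H. unfold Rsqr in H.
  replace ((sin b)^2 + (cos b)^2) with 1 by (simpl; lra).
  rewrite Rmult_1_r sqrt_pow2; [reflexivity|left; apply exp_pos].
Qed.

Lemma Cexp_neq_0 (z : C) : Cexp z <> 0.
Proof. apply Cmod_gt_0. rewrite Cmod_Cexp. apply exp_pos. Qed.

Lemma Cexp_opp (z : C) : Cexp (- z)%C = (/ Cexp z)%C.
Proof.
  assert (H : (Cexp z * Cexp (- z))%C = 1).
  { rewrite -Cexp_plus. replace (z + - z)%C with (RtoC 0) by ring. apply Cexp_0. }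
  rewrite -(Cmult_1_l (/ Cexp z)) -H. field. apply Cexp_neq_0.
Qed.

Lemma rdiff_Cexp_line (w : C) t :
  rdiff (fun u => Cexp (RtoC u * w)%C) t (w * Cexp (RtoC t * w))%C.
Proof.
  destruct w as [a b].
  apply diffg_ext with (fun u => (exp (u * a) * cos (u * b), exp (u * a) * sin (u * b)) : C).
  - intros u. unfold Cexp; apply C_eq; simpl; f_equal; f_equal; ring.
  - replace (Cexp (RtoC t * (a, b))%C)
      with ((exp (t * a) * cos (t * b), exp (t * a) * sin (t * b)) : C)
      by (unfold Cexp; apply C_eq; simpl; f_equal; f_equal; ring).
    apply is_derive_rdiff; simpl; auto_derive; auto; ring.
Qed.

Lemma rdiff_RtoC (f : R -> R) t l : is_derive f t l -> rdiff (fun u => RtoC (f u)) t (RtoC l).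
Proof.
  intros H. apply is_derive_rdiff; simpl; [exact H|]. apply @is_derive_const.
Qed.

(** The real mean value theorem is applied to the projection [Re (Cconj d * g t)] on the increment
    [d = g b - g a]; the increment of this projection is [|d|^2]. *)
Lemma curve_mvt (g g' : R -> C) (a b B : R) : a <= b ->
  (forall t, a <= t <= b -> rdiff g t (g' t)) ->
  (forall t, a <= t <= b -> Cmod (g' t) <= B) ->
  Cmod (g b - g a)%C <= B * (b - a).
Proof.
  intros Hab Hg HB.
  set (d := (g b - g a)%C).
  pose (phi := fun t => Re d * Re (g t) + Im d * Im (g t)).
  pose (phi' := fun t => Re d * Re (g' t) + Im d * Im (g' t)).
  assert (Hphi : forall t, a <= t <= b -> is_derive phi t (phi' t)).
  { intros t Ht. destruct (rdiff_is_derive _ _ _ (Hg t Ht)) as [H1 H2].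
    apply @is_derive_plus; now apply @is_derive_scal. }
  destruct (MVT_gen phi a b phi') as [c [Hc1 Hc2]].
  - rewrite Rmin_left ?Rmax_right; try lra. intros x Hx. apply Hphi; lra.
  - rewrite Rmin_left ?Rmax_right; try lra. intros x Hx.
    apply continuity_pt_filterlim. 
    apply (ex_derive_continuous (V := R_NormedModule)). exists (phi' x). now apply Hphi.
  - rewrite Rmin_left ?Rmax_right in Hc1; try lra.
    assert (E : phi b - phi a = Cmod d ^ 2).
    { rewrite Cmod2_alt. unfold phi, d. destruct (g a), (g b); simpl. ring. }
    rewrite E in Hc2.
    assert (H3 : phi' c <= Cmod d * B).
    { apply Rle_trans with (Cmod (Cconj d * g' c)%C).
      - eapply Rle_trans; [|apply re_le_Cmod]. eapply Rle_trans; [|apply Rle_abs].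
        right. unfold phi'. destruct d, (g' c); simpl. ring.
      - rewrite Cmod_mult Cmod_conj. apply Rmult_le_compat_l; [apply Cmod_ge_0|auto]. }
    pose proof (Cmod_ge_0 d) as Hd.
    assert (HBpos : 0 <= B) by (eapply Rle_trans; [apply Cmod_ge_0|apply (HB a); lra]).
    assert (H4 : Cmod d ^ 2 <= Cmod d * B * (b - a)) by (rewrite Hc2; nra).
    destruct Hd as [Hd|Hd]; [|rewrite -Hd; nra].
    apply Rmult_le_reg_l with (Cmod d); [exact Hd|]. nra.
Qed.

Lemma curve_const (g : R -> C) (a b : R) : a <= b ->
  (forall t, a <= t <= b -> rdiff g t 0) -> g b = g a.
Proof.
  intros Hab Hg. apply Cmod_sub_0. apply Rle_antisym; [|apply Cmod_ge_0].
  eapply Rle_trans; [apply (curve_mvt g (fun _ => 0) a b 0 Hab Hg)|lra].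
  intros; rewrite Cmod_0; lra.
Qed.

Lemma rdiff_line (p d : C) t : rdiff (fun u => p + RtoC u * d)%C t d.
Proof.
  eapply diffg_eq; [|apply diffg_plus; [apply diffg_const|apply diffg_mult;
    [apply RtoC_cont|apply diffg_iota|apply diffg_const]]].
  cbv beta. ring.
Qed.

Lemma seg_mvt (f : C -> C) (f' : C -> C) (a b : C) B :
  (forall t, 0 <= t <= 1 -> cdiff f (a + RtoC t * (b - a))%C (f' (a + RtoC t * (b - a))%C)) ->
  (forall t, 0 <= t <= 1 -> Cmod (f' (a + RtoC t * (b - a))%C) <= B) ->
  Cmod (f b - f a)%C <= B * Cmod (b - a)%C.
Proof.
  intros Hf HB.
  replace (f b) with (f (a + RtoC 1 * (b - a))%C) by (f_equal; ring).
  replace (f a) with (f (a + RtoC 0 * (b - a))%C) by (f_equal; ring).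
  replace (B * Cmod (b - a)%C) with (B * Cmod (b - a)%C * (1 - 0)) by ring.
  apply (curve_mvt (fun t => f (a + RtoC t * (b - a))%C)
    (fun t => f' (a + RtoC t * (b - a))%C * (b - a))%C); [lra| |].
  - intros t Ht. apply (diffg_comp RtoC RtoC_cont); [auto|]. apply rdiff_line.
  - intros t Ht. rewrite Cmod_mult. apply Rmult_le_compat_r; [apply Cmod_ge_0|auto].
Qed.

Lemma Cexp_lin_bound (w : C) : Cmod (Cexp w - 1)%C <= Cmod w * exp (Cmod w).
Proof.
  replace (Cexp w) with (Cexp (RtoC 1 * w)%C) by (f_equal; ring).
  replace (RtoC 1) with (Cexp (RtoC 0 * w)%C) at 2
    by (rewrite -Cexp_0; f_equal; ring).
  replace (Cmod w * exp (Cmod w)) with (Cmod w * exp (Cmod w) * (1 - 0)) by ring.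
  apply (curve_mvt (fun t => Cexp (RtoC t * w)%C) (fun t => w * Cexp (RtoC t * w))%C); [lra| |].
  - intros t _. apply rdiff_Cexp_line.
  - intros t Ht. rewrite Cmod_mult Cmod_Cexp. apply Rmult_le_compat_l; [apply Cmod_ge_0|].
    apply exp_le. eapply Rle_trans; [apply Rle_abs|].
    eapply Rle_trans; [apply re_le_Cmod|]. rewrite Cmod_mult Cmod_R Rabs_pos_eq; [|lra].
    pose proof (Cmod_ge_0 w). nra.
Qed.

(** The mean value inequality for [e^(t w) - t w], whose derivative is controlled by
    [Cexp_lin_bound]. This is the remainder estimate behind the differentiations with respect to an
    exponent. *)
Lemma Cexp_quad_bound (w : C) : Cmod (Cexp w - 1 - w)%C <= Cmod w ^ 2 * exp (Cmod w).
Proof.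
  replace (Cexp w - 1 - w)%C with ((Cexp (RtoC 1 * w) - RtoC 1 * w)
    - (Cexp (RtoC 0 * w) - RtoC 0 * w))%C.
  2:{ replace (RtoC 0 * w)%C with (RtoC 0) by ring. rewrite Cexp_0.
      replace (RtoC 1 * w)%C with w by ring. ring. }
  replace (Cmod w ^ 2 * exp (Cmod w)) with (Cmod w ^ 2 * exp (Cmod w) * (1 - 0)) by ring.
  apply (curve_mvt (fun t => Cexp (RtoC t * w) - RtoC t * w)%C
     (fun t => w * (Cexp (RtoC t * w) - 1))%C); [lra| |].
  - intros t _. eapply diffg_eq; [|apply diffg_minus; [apply RtoC_cont|apply rdiff_Cexp_line|
      apply diffg_mult; [apply RtoC_cont|apply diffg_iota|apply diffg_const]]].
    cbv beta; ring.
  - intros t Ht. rewrite Cmod_mult.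
    replace (Cmod w ^ 2 * exp (Cmod w)) with (Cmod w * (Cmod w * exp (Cmod w))) by ring.
    apply Rmult_le_compat_l; [apply Cmod_ge_0|].
    eapply Rle_trans; [apply Cexp_lin_bound|].
    assert (H : Cmod (RtoC t * w)%C <= Cmod w).
    { rewrite Cmod_mult Cmod_R Rabs_pos_eq; [|lra]. pose proof (Cmod_ge_0 w). nra. }
    apply Rmult_le_compat; try apply Cmod_ge_0; auto. left; apply exp_pos.
    now apply exp_le.
Qed.

Lemma cdiff_Cexp (z : C) : cdiff Cexp z (Cexp z).
Proof.
  apply (diffg_quad (X := C_UniformSpace) (fun w => w) cid_cont) with (Cmod (Cexp z) * exp 1).
  generalize (locally_C z 1 Rlt_0_1). apply filter_imp. intros w Hw.
  replace (Cexp w - Cexp z - Cexp z * (w - z))%C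
    with (Cexp z * (Cexp (w - z) - 1 - (w - z)))%C.
  - rewrite Cmod_mult Rmult_assoc. apply Rmult_le_compat_l; [apply Cmod_ge_0|].
    eapply Rle_trans; [apply Cexp_quad_bound|].
    rewrite Rmult_comm. apply Rmult_le_compat_r; [apply pow_le, Cmod_ge_0|].
    apply exp_le. lra.
  - replace (Cexp w) with (Cexp (z + (w - z))%C) by (f_equal; ring).
    rewrite Cexp_plus. ring.
Qed.

(** * Riemann integrals of complex-valued functions *)

Definition CRI (f : R -> C) (a b : R) (l : C) : Prop := @is_RInt C_R_NormedModule f a b l.
Definition CInt (f : R -> C) (a b : R) : C := @RInt C_R_CompleteNormedModule f a b.

Lemma CRI_ex (f : R -> C) a b :
  (forall t, Rmin a b <= t <= Rmax a b -> clim f (@locally R_UniformSpace t) (f t)) ->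
  CRI f a b (CInt f a b).
Proof.
  intros H. apply (@RInt_correct C_R_CompleteNormedModule).
  apply (@ex_RInt_continuous C_R_CompleteNormedModule). intros t Ht.
  apply clim_filterlim; [typeclasses eauto|]. now apply H.
Qed.

Lemma CInt_unique f a b l : CRI f a b l -> CInt f a b = l.
Proof. apply (@is_RInt_unique C_R_CompleteNormedModule). Qed.

Lemma CRI_plus f g a b l m : CRI f a b l -> CRI g a b m ->
  CRI (fun t => f t + g t)%C a b (l + m)%C.
Proof. apply (@is_RInt_plus C_R_NormedModule). Qed.

Lemma CRI_re f a b l : CRI f a b l -> is_RInt (fun t => Re (f t)) a b (Re l).
Proof. apply (@is_RInt_fct_extend_fst R_NormedModule R_NormedModule f). Qed.

Lemma CRI_im f a b l : CRI f a b l -> is_RInt (fun t => Im (f t)) a b (Im l).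
Proof. apply (@is_RInt_fct_extend_snd R_NormedModule R_NormedModule f). Qed.

Lemma CRI_pair f a b l : is_RInt (fun t => Re (f t)) a b (Re l) ->
  is_RInt (fun t => Im (f t)) a b (Im l) -> CRI f a b l.
Proof.
  intros H1 H2. replace l with (Re l, Im l) by now destruct l.
  now apply (@is_RInt_fct_extend_pair R_NormedModule R_NormedModule f).
Qed.

(** The scalars of [C_R_NormedModule] are real, so a complex factor has to pass through real and
    imaginary parts. *)
Lemma CRI_scal c f a b l : CRI f a b l -> CRI (fun t => c * f t)%C a b (c * l)%C.
Proof.
  intros H. pose proof (CRI_re _ _ _ _ H) as H1. pose proof (CRI_im _ _ _ _ H) as H2.
  apply CRI_pair; destruct c as [x y].
  - apply (@is_RInt_minus R_NormedModule);
    now apply (@is_RInt_scal R_NormedModule).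
  - apply (@is_RInt_plus R_NormedModule);
    now apply (@is_RInt_scal R_NormedModule).
Qed.

Lemma CRI_ext f g a b l : (forall t, Rmin a b < t < Rmax a b -> f t = g t) ->
  CRI f a b l -> CRI g a b l.
Proof. apply (@is_RInt_ext C_R_NormedModule). Qed.

Lemma CRI_minus f g a b l m : CRI f a b l -> CRI g a b m ->
  CRI (fun t => f t - g t)%C a b (l - m)%C.
Proof. apply (@is_RInt_minus C_R_NormedModule). Qed.

Lemma CRI_const c a b : CRI (fun _ => c) a b (RtoC (b - a) * c)%C.
Proof.
  pose proof (@is_RInt_const C_R_NormedModule a b c) as H.
  replace (RtoC (b - a) * c)%C with (@scal R_AbsRing C_R_NormedModule (b - a) c).
  exact H. apply C_eq; simpl; unfold scal, mult; simpl; unfold mult; simpl; ring.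
Qed.

Lemma CRI_Chasles f a b c l m : CRI f a b l -> CRI f b c m -> CRI f a c (l + m)%C.
Proof. apply (@is_RInt_Chasles C_R_NormedModule). Qed.

Lemma CRI_swap f a b l : CRI f b a l -> CRI f a b (- l)%C.
Proof. apply (@is_RInt_swap C_R_NormedModule). Qed.

Lemma CRI_comp_lin f u v a b l : CRI f (u * a + v) (u * b + v) l ->
  CRI (fun y => RtoC u * f (u * y + v)%R)%C a b l.
Proof.
  intros H. apply (@is_RInt_comp_lin C_R_NormedModule) in H.
  eapply CRI_ext; [|exact H]. intros t _. simpl.
  apply C_eq; simpl; unfold scal, mult; simpl; unfold mult; simpl; ring.
Qed.

Lemma CRI_bound_fun f (g : R -> R) a b l lg : a <= b -> CRI f a b l ->
  is_RInt g a b lg ->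
  (forall t, a <= t <= b -> Cmod (f t) <= g t) -> Cmod l <= lg.
Proof.
  intros Hab H Hg HB. rewrite Cmod_norm.
  apply (@norm_RInt_le C_R_NormedModule f g a b); auto.
  intros x Hx. specialize (HB x Hx). now rewrite Cmod_norm in HB.
Qed.

Lemma CRI_bound f a b l B : a <= b -> CRI f a b l ->
  (forall t, a <= t <= b -> Cmod (f t) <= B) -> Cmod l <= B * (b - a).
Proof.
  intros Hab H HB. replace (B * (b - a)) with (scal (b - a) B)
    by (unfold scal; simpl; unfold mult; simpl; ring).
  apply (CRI_bound_fun f (fun _ => B) a b l); auto.
  apply (@is_RInt_const R_NormedModule).
Qed.

Lemma CRI_RtoC (f : R -> R) a b l : is_RInt f a b l -> CRI (fun t => RtoC (f t)) a b (RtoC l).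
Proof.
  intros H. apply CRI_pair; simpl; [exact H|].
  pose proof (@is_RInt_const R_NormedModule a b 0) as K.
  replace (scal (b - a) (0 : R_NormedModule)) with 0 in K
    by (unfold scal; simpl; unfold mult; simpl; ring).
  exact K.
Qed.

(** * Goursat's lemma on a half-plane *)

Definition seg (u : C -> C) (p q : C) : C :=
  ((q - p) * CInt (fun t => u (p + RtoC t * (q - p))%C) 0 1)%C.

Definition tri (u : C -> C) (a b c : C) : C := (seg u a b + seg u b c + seg u c a)%C.

Lemma line_re (p q : C) t m : 0 <= t <= 1 -> Re p <= m -> Re q <= m ->
  Re (p + RtoC t * (q - p))%C <= m.
Proof.
  destruct p as [a b], q as [c d]; simpl. intros Ht Ha Hc.
  assert (0 <= (1 - t) * (m - a)) by (apply Rmult_le_pos; lra).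
  assert (0 <= t * (m - c)) by (apply Rmult_le_pos; lra). lra.
Qed.

Lemma line_re_lt (p q : C) t m : 0 <= t <= 1 -> Re p < m -> Re q < m ->
  Re (p + RtoC t * (q - p))%C < m.
Proof.
  intros Ht Hp Hq. apply Rle_lt_trans with (Rmax (Re p) (Re q)).
  - apply line_re; [exact Ht|apply Rmax_l|apply Rmax_r].
  - now apply Rmax_lub_lt.
Qed.

Lemma line_cont (p d : C) t :
  clim (fun u => p + RtoC u * d)%C (@locally R_UniformSpace t) (p + RtoC t * d)%C.
Proof. apply (rdiff_cont (fun u => p + RtoC u * d)%C t d). apply rdiff_line. Qed.

Section HalfPlane.
Variables (L : R) (u : C -> C).
Hypothesis Hu : forall z, Re z < L -> clim u (@locally C_UniformSpace z) (u z).

Lemma seg_CRI p q : Re p < L -> Re q < L ->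
  CRI (fun t => u (p + RtoC t * (q - p))%C) 0 1
    (CInt (fun t => u (p + RtoC t * (q - p))%C) 0 1).
Proof.
  intros Hp Hq. apply CRI_ex. rewrite Rmin_left ?Rmax_right; try lra.
  intros t Ht.
  apply (clim_comp_C _ (fun t => p + RtoC t * (q - p))%C u (p + RtoC t * (q - p))%C).
  - apply line_cont.
  - apply Hu. now apply line_re_lt.
Qed.

Lemma seg_rev p q : Re p < L -> Re q < L -> seg u q p = (- seg u p q)%C.
Proof.
  intros Hp Hq. pose proof (seg_CRI p q Hp Hq) as H.
  apply CRI_swap in H.
  change (seg u q p = (- ((q - p) * CInt (fun t => u (p + RtoC t * (q - p))) 0 1))%C).
  set (I0 := CInt _ 0 1) in *.
  assert (H' : CRI (fun t => u (p + RtoC t * (q - p))%C) (-1 * 0 + 1) (-1 * 1 + 1) (- I0)%C)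
    by (replace (-1 * 0 + 1) with 1 by ring; replace (-1 * 1 + 1) with 0 by ring; exact H).
  clear H. rename H' into H. apply CRI_comp_lin in H. apply (CRI_scal (RtoC (-1))) in H.
  unfold seg. rewrite (CInt_unique (fun t => u (q + RtoC t * (p - q))%C) _ _
     (RtoC (-1) * - I0)%C).
  - ring.
  - eapply CRI_ext; [|exact H]. intros t _. cbv beta.
    replace (p + RtoC (-1 * t + 1) * (q - p))%C with (q + RtoC t * (p - q))%C.
    + rewrite Cmult_assoc -RtoC_mult. replace (-1 * -1) with 1 by ring. ring.
    + rewrite RtoC_plus RtoC_mult. ring.
Qed.

Lemma seg_mid p q : Re p < L -> Re q < L ->
  seg u p q = (seg u p ((p + q) / 2) + seg u ((p + q) / 2) q)%C.
Proof.
  intros Hp Hq. set (m := ((p + q) / 2)%C).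
  assert (Hm : Re m < L) by (unfold m; destruct p, q; simpl in *; field_simplify; lra).
  pose proof (seg_CRI p m Hp Hm) as H1. pose proof (seg_CRI m q Hm Hq) as H2.
  set (I1 := CInt _ 0 1) in H1. set (I2 := CInt _ 0 1) in H2.
  assert (E1 : CRI (fun t => u (p + RtoC t * (q - p))%C) 0 (/2) (RtoC (/2) * I1)%C).
  { assert (H3 : CRI (fun t => u (p + RtoC t * (m - p))%C) (2 * 0 + 0) (2 * /2 + 0) I1)
      by (replace (2 * 0 + 0) with 0 by ring; replace (2 * /2 + 0) with 1 by field; exact H1).
    apply CRI_comp_lin in H3. apply (CRI_scal (RtoC (/2))) in H3.
    eapply CRI_ext; [|exact H3]. intros t _. cbv beta.
    rewrite Cmult_assoc -RtoC_mult. replace (/2 * 2) with 1 by field.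
    rewrite Cmult_1_l. f_equal. unfold m. rewrite RtoC_plus RtoC_mult. field. }
  assert (E2 : CRI (fun t => u (p + RtoC t * (q - p))%C) (/2) 1 (RtoC (/2) * I2)%C).
  { assert (H3 : CRI (fun t => u (m + RtoC t * (q - m))%C) (2 * /2 + -1) (2 * 1 + -1) I2)
      by (replace (2 * /2 + -1) with 0 by field; replace (2 * 1 + -1) with 1 by ring; exact H2).
    apply CRI_comp_lin in H3. apply (CRI_scal (RtoC (/2))) in H3.
    eapply CRI_ext; [|exact H3]. intros t _. cbv beta.
    rewrite Cmult_assoc -RtoC_mult. replace (/2 * 2) with 1 by field.
    rewrite Cmult_1_l. f_equal. unfold m. rewrite RtoC_plus RtoC_mult. replace (-1) with (- (1)) by ring. rewrite RtoC_opp. field. }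
  unfold seg. rewrite (CInt_unique _ _ _ _ (CRI_Chasles _ _ _ _ _ _ E1 E2)).
  fold I1 I2. unfold m. rewrite RtoC_inv; [field|lra].
Qed.

Lemma seg_bound p q B : Re p < L -> Re q < L ->
  (forall t, 0 <= t <= 1 -> Cmod (u (p + RtoC t * (q - p))%C) <= B) ->
  Cmod (seg u p q) <= Cmod (q - p)%C * B.
Proof.
  intros Hp Hq HB. unfold seg. rewrite Cmod_mult.
  apply Rmult_le_compat_l; [apply Cmod_ge_0|].
  replace B with (B * (1 - 0)) by ring.
  apply (CRI_bound _ _ _ _ _ Rle_0_1 (seg_CRI p q Hp Hq)). exact HB.
Qed.

(** An affine function integrates along a segment to [q - p] times its value at the midpoint. These
    contributions cancel around a triangle, so the tangent map may be subtracted in Goursat's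
    argument. *)
Lemma seg_minus_affine p q al be : Re p < L -> Re q < L ->
  seg (fun z => u z - (al + be * z))%C p q =
    (seg u p q - (q - p) * (al + be * (p + q) / 2))%C.
Proof.
  intros Hp Hq. pose proof (seg_CRI p q Hp Hq) as H. unfold seg.
  assert (Ht : is_RInt (fun t : R => t) 0 1 (/2)).
  { replace (/2) with (1 ^ 2 / 2 - 0 ^ 2 / 2) by field.
    apply (is_RInt_derive (fun t => t ^ 2 / 2) (fun t : R => t)).
    - intros x _. auto_derive; auto. field.
    - intros x _. apply filterlim_id. }
  apply CRI_RtoC in Ht. apply (CRI_scal (be * (q - p))%C) in Ht.
  pose proof (CRI_plus _ _ _ _ _ _ (CRI_const (al + be * p)%C 0 1) Ht) as H3.
  pose proof (CRI_minus _ _ _ _ _ _ H H3) as H4.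
  rewrite (CInt_unique (fun t => u (p + RtoC t * (q - p)) -
    (al + be * (p + RtoC t * (q - p))))%C 0 1 _ 
    (CRI_ext _ _ _ _ _ _ H4)).
  - rewrite Rminus_0_r RtoC_inv; [field|lra].
  - intros t _. cbv beta. ring.
Qed.

End HalfPlane.

Lemma geom_limit (a : nat -> C) (d : R) :
  (forall n, Cmod (a (S n) - a n)%C <= d / 2 ^ n) ->
  exists p, forall n, Cmod (a n - p)%C <= 2 * d / 2 ^ n.
Proof.
  intros H.
  assert (H2 : forall n k, Cmod (a (n + k)%nat - a n)%C <= 2 * d / 2 ^ n).
  { intros n k.
    (* The factor [1 - / 2 ^ k], the exact partial geometric sum, is what lets the induction on [k]
       close. *)
    assert (H3 : Cmod (a (n + k)%nat - a n)%C <= 2 * d / 2 ^ n * (1 - / 2 ^ k)).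
    { induction k as [|k IH].
      - rewrite Nat.add_0_r. replace (a n - a n)%C with (RtoC 0) by ring.
        rewrite Cmod_0 /=. right; field. apply pow_nonzero; lra.
      - rewrite Nat.add_succ_r. eapply Rle_trans; [apply Cmod_sub_triangle|].
        eapply Rle_trans; [apply Rplus_le_compat; [apply H|exact IH]|].
        right. rewrite pow_add. simpl. field.
        split; apply pow_nonzero; lra. }
    eapply Rle_trans; [exact H3|].
    assert (Hd : 0 <= d).
    { specialize (H 0%nat). pose proof (Cmod_ge_0 (a 1%nat - a 0%nat)%C). simpl in H. lra. }
    rewrite -{2}(Rmult_1_r (2 * d / 2 ^ n)). apply Rmult_le_compat_l.
    - apply Rmult_le_pos; [lra|]. left. apply Rinv_0_lt_compat, pow_lt. lra.
    - pose proof (Rinv_0_lt_compat _ (pow_lt 2 k ltac:(lra))). lra. }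
  assert (Hlim : forall (f : C -> R), (forall z w, Rabs (f z - f w) <= Cmod (z - w)%C) ->
     exists l : R, is_lim_seq (fun n => f (a n)) l).
  { intros f Hf. apply ex_lim_seq_cauchy_corr. intros eps.
    assert (Hd : 0 <= d).
    { specialize (H 0%nat). pose proof (Cmod_ge_0 (a 1%nat - a 0%nat)%C). simpl in H. lra. }
    destruct (nfloor_ex (4 * d / eps + 1)) as [N [_ HN]].
    { pose proof (cond_pos eps). assert (0 <= 4 * d / eps) by (apply Rdiv_le_0_compat; lra). lra. }
    exists N.
    assert (HN2 : 2 * d / 2 ^ N < eps / 2).
    { pose proof (cond_pos eps) as He.
      assert (Hp : INR N + 1 <= 2 ^ N).
      { clear. induction N as [|N IH]; [simpl; lra|]. rewrite S_INR. simpl.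
        pose proof (pos_INR N). lra. }
      assert (0 < 2 ^ N) by (apply pow_lt; lra).
      apply Rmult_lt_reg_r with (2 ^ N); [lra|].
      replace (2 * d / 2 ^ N * 2 ^ N) with (2 * d) by (field; lra).
      assert (4 * d / eps < 2 ^ N) by lra.
      apply Rmult_lt_compat_l with (r := eps) in H1; [|lra].
      replace (eps * (4 * d / eps)) with (4 * d) in H1 by (field; lra). lra. }
    assert (Hb : forall n, (N <= n)%nat -> Rabs (f (a n) - f (a N)) < eps / 2).
    { intros n Hn. replace n with (N + (n - N))%nat by lia.
      eapply Rle_lt_trans; [apply Hf|]. eapply Rle_lt_trans; [apply H2|exact HN2]. }
    intros n m Hn Hm.
    replace (f (a n) - f (a m)) with ((f (a n) - f (a N)) - (f (a m) - f (a N))) by ring.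
    eapply Rle_lt_trans; [apply Rabs_triang|]. rewrite Rabs_Ropp.
    pose proof (Hb n Hn). pose proof (Hb m Hm). lra. }
  destruct (Hlim Re) as [x Hx].
  { intros z w. eapply Rle_trans; [|apply re_le_Cmod]. destruct z, w; simpl. right; f_equal. }
  destruct (Hlim Im) as [y Hy].
  { intros z w. eapply Rle_trans; [|apply im_le_Cmod]. destruct z, w; simpl. right; f_equal. }
  exists (x, y). intros n.
  apply Rnot_lt_le. intros Hlt.
  set (e := (Cmod (a n - (x, y))%C - 2 * d / 2 ^ n) / 2).
  assert (He : 0 < e) by (unfold e; lra).
  apply is_lim_seq_spec in Hx, Hy.
  destruct (Hx (mkposreal _ (Rdiv_lt_0_compat _ 2 He Rlt_0_2))) as [N1 HN1].
  destruct (Hy (mkposreal _ (Rdiv_lt_0_compat _ 2 He Rlt_0_2))) as [N2 HN2].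
  set (k := (N1 + N2)%nat). simpl in HN1, HN2.
  specialize (HN1 (n + k)%nat ltac:(unfold k; lia)).
  specialize (HN2 (n + k)%nat ltac:(unfold k; lia)).
  assert (H5 : Cmod (a (n + k)%nat - (x, y))%C < e).
  { eapply Rle_lt_trans; [apply Cmod_le_re_im|]. 
    destruct (a (n + k)%nat); simpl in *. unfold Rminus in *. lra. }
  pose proof (Cmod_sub_triangle (a n) (a (n + k)%nat) (x, y)) as H6.
  rewrite (Cmod_sub_sym (a n) (a (n + k)%nat)) in H6.
  specialize (H2 n k). unfold e in *. lra.
Qed.

(** [Cexp] wraps the half-plane [Re z < L] onto the punctured disc of radius [e^L], so integrals
    over this convex domain control circle integrals around an isolated singularity. *)
Definition holo_lt (L : R) (u : C -> C) : Prop :=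
  forall z, Re z < L -> exists l, cdiff u z l.

(** Bisection: one of the four half-size triangles carries at least a quarter of the integral. The
    bound on [Cmod (a' - a)] makes the first vertices a geometric Cauchy sequence, and the fixed
    bound [m < L] on the real parts keeps their limit inside the open half-plane. *)
Lemma goursat_step L u a b c m s : holo_lt L u -> m < L ->
  Re a <= m -> Re b <= m -> Re c <= m ->
  Cmod (b - a)%C <= s -> Cmod (c - b)%C <= s -> Cmod (a - c)%C <= s ->
  exists a' b' c', Re a' <= m /\ Re b' <= m /\ Re c' <= m /\
    Cmod (b' - a')%C <= s / 2 /\ Cmod (c' - b')%C <= s / 2 /\ Cmod (a' - c')%C <= s / 2 /\
    Cmod (a' - a)%C <= s /\ Cmod (tri u a b c) / 4 <= Cmod (tri u a' b' c').
Proof.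
  intros Hu Hm Ha Hb Hc Hab Hbc Hca.
  assert (Huc : forall z, Re z < L -> clim u (@locally C_UniformSpace z) (u z)).
  { intros z Hz. destruct (Hu z Hz) as [l Hl]. now apply cdiff_cont with l. }
  set (p := ((a + b) / 2)%C). set (q := ((b + c) / 2)%C). set (r := ((c + a) / 2)%C).
  assert (Hp : Re p <= m) by (unfold p; destruct a, b; simpl in *; field_simplify; lra).
  assert (Hq : Re q <= m) by (unfold q; destruct b, c; simpl in *; field_simplify; lra).
  assert (Hr : Re r <= m) by (unfold r; destruct c, a; simpl in *; field_simplify; lra).
  assert (E : tri u a b c = (tri u a p r + tri u p b q + tri u r q c + tri u q r p)%C).
  { unfold tri. rewrite (seg_mid L u Huc a b) ?(seg_mid L u Huc b c) ?(seg_mid L u Huc c a); try lra.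
    fold p q r. rewrite (seg_rev L u Huc r p) ?(seg_rev L u Huc q p) ?(seg_rev L u Huc r q); try lra.
    ring. }
  assert (Hhalf : forall x y, Cmod (x - y)%C <= s -> forall z,
      z = ((x - y) / 2)%C \/ z = ((y - x) / 2)%C -> Cmod z <= s / 2).
  { intros x y H z [-> | ->]; rewrite Cmod_div; try (intros H0; inversion H0; lra);
    rewrite Cmod_R Rabs_pos_eq; try lra; rewrite ?(Cmod_sub_sym y x); lra. }
  assert (Hs : 0 <= s) by (pose proof (Cmod_ge_0 (b - a)%C); lra).
  assert (Hsmall : forall z, Cmod z <= s / 2 -> Cmod z <= s) by (intros; lra).
  destruct (Rle_lt_dec (Cmod (tri u a b c) / 4) (Cmod (tri u a p r))) as [H1|H1].
  { exists a, p, r. repeat split; auto.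
    - apply (Hhalf _ _ Hab). unfold p; first [left; field | right; field].
    - apply (Hhalf _ _ Hbc). unfold p, r; first [left; field | right; field].
    - apply (Hhalf _ _ Hca). unfold r; first [left; field | right; field].
    - replace (a - a)%C with (RtoC 0) by ring. now rewrite Cmod_0. }
  destruct (Rle_lt_dec (Cmod (tri u a b c) / 4) (Cmod (tri u p b q))) as [H2|H2].
  { exists p, b, q. repeat split; auto.
    - apply (Hhalf _ _ Hab). unfold p; first [left; field | right; field].
    - apply (Hhalf _ _ Hbc). unfold q; first [left; field | right; field].
    - apply (Hhalf _ _ Hca). unfold p, q; first [left; field | right; field].
    - apply Hsmall. apply (Hhalf _ _ Hab). unfold p; first [left; field | right; field]. }
  destruct (Rle_lt_dec (Cmod (tri u a b c) / 4) (Cmod (tri u r q c))) as [H3|H3].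
  { exists r, q, c. repeat split; auto.
    - apply (Hhalf _ _ Hab). unfold r, q; first [left; field | right; field].
    - apply (Hhalf _ _ Hbc). unfold q; first [left; field | right; field].
    - apply (Hhalf _ _ Hca). unfold r; first [left; field | right; field].
    - apply Hsmall. apply (Hhalf _ _ Hca). unfold r; first [left; field | right; field]. }
  exists q, r, p. repeat split; auto.
  - apply (Hhalf _ _ Hab). unfold q, r; first [left; field | right; field].
  - apply (Hhalf _ _ Hbc). unfold p, r; first [left; field | right; field].
  - apply (Hhalf _ _ Hca). unfold q, p; first [left; field | right; field].
  - replace (q - a)%C with ((b - a) / 2 + (c - a) / 2)%C by (unfold q; field).
    eapply Rle_trans; [apply Cmod_triangle|].
    pose proof (Hhalf b a Hab _ (or_introl eq_refl)).
    pose proof (Hhalf a c Hca _ (or_intror eq_refl)). lra.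
  - pose proof (Cmod_triangle (tri u a p r + tri u p b q + tri u r q c)%C (tri u q r p)).
    pose proof (Cmod_triangle (tri u a p r + tri u p b q)%C (tri u r q c)).
    pose proof (Cmod_triangle (tri u a p r)%C (tri u p b q)). rewrite -E in H. lra.
Qed.

Lemma goursat L u a b c : holo_lt L u -> Re a < L -> Re b < L -> Re c < L ->
  tri u a b c = 0.
Proof.
  intros Hu Ha Hb Hc.
  assert (Huc : forall z, Re z < L -> clim u (@locally C_UniformSpace z) (u z)).
  { intros z Hz. destruct (Hu z Hz) as [l Hl]. now apply cdiff_cont with l. }
  set (m := Rmax (Re a) (Rmax (Re b) (Re c))).
  assert (Hm : m < L) by (unfold m; repeat apply Rmax_lub_lt; auto).
  assert (Hma : Re a <= m) by apply Rmax_l.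
  assert (Hmb : Re b <= m) by (eapply Rle_trans; [|apply Rmax_r]; apply Rmax_l).
  assert (Hmc : Re c <= m) by (eapply Rle_trans; [|apply Rmax_r]; apply Rmax_r).
  set (d := Cmod (b - a)%C + Cmod (c - b)%C + Cmod (a - c)%C).
  pose (fa := fun T : C * C * C => fst (fst T)).
  pose (fb := fun T : C * C * C => snd (fst T)).
  pose (fc := fun T : C * C * C => snd T).
  pose (P := fun (T : C * C * C) s => Re (fa T) <= m /\ Re (fb T) <= m /\ Re (fc T) <= m /\
    Cmod (fb T - fa T)%C <= s /\ Cmod (fc T - fb T)%C <= s /\ Cmod (fa T - fc T)%C <= s).
  pose (tr := fun T => tri u (fa T) (fb T) (fc T)).
  (* The condition [P] stands under the existential so that [choice] yields a total function. *)
  assert (Hstep : forall Ts : (C * C * C) * R, exists T', P (fst Ts) (snd Ts) ->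
    P T' (snd Ts / 2) /\ Cmod (fa T' - fa (fst Ts))%C <= snd Ts /\
    Cmod (tr (fst Ts)) / 4 <= Cmod (tr T')).
  { intros [[[a0 b0] c0] s]. simpl.
    destruct (classic (P (a0, b0, c0) s)) as [HP|HP].
    - destruct HP as (H1 & H2 & H3 & H4 & H5 & H6).
      destruct (goursat_step L u a0 b0 c0 m s Hu Hm H1 H2 H3 H4 H5 H6)
        as (a1 & b1 & c1 & K1 & K2 & K3 & K4 & K5 & K6 & K7 & K8).
      exists (a1, b1, c1). intros _. unfold P, tr; simpl. tauto.
    - exists (a0, b0, c0). tauto. }
  apply choice in Hstep. destruct Hstep as [next Hnext].
  pose (T := fix T n := match n with O => ((a, b), c) | S k => next (T k, d / 2 ^ k) end).
  assert (HT : forall n, P (T n) (d / 2 ^ n) /\ Cmod (tri u a b c) / 4 ^ n <= Cmod (tr (T n))).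
  { induction n as [|n [IH1 IH2]].
    - split.
      + unfold P, fa, fb, fc, d; simpl.
        pose proof (Cmod_ge_0 (b - a)%C). pose proof (Cmod_ge_0 (c - b)%C).
        pose proof (Cmod_ge_0 (a - c)%C). repeat split; auto; lra.
      + unfold tr, fa, fb, fc; simpl. lra.
    - destruct (Hnext (T n, d / 2 ^ n) IH1) as (K1 & K2 & K3). simpl fst in *. simpl snd in *.
      split.
      + simpl. replace (d / (2 * 2 ^ n)) with (d / 2 ^ n / 2); [exact K1|].
        field. apply pow_nonzero; lra.
      + eapply Rle_trans; [|exact K3]. simpl pow.
        replace (Cmod (tri u a b c) / (4 * 4 ^ n)) with (Cmod (tri u a b c) / 4 ^ n / 4)
          by (field; apply pow_nonzero; lra). lra. }
  destruct (geom_limit (fun n => fa (T n)) d) as [p Hp].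
  { intros n. destruct (HT n) as [H1 _]. now destruct (Hnext (T n, d / 2 ^ n) H1) as (_ & K & _). }
  assert (Hpre : Re p <= m).
  { apply Rnot_lt_le. intros Hlt.
    assert (Hlim : is_lim_seq (fun n => 2 * d / 2 ^ n) 0).
    { replace (Finite 0) with (Rbar_mult (2 * d) 0) by (simpl; f_equal; ring).
      apply is_lim_seq_scal_l. apply is_lim_seq_ext with (fun n => (/2) ^ n).
      - intros n. now rewrite pow_inv.
      - apply is_lim_seq_geom. rewrite Rabs_pos_eq; lra. }
    apply is_lim_seq_spec in Hlim.
    assert (He : 0 < Re p - m) by lra.
    destruct (Hlim (mkposreal _ He)) as [N HN]. specialize (HN N (le_n _)). simpl in HN.
    rewrite Rminus_0_r in HN. apply Rabs_lt_between in HN.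
    specialize (Hp N). cbv beta in Hp. destruct (HT N) as [(H1 & _) _].
    pose proof (re_le_Cmod (fa (T N) - p)%C) as H2. destruct (fa (T N)), p. simpl in *.
    apply Rabs_le_between in H2. lra. }
  destruct (Hu p) as [l Hl]; [lra|].
  apply Cmod_eq_0. apply Rle_antisym; [|apply Cmod_ge_0].
  apply Rnot_lt_le. intros HI. set (I := Cmod (tri u a b c)) in *.
  assert (Hd : 0 <= d).
  { unfold d. pose proof (Cmod_ge_0 (b - a)%C). pose proof (Cmod_ge_0 (c - b)%C).
    pose proof (Cmod_ge_0 (a - c)%C). lra. }
  (* The three sides will contribute at most [3 * s * (4 * e * s)], which rescales to
     [I <= 12 * e * d ^ 2]; with this [e] the right side is below [I / 2]. The summand 1 covers
     [d = 0]. *)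
  set (e := I / (24 * (d ^ 2 + 1))).
  assert (Hd2 : 0 < d ^ 2 + 1) by nra.
  assert (He : 0 < e) by (apply Rdiv_lt_0_compat; lra).
  destruct (locally_C_inv _ _ (diffg_eps_inv _ _ _ _ Hl e He)) as [del [Hdel Hlin]].
  assert (Hlim : is_lim_seq (fun n => 4 * d / 2 ^ n) 0).
  { replace (Finite 0) with (Rbar_mult (4 * d) 0) by (simpl; f_equal; ring).
    apply is_lim_seq_scal_l. apply is_lim_seq_ext with (fun n => (/2) ^ n).
    - intros n. now rewrite pow_inv.
    - apply is_lim_seq_geom. rewrite Rabs_pos_eq; lra. }
  apply is_lim_seq_spec in Hlim.
  destruct (Hlim (mkposreal _ Hdel)) as [n Hn]. specialize (Hn n (le_n _)). simpl in Hn.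
  rewrite Rminus_0_r in Hn. apply Rabs_lt_between in Hn. destruct Hn as [_ Hn].
  destruct (HT n) as [HP HI2]. specialize (Hp n). cbv beta in Hp. unfold tr in HI2.
  unfold P in HP. set (a1 := fa (T n)) in *. set (b1 := fb (T n)) in *. set (c1 := fc (T n)) in *.
  destruct HP as (H1 & H2 & H3 & H4 & H5 & H6).
  set (s := d / 2 ^ n) in *.
  assert (Hs : 0 <= s) by (apply Rdiv_le_0_compat; [lra|apply pow_lt; lra]).
  replace (4 * d / 2 ^ n) with (4 * s) in Hn by (unfold s; field; apply pow_nonzero; lra).
  replace (2 * d / 2 ^ n) with (2 * s) in Hp by (unfold s; field; apply pow_nonzero; lra).
  pose (v := fun z => (u z - ((u p - l * p) + l * z))%C).
  (* The first vertex is within [2 s] of [p], the other two within [3 s], hence every point of the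
     sides within [4 s]. *)
  assert (Hv : forall z, Cmod (z - p)%C <= 4 * s -> Cmod (v z) <= 4 * e * s).
  { intros z Hz. unfold v.
    replace (u z - (u p - l * p + l * z))%C with (u z - u p - l * (z - p))%C by ring.
    eapply Rle_trans; [apply Hlin; lra|]. nra. }
  assert (Hvc : forall z, Re z < L -> clim v (@locally C_UniformSpace z) (v z)).
  { intros z Hz. unfold v. apply clim_minus; [typeclasses eauto|auto|].
    apply clim_plus; [typeclasses eauto|apply clim_const; typeclasses eauto|].
    apply clim_scal; [typeclasses eauto|]. apply clim_id. }
  assert (Ev : tri v a1 b1 c1 = tri u a1 b1 c1).
  { unfold tri, v. rewrite !(seg_minus_affine L u Huc); try lra. field. }
  assert (Hline : forall x y t, 0 <= t <= 1 -> Cmod (x - p)%C <= 3 * s -> Cmod (y - x)%C <= s ->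
     Cmod (x + RtoC t * (y - x) - p)%C <= 4 * s).
  { intros x y t Ht Hx Hxy.
    replace (x + RtoC t * (y - x) - p)%C with ((x - p) + RtoC t * (y - x))%C by ring.
    eapply Rle_trans; [apply Cmod_triangle|]. rewrite Cmod_mult Cmod_R Rabs_pos_eq; [|lra].
    pose proof (Cmod_ge_0 (y - x)%C). nra. }
  assert (Hb1 : Cmod (b1 - p)%C <= 3 * s) by (pose proof (Cmod_sub_triangle b1 a1 p); lra).
  assert (Hc1 : Cmod (c1 - p)%C <= 3 * s).
  { pose proof (Cmod_sub_triangle c1 a1 p). rewrite (Cmod_sub_sym c1 a1) in H. lra. }
  assert (S1 : Cmod (seg v a1 b1) <= Cmod (b1 - a1)%C * (4 * e * s)).
  { apply (seg_bound L v Hvc); try lra. intros t Ht. apply Hv. apply Hline; auto; lra. }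
  assert (S2 : Cmod (seg v b1 c1) <= Cmod (c1 - b1)%C * (4 * e * s)).
  { apply (seg_bound L v Hvc); try lra. intros t Ht. apply Hv. apply Hline; auto; lra. }
  assert (S3 : Cmod (seg v c1 a1) <= Cmod (a1 - c1)%C * (4 * e * s)).
  { apply (seg_bound L v Hvc); try lra. intros t Ht. apply Hv. apply Hline; auto; lra. }
  assert (Hes : 0 <= 4 * e * s) by nra.
  assert (Htot : Cmod (tri u a1 b1 c1) <= 12 * e * s ^ 2).
  { rewrite -Ev. unfold tri.
    pose proof (Cmod_triangle (seg v a1 b1 + seg v b1 c1)%C (seg v c1 a1)).
    pose proof (Cmod_triangle (seg v a1 b1)%C (seg v b1 c1)). nra. }
  assert (H7 : I / 4 ^ n <= 12 * e * s ^ 2) by lra.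
  assert (Es : s ^ 2 = d ^ 2 / 4 ^ n).
  { unfold s. replace 4 with (2 ^ 2) by (simpl; ring). rewrite -pow_mult Nat.mul_comm pow_mult.
    unfold Rdiv. rewrite Rpow_mult_distr pow_inv. reflexivity. }
  rewrite Es in H7.
  assert (H4n : 0 < 4 ^ n) by (apply pow_lt; lra).
  apply Rmult_le_compat_r with (r := 4 ^ n) in H7; [|lra].
  replace (I / 4 ^ n * 4 ^ n) with I in H7 by (field; lra).
  replace (12 * e * (d ^ 2 / 4 ^ n) * 4 ^ n) with (12 * e * d ^ 2) in H7 by (field; lra).
  assert (H8 : e * (24 * (d ^ 2 + 1)) = I) by (unfold e; field; lra).
  nra.
Qed.

(** * Circle means, Cauchy's formula for the derivative, isolated zeros *)

Definition unitc (t : R) : C := Cexp (RtoC t * (0, (2 * PI)%R))%C.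

(** The circle is run through once over a parameter interval of length 1, so the integral is already
    a mean. *)
Definition cmean (h : C -> C) (c : C) (r : R) : C :=
  CInt (fun t => h (c + RtoC r * unitc t)%C) 0 1.

Lemma Cmod_unitc t : Cmod (unitc t) = 1.
Proof. unfold unitc. rewrite Cmod_Cexp. simpl. rewrite -exp_0. f_equal. ring. Qed.

Lemma unitc_neq_0 t : unitc t <> 0.
Proof. apply Cmod_gt_0. rewrite Cmod_unitc. lra. Qed.

Lemma circle_dist (c : C) r t : 0 <= r -> Cmod (c + RtoC r * unitc t - c)%C = r.
Proof.
  intros Hr. replace (c + RtoC r * unitc t - c)%C with (RtoC r * unitc t)%C by ring.
  rewrite Cmod_mult Cmod_unitc Cmod_R Rabs_pos_eq; lra.
Qed.

Lemma circle_cont (c : C) r t :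
  clim (fun u => c + RtoC r * unitc u)%C (@locally R_UniformSpace t) (c + RtoC r * unitc t)%C.
Proof.
  apply clim_plus; [typeclasses eauto|apply clim_const; typeclasses eauto|].
  apply clim_scal; [typeclasses eauto|].
  eapply (rdiff_cont unitc). apply rdiff_Cexp_line.
Qed.

Lemma circle_CRI (h : C -> C) c r :
  (forall t, 0 <= t <= 1 ->
    clim h (@locally C_UniformSpace (c + RtoC r * unitc t)%C) (h (c + RtoC r * unitc t)%C)) ->
  CRI (fun t => h (c + RtoC r * unitc t)%C) 0 1 (cmean h c r).
Proof.
  intros H. apply CRI_ex. rewrite Rmin_left ?Rmax_right; try lra. intros t Ht.
  apply (clim_comp_C _ (fun u => c + RtoC r * unitc u)%C h (c + RtoC r * unitc t)%C); auto.
  apply circle_cont.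
Qed.

(** Under [z -> c + e^z] the circle of radius [r] is the vertical segment from [ln r] to
    [ln r + 2 i PI]. Two applications of Goursat's lemma cover the rectangle between two such
    segments, and its horizontal sides cancel by periodicity. *)
Lemma cmean_const (h : C -> C) (c : C) (R r1 r2 : R) :
  (forall z, 0 < Cmod (z - c)%C < R -> exists l, cdiff h z l) ->
  0 < r1 < R -> 0 < r2 < R -> cmean h c r1 = cmean h c r2.
Proof.
  intros Hh H1 H2.
  set (u := fun z => h (c + Cexp z)%C). set (L := ln R).
  assert (HR : 0 < R) by lra.
  assert (Hu : holo_lt L u).
  { intros z Hz. destruct (Hh (c + Cexp z)%C) as [l Hl].
    - replace (c + Cexp z - c)%C with (Cexp z) by ring. rewrite Cmod_Cexp.
      split; [apply exp_pos|]. rewrite -(exp_ln R HR). now apply exp_increasing.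
    - exists (l * (0 + Cexp z))%C. apply (diffg_comp (X := C_UniformSpace) _ cid_cont h (fun y => c + Cexp y)%C); [exact Hl|].
      apply diffg_plus; [apply diffg_const|apply cdiff_Cexp]. }
  assert (Huc : forall z, Re z < L -> clim u (@locally C_UniformSpace z) (u z)).
  { intros z Hz. destruct (Hu z Hz) as [l Hl]. now apply cdiff_cont with l. }
  set (A := RtoC (ln r1)). set (B := RtoC (ln r2)). set (w := (0, (2 * PI)%R) : C).
  assert (HA : Re A < L) by (simpl; apply ln_increasing; lra).
  assert (HB : Re B < L) by (simpl; apply ln_increasing; lra).
  assert (HA' : Re (A + w)%C < L) by (simpl in *; lra).
  assert (HB' : Re (B + w)%C < L) by (simpl in *; lra).
  pose proof (goursat L u A B (B + w)%C Hu HA HB HB') as T1.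
  pose proof (goursat L u A (B + w)%C (A + w)%C Hu HA HB' HA') as T2.
  unfold tri in T1, T2.
  assert (Hper : forall z, Cexp (z + w)%C = Cexp z).
  { intros z. rewrite Cexp_plus. replace (Cexp w) with (RtoC 1); [ring|].
    unfold Cexp, w; simpl. rewrite exp_0 cos_2PI sin_2PI. apply C_eq; simpl; ring. }
  assert (E1 : seg u (B + w)%C (A + w)%C = (- seg u A B)%C).
  { rewrite (seg_rev L u Huc (A + w)%C (B + w)%C) //. f_equal. unfold seg.
    replace (B + w - (A + w))%C with (B - A)%C by ring. f_equal.
    f_equal. apply functional_extensionality. intros t.
    replace (A + w + RtoC t * (B - A))%C with (A + RtoC t * (B - A) + w)%C by ring.
    unfold u. now rewrite Hper. }
  rewrite (seg_rev L u Huc A (B + w)%C) // in T1.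
  rewrite (seg_rev L u Huc A (A + w)%C) // E1 in T2.
  assert (E2 : seg u B (B + w)%C = seg u A (A + w)%C).
  { transitivity (seg u B (B + w) - (seg u A B + seg u B (B + w) + - seg u A (B + w))
       - (seg u A (B + w) + - seg u A B + - seg u A (A + w)))%C; [|ring].
    rewrite T1 T2. ring. }
  assert (E3 : forall r, 0 < r ->
     seg u (RtoC (ln r)) (RtoC (ln r) + w)%C = (w * cmean h c r)%C).
  { intros r Hr. unfold seg, cmean.
    replace (RtoC (ln r) + w - RtoC (ln r))%C with w by ring. f_equal. f_equal.
    apply functional_extensionality. intros t. unfold u. do 2 f_equal.
    rewrite Cexp_plus Cexp_RtoC exp_ln //. }
  unfold A, B in E2. rewrite !E3 in E2; try lra.
  assert (Hw : w <> 0). { intros E. injection E. pose proof PI_RGT_0. lra. }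
  transitivity ((w * cmean h c r1) / w)%C; [field; exact Hw|].
  rewrite -E2. field; exact Hw.
Qed.

(** The mean does not depend on the radius, so the circle may shrink to [c], where continuity is
    enough. Difference quotients satisfy exactly these hypotheses. *)
Lemma mean_value_punctured (h : C -> C) (c : C) (R r : R) :
  (forall z, 0 < Cmod (z - c)%C < R -> exists l, cdiff h z l) ->
  clim h (@locally C_UniformSpace c) (h c) ->
  0 < r < R -> cmean h c r = h c.
Proof.
  intros Hh Hc Hr. apply Cmod_sub_0. apply Rle_antisym; [|apply Cmod_ge_0].
  apply le_epsilon. intros e He. rewrite Rplus_0_l.
  destruct (locally_C_inv _ _ (Hc e He)) as [d [Hd Hde]].
  set (s := Rmin (d / 2) r).
  assert (Hs : 0 < s) by (apply Rmin_pos; lra).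
  assert (Hs1 : s <= d / 2) by apply Rmin_l. assert (Hs2 : s <= r) by apply Rmin_r.
  rewrite (cmean_const h c R r s Hh); try lra.
  assert (I1 : CRI (fun t => h (c + RtoC s * unitc t)%C) 0 1 (cmean h c s)).
  { apply circle_CRI. intros t Ht. destruct (Hh (c + RtoC s * unitc t)%C) as [l Hl].
    - rewrite circle_dist; lra.
    - now apply cdiff_cont with l. }
  pose proof (CRI_minus _ _ _ _ _ _ I1 (CRI_const (h c) 0 1)) as I2.
  replace (RtoC (1 - 0) * h c)%C with (h c) in I2
    by (replace (1 - 0) with 1 by ring; ring).
  replace e with (e * (1 - 0)) by ring.
  apply (CRI_bound _ _ _ _ _ Rle_0_1 I2). intros t Ht. left. apply Hde.
  rewrite circle_dist; lra.
Qed.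

Definition holo_disc (h : C -> C) (c : C) (R : R) : Prop :=
  forall z, Cmod (z - c)%C < R -> exists l, cdiff h z l.

Lemma holo_disc_deriv h c R : holo_disc h c R ->
  exists D, forall z, Cmod (z - c)%C < R -> cdiff h z (D z).
Proof.
  intros H. assert (H2 : forall z, exists l, Cmod (z - c)%C < R -> cdiff h z l).
  { intros z. destruct (Rlt_dec (Cmod (z - c)%C) R) as [Hz|Hz].
    - destruct (H z Hz) as [l Hl]. now exists l.
    - exists (RtoC 0). tauto. }
  apply choice in H2. destruct H2 as [D HD]. now exists D.
Qed.

Lemma mean_value h c R r : holo_disc h c R -> 0 < r < R -> cmean h c r = h c.
Proof.
  intros H Hr. apply mean_value_punctured with R; auto.
  - intros z Hz. apply H. lra.
  - destruct (H c) as [l Hl].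
    + replace (c - c)%C with (RtoC 0) by ring. rewrite Cmod_0. lra.
    + now apply cdiff_cont with l.
Qed.

Lemma holo_disc_sub h c R c' R' : holo_disc h c R -> Cmod (c' - c)%C + R' <= R ->
  holo_disc h c' R'.
Proof.
  intros H Hc z Hz. apply H. pose proof (Cmod_sub_triangle z c' c). lra.
Qed.

(** The difference quotient at [p]; it is continuous at [p] when the filled-in value [l] is the
    derivative. *)
Definition dquot (h : C -> C) (p l : C) (z : C) : C :=
  if excluded_middle_informative (z = p) then l else ((h z - h p) / (z - p))%C.

Lemma dquot_at h p l : dquot h p l p = l.
Proof. unfold dquot. destruct (excluded_middle_informative _); congruence. Qed.

Lemma dquot_neq h p l z : z <> p -> dquot h p l z = ((h z - h p) / (z - p))%C.
Proof. unfold dquot. destruct (excluded_middle_informative _); congruence. Qed.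

Lemma sub_neq_0 (z w : C) : z <> w -> (z - w)%C <> 0.
Proof. intros H E. apply H. apply Cmod_sub_0. rewrite E. apply Cmod_0. Qed.

Lemma dquot_cdiff_away h p l z m : z <> p -> cdiff h z m ->
  exists k, cdiff (dquot h p l) z k.
Proof.
  intros Hz Hh. eexists.
  apply diffg_ext_loc with (fun w => (h w - h p) / (w - p))%C.
  - assert (Hd : 0 < Cmod (z - p)%C) by (apply Cmod_gt_0; now apply sub_neq_0).
    generalize (locally_C z _ Hd). apply filter_imp. intros w Hw.
    rewrite dquot_neq //. intros ->. rewrite Cmod_sub_sym in Hw. lra.
  - apply (diffg_div _ cid_cont).
    + apply (diffg_minus _ cid_cont); [exact Hh|apply diffg_const].
    + apply (diffg_minus _ cid_cont); [apply diffg_iota|apply diffg_const].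
    + now apply sub_neq_0.
Qed.

Lemma dquot_cont h p l : cdiff h p l -> clim (dquot h p l) (@locally C_UniformSpace p) l.
Proof.
  intros H e He. assert (He2 : 0 < e / 2) by lra.
  generalize (diffg_eps_inv _ _ _ _ H _ He2). apply filter_imp. intros w Hw.
  destruct (classic (w = p)) as [->|Hne].
  - rewrite dquot_at. replace (l - l)%C with (RtoC 0) by ring. rewrite Cmod_0. lra.
  - rewrite dquot_neq //. assert (Hne' := sub_neq_0 _ _ Hne).
    replace ((h w - h p) / (w - p) - l)%C with ((h w - h p - l * (w - p)) / (w - p))%C
      by (field; exact Hne').
    rewrite Cmod_div //. apply Cmod_gt_0 in Hne'.
    apply Rle_lt_trans with (e / 2); [|lra].
    apply Rmult_le_reg_r with (Cmod (w - p)%C); [lra|].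
    unfold Rdiv at 1. rewrite Rmult_assoc Rinv_l; lra.
Qed.

Lemma Cmod_self_sub (c : C) : Cmod (c - c)%C = 0.
Proof. replace (c - c)%C with (RtoC 0) by ring. apply Cmod_0. Qed.

(** This is the mean value property of the difference quotient of [h] at [c], whose value at [c] is
    the derivative. *)
Lemma cauchy_derivative h c R l r : holo_disc h c R -> cdiff h c l -> 0 < r < R ->
  CRI (fun t => (h (c + RtoC r * unitc t) - h c) / (RtoC r * unitc t))%C 0 1 l.
Proof.
  intros H Hl Hr.
  assert (Hp : forall z, 0 < Cmod (z - c)%C < R -> exists m, cdiff (dquot h c l) z m).
  { intros z Hz. destruct (H z) as [m Hm]; [lra|]. apply dquot_cdiff_away with m; auto.
    intros ->. rewrite Cmod_self_sub in Hz. lra. }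
  pose proof (mean_value_punctured (dquot h c l) c R r Hp) as Hmv.
  rewrite dquot_at in Hmv. rewrite -Hmv //; [|now apply dquot_cont].
  apply CRI_ext with (fun t => dquot h c l (c + RtoC r * unitc t)%C).
  - intros t _. rewrite dquot_neq.
    + replace (c + RtoC r * unitc t - c)%C with (RtoC r * unitc t)%C by ring. reflexivity.
    + intros E. pose proof (circle_dist c r t) as K. rewrite E Cmod_self_sub in K. lra.
  - apply circle_CRI. intros t Ht.
    destruct (Hp (c + RtoC r * unitc t)%C) as [m Hm].
    + rewrite circle_dist; lra.
    + now apply cdiff_cont with m.
Qed.

Lemma disc_convex (c p q : C) rho t : Cmod (p - c)%C < rho -> Cmod (q - c)%C < rho ->
  0 <= t <= 1 -> Cmod (p + RtoC t * (q - p) - c)%C < rho.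
Proof.
  intros Hp Hq Ht.
  replace (p + RtoC t * (q - p) - c)%C with (RtoC (1 - t) * (p - c) + RtoC t * (q - c))%C
    by (rewrite RtoC_minus; ring).
  eapply Rle_lt_trans; [apply Cmod_triangle|]. rewrite !Cmod_mult !Cmod_R !Rabs_pos_eq; try lra.
  apply Rle_lt_trans with ((1 - t) * Rmax (Cmod (p - c)%C) (Cmod (q - c)%C)
     + t * Rmax (Cmod (p - c)%C) (Cmod (q - c)%C)).
  - apply Rplus_le_compat; apply Rmult_le_compat_l; try lra; [apply Rmax_l|apply Rmax_r].
  - replace (_ + _) with (Rmax (Cmod (p - c)%C) (Cmod (q - c)%C)) by ring.
    now apply Rmax_lub_lt.
Qed.

Lemma disc_lipschitz h D c rho B :
  (forall z, Cmod (z - c)%C < rho -> cdiff h z (D z)) ->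
  (forall z, Cmod (z - c)%C < rho -> Cmod (D z) <= B) ->
  forall p q, Cmod (p - c)%C < rho -> Cmod (q - c)%C < rho ->
    Cmod (h q - h p)%C <= B * Cmod (q - p)%C.
Proof.
  intros Hh HB p q Hp Hq. apply seg_mvt with D; intros t Ht.
  - apply Hh. now apply disc_convex.
  - apply HB. now apply disc_convex.
Qed.

Lemma Cmod_quot_circle (z : C) r t B : 0 < r -> Cmod z <= B -> Cmod (z / (RtoC r * unitc t))%C <= B / r.
Proof.
  intros Hr Hz. rewrite Cmod_div.
  - rewrite Cmod_mult Cmod_unitc Cmod_R Rabs_pos_eq; [|lra].
    rewrite Rmult_1_r. apply Rmult_le_compat_r; [left; now apply Rinv_0_lt_compat|exact Hz].
  - apply Cmult_neq_0; [|apply unitc_neq_0]. intros E. injection E. lra.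
Qed.

Lemma holo_disc_local_bound h c R : 0 < R -> holo_disc h c R ->
  exists r M, 0 < r /\ 4 * r <= R /\ forall z, Cmod (z - c)%C < 4 * r -> Cmod (h z) <= M.
Proof.
  intros HR H. destruct (H c) as [l Hl]; [rewrite Cmod_self_sub; lra|].
  apply cdiff_cont in Hl. apply clim_bounded in Hl; [|typeclasses eauto].
  destruct (locally_C_inv _ _ Hl) as [d [Hd Hb]].
  exists (Rmin (d / 4) (R / 4)), (Cmod (h c) + 1).
  pose proof (Rmin_l (d / 4) (R / 4)). pose proof (Rmin_r (d / 4) (R / 4)).
  split; [apply Rmin_pos; lra|]. split; [lra|]. intros z Hz. apply Hb. lra.
Qed.

(** Cauchy's formula expresses [D] by values of [h] on a circle of radius [r], so bounds climb by
    turns: [h] bounded on radius [4 r], then [D] bounded and [h] Lipschitz on [3 r], then [D]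
    Lipschitz and [h] quadratically approximated on [2 r], then [D] differentiable at [c]. The
    candidate derivative is the circle mean of the difference quotient of [D]. *)
Lemma deriv_cdiff h D c R : 0 < R ->
  (forall z, Cmod (z - c)%C < R -> cdiff h z (D z)) -> exists l, cdiff D c l.
Proof.
  intros HR HD.
  assert (Hh : holo_disc h c R) by (intros z Hz; exists (D z); auto).
  destruct (holo_disc_local_bound h c R HR Hh) as (r & M & Hr & Hr4 & HM).
  assert (HDI : forall z, Cmod (z - c)%C < 3 * r ->
    CRI (fun t => (h (z + RtoC r * unitc t) - h z) / (RtoC r * unitc t))%C 0 1 (D z)).
  { intros z Hz. apply cauchy_derivative with (R - Cmod (z - c)%C); [|apply HD; lra|lra].
    apply holo_disc_sub with c R; [exact Hh|lra]. }
  assert (Hcirc : forall z t, Cmod (z + RtoC r * unitc t - c)%C <= Cmod (z - c)%C + r).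
  { intros z t. pose proof (Cmod_sub_triangle (z + RtoC r * unitc t)%C z c).
    rewrite circle_dist in H; lra. }
  set (K := 2 * M / r).
  assert (HB : forall z, Cmod (z - c)%C < 3 * r -> Cmod (D z) <= K).
  { intros z Hz. replace K with (K * (1 - 0)) by ring.
    apply (CRI_bound _ _ _ _ _ Rle_0_1 (HDI z Hz)). intros t Ht.
    apply Cmod_quot_circle; [exact Hr|].
    eapply Rle_trans; [apply Cmod_triangle_sub|].
    pose proof (HM (z + RtoC r * unitc t)%C). pose proof (HM z).
    pose proof (Hcirc z t). lra. }
  assert (HD3 : forall z, Cmod (z - c)%C < 3 * r -> cdiff h z (D z)) by (intros; apply HD; lra).
  pose proof (disc_lipschitz h D c (3 * r) K HD3 HB) as HL.
  set (K2 := 2 * K / r).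
  assert (HL2 : forall p q, Cmod (p - c)%C < 2 * r -> Cmod (q - c)%C < 2 * r ->
    Cmod (D q - D p)%C <= K2 * Cmod (q - p)%C).
  { intros p q Hp Hq.
    pose proof (CRI_minus _ _ _ _ _ _ (HDI q ltac:(lra)) (HDI p ltac:(lra))) as I.
    replace (K2 * Cmod (q - p)%C) with (K2 * Cmod (q - p)%C * (1 - 0)) by ring.
    apply (CRI_bound _ _ _ _ _ Rle_0_1 I). intros t Ht.
    replace ((h (q + RtoC r * unitc t) - h q) / (RtoC r * unitc t)
      - (h (p + RtoC r * unitc t) - h p) / (RtoC r * unitc t))%C
    with (((h (q + RtoC r * unitc t) - h (p + RtoC r * unitc t)) - (h q - h p))
         / (RtoC r * unitc t))%C.
    2:{ field. split; [apply unitc_neq_0|]. intros E; injection E; lra. }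
    replace (K2 * Cmod (q - p)%C) with ((2 * K * Cmod (q - p)%C) / r) by (unfold K2; field; lra).
    apply Cmod_quot_circle; [exact Hr|].
    eapply Rle_trans; [apply Cmod_triangle_sub|].
    pose proof (Hcirc p t). pose proof (Hcirc q t).
    pose proof (HL p q ltac:(lra) ltac:(lra)).
    pose proof (HL (p + RtoC r * unitc t)%C (q + RtoC r * unitc t)%C ltac:(lra) ltac:(lra)) as H3.
    replace (q + RtoC r * unitc t - (p + RtoC r * unitc t))%C with (q - p)%C in H3 by ring.
    lra. }
  assert (HK2 : 0 <= K2).
  { pose proof (HB c) as H. rewrite Cmod_self_sub in H. specialize (H ltac:(lra)).
    pose proof (Cmod_ge_0 (D c)). unfold K2. apply Rdiv_le_0_compat; lra. }
  assert (HQ : forall p q, Cmod (p - c)%C < 2 * r -> Cmod (q - c)%C < 2 * r ->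
    Cmod (h q - h p - (q - p) * D p)%C <= K2 * Cmod (q - p)%C ^ 2).
  { intros p q Hp Hq.
    replace (h q - h p - (q - p) * D p)%C with ((h q - D p * q) - (h p - D p * p))%C by ring.
    replace (K2 * Cmod (q - p)%C ^ 2) with (K2 * Cmod (q - p)%C * Cmod (q - p)%C) by ring.
    apply (seg_mvt (fun z => h z - D p * z)%C (fun z => D z - D p)%C); intros t Ht.
    - pose proof (disc_convex c p q _ t Hp Hq Ht).
      eapply diffg_eq; [|apply (diffg_minus _ cid_cont); [apply HD; lra|
        apply (diffg_scal _ cid_cont); apply diffg_iota]]. ring.
    - eapply Rle_trans; [apply HL2; auto; now apply disc_convex|].
      replace (p + RtoC t * (q - p) - p)%C with (RtoC t * (q - p))%C by ring.
      rewrite Cmod_mult Cmod_R Rabs_pos_eq; [|lra].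
      apply Rmult_le_compat_l; [exact HK2|]. pose proof (Cmod_ge_0 (q - p)%C). nra. }
  assert (Hcont : forall z, Cmod (z - c)%C < 2 * r -> clim D (@locally C_UniformSpace z) (D z)).
  { intros z Hz e He. set (dd := Rmin (2 * r - Cmod (z - c)%C) (e / (K2 + 1))).
    assert (H1 : 0 < e / (K2 + 1)) by (apply Rdiv_lt_0_compat; lra).
    assert (Hdd : 0 < dd) by (apply Rmin_pos; lra).
    generalize (locally_C z dd Hdd). apply filter_imp. intros w Hw.
    assert (Hw1 : Cmod (w - z)%C < 2 * r - Cmod (z - c)%C) by (eapply Rlt_le_trans; [exact Hw|apply Rmin_l]).
    assert (Hw2 : Cmod (w - z)%C < e / (K2 + 1)) by (eapply Rlt_le_trans; [exact Hw|apply Rmin_r]).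
    pose proof (Cmod_sub_triangle w z c).
    eapply Rle_lt_trans; [apply HL2; [exact Hz|lra]|].
    apply Rle_lt_trans with (K2 * (e / (K2 + 1))); [apply Rmult_le_compat_l; lra|].
    apply Rmult_lt_reg_r with (K2 + 1); [lra|].
    replace (K2 * (e / (K2 + 1)) * (K2 + 1)) with (K2 * e) by (field; lra). nra. }
  pose (q2 := fun z => ((D z - D c) / (z - c))%C).
  assert (Hq2 : CRI (fun t => q2 (c + RtoC r * unitc t)%C) 0 1 (cmean q2 c r)).
  { apply circle_CRI. intros t Ht. unfold q2. apply clim_div; [typeclasses eauto| | |].
    - apply clim_minus; [typeclasses eauto| |apply clim_const; typeclasses eauto].
      apply Hcont. rewrite circle_dist; lra.
    - apply clim_minus; [typeclasses eauto|apply clim_id|apply clim_const; typeclasses eauto].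
    - apply Cmod_gt_0. rewrite circle_dist; lra. }
  exists (cmean q2 c r).
  apply (diffg_quad (X := C_UniformSpace) (fun w => w) cid_cont) with (2 * K2 / r).
  generalize (locally_C c r Hr). apply filter_imp. intros w Hw.
  pose proof (CRI_minus _ _ _ _ _ _ (HDI w ltac:(lra))
     (HDI c ltac:(rewrite Cmod_self_sub; lra))) as I1.
  pose proof (CRI_minus _ _ _ _ _ _ I1 (CRI_scal (w - c)%C _ _ _ _ Hq2)) as I2.
  replace (cmean q2 c r * (w - c))%C with ((w - c) * cmean q2 c r)%C by ring.
  replace (2 * K2 / r * Cmod (w - c)%C ^ 2) with ((2 * K2 * Cmod (w - c)%C ^ 2) / r * (1 - 0))
    by (field; lra).
  apply (CRI_bound _ _ _ _ _ Rle_0_1 I2). intros t Ht. unfold q2.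
  assert (Hne : RtoC r <> 0) by (intros E; injection E; lra).
  pose proof (unitc_neq_0 t) as Hne2.
  replace (c + RtoC r * unitc t - c)%C with (RtoC r * unitc t)%C by ring.
  replace (_ - _)%C with
    (((h (w + RtoC r * unitc t) - h (c + RtoC r * unitc t) - (w - c) * D (c + RtoC r * unitc t))
      - (h w - h c - (w - c) * D c)) / (RtoC r * unitc t))%C by (field; auto).
  apply Cmod_quot_circle; [exact Hr|].
  eapply Rle_trans; [apply Cmod_triangle_sub|].
  pose proof (HQ c w ltac:(rewrite Cmod_self_sub; lra) ltac:(lra)) as Q1.
  pose proof (Hcirc w t). pose proof (circle_dist c r t ltac:(lra)).
  pose proof (HQ (c + RtoC r * unitc t)%C (w + RtoC r * unitc t)%C ltac:(lra) ltac:(lra)) as Q2.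
  replace (w + RtoC r * unitc t - (c + RtoC r * unitc t))%C with (w - c)%C in Q2 by ring.
  lra.
Qed.

Lemma locally'_C_proper (c : C) : ProperFilter' (@locally' C_UniformSpace c).
Proof.
  split; [|typeclasses eauto]. intros [eps He].
  pose proof (cond_pos eps) as Hp.
  assert (E0 : (c + RtoC (eps / 2) - c)%C = RtoC (eps / 2)) by ring.
  apply (He (c + RtoC (eps / 2))%C).
  - apply C_NormedModule_mixin_compat1.
    change (Cmod (c + RtoC (eps / 2) - c)%C < eps).
    rewrite E0 Cmod_R Rabs_pos_eq; lra.
  - intros E. rewrite E in E0. replace (c - c)%C with (RtoC 0) in E0 by ring.
    injection E0. lra.
Qed.

(** Only the point [c] is in question. There the derivative is half the second derivative of [h], by
    the mean value inequality for [h] minus its quadratic Taylor polynomial. *)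
Lemma holo_disc_dquot h c R l : cdiff h c l -> holo_disc h c R ->
  holo_disc (dquot h c l) c R.
Proof.
  intros Hl H z Hz.
  destruct (classic (z = c)) as [->|Hne].
  2:{ destruct (H z Hz) as [m Hm]. now apply dquot_cdiff_away with m. }
  rewrite Cmod_self_sub in Hz.
  destruct (holo_disc_deriv h c R H) as [D HD].
  destruct (deriv_cdiff h D c R Hz HD) as [D2 HD2].
  assert (HDc : D c = l).
  { apply (clim_unique (FF := locally'_C_proper c) (@locally' C_UniformSpace c) (dquot h c l)).
    - intros e He.
      pose proof (dquot_cont h c (D c) (HD c ltac:(rewrite Cmod_self_sub; lra)) e He) as K.
      change (@locally C_UniformSpace c (fun w => w <> c -> Cmod (dquot h c l w - D c)%C < e)).
      generalize K. apply filter_imp. intros w Hw Hne.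
      rewrite dquot_neq // in Hw. rewrite dquot_neq //.
    - intros e He. pose proof (dquot_cont h c l Hl e He) as K.
      change (@locally C_UniformSpace c (fun w => w <> c -> Cmod (dquot h c l w - l)%C < e)).
      generalize K. apply filter_imp. intros w Hw Hne. exact Hw. }
  exists (D2 / 2)%C.
  apply (diffg_eps (X := C_UniformSpace)). intros e He.
  destruct (locally_C_inv _ _ (diffg_eps_inv _ _ _ _ HD2 e He)) as [d [Hd Hq]].
  assert (Hm : 0 < Rmin d R) by (apply Rmin_pos; lra).
  generalize (locally_C c _ Hm). apply filter_imp. intros w Hw.
  assert (Hw1 : Cmod (w - c)%C < d) by (eapply Rlt_le_trans; [exact Hw|apply Rmin_l]).
  assert (Hw2 : Cmod (w - c)%C < R) by (eapply Rlt_le_trans; [exact Hw|apply Rmin_r]).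
  destruct (classic (w = c)) as [->|Hne].
  { rewrite !dquot_at. replace (l - l - D2 / 2 * (c - c))%C with (RtoC 0) by ring.
    rewrite Cmod_0 Cmod_self_sub. lra. }
  rewrite dquot_at dquot_neq //. assert (Hne' := sub_neq_0 _ _ Hne).
  replace ((h w - h c) / (w - c) - l - D2 / 2 * (w - c))%C with
    ((h w - h c - l * (w - c) - D2 / 2 * (w - c) * (w - c)) / (w - c))%C
    by (field; exact Hne').
  rewrite Cmod_div //. apply Cmod_gt_0 in Hne'.
  apply Rmult_le_reg_r with (Cmod (w - c)%C); [lra|].
  unfold Rdiv at 1. rewrite Rmult_assoc Rinv_l; [|lra]. rewrite Rmult_1_r.
  replace (h w - h c - l * (w - c) - D2 / 2 * (w - c) * (w - c))%C with
    ((h w - (l * (w - c) + D2 / 2 * (w - c) * (w - c)))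
     - (h c - (l * (c - c) + D2 / 2 * (c - c) * (c - c))))%C by ring.
  apply (seg_mvt (fun z => h z - (l * (z - c) + D2 / 2 * (z - c) * (z - c)))%C
     (fun z => D z - (l + D2 * (z - c)))%C); intros t Ht.
  - eapply diffg_eq; [|apply (diffg_minus _ cid_cont);
      [apply HD|apply diffg_plus;[apply (diffg_scal _ cid_cont); apply (diffg_minus _ cid_cont);
         [apply diffg_iota|apply diffg_const]
       |apply (diffg_mult _ cid_cont); [apply (diffg_scal _ cid_cont)|];
        apply (diffg_minus _ cid_cont); [apply diffg_iota|apply diffg_const|apply diffg_iota|apply diffg_const]]]].
    + cbv beta. field.
    + apply disc_convex; auto. rewrite Cmod_self_sub; lra.
  - rewrite -HDc.
    set (v := (c + RtoC t * (w - c))%C).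
    assert (Hv : Cmod (v - c)%C <= Cmod (w - c)%C).
    { unfold v. replace (c + RtoC t * (w - c) - c)%C with (RtoC t * (w - c))%C by ring.
      rewrite Cmod_mult Cmod_R Rabs_pos_eq; [|lra]. nra. }
    replace (D v - (D c + D2 * (v - c)))%C with (D v - D c - D2 * (v - c))%C by ring.
    eapply Rle_trans; [apply Hq; lra|]. apply Rmult_le_compat_l; lra.
Qed.

(** Factors [z - c] are divided out for as long as the quotient vanishes at [c]. If this never
    stops, [h = (z - c)^n g] for every [n]. Points at distance [2 r] from [w] are at distance at
    least [r] from [c], so the mean value property gives [|g w| <= M / r^n], and
    [|h w| <= M (|w - c| / r)^n] tends to 0. *)
Lemma isolated_zeros h c R : 0 < R -> holo_disc h c R ->
  (exists d, 0 < d /\ forall z, Cmod (z - c)%C < d -> h z = 0) \/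
  (exists d, 0 < d /\ forall z, 0 < Cmod (z - c)%C < d -> h z <> 0).
Proof.
  intros HR H.
  destruct (classic (exists n g, holo_disc g c R /\ g c <> 0 /\
     forall z, Cmod (z - c)%C < R -> h z = ((z - c) ^ n * g z)%C)) as [Hex|Hno].
  - right. destruct Hex as (n & g & Hg & Hgc & E).
    destruct (Hg c) as [l Hl]; [rewrite Cmod_self_sub; lra|].
    apply cdiff_cont in Hl.
    destruct (locally_C_inv _ _ (clim_away_0 _ _ _ Hl Hgc)) as [d [Hd Hda]].
    exists (Rmin d R). split; [apply Rmin_pos; lra|]. intros z [Hz0 Hz].
    assert (Hw1 : Cmod (z - c)%C < d) by (eapply Rlt_le_trans; [exact Hz|apply Rmin_l]).
    assert (Hw2 : Cmod (z - c)%C < R) by (eapply Rlt_le_trans; [exact Hz|apply Rmin_r]).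
    rewrite E //. apply Cmult_neq_0.
    + apply Cpow_nz. now apply Cmod_gt_0.
    + apply Cmod_gt_0. specialize (Hda z Hw1). apply Cmod_gt_0 in Hgc. lra.
  - left.
    assert (Hall : forall n, exists g, holo_disc g c R /\
       forall z, Cmod (z - c)%C < R -> h z = ((z - c) ^ n * g z)%C).
    { induction n as [|n (g & Hg & E)].
      - exists h. split; [exact H|]. intros; simpl; ring.
      - destruct (classic (g c = 0)) as [Hgc|Hgc].
        2:{ exfalso. apply Hno. exists n, g. auto. }
        destruct (Hg c) as [l Hl]; [rewrite Cmod_self_sub; lra|].
        exists (dquot g c l). split; [now apply holo_disc_dquot|].
        intros z Hz. rewrite E //. destruct (classic (z = c)) as [->|Hne].
        + rewrite Hgc. simpl. ring.
        + rewrite dquot_neq // Hgc. simpl. field. now apply sub_neq_0. }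
    destruct (holo_disc_local_bound h c R HR H) as (r & M & Hr & Hr4 & HM).
    exists r. split; [exact Hr|]. intros w Hw.
    assert (Hb : forall n, Cmod (h w) <= M * (Cmod (w - c)%C / r) ^ n).
    { intros n. destruct (Hall n) as (g & Hg & E).
      rewrite E; [|lra]. rewrite Cmod_mult Cmod_pow.
      assert (Hg2 : holo_disc g w (3 * r)) by (apply holo_disc_sub with c R; [exact Hg|lra]).
      rewrite -(mean_value g w (3 * r) (2 * r) Hg2); [|lra].
      assert (I : CRI (fun t => g (w + RtoC (2 * r) * unitc t)%C) 0 1 (cmean g w (2 * r))).
      { apply circle_CRI. intros t Ht. destruct (Hg2 (w + RtoC (2 * r) * unitc t)%C) as [l Hl].
        - rewrite circle_dist; lra.
        - now apply cdiff_cont with l. }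
      assert (Hcm : Cmod (cmean g w (2 * r)) <= M / r ^ n * (1 - 0)).
      { apply (CRI_bound _ _ _ _ _ Rle_0_1 I). intros t Ht.
        set (z := (w + RtoC (2 * r) * unitc t)%C).
        assert (Hz : Cmod (z - w)%C = 2 * r) by (apply circle_dist; lra).
        pose proof (Cmod_sub_triangle z w c). pose proof (Cmod_sub_triangle z c w).
        rewrite (Cmod_sub_sym c w) in H1.
        assert (Hzr : r <= Cmod (z - c)%C) by lra.
        specialize (HM z ltac:(lra)). rewrite E in HM; [|lra].
        rewrite Cmod_mult Cmod_pow in HM.
        assert (Hrn : 0 < r ^ n) by now apply pow_lt.
        apply Rmult_le_reg_r with (r ^ n); [exact Hrn|].
        unfold Rdiv. rewrite Rmult_assoc Rinv_l ?Rmult_1_r; [|lra].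
        eapply Rle_trans; [|exact HM]. rewrite Rmult_comm.
        apply Rmult_le_compat_r; [apply Cmod_ge_0|]. apply pow_incr. lra. }
      rewrite Rminus_0_r Rmult_1_r in Hcm.
      unfold Rdiv. rewrite Rpow_mult_distr pow_inv.
      apply Rle_trans with (Cmod (w - c)%C ^ n * (M / r ^ n)).
      - apply Rmult_le_compat_l; [apply pow_le, Cmod_ge_0|exact Hcm].
      - right. unfold Rdiv. ring. }
    apply Cmod_eq_0. apply Rle_antisym; [|apply Cmod_ge_0].
    assert (Hlim : is_lim_seq (fun n => M * (Cmod (w - c)%C / r) ^ n) 0).
    { replace (Finite 0) with (Rbar_mult M 0) by (simpl; f_equal; ring).
      apply is_lim_seq_scal_l. apply is_lim_seq_geom.
      rewrite Rabs_pos_eq; [|apply Rdiv_le_0_compat; [apply Cmod_ge_0|lra]].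
      apply Rmult_lt_reg_r with r; [lra|]. unfold Rdiv. rewrite Rmult_assoc Rinv_l; lra. }
    apply (is_lim_seq_le (fun _ => Cmod (h w)) _ (Cmod (h w)) 0 Hb (is_lim_seq_const _) Hlim).
Qed.

(** * Identity theorem for meromorphic functions *)

(** With [n = 0] allowed and no condition on [g p], this weaker form of holomorphic or pole is
    stable under differences and products. *)
Definition mero_at (h : C -> C) (p : C) : Prop :=
  exists (n : nat) (g : C -> C) (R : R), 0 < R /\ holo_disc g p R /\
    forall z, 0 < Cmod (z - p)%C < R -> h z = (g z / (z - p) ^ n)%C.

(** The neighbourhood is punctured because values at poles are arbitrary. *)
Definition zero_near (h : C -> C) (p : C) : Prop :=
  exists d, 0 < d /\ forall z, 0 < Cmod (z - p)%C < d -> h z = 0.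

Lemma is_derive_cdiff (f : C -> C) (z l : C) :
  @is_derive C_AbsRing C_NormedModule f z l -> cdiff f z l.
Proof.
  intros [_ H]. apply (diffg_eps (X := C_UniformSpace)). intros e He.
  specialize (H z (fun P HP => HP) (mkposreal _ He)).
  destruct H as [d Hd]. generalize (locally_C z d (cond_pos d)). apply filter_imp.
  intros w Hwd. specialize (Hd w Hwd). rename Hd into Hw.
  change (Cmod ((f w - f z) - (w - z) * l)%C <= e * Cmod (w - z)%C) in Hw.
  now replace (f w - f z - l * (w - z))%C with (f w - f z - (w - z) * l)%C by ring.
Qed.

Lemma holomorphic_at_disc f z : holomorphic_at f z -> exists r, 0 < r /\ holo_disc f z r.
Proof.
  intros (r & Hr & H). exists r. split; [exact Hr|]. intros w Hw.
  destruct (H w Hw) as [l Hl]. exists l. now apply is_derive_cdiff.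
Qed.

Lemma Cmod_sub_pos (z w : C) : z <> w -> 0 < Cmod (z - w)%C.
Proof. intros H. apply Cmod_gt_0. now apply sub_neq_0. Qed.

Lemma sub_pos_neq (z p : C) : 0 < Cmod (z - p)%C -> (z - p)%C <> 0.
Proof. intros H. now apply Cmod_gt_0. Qed.

Lemma holo_mero f p r : 0 < r -> holo_disc f p r -> mero_at f p.
Proof.
  intros Hr H. exists 0%nat, f, r. repeat split; auto. intros z _. simpl. field.
Qed.

Lemma holomorphic_or_pole_mero f p : holomorphic_at f p \/ pole_at f p -> mero_at f p.
Proof.
  intros [H|H].
  - destruct (holomorphic_at_disc _ _ H) as (r & Hr & H'). now apply holo_mero with r.
  - destruct H as (n & g & r & _ & Hr & Hg & _ & E).
    destruct (holomorphic_at_disc _ _ Hg) as (r' & Hr' & Hg').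
    exists n, g, (Rmin r r'). repeat split.
    + apply Rmin_pos; lra.
    + apply holo_disc_sub with p r'; [exact Hg'|]. rewrite Cmod_self_sub.
      pose proof (Rmin_r r r'). lra.
    + intros z Hz. apply E. pose proof (Rmin_l r r'). lra.
Qed.

Lemma cdiff_pow_line p n z : exists l, cdiff (fun w => (w - p) ^ n)%C z l.
Proof.
  induction n as [|n [l IH]].
  - exists (RtoC 0). apply (diffg_const (X := C_UniformSpace) (fun w => w) (RtoC 1) z).
  - eexists. simpl. apply (diffg_mult _ cid_cont); [|exact IH].
    apply (diffg_minus _ cid_cont); [apply diffg_iota|apply diffg_const].
Qed.

Lemma mero_minus f g p : mero_at f p -> mero_at g p -> mero_at (fun z => f z - g z)%C p.
Proof.
  intros (n & f1 & R1 & HR1 & H1 & E1) (m & g1 & R2 & HR2 & H2 & E2).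
  exists (n + m)%nat, (fun z => f1 z * (z - p) ^ m - g1 z * (z - p) ^ n)%C, (Rmin R1 R2).
  pose proof (Rmin_l R1 R2). pose proof (Rmin_r R1 R2).
  repeat split.
  - apply Rmin_pos; lra.
  - intros z Hz. destruct (H1 z) as [l1 L1]; [lra|]. destruct (H2 z) as [l2 L2]; [lra|].
    destruct (cdiff_pow_line p m z) as [k1 K1]. destruct (cdiff_pow_line p n z) as [k2 K2].
    eexists. apply (diffg_minus _ cid_cont); apply (diffg_mult _ cid_cont); eassumption.
  - intros z [Hz0 Hz]. rewrite E1; [|lra]. rewrite E2; [|lra].
    apply sub_pos_neq in Hz0. rewrite Cpow_add_r. field. split; now apply Cpow_nz.
Qed.

Lemma mero_mult f g p : mero_at f p -> mero_at g p -> mero_at (fun z => f z * g z)%C p.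
Proof.
  intros (n & f1 & R1 & HR1 & H1 & E1) (m & g1 & R2 & HR2 & H2 & E2).
  exists (n + m)%nat, (fun z => f1 z * g1 z)%C, (Rmin R1 R2).
  pose proof (Rmin_l R1 R2). pose proof (Rmin_r R1 R2).
  repeat split.
  - apply Rmin_pos; lra.
  - intros z Hz. destruct (H1 z) as [l1 L1]; [lra|]. destruct (H2 z) as [l2 L2]; [lra|].
    eexists. apply (diffg_mult _ cid_cont); eassumption.
  - intros z [Hz0 Hz]. rewrite E1; [|lra]. rewrite E2; [|lra].
    apply sub_pos_neq in Hz0. rewrite Cpow_add_r. field. split; now apply Cpow_nz.
Qed.

Lemma mero_zero_or_nonzero h p : mero_at h p ->
  zero_near h p \/ exists d, 0 < d /\ forall z, 0 < Cmod (z - p)%C < d -> h z <> 0.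
Proof.
  intros (n & g & R & HR & Hg & E).
  destruct (isolated_zeros g p R HR Hg) as [(d & Hd & H)|(d & Hd & H)]; [left|right];
    exists (Rmin d R); (split; [apply Rmin_pos; lra|]); intros z Hz;
    pose proof (Rmin_l d R); pose proof (Rmin_r d R); (rewrite E; [|lra]).
  - rewrite H; [|lra]. unfold Cdiv. ring.
  - intros E0. apply (H z); [lra|].
    assert (Hne : ((z - p) ^ n)%C <> 0) by (apply Cpow_nz, sub_pos_neq; lra).
    transitivity (g z / (z - p) ^ n * (z - p) ^ n)%C; [field; exact Hne|].
    rewrite E0. ring.
Qed.

Lemma small_step (q : C) (e : R) : 0 < e -> exists z, 0 < Cmod (z - q)%C < e.
Proof.
  intros He. exists (q + RtoC (e / 2))%C.
  replace (q + RtoC (e / 2) - q)%C with (RtoC (e / 2)) by ring.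
  rewrite Cmod_R Rabs_pos_eq; lra.
Qed.

Lemma zero_near_open (h : C -> C) p d : (forall z, 0 < Cmod (z - p)%C < d -> h z = 0) ->
  forall q, Cmod (q - p)%C < d -> zero_near h q.
Proof.
  intros H q Hq. destruct (classic (q = p)) as [->|Hne].
  - rewrite Cmod_self_sub in Hq. exists d. split; [lra|exact H].
  - apply Cmod_sub_pos in Hne.
    exists (Rmin (Cmod (q - p)%C) (d - Cmod (q - p)%C)). split; [apply Rmin_pos; lra|].
    intros z Hz. pose proof (Rmin_l (Cmod (q - p)%C) (d - Cmod (q - p)%C)).
    pose proof (Rmin_r (Cmod (q - p)%C) (d - Cmod (q - p)%C)).
    apply H. pose proof (Cmod_sub_triangle z q p). pose proof (Cmod_sub_triangle q z p).
    rewrite (Cmod_sub_sym q z) in H3. lra.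
Qed.

(** Connectedness of the segment by a least upper bound: at the supremum [tau] the zeros cannot be
    isolated, so [h] vanishes around it and the interval would extend further unless [tau = 1].
    Segments suffice since the identity theorem is used on half-planes only. *)
Lemma identity_segment h a b :
  (forall t, 0 <= t <= 1 -> mero_at h (a + RtoC t * (b - a))%C) ->
  zero_near h a -> zero_near h b.
Proof.
  intros Hm Ha. set (g := fun t => (a + RtoC t * (b - a))%C).
  assert (Hdist : forall s t, Cmod (g s - g t)%C = Rabs (s - t) * Cmod (b - a)%C).
  { intros s t. unfold g. rewrite -Cmod_R -Cmod_mult RtoC_minus. f_equal. ring. }
  pose (E := fun t => 0 <= t <= 1 /\ forall s, 0 <= s <= t -> zero_near h (g s)).
  assert (HE0 : E 0).
  { split; [lra|]. intros s Hs. replace s with 0 by lra.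
    unfold g. replace (a + RtoC 0 * (b - a))%C with a by ring. exact Ha. }
  destruct (completeness E) as [tau [Hub Hlub]].
  { exists 1. intros t [Ht _]. lra. }
  { now exists 0. }
  assert (Htau : 0 <= tau <= 1).
  { split; [now apply Hub|]. apply Hlub. intros t [Ht _]; lra. }
  assert (Hbefore : forall s, 0 <= s < tau -> zero_near h (g s)).
  { intros s Hs. apply NNPP. intros Hno. assert (tau <= s); [|lra]. apply Hlub.
    intros t [Ht1 Ht2]. apply Rnot_lt_le. intros Hlt. apply Hno, Ht2. lra. }
  pose proof (Cmod_ge_0 (b - a)%C) as HB. set (D := Cmod (b - a)%C) in *.
  assert (Hzt : zero_near h (g tau)).
  { destruct (Rle_lt_or_eq_dec 0 tau (proj1 Htau)) as [Hpos|<-].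
    2:{ apply HE0; lra. }
    destruct (mero_zero_or_nonzero h (g tau) (Hm tau Htau)) as [H|(d & Hd & H)]; [exact H|].
    (* A parameter just before [tau] whose image is within [d] of that of [tau]; [D + 1] in the
       denominator allows [a = b]. *)
    exfalso. set (s := Rmax 0 (tau - d / (2 * (D + 1)))).
    assert (Hq : 0 < d / (2 * (D + 1))) by (apply Rdiv_lt_0_compat; lra).
    assert (Hs : 0 <= s < tau) by (split; [apply Rmax_l|apply Rmax_lub_lt; lra]).
    assert (Hs2 : tau - d / (2 * (D + 1)) <= s) by apply Rmax_r.
    assert (Hst : Cmod (g s - g tau)%C < d).
    { rewrite Hdist Rabs_left1; [|lra]. fold D.
      apply Rle_lt_trans with (d / (2 * (D + 1)) * D); [apply Rmult_le_compat_r; lra|].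
      apply Rmult_lt_reg_r with (2 * (D + 1)); [lra|].
      replace (d / (2 * (D + 1)) * D * (2 * (D + 1))) with (d * D) by (field; lra). nra. }
    destruct (Hbefore s Hs) as (d1 & Hd1 & Hz).
    destruct (classic (g s = g tau)) as [Eq|Hne].
    - rewrite Eq in Hz. destruct (small_step (g tau) (Rmin d d1)) as [z Hz0].
      { apply Rmin_pos; lra. }
      pose proof (Rmin_l d d1). pose proof (Rmin_r d d1).
      apply (H z); [lra|]. apply Hz. lra.
    - apply Cmod_sub_pos in Hne.
      set (e := Rmin d1 (Rmin (Cmod (g s - g tau)%C) (d - Cmod (g s - g tau)%C))).
      assert (He : 0 < e) by (repeat apply Rmin_pos; lra).
      assert (He1 : e <= d1) by apply Rmin_l.
      assert (He2 : e <= Cmod (g s - g tau)%C).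
      { eapply Rle_trans; [apply Rmin_r|apply Rmin_l]. }
      assert (He3 : e <= d - Cmod (g s - g tau)%C).
      { eapply Rle_trans; [apply Rmin_r|apply Rmin_r]. }
      destruct (small_step (g s) e He) as [z Hz0].
      apply (H z); [|apply Hz; lra].
      pose proof (Cmod_sub_triangle z (g s) (g tau)).
      pose proof (Cmod_sub_triangle (g s) z (g tau)).
      rewrite (Cmod_sub_sym (g s) z) in H1. lra. }
  assert (Ht1 : tau = 1).
  { destruct (proj2 Htau) as [Hlt|]; [|assumption]. exfalso.
    destruct Hzt as (d & Hd & Hz).
    set (s := Rmin 1 (tau + d / (2 * (D + 1)))).
    assert (Hq : 0 < d / (2 * (D + 1))) by (apply Rdiv_lt_0_compat; lra).
    assert (Hs : tau < s <= 1) by (split; [apply Rmin_glb_lt; lra|apply Rmin_l]).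
    assert (Hs2 : s <= tau + d / (2 * (D + 1))) by apply Rmin_r.
    assert (E s); [|assert (s <= tau) by (now apply Hub); lra].
    split; [lra|]. intros r Hr. destruct (Rlt_le_dec r tau) as [Hr1|Hr1].
    - apply Hbefore; lra.
    - apply (zero_near_open h (g tau) d Hz). rewrite Hdist Rabs_pos_eq; [|lra]. fold D.
      apply Rle_lt_trans with (d / (2 * (D + 1)) * D); [apply Rmult_le_compat_r; lra|].
      apply Rmult_lt_reg_r with (2 * (D + 1)); [lra|].
      replace (d / (2 * (D + 1)) * D * (2 * (D + 1))) with (d * D) by (field; lra). nra. }
  rewrite Ht1 in Hzt. unfold g in Hzt.
  now replace (a + RtoC 1 * (b - a))%C with b in Hzt by ring.
Qed.

(** * Maximum principle on a strip and removable singularities *)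

(** A Lebesgue number argument for a property that improves as [d] decreases. It serves twice for
    extreme values: with [/ d] as an upper bound, and with [d] as a gap below the supremum. *)
Lemma compact_uniform (P : R -> R -> R -> Prop) a b a' b' :
  (forall x y, a <= x <= b -> a' <= y <= b' -> exists d, 0 < d /\
     forall u v, Rabs (u - x) < d -> Rabs (v - y) < d -> P d u v) ->
  (forall d e u v, 0 < d <= e -> P e u v -> P d u v) ->
  exists d, 0 < d /\ forall u v, a <= u <= b -> a' <= v <= b' -> P d u v.
Proof.
  intros H Hmono.
  assert (H2 : forall xy : R * R, exists d : posreal,
    a <= fst xy <= b -> a' <= snd xy <= b' ->
    forall u v, Rabs (u - fst xy) < d -> Rabs (v - snd xy) < d -> P d u v).
  { intros [x y]. simpl. destruct (classic (a <= x <= b /\ a' <= y <= b')) as [[H1 H2]|H1].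
    - destruct (H x y H1 H2) as [d [Hd Hp]]. exists (mkposreal d Hd). auto.
    - exists (mkposreal 1 Rlt_0_1). intros; exfalso; auto. }
  apply choice in H2. destruct H2 as [del Hdel].
  destruct (compactness_value_2d a b a' b' (fun x y => del (x, y))) as [d Hd].
  exists d. split; [apply cond_pos|]. intros u v Hu Hv. apply NNPP. intros Hno.
  apply (Hd u v Hu Hv). intros (x & y & Hx & Hy & H3 & H4 & H5). apply Hno.
  apply Hmono with (del (x, y)); [split; [apply cond_pos|exact H5]|].
  now apply (Hdel (x, y)).
Qed.

Lemma extreme_value_2d (f : R -> R -> R) a b a' b' : a <= b -> a' <= b' ->
  (forall x y, a <= x <= b -> a' <= y <= b' -> forall e, 0 < e -> exists d, 0 < d /\
     forall u v, Rabs (u - x) < d -> Rabs (v - y) < d -> Rabs (f u v - f x y) < e) ->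
  exists x y, a <= x <= b /\ a' <= y <= b' /\
    forall u v, a <= u <= b -> a' <= v <= b' -> f u v <= f x y.
Proof.
  intros Hab Hab' Hf.
  destruct (compact_uniform (fun d u v => f u v <= / d) a b a' b') as (d0 & Hd0 & Hbd).
  { intros x y Hx Hy. destruct (Hf x y Hx Hy 1 Rlt_0_1) as (d & Hd & H).
    pose proof (Rabs_pos (f x y)) as Hp. pose proof (Rle_abs (f x y)) as Hp2.
    assert (Hi : 0 < / (Rabs (f x y) + 1)) by (apply Rinv_0_lt_compat; lra).
    exists (Rmin d (/ (Rabs (f x y) + 1))). split; [apply Rmin_pos; lra|].
    intros u v Hu Hv.
    pose proof (Rmin_l d (/ (Rabs (f x y) + 1))). pose proof (Rmin_r d (/ (Rabs (f x y) + 1))).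
    specialize (H u v ltac:(lra) ltac:(lra)). apply Rabs_lt_between in H.
    apply Rle_trans with (Rabs (f x y) + 1); [lra|].
    rewrite -{1}(Rinv_inv (Rabs (f x y) + 1)). apply Rinv_le_contravar; [|lra].
    apply Rmin_pos; lra. }
  { intros d e u v Hde H. eapply Rle_trans; [exact H|]. apply Rinv_le_contravar; lra. }
  pose (E := fun m => exists u v, a <= u <= b /\ a' <= v <= b' /\ m = f u v).
  destruct (completeness E) as [B [Hub Hlub]].
  { exists (/ d0). intros m (u & v & Hu & Hv & ->). auto. }
  { exists (f a a'), a, a'. repeat split; lra. }
  apply NNPP. intros Hno.
  assert (Hlt : forall u v, a <= u <= b -> a' <= v <= b' -> f u v < B).
  { intros u v Hu Hv. apply Rnot_le_lt. intros Hle. apply Hno. exists u, v.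
    repeat split; try lra. intros x y Hx Hy. apply Rle_trans with B; [|exact Hle].
    apply Hub. exists x, y. auto. }
  destruct (compact_uniform (fun d u v => f u v <= B - d) a b a' b') as (d1 & Hd1 & Hbd1).
  { intros x y Hx Hy. pose proof (Hlt x y Hx Hy) as H0. set (e := (B - f x y) / 2).
    assert (He : 0 < e) by (unfold e; lra).
    destruct (Hf x y Hx Hy e He) as (d & Hd & H).
    exists (Rmin d e). split; [apply Rmin_pos; lra|]. intros u v Hu Hv.
    pose proof (Rmin_l d e). pose proof (Rmin_r d e).
    specialize (H u v ltac:(lra) ltac:(lra)). apply Rabs_lt_between in H. unfold e in *. lra. }
  { intros d e u v Hde H. lra. }
  assert (B <= B - d1); [|lra]. apply Hlub. intros m (u & v & Hu & Hv & ->). auto.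
Qed.

(** By continuity [|H|] stays below [B] by a fixed amount on a short arc from the point [rho], which
    is the parameter [t = 0]; this lowers the whole mean. *)
Lemma mean_value_strict H R rho B : holo_disc H 0 R -> 0 < rho < R ->
  (forall t, Cmod (H (RtoC rho * unitc t)%C) <= B) -> Cmod (H (RtoC rho)) < B ->
  Cmod (H 0) < B.
Proof.
  intros HH Hr HB Hlt.
  assert (Hc : forall t, clim (fun t => H (0 + RtoC rho * unitc t)%C) (@locally R_UniformSpace t)
      (H (0 + RtoC rho * unitc t)%C)).
  { intros t. apply (clim_comp_C _ (fun u => 0 + RtoC rho * unitc u)%C H (0 + RtoC rho * unitc t)%C).
    - apply circle_cont.
    - destruct (HH (0 + RtoC rho * unitc t)%C) as [l Hl]; [rewrite circle_dist; lra|].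
      now apply cdiff_cont with l. }
  set (eta := (B - Cmod (H (RtoC rho))) / 2).
  assert (Heta : 0 < eta) by (unfold eta; lra).
  destruct (Hc 0 eta Heta) as [d Hd].
  assert (E0 : (0 + RtoC rho * unitc 0)%C = RtoC rho).
  { unfold unitc. replace (RtoC 0 * (0, (2 * PI)%R))%C with (RtoC 0) by ring. rewrite Cexp_0. ring. }
  rewrite E0 in Hd.
  set (s := Rmin (d / 2) (/2)).
  assert (Hs : 0 < s) by (apply Rmin_pos; [pose proof (cond_pos d)|]; lra).
  assert (Hs1 : s <= d / 2) by apply Rmin_l. assert (Hs2 : s <= / 2) by apply Rmin_r.
  rewrite -(mean_value H 0 R rho HH Hr).
  set (phi := fun t => H (0 + RtoC rho * unitc t)%C) in *.
  assert (I1 : CRI phi 0 s (CInt phi 0 s)) by (apply CRI_ex; intros; apply Hc).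
  assert (I2 : CRI phi s 1 (CInt phi s 1)) by (apply CRI_ex; intros; apply Hc).
  unfold cmean. fold phi. rewrite (CInt_unique phi 0 1 _ (CRI_Chasles _ _ _ _ _ _ I1 I2)).
  eapply Rle_lt_trans; [apply Cmod_triangle|].
  assert (B1 : Cmod (CInt phi 0 s) <= (B - eta) * (s - 0)).
  { apply (CRI_bound phi 0 s); [lra|exact I1|]. intros t Ht.
    assert (K : ball (0 : R_UniformSpace) d t).
    { change (Rabs (t - 0) < d). rewrite Rminus_0_r Rabs_pos_eq; [|lra].
      pose proof (cond_pos d). lra. }
    specialize (Hd t K). pose proof (Cmod_rev_triangle (phi t) (H (RtoC rho))).
    cbv beta in Hd. unfold eta in *. fold (phi t) in Hd. lra. }
  assert (B2 : Cmod (CInt phi s 1) <= B * (1 - s)).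
  { apply (CRI_bound phi s 1); [lra|exact I2|]. intros t Ht. unfold phi.
    rewrite Cplus_0_l. apply HB. }
  nra.
Qed.

Lemma strip_max (G : C -> C) (Y Y1 X eps : R) : 0 < Y < Y1 -> 0 < X ->
  (forall z, Rabs (Im z) < Y1 -> exists l, cdiff G z l) ->
  (forall z, Rabs (Im z) = Y -> Cmod (G z) <= eps) ->
  (forall z, X <= Rabs (Re z) -> Rabs (Im z) <= Y -> Cmod (G z) <= eps) ->
  forall z, Rabs (Im z) <= Y -> Cmod (G z) <= eps.
Proof.
  intros HY HX HG Hb Hside z Hz.
  destruct (extreme_value_2d (fun x y => Cmod (G (x, y))) (- X) X (- Y) Y) as (x & y & Hx & Hy & Hmax);
    [lra|lra| |].
  { intros x y Hx Hy e He. destruct (HG (x, y)) as [l Hl].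
    { simpl. apply Rabs_lt_between. lra. }
    apply cdiff_cont in Hl. destruct (locally_C_inv _ _ (Hl e He)) as [d [Hd Hc]].
    exists (d / 2). split; [lra|]. intros u v Hu Hv.
    assert (K : Cmod ((u, v) - (x, y))%C < d).
    { eapply Rle_lt_trans; [apply Cmod_le_re_im|]. simpl. unfold Rminus in *. lra. }
    specialize (Hc _ K).
    pose proof (Cmod_rev_triangle (G (u, v)) (G (x, y))).
    pose proof (Cmod_rev_triangle (G (x, y)) (G (u, v))).
    rewrite (Cmod_sub_sym (G (x, y))) in H0. apply Rabs_lt_between. lra. }
  set (p := (x, y) : C). set (B := Cmod (G p)).
  assert (Hall : forall w, Rabs (Im w) <= Y -> Cmod (G w) <= Rmax B eps).
  { intros w Hw. destruct (Rle_lt_dec X (Rabs (Re w))) as [H|H].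
    - eapply Rle_trans; [now apply Hside|apply Rmax_r].
    - eapply Rle_trans; [|apply Rmax_l]. destruct w as [u v]. simpl in *.
      apply (Hmax u v); apply Rabs_le_between; lra. }
  destruct (Rle_lt_dec B eps) as [HB|HB].
  { rewrite Rmax_right in Hall; auto. }
  exfalso. rewrite Rmax_left in Hall; [|lra].
  assert (Hyi : Rabs y < Y).
  { apply Rnot_le_lt. intros H. assert (Rabs y = Y).
    { apply Rle_antisym; [|exact H]. apply Rabs_le_between; lra. }
    specialize (Hb p H0). unfold B in HB. lra. }
  set (rho := Y - Rabs y).
  (* The rotation that brings the parameter [t = 0] of the circle to its point of contact with the
     edge. *)
  set (kap := if Rle_dec 0 y then Ci else (- Ci)%C).
  assert (Hkap : Cmod kap = 1).
  { unfold kap. destruct (Rle_dec 0 y); rewrite ?Cmod_opp; apply Cmod_Ci. }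
  assert (Htop : Rabs (Im (p + kap * RtoC rho)%C) = Y).
  { unfold kap, rho. destruct (Rle_dec 0 y) as [H|H]; simpl.
    - rewrite (Rabs_pos_eq y) //. rewrite Rabs_pos_eq; lra.
    - rewrite (Rabs_left1 y); [|lra]. rewrite Rabs_left1; lra. }
  assert (Hdist : forall w, Rabs (Im (p + kap * w)%C) <= Rabs y + Cmod w).
  { intros w. replace (Im (p + kap * w)%C) with (y + Im (kap * w)%C) by (simpl; ring).
    eapply Rle_trans; [apply Rabs_triang|]. apply Rplus_le_compat_l.
    eapply Rle_trans; [apply im_le_Cmod|]. rewrite Cmod_mult Hkap. lra. }
  assert (Hst : Cmod (G (p + kap * 0)%C) < B).
  { apply (mean_value_strict (fun w => G (p + kap * w)%C) (Y1 - Rabs y) rho).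
    - intros w Hw. replace (w - 0)%C with w in Hw by ring.
      destruct (HG (p + kap * w)%C) as [l Hl].
      { pose proof (Hdist w). lra. }
      eexists. apply (diffg_comp (X := C_UniformSpace) _ cid_cont G (fun w => p + kap * w)%C);
        [exact Hl|].
      apply diffg_plus; [apply diffg_const|apply (diffg_scal _ cid_cont), diffg_iota].
    - unfold rho. lra.
    - intros t. apply Hall. eapply Rle_trans; [apply Hdist|].
      rewrite Cmod_mult Cmod_unitc Cmod_R (Rabs_pos_eq rho); unfold rho; lra.
    - apply Rle_lt_trans with eps; [|exact HB]. now apply Hb. }
  replace (p + kap * 0)%C with p in Hst by ring. unfold B in Hst. lra.
Qed.

(** The extension takes at [z] the value of the local extension chosen at [z]. Two local extensions
    agree with [h] near a common point, that point perhaps excepted, hence agree there too by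
    continuity. *)
Lemma removable_extension (Om : C -> Prop) (h : C -> C) :
  (forall z, Om z -> exists r, 0 < r /\ forall w, Cmod (w - z)%C < r -> Om w) ->
  (forall z, Om z -> exists g r, 0 < r /\ holo_disc g z r /\
     forall w, 0 < Cmod (w - z)%C < r -> h w = g w) ->
  exists H : C -> C, (forall z, Om z -> exists l, cdiff H z l) /\
    forall z, Om z -> clim h (@locally C_UniformSpace z) (h z) -> H z = h z.
Proof.
  intros Hop Hloc.
  assert (Hex : forall z, exists gr : (C -> C) * R, Om z -> 0 < snd gr /\ holo_disc (fst gr) z (snd gr) /\
     forall w, 0 < Cmod (w - z)%C < snd gr -> h w = fst gr w).
  { intros z. destruct (classic (Om z)) as [Hz|Hz].
    - destruct (Hloc z Hz) as (g & r & K). exists (g, r). auto.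
    - exists (h, 0). tauto. }
  apply choice in Hex. destruct Hex as [gr Hgr].
  assert (Heq : forall (f g : C -> C) (z : C) r, 0 < r ->
     (forall w, 0 < Cmod (w - z)%C < r -> f w = g w) ->
     clim f (@locally C_UniformSpace z) (f z) -> clim g (@locally C_UniformSpace z) (g z) ->
     f z = g z).
  { intros f g z r Hr E Hf Hg.
    apply (clim_unique (FF := locally'_C_proper z) (@locally' C_UniformSpace z) f).
    - intros e He. change (@locally C_UniformSpace z (fun w => w <> z -> Cmod (f w - f z)%C < e)).
      generalize (Hf e He). apply filter_imp. auto.
    - intros e He. change (@locally C_UniformSpace z (fun w => w <> z -> Cmod (f w - g z)%C < e)).
      generalize (filter_and _ _ (Hg e He) (locally_C z r Hr)). apply filter_imp.
      intros w [H1 H2] Hne. rewrite E //. split; [|exact H2].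
      apply Cmod_gt_0. now apply sub_neq_0. }
  exists (fun z => fst (gr z) z). split.
  - intros z Hz. destruct (Hgr z Hz) as (Hr & Hg & E). destruct (Hop z Hz) as (r0 & Hr0 & HOm).
    destruct (Hg z) as [l Hl]; [rewrite Cmod_self_sub; lra|]. exists l.
    apply (diffg_ext_loc (X := C_UniformSpace)) with (2 := Hl).
    assert (Hmin : 0 < Rmin (snd (gr z)) r0) by (apply Rmin_pos; lra).
    generalize (locally_C z _ Hmin). apply filter_imp. intros w Hw.
    assert (Hw1 : Cmod (w - z)%C < snd (gr z)) by (eapply Rlt_le_trans; [exact Hw|apply Rmin_l]).
    assert (Hw2 : Cmod (w - z)%C < r0) by (eapply Rlt_le_trans; [exact Hw|apply Rmin_r]).
    destruct (classic (w = z)) as [->|Hne]; [reflexivity|].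
    apply Cmod_sub_pos in Hne.
    destruct (Hgr w (HOm w Hw2)) as (Hrw & Hgw & Ew).
    set (r := Rmin (snd (gr w)) (Rmin (Cmod (w - z)%C) (snd (gr z) - Cmod (w - z)%C))).
    apply Heq with r.
    + repeat apply Rmin_pos; lra.
    + intros v Hv.
      assert (r <= snd (gr w)) by apply Rmin_l.
      assert (r <= Cmod (w - z)%C) by (eapply Rle_trans; [apply Rmin_r|apply Rmin_l]).
      assert (r <= snd (gr z) - Cmod (w - z)%C) by (eapply Rle_trans; [apply Rmin_r|apply Rmin_r]).
      rewrite -Ew; [|lra]. symmetry. apply E.
      pose proof (Cmod_sub_triangle v w z). pose proof (Cmod_sub_triangle w v z).
      rewrite (Cmod_sub_sym w v) in H3. lra.
    + destruct (Hg w Hw1) as [m Hm]. now apply cdiff_cont with m.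
    + destruct (Hgw w) as [m Hm]; [rewrite Cmod_self_sub; lra|]. now apply cdiff_cont with m.
  - intros z Hz Hc. destruct (Hgr z Hz) as (Hr & Hg & E).
    symmetry. apply Heq with (snd (gr z)); auto.
    destruct (Hg z) as [m Hm]; [rewrite Cmod_self_sub; lra|]. now apply cdiff_cont with m.
Qed.

(** * Improper integrals over the half-line and Mellin transforms *)

Lemma Rpower_pos x y : 0 < Rpower x y.
Proof. apply exp_pos. Qed.

Lemma Rpower_base_1 y : Rpower 1 y = 1.
Proof. unfold Rpower. rewrite ln_1 Rmult_0_r exp_0. reflexivity. Qed.

Lemma Rpower_le_small x a b : 0 < x <= 1 -> a <= b -> Rpower x b <= Rpower x a.
Proof.
  intros Hx Hab. apply exp_le.
  assert (ln x <= 0).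
  { rewrite -ln_1. destruct (proj2 Hx) as [H| ->]; [left; apply ln_increasing; lra|lra]. }
  nra.
Qed.

Lemma Rpower_anti x y b : b <= 0 -> 0 < x <= y -> Rpower y b <= Rpower x b.
Proof.
  intros Hb Hxy. replace b with (- (- b)) by ring. rewrite !(Rpower_Ropp _ (- b)).
  apply Rinv_le_contravar; [apply Rpower_pos|]. apply Rle_Rpower_l; lra.
Qed.

Lemma is_derive_Rpower x y : 0 < x -> is_derive (fun t => Rpower t y) x (y * Rpower x (y - 1)).
Proof. intros Hx. apply is_derive_Reals. now apply derivable_pt_lim_power. Qed.

Lemma continuous_Rpower x y : 0 < x -> continuous (fun t => Rpower t y) x.
Proof.
  intros Hx. apply (ex_derive_continuous (V := R_NormedModule)).
  eexists. now apply is_derive_Rpower.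
Qed.

Lemma is_RInt_Rpower c a b : c <> 0 -> 0 < a <= b ->
  is_RInt (fun x => Rpower x (c - 1)) a b ((Rpower b c - Rpower a c) / c).
Proof.
  intros Hc Hab.
  replace ((Rpower b c - Rpower a c) / c) with (Rpower b c / c - Rpower a c / c) by (field; auto).
  apply (is_RInt_derive (fun x => Rpower x c / c) (fun x => Rpower x (c - 1)));
    rewrite Rmin_left ?Rmax_right; try lra; intros x Hx.
  - replace (Rpower x (c - 1)) with (/ c * (c * Rpower x (c - 1))) by (field; auto).
    apply is_derive_ext with (fun t => / c * Rpower t c); [intros; unfold Rdiv; simpl; ring|].
    apply @is_derive_scal. apply is_derive_Rpower. lra.
  - apply continuous_Rpower. lra.
Qed.

Definition Iimp (f : R -> C) (I : C) : Prop :=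
  @is_RInt_gen C_R_NormedModule f (at_right 0) (Rbar_locally p_infty) I.

Definition cont0 (f : R -> C) : Prop :=
  forall x, 0 < x -> clim f (@locally R_UniformSpace x) (f x).

(** Being below both powers for all [x] is being below [x^(al-1)] near [0] and
    below [x^(-be-1)] near infinity; this form needs no case distinction. *)
Definition dom (f : R -> C) (K al be : R) : Prop :=
  forall x, 0 < x -> Cmod (f x) <= K * Rpower x (al - 1) /\ Cmod (f x) <= K * Rpower x (- be - 1).

Lemma Iimp_intro (f : R -> C) (I : C) : cont0 f ->
  (forall e, 0 < e -> exists d M, 0 < d /\ forall a b, 0 < a < d -> M < b ->
     Cmod (CInt f a b - I)%C < e) -> Iimp f I.
Proof.
  intros Hf H P HP. destruct (locally_C_inv _ _ HP) as [e [He HPe]].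
  destruct (H e He) as (d & M & Hd & HdM).
  apply (Filter_prod _ _ _ (fun a => 0 < a < d) (fun b => Rmax M d < b)).
  - exists (mkposreal d Hd). intros a Ha Ha0.
    change (Rabs (a - 0) < d) in Ha. apply Rabs_lt_between in Ha. lra.
  - exists (Rmax M d). auto.
  - intros a b Ha Hb. pose proof (Rmax_l M d). pose proof (Rmax_r M d). exists (CInt f a b). split.
    + apply CRI_ex. intros t Ht. apply Hf. simpl in *. rewrite Rmin_left in Ht; lra.
    + apply HPe. apply HdM; auto; lra.
Qed.

Lemma Iimp_elim f I : Iimp f I -> forall e, 0 < e -> exists d M, 0 < d /\
  forall a b, 0 < a < d -> M < b -> exists y, CRI f a b y /\ Cmod (y - I)%C < e.
Proof.
  intros H e He. destruct (H _ (locally_C I e He)) as [Q1 Q2 [d Hd] [M HM] HQ].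
  exists d, M. split; [apply cond_pos|]. intros a b Ha Hb.
  apply (HQ a b).
  - apply Hd; [|lra]. change (Rabs (a - 0) < d). rewrite Rminus_0_r Rabs_pos_eq; lra.
  - now apply HM.
Qed.

Lemma CInt_0_infty_unique f I : Iimp f I -> CInt_0_infty f = I.
Proof.
  intros H. exact (@is_RInt_gen_unique C_R_CompleteNormedModule (at_right 0)
    (Rbar_locally p_infty) _ _ f I H).
Qed.

Lemma Iimp_unique f I J : Iimp f I -> Iimp f J -> I = J.
Proof. intros H1 H2. now rewrite -(CInt_0_infty_unique _ _ H1) -(CInt_0_infty_unique _ _ H2). Qed.

Lemma Iimp_plus f g I J : Iimp f I -> Iimp g J -> Iimp (fun x => f x + g x)%C (I + J)%C.
Proof. intros H1 H2. exact (is_RInt_gen_plus f g I J H1 H2). Qed.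

Lemma Iimp_minus f g I J : Iimp f I -> Iimp g J -> Iimp (fun x => f x - g x)%C (I - J)%C.
Proof. intros H1 H2. exact (is_RInt_gen_minus f g I J H1 H2). Qed.

Lemma Iimp_ext f g I : (forall x, 0 < x -> f x = g x) -> Iimp f I -> Iimp g I.
Proof.
  intros H HI. refine (is_RInt_gen_ext f g I _ HI).
  apply (Filter_prod _ _ _ (fun a => 0 < a) (fun b => 0 < b)).
  - exists (mkposreal 1 Rlt_0_1). auto.
  - now exists 0.
  - intros a b Ha Hb x Hx. apply H. simpl in Hx. destruct Hx as [Hx _].
    revert Hx. unfold Rmin. destruct (Rle_dec a b); lra.
Qed.

Lemma Iimp_scal c f I : Iimp f I -> Iimp (fun x => c * f x)%C (c * I)%C.
Proof.
  intros H P HP. destruct (locally_C_inv _ _ HP) as [e [He HPe]].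
  pose proof (Cmod_ge_0 c) as Hc.
  assert (He2 : 0 < e / (Cmod c + 1)) by (apply Rdiv_lt_0_compat; lra).
  pose proof (H _ (locally_C I _ He2)) as K. unfold filtermapi in *. revert K.
  apply filter_imp. intros [a b] [y [Hy1 Hy2]]. exists (c * y)%C. split; [now apply CRI_scal|].
  apply HPe. replace (c * y - c * I)%C with (c * (y - I))%C by ring. rewrite Cmod_mult.
  apply Rle_lt_trans with (Cmod c * (e / (Cmod c + 1))).
  - apply Rmult_le_compat_l; lra.
  - apply Rmult_lt_reg_r with (Cmod c + 1); [lra|].
    replace (Cmod c * (e / (Cmod c + 1)) * (Cmod c + 1)) with (Cmod c * e) by (field; lra). nra.
Qed.

Lemma Iimp_le (f : R -> C) (g : R -> R) I (G : R) :
  Iimp f I -> Iimp (fun x => RtoC (g x)) (RtoC G) ->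
  (forall x, 0 < x -> Cmod (f x) <= g x) -> Cmod I <= G.
Proof.
  intros Hf Hg H. apply le_epsilon. intros e He.
  assert (He2 : 0 < e / 2) by lra.
  destruct (Iimp_elim _ _ Hf _ He2) as (d1 & M1 & Hd1 & H1).
  destruct (Iimp_elim _ _ Hg _ He2) as (d2 & M2 & Hd2 & H2).
  set (a := Rmin d1 d2 / 2). set (b := Rmax (Rmax M1 M2) a + 1).
  assert (Ha : 0 < Rmin d1 d2) by (apply Rmin_pos; lra).
  pose proof (Rmin_l d1 d2). pose proof (Rmin_r d1 d2).
  pose proof (Rmax_l (Rmax M1 M2) a). pose proof (Rmax_r (Rmax M1 M2) a).
  pose proof (Rmax_l M1 M2). pose proof (Rmax_r M1 M2).
  destruct (H1 a b) as (y1 & Hy1 & K1); [unfold a; lra|unfold b; lra|].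
  destruct (H2 a b) as (y2 & Hy2 & K2); [unfold a; lra|unfold b; lra|].
  assert (Cmod y1 <= Re y2).
  { apply (CRI_bound_fun f g a b); [unfold b; lra|exact Hy1|exact (CRI_re _ _ _ _ Hy2)|].
    intros t Ht. apply H. unfold a in Ht. lra. }
  pose proof (Cmod_rev_triangle I y1) as T1. rewrite (Cmod_sub_sym I y1) in T1.
  pose proof (re_le_Cmod (y2 - RtoC G)%C) as T2. destruct y2 as [u v]. simpl in *.
  apply Rabs_le_between in T2. lra.
Qed.

Lemma CInt_swap f a b : cont0 f -> 0 < a -> 0 < b -> CInt f b a = (- CInt f a b)%C.
Proof.
  intros Hf Ha Hb. apply CInt_unique, CRI_swap, CRI_ex. intros t [Ht _]. apply Hf.
  eapply Rlt_le_trans; [|exact Ht]. now apply Rmin_pos.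
Qed.

Lemma CInt_Chasles f a b c : cont0 f -> 0 < a -> 0 < b -> 0 < c ->
  CInt f a c = (CInt f a b + CInt f b c)%C.
Proof.
  intros Hf Ha Hb Hc. apply CInt_unique. apply CRI_Chasles with b; apply CRI_ex;
  intros t [Ht _]; apply Hf; (eapply Rlt_le_trans; [|exact Ht]); now apply Rmin_pos.
Qed.

Lemma dom_K_pos f K al be : dom f K al be -> 0 <= K.
Proof.
  intros H. destruct (H 1 Rlt_0_1) as [H1 _]. rewrite Rpower_base_1 in H1.
  pose proof (Cmod_ge_0 (f 1)). lra.
Qed.

Lemma CInt_power_bound f K c a b : cont0 f -> c <> 0 -> 0 < a <= b ->
  (forall x, 0 < x -> Cmod (f x) <= K * Rpower x (c - 1)) ->
  Cmod (CInt f a b) <= K * ((Rpower b c - Rpower a c) / c).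
Proof.
  intros Hf Hc Hab H.
  apply (CRI_bound_fun f (fun x => K * Rpower x (c - 1)) a b); [lra| | |].
  - apply CRI_ex. intros t [Ht _]. apply Hf. rewrite Rmin_left in Ht; lra.
  - apply (@is_RInt_scal R_NormedModule). now apply is_RInt_Rpower.
  - intros t Ht. apply H. lra.
Qed.

Lemma CInt_near_0 f K al be d a b : cont0 f -> 0 < al -> dom f K al be ->
  0 < a <= d -> 0 < b <= d -> Cmod (CInt f a b) <= K * Rpower d al / al.
Proof.
  intros Hf Hal Hd.
  assert (HK := dom_K_pos _ _ _ _ Hd).
  assert (Hw : forall a b, 0 < a <= b -> b <= d -> Cmod (CInt f a b) <= K * Rpower d al / al).
  { intros x y Hxy Hy. eapply Rle_trans.
    - apply (CInt_power_bound f K al); [exact Hf|lra|exact Hxy|]. intros; now apply Hd.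
    - unfold Rdiv. rewrite Rmult_assoc. apply Rmult_le_compat_l; [exact HK|].
      apply Rmult_le_compat_r; [left; now apply Rinv_0_lt_compat|].
      pose proof (Rpower_pos x al). pose proof (Rle_Rpower_l y d al). lra. }
  intros Ha Hb. destruct (Rle_lt_dec a b).
  - apply Hw; lra.
  - rewrite CInt_swap // ?Cmod_opp; try lra. apply Hw; lra.
Qed.

Lemma CInt_near_infty f K al be M a b : cont0 f -> 0 < be -> dom f K al be -> 0 < M ->
  M <= a -> M <= b -> Cmod (CInt f a b) <= K * Rpower M (- be) / be.
Proof.
  intros Hf Hbe Hd HM.
  assert (HK := dom_K_pos _ _ _ _ Hd).
  assert (Hw : forall a b, M <= a <= b -> Cmod (CInt f a b) <= K * Rpower M (- be) / be).
  { intros x y Hxy. eapply Rle_trans.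
    - apply (CInt_power_bound f K (- be)); [exact Hf|lra|lra|]. intros; now apply Hd.
    - replace ((Rpower y (- be) - Rpower x (- be)) / - be)
        with ((Rpower x (- be) - Rpower y (- be)) / be) by (field; lra).
      unfold Rdiv. rewrite Rmult_assoc. apply Rmult_le_compat_l; [exact HK|].
      apply Rmult_le_compat_r; [left; now apply Rinv_0_lt_compat|].
      pose proof (Rpower_pos y (- be)). pose proof (Rpower_anti M x (- be)). lra. }
  intros Ha Hb. destruct (Rle_lt_dec a b).
  - apply Hw; lra.
  - rewrite CInt_swap // ?Cmod_opp; try lra. apply Hw; lra.
Qed.

Lemma Rpower_small c e : 0 < c -> 0 < e -> exists d, 0 < d /\ Rpower d c < e.
Proof.
  intros Hc He. exists (Rpower (e / 2) (/ c)). split; [apply Rpower_pos|].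
  rewrite Rpower_mult Rinv_l; [|lra]. rewrite Rpower_1; lra.
Qed.

Lemma Rpower_large c e : 0 < c -> 0 < e -> exists M, 0 < M /\ Rpower M (- c) < e.
Proof.
  intros Hc He. exists (Rpower (e / 2) (- / c)). split; [apply Rpower_pos|].
  rewrite Rpower_mult. replace (- / c * - c) with 1 by (field; lra). rewrite Rpower_1; lra.
Qed.

(** Convergence by the Cauchy criterion at both ends, and a bound by splitting at 1. The bound is
    linear in [K]: making a remainder small reduces to making its domination constant small. *)
Lemma Iimp_dom f K al be : cont0 f -> 0 < al -> 0 < be -> dom f K al be ->
  Iimp f (CInt_0_infty f) /\ Cmod (CInt_0_infty f) <= K * (/ al + / be).
Proof.
  intros Hf Hal Hbe Hd. assert (HK := dom_K_pos _ _ _ _ Hd).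
  assert (HK1 : 0 < K + 1) by lra.
  assert (Hdelta : forall e, 0 < e -> exists d M, 0 < d /\ d < M /\
     (forall a b, 0 < a <= d -> 0 < b <= d -> Cmod (CInt f a b) < e) /\
     (forall a b, M <= a -> M <= b -> Cmod (CInt f a b) < e)).
  { intros e He.
    assert (E : forall g, 0 < g -> 0 < e * g / (K + 1)) by (intros; apply Rdiv_lt_0_compat; nra).
    destruct (Rpower_small al _ Hal (E al Hal)) as (d & Hd0 & Hd1).
    destruct (Rpower_large be _ Hbe (E be Hbe)) as (M & HM0 & HM1).
    assert (F : forall g q, 0 < g -> 0 < q -> q < e * g / (K + 1) -> K * q / g < e).
    { intros g q Hg Hq0 Hq. apply Rmult_lt_reg_r with g; [exact Hg|].
      replace (K * q / g * g) with (K * q) by (field; lra).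
      apply Rmult_lt_compat_r with (r := K + 1) in Hq; [|lra].
      replace (e * g / (K + 1) * (K + 1)) with (e * g) in Hq by (field; lra). nra. }
    exists d, (Rmax M (d + 1)). pose proof (Rmax_l M (d + 1)). pose proof (Rmax_r M (d + 1)).
    split; [lra|]. split; [lra|]. split.
    - intros a b Ha Hb. eapply Rle_lt_trans; [apply (CInt_near_0 f K al be d); eauto|].
      apply F; auto. apply Rpower_pos.
    - intros a b Ha Hb. eapply Rle_lt_trans; [apply (CInt_near_infty f K al be M); eauto; lra|].
      apply F; auto. apply Rpower_pos. }
  assert (Hlim : exists I, clim (fun ab => CInt f (fst ab) (snd ab))
      (filter_prod (at_right 0) (Rbar_locally p_infty)) I).
  { destruct (proj1 (@filterlim_locally_cauchy (R * R) C_R_CompleteNormedModule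
      (filter_prod (at_right 0) (Rbar_locally p_infty)) _
      (fun ab => CInt f (fst ab) (snd ab)))) as [I HI].
    - intros eps. assert (He2 : 0 < eps / 2) by (pose proof (cond_pos eps); lra).
      destruct (Hdelta _ He2) as (d & M & Hd0 & HdM & H1 & H2).
      exists (fun ab => 0 < fst ab < d /\ M < snd ab). split.
      + apply (Filter_prod _ _ _ (fun a => 0 < a < d) (fun b => M < b)).
        * exists (mkposreal d Hd0). intros a Ha Ha0.
          change (Rabs (a - 0) < d) in Ha. apply Rabs_lt_between in Ha. lra.
        * now exists M.
        * simpl. auto.
      + intros [a b] [a' b'] [Ha Hb] [Ha' Hb']. simpl in *.
        apply C_NormedModule_mixin_compat1.
        change (Cmod (CInt f a' b' - CInt f a b)%C < eps).
        rewrite (CInt_Chasles f a' a b' Hf); try lra.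
        rewrite (CInt_Chasles f a b b' Hf); try lra.
        replace (_ - _)%C with (CInt f a' a + CInt f b b')%C by ring.
        eapply Rle_lt_trans; [apply Cmod_triangle|].
        pose proof (H1 a' a ltac:(lra) ltac:(lra)). pose proof (H2 b b' ltac:(lra) ltac:(lra)). lra.
    - exists I. apply clim_filterlim; [typeclasses eauto|exact HI]. }
  destruct Hlim as [I HI].
  assert (HIi : Iimp f I).
  { apply Iimp_intro; [exact Hf|]. intros e He. destruct (HI e He) as [Q1 Q2 [d Hd0] [M HM] HQ].
    exists d, M. split; [apply cond_pos|]. intros a b Ha Hb.
    apply (HQ a b).
    - apply Hd0; [|lra]. change (Rabs (a - 0) < d). rewrite Rminus_0_r Rabs_pos_eq; lra.
    - now apply HM. }
  rewrite (CInt_0_infty_unique _ _ HIi). split; [exact HIi|].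
  eapply (clim_le (filter_prod (at_right 0) (Rbar_locally p_infty))); [exact HI|].
  apply (Filter_prod _ _ _ (fun a => 0 < a < 1) (fun b => 1 < b)).
  - exists (mkposreal 1 Rlt_0_1). intros a Ha Ha0.
    change (Rabs (a - 0) < 1) in Ha. apply Rabs_lt_between in Ha. lra.
  - now exists 1.
  - intros a b Ha Hb. simpl. rewrite (CInt_Chasles f a 1 b Hf); try lra.
    eapply Rle_trans; [apply Cmod_triangle|].
    pose proof (CInt_near_0 f K al be 1 a 1 Hf Hal Hd ltac:(lra) ltac:(lra)) as B1.
    pose proof (CInt_near_infty f K al be 1 1 b Hf Hbe Hd ltac:(lra) ltac:(lra) ltac:(lra)) as B2.
    rewrite Rpower_base_1 Rmult_1_r in B1. rewrite Rpower_base_1 Rmult_1_r in B2.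
    rewrite Rmult_plus_distr_l. unfold Rdiv in *. lra.
Qed.

Lemma Iimp_dom_bound f I K al be : Iimp f I -> cont0 f -> 0 < al -> 0 < be ->
  dom f K al be -> Cmod I <= K * (/ al + / be).
Proof.
  intros HI Hf Hal Hbe Hd. rewrite -(CInt_0_infty_unique _ _ HI).
  now apply (Iimp_dom f K al be).
Qed.

Lemma Iimp_derive (P p : R -> C) A B :
  (forall x, 0 < x -> rdiff P x (p x)) -> cont0 p ->
  clim P (at_right 0) A -> clim P (Rbar_locally p_infty) B -> Iimp p (B - A)%C.
Proof.
  intros HP Hp HA HB. apply Iimp_intro; [exact Hp|]. intros e He.
  assert (He2 : 0 < e / 2) by lra.
  destruct (HA _ He2) as [d Hd]. destruct (HB _ He2) as [M HM].
  exists d, (Rmax M d). split; [apply cond_pos|]. intros a b Ha Hb.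
  pose proof (Rmax_l M d). pose proof (Rmax_r M d).
  assert (E : CRI p a b (P b - P a)%C).
  { apply CRI_pair.
    - apply (is_RInt_derive (fun t => Re (P t)) (fun t => Re (p t))); intros x [Hx _];
        (assert (Hx0 : 0 < x) by (eapply Rlt_le_trans; [|exact Hx]; apply Rmin_pos; lra)).
      + apply rdiff_is_derive; auto.
      + intros Q [eps HQ]. destruct (Hp x Hx0 eps (cond_pos eps)) as [d' Hd'].
        exists d'. intros y Hy. apply HQ. change (Rabs (Re (p y) - Re (p x)) < eps).
        eapply Rle_lt_trans; [|apply (Hd' y Hy)]. eapply Rle_trans; [|apply re_le_Cmod].
        right. destruct (p y), (p x). reflexivity.
    - apply (is_RInt_derive (fun t => Im (P t)) (fun t => Im (p t))); intros x [Hx _];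
        (assert (Hx0 : 0 < x) by (eapply Rlt_le_trans; [|exact Hx]; apply Rmin_pos; lra)).
      + apply rdiff_is_derive; auto.
      + intros Q [eps HQ]. destruct (Hp x Hx0 eps (cond_pos eps)) as [d' Hd'].
        exists d'. intros y Hy. apply HQ. change (Rabs (Im (p y) - Im (p x)) < eps).
        eapply Rle_lt_trans; [|apply (Hd' y Hy)]. eapply Rle_trans; [|apply im_le_Cmod].
        right. destruct (p y), (p x). reflexivity. }
  rewrite (CInt_unique _ _ _ _ E).
  replace (P b - P a - (B - A))%C with ((P b - B) - (P a - A))%C by ring.
  eapply Rle_lt_trans; [apply Cmod_triangle_sub|].
  assert (Ka : Cmod (P a - A)%C < e / 2).
  { apply Hd; [|lra]. change (Rabs (a - 0) < d). rewrite Rminus_0_r Rabs_pos_eq; lra. }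
  pose proof (HM b ltac:(lra)). lra.
Qed.

Lemma cont0_rdiff f f' : (forall x, 0 < x -> rdiff f x (f' x)) -> cont0 f.
Proof. intros H x Hx. apply rdiff_cont with (f' x). now apply H. Qed.

Lemma cont0_plus f g : cont0 f -> cont0 g -> cont0 (fun x => f x + g x)%C.
Proof. intros Hf Hg x Hx. apply clim_plus; auto; typeclasses eauto. Qed.

Lemma cont0_minus f g : cont0 f -> cont0 g -> cont0 (fun x => f x - g x)%C.
Proof. intros Hf Hg x Hx. apply clim_minus; auto; typeclasses eauto. Qed.

Lemma cont0_mult f g : cont0 f -> cont0 g -> cont0 (fun x => f x * g x)%C.
Proof. intros Hf Hg x Hx. apply clim_mult; auto; typeclasses eauto. Qed.

Lemma cont0_const c : cont0 (fun _ => c).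
Proof. intros x Hx. apply clim_const; typeclasses eauto. Qed.

Lemma cont0_RtoC (f : R -> R) : (forall x, 0 < x -> continuous f x) ->
  cont0 (fun x => RtoC (f x)).
Proof. intros H x Hx. apply clim_RtoC; [typeclasses eauto|]. now apply H. Qed.

Lemma cont0_id : cont0 RtoC.
Proof. intros x _. apply RtoC_cont. Qed.

(** * Complex powers of positive reals and Mellin transforms *)

Lemma Rcpow_plus x s t : Rcpow x (s + t)%C = (Rcpow x s * Rcpow x t)%C.
Proof. unfold Rcpow. rewrite -Cexp_plus. f_equal. ring. Qed.

Lemma Rcpow_minus x s t : Rcpow x (s - t)%C = (Rcpow x s / Rcpow x t)%C.
Proof.
  unfold Rcpow, Cdiv. rewrite -Cexp_opp -Cexp_plus. f_equal. ring.
Qed.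

Lemma Cmod_Rcpow x s : Cmod (Rcpow x s) = Rpower x (Re s).
Proof.
  unfold Rcpow. rewrite Cmod_Cexp. unfold Rpower. f_equal.
  destruct s; simpl; ring.
Qed.

Lemma Rcpow_RtoC x y : Rcpow x (RtoC y) = RtoC (Rpower x y).
Proof. unfold Rcpow. rewrite -RtoC_mult Cexp_RtoC. reflexivity. Qed.

Lemma Rcpow_1 x : 0 < x -> Rcpow x 1 = RtoC x.
Proof. intros Hx. now rewrite Rcpow_RtoC Rpower_1. Qed.

Lemma rdiff_ln_scal (s : C) x : 0 < x -> rdiff (fun t => s * RtoC (ln t))%C x (s * RtoC (/ x))%C.
Proof.
  intros Hx. apply (diffg_scal _ RtoC_cont). apply (rdiff_RtoC ln).
  apply is_derive_Reals. now apply derivable_pt_lim_ln.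
Qed.

Lemma rdiff_Rcpow s x : 0 < x -> rdiff (fun t => Rcpow t s) x (s * Rcpow x (s - 1))%C.
Proof.
  intros Hx. eapply diffg_eq; [|apply (diffg_comp _ RtoC_cont Cexp (fun t => s * RtoC (ln t))%C);
    [apply cdiff_Cexp|now apply rdiff_ln_scal]].
  rewrite Rcpow_minus Rcpow_1 //. rewrite RtoC_inv; [|lra]. unfold Rcpow. field.
  intros E; injection E; lra.
Qed.

Lemma cont0_Rcpow s : cont0 (fun x => Rcpow x s).
Proof. apply cont0_rdiff with (fun x => s * Rcpow x (s - 1))%C. intros. now apply rdiff_Rcpow. Qed.

Lemma dom_Rcpow g K al be s : dom g K al be ->
  dom (fun x => Rcpow x s * g x)%C K (al + Re s) (be - Re s).
Proof.
  intros H x Hx. destruct (H x Hx) as [H1 H2]. rewrite Cmod_mult Cmod_Rcpow.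
  pose proof (Rpower_pos x (Re s)).
  replace (al + Re s - 1) with (Re s + (al - 1)) by ring.
  replace (- (be - Re s) - 1) with (Re s + (- be - 1)) by ring.
  rewrite (Rpower_plus (Re s) (al - 1)) (Rpower_plus (Re s) (- be - 1)).
  split; rewrite (Rmult_comm (Rpower x (Re s)) (Rpower x _)) -Rmult_assoc (Rmult_comm _ (Cmod (g x)));
    apply Rmult_le_compat_r; lra.
Qed.

Lemma dom_le f g K L al be : dom g K al be -> 0 <= L ->
  (forall x, 0 < x -> Cmod (f x) <= L * Cmod (g x)) -> dom f (L * K) al be.
Proof.
  intros H HL Hfg x Hx. destruct (H x Hx) as [H1 H2]. specialize (Hfg x Hx).
  split; (eapply Rle_trans; [exact Hfg|]); rewrite Rmult_assoc; now apply Rmult_le_compat_l.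
Qed.

Lemma dom_plus f g K L al be : dom f K al be -> dom g L al be ->
  dom (fun x => f x + g x)%C (K + L) al be.
Proof.
  intros Hf Hg x Hx. destruct (Hf x Hx), (Hg x Hx).
  pose proof (Cmod_triangle (f x) (g x)). split; lra.
Qed.

(** The factor is [x^(-eps)] below 1 and [x^eps] above, so it costs [eps] at each end; it dominates
    the powers of [ln x] that differentiation in the exponent creates. The condition on [2 * eps]
    keeps the two new powers in the right order on either side of 1. *)
Lemma dom_log g K al be eps : dom g K al be -> 0 <= eps -> 2 * eps <= al + be ->
  dom (fun x => RtoC (exp (eps * Rabs (ln x))) * g x)%C K (al - eps) (be - eps).
Proof.
  intros H He Hab x Hx. assert (HK := dom_K_pos _ _ _ _ H). destruct (H x Hx) as [H1 H2].
  rewrite Cmod_mult Cmod_R Rabs_pos_eq; [|left; apply exp_pos].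
  pose proof (exp_pos (eps * Rabs (ln x))) as Hp.
  destruct (Rle_lt_dec x 1) as [Hx1|Hx1].
  - assert (E : exp (eps * Rabs (ln x)) = Rpower x (- eps)).
    { unfold Rpower. f_equal. rewrite Rabs_left1; [ring|].
      rewrite -ln_1. destruct Hx1 as [Hx1| ->]; [left; now apply ln_increasing|lra]. }
    assert (H0 : Cmod (g x) * Rpower x (- eps) <= K * Rpower x (al - eps - 1)).
    { replace (al - eps - 1) with (al - 1 + - eps) by ring. rewrite (Rpower_plus _ (- eps)).
      pose proof (Rpower_pos x (- eps)). rewrite -Rmult_assoc. apply Rmult_le_compat_r; lra. }
    rewrite E. split; [lra|]. eapply Rle_trans; [|apply Rmult_le_compat_l; [exact HK|]].
    + rewrite Rmult_comm. exact H0.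
    + apply Rpower_le_small; lra.
  - assert (E : exp (eps * Rabs (ln x)) = Rpower x eps).
    { unfold Rpower. f_equal. rewrite Rabs_pos_eq; [ring|].
      rewrite -ln_1. left; apply ln_increasing; lra. }
    assert (H0 : Cmod (g x) * Rpower x eps <= K * Rpower x (- (be - eps) - 1)).
    { replace (- (be - eps) - 1) with (- be - 1 + eps) by ring. rewrite (Rpower_plus _ eps).
      pose proof (Rpower_pos x eps). rewrite -Rmult_assoc. apply Rmult_le_compat_r; lra. }
    rewrite E. split; [|lra]. eapply Rle_trans; [|apply Rmult_le_compat_l; [exact HK|]].
    + rewrite Rmult_comm. exact H0.
    + apply Rle_Rpower; lra.
Qed.

Definition mellin (g : R -> C) (s : C) : C := CInt_0_infty (fun x => Rcpow x s * g x)%C.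

Lemma mellin_Iimp g K al be s : cont0 g -> dom g K al be -> - al < Re s < be ->
  Iimp (fun x => Rcpow x s * g x)%C (mellin g s).
Proof.
  intros Hg Hd Hs. apply (Iimp_dom _ K (al + Re s) (be - Re s)); try lra.
  - apply cont0_mult; [apply cont0_Rcpow|exact Hg].
  - now apply dom_Rcpow.
Qed.

Lemma exp_ge_quad u : 0 <= u -> u ^ 2 <= 2 * exp u.
Proof.
  intros Hu. pose (f := fun t => 2 * exp t - t ^ 2).
  assert (H : f 0 <= f u).
  { destruct Hu as [Hu| <-]; [|lra].
    destruct (MVT_gen f 0 u (fun t => 2 * exp t - 2 * t)) as [c [Hc1 Hc2]].
    - intros x _. unfold f. auto_derive; auto. ring.
    - intros x _. apply continuity_pt_filterlim, (ex_derive_continuous (V := R_NormedModule)).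
      unfold f. auto_derive. auto.
    - rewrite Rmin_left ?Rmax_right in Hc1; try lra. rewrite Rminus_0_r in Hc2.
      pose proof (exp_ineq1_le c). nra. }
  unfold f in H. rewrite exp_0 in H. lra.
Qed.

(** The remainder of [x^w] around [s] is at most [|w - s|^2 (ln x)^2 e^(|w - s| |ln x|)] times
    [x^(Re s)], and for [|w - s| < del] both logarithmic factors fit into [e^(2 del |ln x|)]. With
    [del] a quarter of the distance to the edges of the strip, the loss of [2 del] at each end
    leaves room. *)
Lemma mellin_cdiff g K al be s : cont0 g -> dom g K al be -> - al < Re s < be ->
  exists l, cdiff (mellin g) s l.
Proof.
  intros Hg Hd Hs.
  set (del := Rmin (al + Re s) (be - Re s) / 4).
  assert (Hm : 0 < Rmin (al + Re s) (be - Re s)) by (apply Rmin_pos; lra).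
  pose proof (Rmin_l (al + Re s) (be - Re s)). pose proof (Rmin_r (al + Re s) (be - Re s)).
  assert (Hdel : 0 < del) by (unfold del; lra).
  assert (Hdel1 : 4 * del <= al + Re s) by (unfold del; lra).
  assert (Hdel2 : 4 * del <= be - Re s) by (unfold del; lra).
  pose proof (dom_Rcpow _ _ _ _ s Hd) as Hds.
  pose proof (dom_log _ _ _ _ del Hds ltac:(lra) ltac:(lra)) as Hd1.
  pose proof (dom_log _ _ _ _ (2 * del) Hds ltac:(lra) ltac:(lra)) as Hd2.
  assert (Hcl : cont0 (fun x => RtoC (ln x))).
  { apply cont0_rdiff with (fun x => RtoC (/ x)). intros x Hx. apply (rdiff_RtoC ln).
    apply is_derive_Reals. now apply derivable_pt_lim_ln. }
  assert (Hexp : forall e x, Cmod (RtoC (exp (e * Rabs (ln x)))) = exp (e * Rabs (ln x))).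
  { intros. rewrite Cmod_R Rabs_pos_eq //. left; apply exp_pos. }
  pose (D := fun x => (RtoC (ln x) * (Rcpow x s * g x))%C).
  assert (HcD : cont0 D) by (repeat apply cont0_mult; auto; apply cont0_Rcpow).
  assert (HdD : dom D (/ del * K) (al + Re s - del) (be - Re s - del)).
  { apply (dom_le _ _ _ (/ del) _ _ Hd1); [left; now apply Rinv_0_lt_compat|].
    intros x Hx. unfold D. rewrite !(Cmod_mult _ (Rcpow x s * g x)%C) Hexp Cmod_R -Rmult_assoc.
    apply Rmult_le_compat_r; [apply Cmod_ge_0|].
    apply Rmult_le_reg_l with del; [exact Hdel|].
    replace (del * (/ del * exp (del * Rabs (ln x)))) with (exp (del * Rabs (ln x))) by (field; lra).
    pose proof (exp_ineq1_le (del * Rabs (ln x))). lra. }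
  destruct (Iimp_dom D _ (al + Re s - del) (be - Re s - del) HcD ltac:(lra) ltac:(lra) HdD) as [HID _].
  exists (CInt_0_infty D).
  apply (diffg_quad (X := C_UniformSpace) (fun w => w) cid_cont)
    with (2 / del ^ 2 * K * (/ (al + Re s - 2 * del) + / (be - Re s - 2 * del))).
  generalize (locally_C s del Hdel). apply filter_imp. intros w Hw.
  assert (Hw2 : - al < Re w < be).
  { pose proof (re_le_Cmod (w - s)%C) as Hre. destruct w, s. simpl in *.
    apply Rabs_le_between in Hre. lra. }
  pose proof (mellin_Iimp g K al be w Hg Hd Hw2) as I1.
  pose proof (mellin_Iimp g K al be s Hg Hd Hs) as I2.
  pose proof (Iimp_minus _ _ _ _ (Iimp_minus _ _ _ _ I1 I2) (Iimp_scal (w - s)%C _ _ HID)) as I3.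
  replace (CInt_0_infty D * (w - s))%C with ((w - s) * CInt_0_infty D)%C by ring.
  replace (2 / del ^ 2 * K * (/ (al + Re s - 2 * del) + / (be - Re s - 2 * del)) * Cmod (w - s)%C ^ 2)
    with ((2 / del ^ 2 * Cmod (w - s)%C ^ 2) * K * (/ (al + Re s - 2 * del) + / (be - Re s - 2 * del)))
    by ring.
  apply (Iimp_dom_bound _ _ _ _ _ I3); try lra.
  { repeat first [exact HcD | exact Hg | apply cont0_minus | apply cont0_mult | apply cont0_const
       | apply cont0_Rcpow]. }
  apply (dom_le _ _ _ _ _ _ Hd2).
  { pose proof (Cmod_ge_0 (w - s)%C). apply Rmult_le_pos; [|nra].
    apply Rdiv_le_0_compat; [lra|]. nra. }
  intros x Hx. unfold D.
  replace (Rcpow x w) with (Rcpow x s * Cexp ((w - s) * RtoC (ln x)))%C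
    by (unfold Rcpow; rewrite -Cexp_plus; f_equal; ring).
  replace (_ - _ - _)%C with
    ((Cexp ((w - s) * RtoC (ln x)) - 1 - (w - s) * RtoC (ln x)) * (Rcpow x s * g x))%C by ring.
  rewrite !(Cmod_mult _ (Rcpow x s * g x)%C) Hexp -Rmult_assoc.
  apply Rmult_le_compat_r; [apply Cmod_ge_0|].
  eapply Rle_trans; [apply Cexp_quad_bound|]. rewrite Cmod_mult Cmod_R.
  set (k := Cmod (w - s)%C) in *. set (u := Rabs (ln x)).
  assert (Hu : 0 <= u) by apply Rabs_pos. assert (Hk : 0 <= k) by apply Cmod_ge_0.
  replace (2 * del * u) with (del * u + del * u) by ring. rewrite exp_plus.
  assert (E1 : exp (k * u) <= exp (del * u)) by (apply exp_le; nra).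
  pose proof (exp_ge_quad (del * u) ltac:(nra)) as E2.
  pose proof (exp_pos (del * u)) as E3. pose proof (exp_pos (k * u)) as E4.
  replace ((k * u) ^ 2 * exp (k * u)) with (k ^ 2 * (u ^ 2 * exp (k * u))) by ring.
  replace (2 / del ^ 2 * k ^ 2 * (exp (del * u) * exp (del * u)))
    with (k ^ 2 * (2 / del ^ 2 * exp (del * u) * exp (del * u))) by ring.
  apply Rmult_le_compat_l; [nra|].
  apply Rmult_le_compat; [nra|lra| |exact E1].
  apply Rmult_le_reg_l with (del ^ 2); [nra|].
  replace (del ^ 2 * (2 / del ^ 2 * exp (del * u))) with (2 * exp (del * u)) by (field; lra).
  lra.
Qed.

(** * Euler's Gamma integral *)

Lemma RtoC_neq_0 (x : R) : x <> 0 -> RtoC x <> 0.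
Proof. intros H E. injection E. exact H. Qed.

(** [K = p^p e^(-p)] is the maximum of [u^p e^(-u)]; the bound follows from [1 + ln v <= v] at
    [v = t x / p]. *)
Lemma exp_power_bound p : 0 < p -> exists K, 0 < K /\
  forall t x, 0 < t -> 0 < x -> exp (- (t * x)) <= K * Rpower t (- p) * Rpower x (- p).
Proof.
  intros Hp. exists (exp (p * ln p - p)). split; [apply exp_pos|]. intros t x Ht Hx.
  unfold Rpower. rewrite -!exp_plus. apply exp_le.
  assert (Htx : 0 < t * x / p) by (apply Rdiv_lt_0_compat; nra).
  pose proof (exp_ineq1_le (ln (t * x / p))) as H. rewrite exp_ln // in H.
  rewrite ln_div // ?ln_mult // in H; [|nra].
  apply Rmult_le_compat_l with (r := p) in H; [|lra].
  replace (p * (t * x / p)) with (t * x) in H by (field; lra). lra.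
Qed.

Lemma dom_exp t b : 0 < t -> 0 < b -> exists K, dom (fun x => RtoC (exp (- (t * x)))) K 1 b.
Proof.
  intros Ht Hb. destruct (exp_power_bound (b + 1)) as (K & HK & H); [lra|].
  set (L := K * Rpower t (- (b + 1))).
  assert (HL : 0 < L) by (apply Rmult_lt_0_compat; [exact HK|apply Rpower_pos]).
  exists (1 + L). intros x Hx. specialize (H t x Ht Hx). fold L in H.
  rewrite Cmod_R Rabs_pos_eq; [|left; apply exp_pos].
  replace (1 - 1) with 0 by ring. rewrite Rpower_O //.
  replace (- (b + 1)) with (- b - 1) in H by ring.
  pose proof (Rpower_pos x (- b - 1)).
  assert (exp (- (t * x)) <= 1) by (rewrite -exp_0; apply exp_le; nra).
  split; nra.
Qed.

Lemma cont0_exp t : cont0 (fun x => RtoC (exp (- (t * x)))).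
Proof.
  apply cont0_RtoC. intros x _. apply (ex_derive_continuous (V := R_NormedModule)).
  auto_derive. auto.
Qed.

Lemma Iimp_exp_power t s : 0 < t -> 0 < Re s ->
  Iimp (fun x => Rcpow x (s - 1) * RtoC (exp (- (t * x))))%C
    (mellin (fun x => RtoC (exp (- (t * x)))) (s - 1)%C).
Proof.
  intros Ht Hs. destruct (dom_exp t (Re s + 1) Ht ltac:(lra)) as [K HK].
  apply (mellin_Iimp _ K 1 (Re s + 1)); [apply cont0_exp|exact HK|].
  destruct s; simpl in *; lra.
Qed.

Lemma Gamma_mellin s : Gamma s = mellin (fun x => RtoC (exp (- (1 * x)))) (s - 1)%C.
Proof.
  unfold Gamma, mellin. f_equal. apply functional_extensionality. intros x.
  now rewrite Rmult_1_l.
Qed.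

Lemma Gamma_Iimp s : 0 < Re s ->
  Iimp (fun x => Rcpow x (s - 1) * RtoC (exp (- x)))%C (Gamma s).
Proof.
  intros Hs. rewrite Gamma_mellin. eapply Iimp_ext; [|apply (Iimp_exp_power 1 s); lra].
  intros x _. cbv beta. now rewrite Rmult_1_l.
Qed.

Lemma Gamma_cdiff s : 0 < Re s -> exists l, cdiff Gamma s l.
Proof.
  intros Hs. destruct (dom_exp 1 (Re s + 1) ltac:(lra) ltac:(lra)) as [K HK].
  destruct (mellin_cdiff _ K 1 (Re s + 1) (s - 1)%C (cont0_exp 1) HK) as [l Hl].
  { destruct s; simpl in *; lra. }
  eexists. apply (diffg_ext (X := C_UniformSpace)) with
    (fun w => mellin (fun x => RtoC (exp (- (1 * x)))) (w - 1)%C).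
  - intros w. now rewrite Gamma_mellin.
  - apply (diffg_comp (X := C_UniformSpace) _ cid_cont _ (fun w => w - 1)%C); [exact Hl|].
    apply (diffg_minus _ cid_cont); [apply diffg_iota|apply diffg_const].
Qed.

Lemma clim_power_0 (P : R -> C) K c : 0 < c ->
  (forall x, 0 < x -> Cmod (P x) <= K * Rpower x c) -> clim P (at_right 0) 0.
Proof.
  intros Hc H e He.
  assert (HK : 0 <= K).
  { pose proof (H 1 Rlt_0_1) as H1. rewrite Rpower_base_1 in H1. pose proof (Cmod_ge_0 (P 1)). lra. }
  destruct (Rpower_small c (e / (K + 1)) Hc) as (d & Hd & Hdc); [apply Rdiv_lt_0_compat; lra|].
  exists (mkposreal d Hd). intros x Hx Hx0.
  change (Rabs (x - 0) < d) in Hx. rewrite Rminus_0_r Rabs_pos_eq in Hx; [|lra].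
  replace (P x - 0)%C with (P x) by ring. eapply Rle_lt_trans; [now apply H|].
  pose proof (Rle_Rpower_l x d c ltac:(lra) ltac:(lra)).
  apply Rle_lt_trans with (K * (e / (K + 1))); [apply Rmult_le_compat_l; lra|].
  apply Rmult_lt_reg_r with (K + 1); [lra|].
  replace (K * (e / (K + 1)) * (K + 1)) with (K * e) by (field; lra). nra.
Qed.

Lemma clim_power_infty (P : R -> C) K c : 0 < c ->
  (forall x, 0 < x -> Cmod (P x) <= K * Rpower x (- c)) -> clim P (Rbar_locally p_infty) 0.
Proof.
  intros Hc H e He.
  assert (HK : 0 <= K).
  { pose proof (H 1 Rlt_0_1) as H1. rewrite Rpower_base_1 in H1. pose proof (Cmod_ge_0 (P 1)). lra. }
  destruct (Rpower_large c (e / (K + 1)) Hc) as (M & HM & HMc); [apply Rdiv_lt_0_compat; lra|].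
  exists M. intros x Hx. replace (P x - 0)%C with (P x) by ring.
  eapply Rle_lt_trans; [apply H; lra|].
  pose proof (Rpower_anti M x (- c) ltac:(lra) ltac:(lra)).
  apply Rle_lt_trans with (K * (e / (K + 1))); [apply Rmult_le_compat_l; lra|].
  apply Rmult_lt_reg_r with (K + 1); [lra|].
  replace (K * (e / (K + 1)) * (K + 1)) with (K * e) by (field; lra). nra.
Qed.

(** Integration by parts without boundary terms: a primitive small at both ends gives an integral
    equal to 0, from which an identity between integrals is read off by linearity. *)
Lemma Iimp_derive_0 (P p : R -> C) K al be : 0 < al -> 0 < be ->
  (forall x, 0 < x -> rdiff P x (p x)) -> cont0 p ->
  (forall x, 0 < x -> Cmod (P x) <= K * Rpower x al /\ Cmod (P x) <= K * Rpower x (- be)) ->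
  Iimp p 0.
Proof.
  intros Hal Hbe HP Hp H. replace (RtoC 0) with (0 - 0)%C by ring.
  apply Iimp_derive with P; auto.
  - apply clim_power_0 with K al; auto. intros; now apply H.
  - apply clim_power_infty with K be; auto. intros; now apply H.
Qed.

Lemma rdiff_exp_opp x : rdiff (fun t => RtoC (exp (- t))) x (- RtoC (exp (- x)))%C.
Proof.
  rewrite -RtoC_opp. apply (rdiff_RtoC (fun t => exp (- t))). auto_derive; auto. ring.
Qed.

Lemma cont0_exp_opp : cont0 (fun x => RtoC (exp (- x))).
Proof. apply (cont0_rdiff _ (fun x => - RtoC (exp (- x)))%C). intros; apply rdiff_exp_opp. Qed.

Lemma Gamma_succ s : 0 < Re s -> Gamma (s + 1)%C = (s * Gamma s)%C.
Proof.
  intros Hs.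
  pose proof (Gamma_Iimp s Hs) as I1.
  pose proof (Gamma_Iimp (s + 1)%C ltac:(destruct s; simpl in *; lra)) as I2.
  assert (I0 : Iimp (fun x => s * (Rcpow x (s - 1) * RtoC (exp (- x)))
       - Rcpow x (s + 1 - 1) * RtoC (exp (- x)))%C 0).
  { destruct (dom_exp 1 (Re s) ltac:(lra) Hs) as [K HK].
    apply (Iimp_derive_0 (fun x => Rcpow x s * RtoC (exp (- x)))%C _ K (Re s) 1); try lra.
    - intros x Hx. eapply diffg_eq; [|apply (diffg_mult _ RtoC_cont);
        [now apply rdiff_Rcpow|apply rdiff_exp_opp]].
      cbv beta. replace (s + 1 - 1)%C with s by ring. ring.
    - repeat first [apply cont0_minus|apply cont0_mult|apply cont0_const|apply cont0_Rcpow
        |apply cont0_exp_opp].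
    - intros x Hx. destruct (dom_Rcpow _ _ _ _ s HK x Hx) as [H1 H2].
      rewrite Rmult_1_l in H1, H2.
      replace (1 + Re s - 1) with (Re s) in H1 by ring.
      replace (- (Re s - Re s) - 1) with (- (1)) in H2 by ring. auto. }
  pose proof (Iimp_unique _ _ _ I0 (Iimp_minus _ _ _ _ (Iimp_scal s _ _ I1) I2)) as E.
  transitivity (s * Gamma s - (s * Gamma s - Gamma (s + 1)))%C; [ring|]. rewrite -E. ring.
Qed.

(** The combination [(1 + x) e^(-x)] is chosen because its derivative is
    [- x e^(-x)], so that one integration by parts returns [Gamma (s + 1)]. *)
Lemma Iimp_power_tail s c1 c2 : 1 < Re s ->
  Iimp (fun x => Rcpow x s * (c2 * RtoC ((1 + x) * exp (- x) / x ^ 2) + c1 * RtoC (exp (- x) / x)))%C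
    (Gamma (s + 1) * (c2 / (s - 1) + c1 / s))%C.
Proof.
  intros Hs.
  assert (Hs1 : (s - 1)%C <> 0) by (intros E; apply (f_equal Re) in E; destruct s; simpl in *; lra).
  assert (Hs0 : s <> 0) by (intros E; apply (f_equal Re) in E; destruct s; simpl in *; lra).
  pose proof (Gamma_Iimp s ltac:(lra)) as I1.
  pose proof (Gamma_Iimp (s - 1)%C ltac:(destruct s; simpl in *; lra)) as I2.
  pose proof (Gamma_succ s ltac:(lra)) as E1.
  pose proof (Gamma_succ (s - 1)%C ltac:(destruct s; simpl in *; lra)) as E2.
  replace (s - 1 + 1)%C with s in E2 by ring.
  pose proof (Iimp_plus _ _ _ _ (Iimp_scal c2 _ _ (Iimp_plus _ _ _ _ I1 I2)) (Iimp_scal c1 _ _ I1)) as I3.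
  replace (Gamma (s + 1) * (c2 / (s - 1) + c1 / s))%C
    with (c2 * (Gamma s + Gamma (s - 1)) + c1 * Gamma s)%C.
  - eapply Iimp_ext; [|exact I3]. intros x Hx. cbv beta.
    assert (Hx0 : RtoC x <> 0) by (apply RtoC_neq_0; lra).
    rewrite !(Rcpow_minus _ _ 1) Rcpow_1 //.
    replace (RtoC ((1 + x) * exp (- x) / x ^ 2)) with ((1 + RtoC x) * RtoC (exp (- x)) / (RtoC x * RtoC x))%C.
    replace (RtoC (exp (- x) / x)) with (RtoC (exp (- x)) / RtoC x)%C.
    + field. exact Hx0.
    + rewrite RtoC_div //. lra.
    + replace (x ^ 2) with (x * x) by ring. rewrite RtoC_div; [|nra]. now rewrite !RtoC_mult RtoC_plus.
  - rewrite E1 E2. field. auto.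
Qed.

Lemma exp_opp_lower x : 1 - x <= exp (- x).
Proof. pose proof (exp_ineq1_le (- x)). lra. Qed.

(** The continuation of [Iimp_power_tail]: subtracting the 1 makes the kernel bounded at 0 but only
    of size [1 / x] at infinity, which moves the region of convergence to [-1 < Re s < 0] and leaves
    the value formula unchanged. Each of the two fractions is integrated by parts once. *)
Lemma Iimp_power_head s c1 c2 : -1 < Re s < 0 ->
  Iimp (fun x => Rcpow x s * (c2 * RtoC (((1 + x) * exp (- x) - 1) / x ^ 2)
       + c1 * RtoC ((exp (- x) - 1) / x)))%C
    (Gamma (s + 1) * (c2 / (s - 1) + c1 / s))%C.
Proof.
  intros Hs.
  assert (Hs1 : (s - 1)%C <> 0) by (intros E; apply (f_equal Re) in E; destruct s; simpl in *; lra).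
  assert (Hs0 : s <> 0) by (intros E; apply (f_equal Re) in E; destruct s; simpl in *; lra).
  pose proof (Gamma_Iimp (s + 1)%C ltac:(destruct s; simpl in *; lra)) as I1.
  replace (s + 1 - 1)%C with s in I1 by ring.
  pose proof cont0_exp_opp as Hce.
  pose proof cont0_id as Hcid.
  assert (Hbound1 : forall x, 0 < x -> Rabs (exp (- x) - 1) <= x /\ Rabs (exp (- x) - 1) <= 1).
  { intros x Hx. pose proof (exp_pos (- x)). pose proof (exp_opp_lower x).
    assert (exp (- x) <= 1) by (rewrite -exp_0; apply exp_le; lra).
    rewrite Rabs_left1; lra. }
  assert (Hbound2 : forall x, 0 < x ->
    Rabs ((1 + x) * exp (- x) - 1) <= x ^ 2 /\ Rabs ((1 + x) * exp (- x) - 1) <= 1).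
  { intros x Hx. pose proof (exp_pos (- x)). pose proof (exp_opp_lower x).
    assert ((1 + x) * exp (- x) <= 1).
    { pose proof (exp_ineq1_le x). replace 1 with (exp x * exp (- x)) at 2.
      - apply Rmult_le_compat_r; lra.
      - rewrite -exp_plus Rplus_opp_r. apply exp_0. }
    rewrite Rabs_left1; nra. }
  assert (IA : Iimp (fun x => Rcpow x (s - 1) * (RtoC (exp (- x)) - 1)
      - / s * (Rcpow x s * RtoC (exp (- x))))%C 0).
  { apply (Iimp_derive_0 (fun x => / s * Rcpow x s * (RtoC (exp (- x)) - 1))%C _
       (Cmod (/ s)%C) (Re s + 1) (- Re s)); try lra.
    - intros x Hx. eapply diffg_eq; [|apply (diffg_mult _ RtoC_cont); [apply (diffg_scal _ RtoC_cont);
        now apply rdiff_Rcpow|apply (diffg_minus _ RtoC_cont); [apply rdiff_exp_opp|apply diffg_const]]].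
      cbv beta. field. exact Hs0.
    - repeat first [apply cont0_minus|apply cont0_mult|apply cont0_const|apply cont0_Rcpow|exact Hce].
    - intros x Hx. destruct (Hbound1 x Hx) as [B1 B2].
      rewrite !Cmod_mult Cmod_Rcpow -RtoC_minus Cmod_R Ropp_involutive Rpower_plus Rpower_1 //.
      pose proof (Cmod_ge_0 (/ s)%C). pose proof (Rpower_pos x (Re s)). rewrite !Rmult_assoc.
      split; apply Rmult_le_compat_l; try lra.
      + apply Rmult_le_compat_l; lra.
      + rewrite -{2}(Rmult_1_r (Rpower x (Re s))). apply Rmult_le_compat_l; lra. }
  assert (IB : Iimp (fun x => Rcpow x (s - 1 - 1) * ((1 + RtoC x) * RtoC (exp (- x)) - 1)
      - / (s - 1) * (Rcpow x s * RtoC (exp (- x))))%C 0).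
  { apply (Iimp_derive_0 (fun x => / (s - 1) * Rcpow x (s - 1) * ((1 + RtoC x) * RtoC (exp (- x)) - 1))%C _
       (Cmod (/ (s - 1))%C) (Re s + 1) (1 - Re s)); try lra.
    - intros x Hx. eapply diffg_eq; [|apply (diffg_mult _ RtoC_cont); [apply (diffg_scal _ RtoC_cont);
        now apply rdiff_Rcpow|apply (diffg_minus _ RtoC_cont); [apply (diffg_mult _ RtoC_cont);
          [apply diffg_plus; [apply diffg_const|apply diffg_iota]|apply rdiff_exp_opp]|apply diffg_const]]].
      cbv beta. replace (Rcpow x s) with (Rcpow x (s - 1) * RtoC x)%C.
      + field. exact Hs1.
      + rewrite -{1}(Rcpow_1 x) // -Rcpow_plus. f_equal. ring.
    - repeat first [apply cont0_minus|apply cont0_mult|apply cont0_plus|apply cont0_const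
       |apply cont0_Rcpow|exact Hce|exact Hcid].
    - intros x Hx. destruct (Hbound2 x Hx) as [B1 B2].
      rewrite !Cmod_mult Cmod_Rcpow -RtoC_plus -RtoC_mult -RtoC_minus Cmod_R.
      replace (Re (s - 1)%C) with (Re s - 1) by (destruct s; simpl; ring).
      replace (- (1 - Re s)) with (Re s - 1) by ring.
      replace (Re s + 1) with (Re s - 1 + INR 2) by (simpl; ring). rewrite Rpower_plus Rpower_pow //.
      pose proof (Cmod_ge_0 (/ (s - 1))%C). pose proof (Rpower_pos x (Re s - 1)). rewrite !Rmult_assoc.
      split; apply Rmult_le_compat_l; try lra.
      + apply Rmult_le_compat_l; lra.
      + rewrite -{2}(Rmult_1_r (Rpower x (Re s - 1))). apply Rmult_le_compat_l; lra. }
  pose proof (Iimp_plus _ _ _ _ IA (Iimp_scal (/ s)%C _ _ I1)) as IA'.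
  pose proof (Iimp_plus _ _ _ _ IB (Iimp_scal (/ (s - 1))%C _ _ I1)) as IB'.
  pose proof (Iimp_plus _ _ _ _ (Iimp_scal c2 _ _ IB') (Iimp_scal c1 _ _ IA')) as I3.
  replace (Gamma (s + 1) * (c2 / (s - 1) + c1 / s))%C
    with (c2 * (0 + / (s - 1) * Gamma (s + 1)) + c1 * (0 + / s * Gamma (s + 1)))%C by (field; auto).
  eapply Iimp_ext; [|exact I3]. intros x Hx. cbv beta.
  assert (Hx0 : RtoC x <> 0) by (apply RtoC_neq_0; lra).
  rewrite !(Rcpow_minus _ _ 1) Rcpow_1 //.
  replace (RtoC (((1 + x) * exp (- x) - 1) / x ^ 2))
    with (((1 + RtoC x) * RtoC (exp (- x)) - 1) / (RtoC x * RtoC x))%C.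
  replace (RtoC ((exp (- x) - 1) / x)) with ((RtoC (exp (- x)) - 1) / RtoC x)%C.
  - field. auto.
  - rewrite RtoC_div ?RtoC_minus //. lra.
  - replace (x ^ 2) with (x * x) by ring. rewrite RtoC_div; [|nra].
    now rewrite RtoC_minus !RtoC_mult RtoC_plus.
Qed.

(** * The integral of [x^s / (1 + x)] *)

Lemma Iimp_scaling f I lam : cont0 f -> 0 < lam -> Iimp f I ->
  Iimp (fun x => RtoC lam * f (lam * x)%R)%C I.
Proof.
  intros Hf Hl H.
  assert (Hc : cont0 (fun x => RtoC lam * f (lam * x)%R)%C).
  { apply cont0_mult; [apply cont0_const|]. intros x Hx.
    apply (clim_comp _ (locally (lam * x)) (fun y => lam * y) f); [|apply Hf; nra].
    apply (continuous_scal_r lam (fun y : R_NormedModule => y)). apply continuous_id. }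
  apply Iimp_intro; [exact Hc|]. intros e He.
  destruct (Iimp_elim _ _ H e He) as (d & M & Hd & HdM).
  exists (Rmin (d / lam) 1), (Rmax (M / lam) 1).
  assert (Hdl : 0 < d / lam) by (apply Rdiv_lt_0_compat; lra).
  split; [apply Rmin_pos; lra|]. intros a b Ha Hb.
  pose proof (Rmin_l (d / lam) 1). pose proof (Rmin_r (d / lam) 1).
  pose proof (Rmax_l (M / lam) 1). pose proof (Rmax_r (M / lam) 1).
  assert (Ka : lam * a < d).
  { replace d with (lam * (d / lam)) by (field; lra). apply Rmult_lt_compat_l; lra. }
  assert (Kb : M < lam * b).
  { replace M with (lam * (M / lam)) by (field; lra). apply Rmult_lt_compat_l; lra. }
  destruct (HdM (lam * a) (lam * b)) as (y & Hy & Hye); [nra|exact Kb|].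
  replace (lam * a) with (lam * a + 0) in Hy by ring.
  replace (lam * b) with (lam * b + 0) in Hy by ring.
  apply CRI_comp_lin in Hy. rewrite (CInt_unique _ a b y); [exact Hye|].
  eapply CRI_ext; [|exact Hy]. intros t _. cbv beta. now rewrite Rplus_0_r.
Qed.

Lemma Gamma_scaling t s : 0 < t -> 0 < Re s ->
  Iimp (fun x => Rcpow x (s - 1) * RtoC (exp (- (t * x))))%C (Rcpow t (- s) * Gamma s)%C.
Proof.
  intros Ht Hs.
  pose proof (Iimp_scaling _ _ t (cont0_mult _ _ (cont0_Rcpow (s - 1)%C) cont0_exp_opp) Ht
    (Gamma_Iimp s Hs)) as I.
  apply (Iimp_scal (Rcpow t (- s))%C) in I. eapply Iimp_ext; [|exact I]. intros x Hx. cbv beta.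
  assert (E : Rcpow (t * x) (s - 1)%C = (Rcpow t (s - 1) * Rcpow x (s - 1))%C).
  { unfold Rcpow. rewrite -Cexp_plus ln_mult // RtoC_plus. f_equal. ring. }
  rewrite E.
  transitivity (Rcpow t (- s) * (Rcpow t 1 * Rcpow t (s - 1)) * (Rcpow x (s - 1) * RtoC (exp (- (t * x)))))%C.
  - rewrite (Rcpow_1 t) //. ring.
  - rewrite -!Rcpow_plus. replace (- s + (1 + (s - 1)))%C with (RtoC 0) by ring.
    rewrite Rcpow_RtoC Rpower_O //. ring.
Qed.

(** An interpolation between the bounds [u] and 1. It trades a small power of [t] against a small
    power of [x], which gives continuity at [t = 0] of a Laplace integral in [t]. *)
Lemma Rpower_one_minus_exp u eta : 0 < u -> 0 < eta <= 1 -> 1 - exp (- u) <= Rpower u eta.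
Proof.
  intros Hu He. pose proof (exp_opp_lower u). pose proof (exp_pos (- u)).
  destruct (Rle_lt_dec u 1) as [H1|H1].
  - pose proof (Rpower_le_small u eta 1 ltac:(lra) ltac:(lra)) as K. rewrite Rpower_1 in K; lra.
  - pose proof (Rle_Rpower u 0 eta ltac:(lra) ltac:(lra)) as K. rewrite Rpower_O in K; lra.
Qed.

Definition laplace_kernel (t x : R) : C := RtoC (exp (- (t * x)) / (1 + x)).

Lemma cont0_laplace_kernel t : cont0 (laplace_kernel t).
Proof.
  apply (cont0_RtoC (fun x => exp (- (t * x)) / (1 + x))).
  intros x Hx. apply (ex_derive_continuous (V := R_NormedModule)). auto_derive. lra.
Qed.

Lemma dom_laplace_kernel t : 0 <= t -> dom (laplace_kernel t) 1 1 0.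
Proof.
  intros Ht x Hx. unfold laplace_kernel. rewrite Cmod_R.
  assert (H1 : exp (- (t * x)) <= 1) by (rewrite -exp_0; apply exp_le; nra).
  pose proof (exp_pos (- (t * x))).
  rewrite Rabs_pos_eq; [|apply Rdiv_le_0_compat; lra].
  replace (1 - 1) with 0 by ring. replace (- 0 - 1) with (- (1)) by ring.
  rewrite Rpower_Ropp Rpower_O // Rpower_1 //.
  split; apply Rmult_le_reg_r with (1 + x); try lra; unfold Rdiv; rewrite Rmult_assoc Rinv_l; try lra.
  rewrite Rmult_plus_distr_l Rmult_1_l Rinv_l; [|lra].
  pose proof (Rinv_0_lt_compat x Hx). lra.
Qed.

(** [K t - K' t] is a Gamma integral, so [(e^(-t) K)' = - Gamma (s+1) e^(-t) t^(-s-1)];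
    integrating this over the half-line gives [K 0 = Gamma (s+1) Gamma (-s)]. *)
Lemma stieltjes_Gamma s : -1 < Re s < 0 ->
  Iimp (fun x => Rcpow x s * RtoC (/ (1 + x)))%C (Gamma (s + 1) * Gamma (- s))%C.
Proof.
  intros Hs.
  set (K := fun t => mellin (laplace_kernel t) s).
  assert (IK : forall t, 0 <= t -> Iimp (fun x => Rcpow x s * laplace_kernel t x)%C (K t)).
  { intros t Ht. apply (mellin_Iimp _ 1 1 0); [apply cont0_laplace_kernel|
      now apply dom_laplace_kernel|lra]. }
  set (G := fun t => (Rcpow t (- (s + 1)) * Gamma (s + 1))%C).
  assert (IG : forall t, 0 < t -> Iimp (fun x => Rcpow x s * RtoC (exp (- (t * x))))%C (G t)).
  { intros t Ht. unfold G.
    pose proof (Gamma_scaling t (s + 1)%C Ht ltac:(destruct s; simpl in *; lra)) as H.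
    replace (s + 1 - 1)%C with s in H by ring. exact H. }
  set (q := fun t x => RtoC (x * exp (- (t * x)) / (1 + x))).
  assert (Iq : forall t, 0 < t -> Iimp (fun x => Rcpow x s * q t x)%C (G t - K t)%C).
  { intros t Ht. eapply Iimp_ext; [|apply (Iimp_minus _ _ _ _ (IG t Ht) (IK t ltac:(lra)))].
    intros x Hx. cbv beta. unfold q, laplace_kernel.
    replace (exp (- (t * x))) with (x * exp (- (t * x)) / (1 + x) + exp (- (t * x)) / (1 + x)) at 1
      by (field; lra).
    rewrite RtoC_plus. ring. }
  assert (HK' : forall t, 0 < t -> rdiff K t (K t - G t)%C).
  (* Half of [e^(-t x)] absorbs the factor [e^(|h| x)] of the Taylor remainder for [|h| < t / 2].
     Decay of order 3 leaves room for the factor [x^2]. *)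
  { intros t Ht. destruct (dom_exp (t / 2) 3 ltac:(lra) ltac:(lra)) as [L HL].
    pose proof (dom_Rcpow _ _ _ _ (RtoC (INR 2)) HL) as HL2. apply (dom_Rcpow _ _ _ _ s) in HL2.
    set (al := 1 + Re (RtoC (INR 2)) + Re s) in HL2. set (be := 3 - Re (RtoC (INR 2)) - Re s) in HL2.
    assert (Hal : 0 < al) by (unfold al; simpl; lra). assert (Hbe : 0 < be) by (unfold be; simpl; lra).
    apply (diffg_quad (X := R_UniformSpace) RtoC RtoC_cont) with (L * (/ al + / be)).
    assert (Ht2 : 0 < t / 2) by lra.
    generalize (locally_R t _ Ht2). apply filter_imp. intros t' Ht'.
    assert (Ht'0 : 0 < t') by (apply Rabs_lt_between in Ht'; lra).
    pose proof (Iimp_plus _ _ _ _ (Iimp_minus _ _ _ _ (IK t' ltac:(lra)) (IK t ltac:(lra)))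
      (Iimp_scal (RtoC (t' - t)) _ _ (Iq t Ht))) as I.
    rewrite -RtoC_minus Cmod_R.
    replace (K t' - K t - (K t - G t) * RtoC (t' - t))%C
      with (K t' - K t + RtoC (t' - t) * (G t - K t))%C by ring.
    replace (L * (/ al + / be) * Rabs (t' - t) ^ 2) with ((Rabs (t' - t) ^ 2 * L) * (/ al + / be)) by ring.
    apply (Iimp_dom_bound _ _ _ _ _ I); auto.
    { repeat first [apply cont0_laplace_kernel|apply cont0_minus|apply cont0_plus|apply cont0_mult
        |apply cont0_const|apply cont0_Rcpow].
      apply (cont0_RtoC (fun x => x * exp (- (t * x)) / (1 + x))). intros x Hx.
      apply (ex_derive_continuous (V := R_NormedModule)). auto_derive. lra. }
    apply (dom_le _ _ _ _ _ _ HL2); [apply pow_le, Rabs_pos|]. intros x Hx.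
    unfold laplace_kernel, q.
    rewrite !(Rcpow_RtoC x (INR 2)) Rpower_pow //.
    replace (_ + _)%C with (Rcpow x s * RtoC (/ (1 + x) *
      (exp (- (t' * x)) - exp (- (t * x)) + (t' - t) * x * exp (- (t * x)))))%C.
    2:{ unfold Rdiv. rewrite !(RtoC_mult, RtoC_plus, RtoC_minus). ring. }
    rewrite !Cmod_mult !Cmod_R.
    replace (Rabs (t' - t) ^ 2 * (Cmod (Rcpow x s) * (Rabs (x ^ 2) * Rabs (exp (- (t / 2 * x))))))
      with (Cmod (Rcpow x s) * (Rabs (t' - t) ^ 2 * (Rabs (x ^ 2) * Rabs (exp (- (t / 2 * x)))))) by ring.
    apply Rmult_le_compat_l; [apply Cmod_ge_0|].
    rewrite Rabs_mult.
    assert (Hi : Rabs (/ (1 + x)) <= 1).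
    { rewrite Rabs_pos_eq; [|left; apply Rinv_0_lt_compat; lra].
      rewrite -Rinv_1. apply Rinv_le_contravar; lra. }
    set (h := t' - t) in *.
    replace (exp (- (t' * x)) - exp (- (t * x)) + h * x * exp (- (t * x)))
      with (exp (- (t * x)) * (exp (- (h * x)) - 1 - (- (h * x)))).
    2:{ replace (- (t' * x)) with (- (t * x) + - (h * x)) by (unfold h; ring).
        rewrite exp_plus. ring. }
    rewrite Rabs_mult.
    pose proof (Cexp_quad_bound (RtoC (- (h * x)))) as Q.
    rewrite Cexp_RtoC -!RtoC_minus !Cmod_R in Q.
    rewrite (Rabs_pos_eq (exp (- (t * x)))) ?(Rabs_pos_eq (exp (- (t / 2 * x))));
      try (left; apply exp_pos).
    assert (Eu : Rabs (- (h * x)) = Rabs h * x).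
    { rewrite Rabs_Ropp Rabs_mult (Rabs_pos_eq x); lra. }
    rewrite Eu in Q. rewrite (Rabs_pos_eq (x ^ 2)); [|nra].
    assert (Q2 : exp (- (t * x)) * exp (Rabs h * x) <= exp (- (t / 2 * x))).
    { rewrite -exp_plus. apply exp_le. nra. }
    pose proof (exp_pos (- (t * x))) as P1. pose proof (exp_pos (Rabs h * x)) as P2.
    pose proof (Rabs_pos h) as P3.
    set (w := Rabs (exp (- (h * x)) - 1 - - (h * x))) in *.
    assert (Hw : 0 <= w) by apply Rabs_pos.
    apply Rle_trans with (1 * (exp (- (t * x)) * ((Rabs h * x) ^ 2 * exp (Rabs h * x)))).
    - apply Rmult_le_compat; [apply Rabs_pos|nra|exact Hi|]. apply Rmult_le_compat_l; lra.
    - replace (1 * (exp (- (t * x)) * ((Rabs h * x) ^ 2 * exp (Rabs h * x))))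
        with (Rabs h ^ 2 * x ^ 2 * (exp (- (t * x)) * exp (Rabs h * x))) by ring.
      replace (Rabs h ^ 2 * (x ^ 2 * exp (- (t / 2 * x))))
        with (Rabs h ^ 2 * x ^ 2 * exp (- (t / 2 * x))) by ring.
      apply Rmult_le_compat_l; [nra|exact Q2]. }
  assert (HKb : forall t, 0 <= t -> Cmod (K t) <= 1 * (/ (1 + Re s) + / (0 - Re s))).
  { intros t Ht. apply (Iimp_dom_bound _ _ _ _ _ (IK t Ht)); try lra.
    - apply cont0_mult; [apply cont0_Rcpow|apply cont0_laplace_kernel].
    - apply dom_Rcpow. now apply dom_laplace_kernel. }
  assert (IW : Iimp (fun t => RtoC (exp (- t)) * - G t)%C (0 - K 0)%C).
  { apply Iimp_derive with (fun t => RtoC (exp (- t)) * K t)%C.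
    - intros t Ht. eapply diffg_eq; [|apply (diffg_mult _ RtoC_cont);
        [apply rdiff_exp_opp|now apply HK']]. cbv beta. ring.
    - apply cont0_mult; [apply cont0_exp_opp|].
      intros t Ht. apply clim_opp; [typeclasses eauto|]. revert t Ht.
      apply cont0_mult; [apply cont0_Rcpow|apply cont0_const].
    (* Any exponent strictly between 0 and [- Re s] would do: [K t - K 0] is of order [t^eta], and
       the power [x^eta] paid for it keeps the integral convergent at infinity. *)
    - set (eta := - Re s / 2).
      assert (HK0 : clim K (at_right 0) (K 0)).
      { apply clim_0_iff; [typeclasses eauto|].
        apply clim_power_0 with (1 * (/ (1 + eta + Re s) + / (- eta - Re s))) eta; [unfold eta; lra|].
        intros t Ht. pose proof (Iimp_minus _ _ _ _ (IK t ltac:(lra)) (IK 0 ltac:(lra))) as I.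
        rewrite Rmult_comm -Rmult_assoc.
        apply (Iimp_dom_bound _ _ _ _ _ I); [|unfold eta; lra|unfold eta; lra|].
        { apply cont0_minus; apply cont0_mult; first [apply cont0_Rcpow|apply cont0_laplace_kernel]. }
        rewrite Rmult_1_r.
        assert (Hd : dom (fun x => laplace_kernel t x - laplace_kernel 0 x)%C (Rpower t eta) (1 + eta) (- eta)).
        { intros x Hx. unfold laplace_kernel. rewrite -RtoC_minus Cmod_R Rmult_0_l Ropp_0 exp_0.
          pose proof (Rpower_one_minus_exp (t * x) eta ltac:(nra) ltac:(unfold eta; lra)) as B.
          rewrite -Rpower_mult_distr // in B.
          assert (H1 : exp (- (t * x)) <= 1) by (rewrite -exp_0; apply exp_le; nra).
          replace (exp (- (t * x)) / (1 + x) - 1 / (1 + x)) with (- ((1 - exp (- (t * x))) / (1 + x)))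
            by (field; lra).
          rewrite Rabs_Ropp Rabs_pos_eq; [|apply Rdiv_le_0_compat; lra].
          set (P := Rpower t eta * Rpower x eta) in *.
          assert (HP : 0 <= P) by (apply Rmult_le_pos; left; apply Rpower_pos).
          replace (1 + eta - 1) with eta by ring. replace (- - eta - 1) with (eta + - (1)) by ring.
          rewrite Rpower_plus Rpower_Ropp Rpower_1 // -Rmult_assoc. fold P.
          assert (Hle : forall y, 0 <= y -> / (1 + x) <= y -> (1 - exp (- (t * x))) / (1 + x) <= P * y).
          { intros y Hy Hy2. apply Rmult_le_compat; try lra. left; apply Rinv_0_lt_compat; lra. }
          split.
          - rewrite -(Rmult_1_r P). apply Hle; [lra|]. rewrite -Rinv_1. apply Rinv_le_contravar; lra.
          - apply Hle; [left; now apply Rinv_0_lt_compat|]. apply Rinv_le_contravar; lra. }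
        apply (dom_Rcpow _ _ _ _ s) in Hd. intros x Hx. specialize (Hd x Hx).
        replace (Rcpow x s * laplace_kernel t x - Rcpow x s * laplace_kernel 0 x)%C
          with (Rcpow x s * (laplace_kernel t x - laplace_kernel 0 x))%C by ring. exact Hd. }
      apply clim_eq with (1 * K 0)%C; [ring|].
      apply clim_mult; [typeclasses eauto| |exact HK0].
      intros e He. assert (Hc : rdiff (fun t => RtoC (exp (- t))) 0 (- RtoC (exp (- 0)))%C)
        by apply rdiff_exp_opp.
      apply rdiff_cont in Hc. destruct (Hc e He) as [d Hd]. exists d. intros x Hx _.
      specialize (Hd x Hx). now rewrite Ropp_0 exp_0 in Hd.
    - destruct (exp_power_bound 1 Rlt_0_1) as (L & HL & Hb).
      apply clim_power_infty with (1 * (/ (1 + Re s) + / (0 - Re s)) * L) 1; [lra|].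
      intros t Ht. rewrite Cmod_mult Cmod_R Rabs_pos_eq; [|left; apply exp_pos].
      specialize (Hb 1 t Rlt_0_1 Ht). rewrite Rmult_1_l Rpower_base_1 Rmult_1_r in Hb.
      specialize (HKb t ltac:(lra)).
      rewrite Rmult_assoc (Rmult_comm (exp (- t))).
      apply Rmult_le_compat; [apply Cmod_ge_0|left; apply exp_pos|exact HKb|exact Hb]. }
  pose proof (Gamma_Iimp (- s)%C ltac:(destruct s; simpl in *; lra)) as I1.
  apply (Iimp_scal (- Gamma (s + 1))%C) in I1.
  assert (E : (0 - K 0)%C = (- Gamma (s + 1) * Gamma (- s))%C).
  { apply (Iimp_unique _ _ _ IW). eapply Iimp_ext; [|exact I1]. intros t Ht. cbv beta. unfold G.
    replace (- (s + 1))%C with (- s - 1)%C by ring. ring. }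
  replace (Gamma (s + 1) * Gamma (- s))%C with (K 0)
    by (transitivity (- (0 - K 0))%C; [ring|rewrite E; ring]).
  eapply Iimp_ext; [|apply (IK 0); lra]. intros x Hx. cbv beta. unfold laplace_kernel.
  rewrite Rmult_0_l Ropp_0 exp_0. unfold Rdiv. now rewrite Rmult_1_l.
Qed.

(** * Non-vanishing of Gamma *)

Lemma Iimp_fact k : Iimp (fun x => RtoC (x ^ k * exp (- x))) (RtoC (INR (fact k))).
Proof.
  assert (E0 : forall n : nat, Re (RtoC (INR n) + 1)%C = INR n + 1) by (intros; simpl; ring).
  assert (H : Gamma (RtoC (INR k) + 1)%C = RtoC (INR (fact k))).
  { induction k as [|k IH].
    - simpl. replace (RtoC 0 + 1)%C with (RtoC 1) by ring.
      apply (Iimp_unique (fun x => RtoC (exp (- x)))).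
      + eapply Iimp_ext; [|apply (Gamma_Iimp 1); simpl; lra]. intros x Hx. cbv beta.
        replace (1 - 1)%C with (RtoC 0) by ring. rewrite Rcpow_RtoC Rpower_O //. ring.
      + replace (RtoC 1) with (0 - - (1))%C by ring.
        apply Iimp_derive with (fun x => - RtoC (exp (- x)))%C.
        * intros x _. apply (diffg_ext (X := R_UniformSpace) _ (fun t => - (1) * RtoC (exp (- t)))%C).
          { intros; ring. }
          eapply diffg_eq; [|apply (diffg_scal _ RtoC_cont), rdiff_exp_opp]. ring.
        * apply cont0_exp_opp.
        * apply clim_opp; [typeclasses eauto|]. intros e He.
          assert (Hc : rdiff (fun t => RtoC (exp (- t))) 0 (- RtoC (exp (- 0)))%C) by apply rdiff_exp_opp.
          apply rdiff_cont in Hc. destruct (Hc e He) as [d Hd]. exists d. intros x Hx _.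
          specialize (Hd x Hx). now rewrite Ropp_0 exp_0 in Hd.
        * replace (RtoC 0) with (- 0)%C by ring. apply clim_opp; [typeclasses eauto|].
          destruct (exp_power_bound 1 Rlt_0_1) as (L & HL & Hb).
          apply clim_power_infty with L 1; [lra|]. intros x Hx.
          specialize (Hb 1 x Rlt_0_1 Hx). rewrite Rmult_1_l Rpower_base_1 Rmult_1_r in Hb.
          rewrite Cmod_R Rabs_pos_eq; [exact Hb|left; apply exp_pos].
    - rewrite S_INR RtoC_plus Gamma_succ; [|rewrite E0; pose proof (pos_INR k); lra].
      rewrite IH -RtoC_plus -RtoC_mult. f_equal. rewrite fact_simpl mult_INR S_INR. ring. }
  rewrite -H. eapply Iimp_ext; [|apply Gamma_Iimp; rewrite E0; pose proof (pos_INR k); lra].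
  intros x Hx. cbv beta. replace (RtoC (INR k) + 1 - 1)%C with (RtoC (INR k)) by ring.
  rewrite Rcpow_RtoC Rpower_pow // RtoC_mult. reflexivity.
Qed.

(** If [Gamma w = 0] then [Gamma (w + n) = 0] for all [n]; but under the Gamma
    distribution of parameter [n] the variable [x / n] concentrates at [1],
    so that [Gamma (w + n) / (n^w Gamma n)] tends to [1]. *)
Lemma Gamma_neq_0 w : 0 < Re w -> Gamma w <> 0.
Proof.
  intros Hw H0.
  assert (Hn : forall n, Gamma (w + RtoC (INR n))%C = 0).
  { induction n as [|n IH].
    - simpl. replace (w + 0)%C with w by ring. exact H0.
    - rewrite S_INR RtoC_plus Cplus_assoc Gamma_succ.
      + rewrite IH. ring.
      + pose proof (pos_INR n). destruct w; simpl in *; lra. }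
  destruct (INR_unbounded (Re w)) as [m Hm].
  destruct (cont0_Rcpow w 1 Rlt_0_1 (/ 2) ltac:(lra)) as [d Hd].
  assert (E1 : Rcpow 1 w = 1).
  { unfold Rcpow. rewrite ln_1. replace (w * 0)%C with (RtoC 0) by ring. apply Cexp_0. }
  pose proof (cond_pos d) as Hd0.
  assert (Hd2 : 0 < d ^ 2) by (apply pow_lt; exact Hd0).
  (* A Chebyshev inequality: within [d] of 1 continuity gives [/ 2]; farther away [(u - 1)^2 / d^2]
     is at least 1, and [2 + u^m] bounds [|u^w - 1|] because [m] exceeds [Re w]. *)
  assert (Hpt : forall u, 0 < u ->
     Cmod (Rcpow u w - 1)%C <= / 2 + (2 + u ^ m) * (u - 1) ^ 2 / d ^ 2).
  { intros u Hu. assert (Hum : 0 < u ^ m) by now apply pow_lt.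
    assert (Hq : 0 <= (u - 1) ^ 2 / d ^ 2) by (apply Rdiv_le_0_compat; [apply pow2_ge_0|exact Hd2]).
    destruct (Rlt_le_dec (Rabs (u - 1)) d) as [Hlt|Hge].
    - specialize (Hd u Hlt). cbv beta in Hd. rewrite E1 in Hd.
      unfold Rdiv in *. rewrite Rmult_assoc. nra.
    - assert (H1 : 1 <= (u - 1) ^ 2 / d ^ 2).
      { apply Rmult_le_reg_r with (d ^ 2); [exact Hd2|]. unfold Rdiv.
        rewrite Rmult_assoc Rinv_l; [|lra]. rewrite -(pow2_abs (u - 1)).
        rewrite Rmult_1_l Rmult_1_r. apply pow_incr; lra. }
      eapply Rle_trans; [apply Cmod_triangle_sub|]. rewrite Cmod_Rcpow Cmod_1.
      assert (Rpower u (Re w) <= 1 + u ^ m).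
      { destruct (Rle_lt_dec u 1) as [Hu1|Hu1].
        - pose proof (Rpower_le_small u 0 (Re w) ltac:(lra) ltac:(lra)) as K.
          rewrite Rpower_O in K; lra.
        - pose proof (Rle_Rpower u (Re w) (INR m) ltac:(lra) ltac:(lra)) as K.
          rewrite Rpower_pow in K; lra. }
      unfold Rdiv in *. rewrite Rmult_assoc. nra. }
  (* The [j]-th moment of [x / n] under the Gamma distribution of parameter [n = N + 1]; each of
     them tends to 1. *)
  pose (r := fun j N => INR (fact (N + j)) / (INR N + 1) ^ j / INR (fact N)).
  assert (Hfact : forall N, 0 < INR (fact N)) by (intros; apply lt_0_INR, lt_O_fact).
  assert (Hr : forall j, is_lim_seq (r j) 1).
  { induction j as [|j IH].
    - apply is_lim_seq_ext with (fun _ => 1); [|apply is_lim_seq_const].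
      intros N. unfold r. rewrite Nat.add_0_r. simpl. field. specialize (Hfact N). lra.
    - apply is_lim_seq_ext with (fun N => r j N * (1 + INR j / (INR N + 1))).
      + intros N. unfold r. rewrite Nat.add_succ_r fact_simpl mult_INR S_INR plus_INR. simpl.
        field. pose proof (pos_INR N). specialize (Hfact N). repeat split; try lra.
        apply pow_nonzero. lra.
      + replace (Finite 1) with (Rbar_mult 1 1) by (simpl; f_equal; ring).
        apply is_lim_seq_mult'; [exact IH|].
        apply is_lim_seq_ext with (fun N => 1 + INR j * / INR (S N)).
        { intros N. rewrite S_INR. reflexivity. }
        assert (E2 : Finite 1 = Finite (1 + INR j * 0)) by (f_equal; ring).
        rewrite E2. apply (is_lim_seq_plus' _ _ 1 (INR j * 0)); [apply is_lim_seq_const|].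
        apply (is_lim_seq_scal_l _ (INR j) 0).
        apply is_lim_seq_incr_1 with (u := fun N => / INR N).
        apply (is_lim_seq_inv _ p_infty); [apply is_lim_seq_INR|discriminate]. }
  (* The parenthesis is [(2 + u^m) (u - 1)^2] expanded into moments. Its limit is 0, which will
     leave [1 <= / 2]. *)
  assert (Hineq : forall N, 1 <= / 2 + / d ^ 2 *
     (2 * r 2%nat N - 4 * r 1%nat N + 2 * r 0%nat N + r (m + 2)%nat N - 2 * r (m + 1)%nat N + r m N)).
  { intros N. set (n := INR N + 1). assert (Hn0 : 0 < n) by (pose proof (pos_INR N); unfold n; lra).
    pose (A := fun j x => x ^ N * exp (- x) * (x / n) ^ j).
    assert (IA : forall j, Iimp (fun x => RtoC (A j x)) (RtoC (r j N * INR (fact N)))).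
    { intros j. pose proof (Iimp_scal (RtoC (/ n ^ j)) _ _ (Iimp_fact (N + j))) as I.
      replace (r j N * INR (fact N)) with (/ n ^ j * INR (fact (N + j))).
      2:{ unfold r. fold n. field. specialize (Hfact N). split; try apply pow_nonzero; lra. }
      rewrite RtoC_mult. eapply Iimp_ext; [|exact I]. intros x Hx. cbv beta. rewrite -RtoC_mult. f_equal.
      unfold A, Rdiv. rewrite Rpow_mult_distr pow_inv pow_add. ring. }
    pose (g := fun x => x ^ N * exp (- x) * (/ 2 + (2 + (x / n) ^ m) * ((x / n) - 1) ^ 2 / d ^ 2)).
    assert (Ig : Iimp (fun x => RtoC (g x)) (RtoC ((/ 2 + / d ^ 2 *
      (2 * r 2%nat N - 4 * r 1%nat N + 2 * r 0%nat N + r (m + 2)%nat N - 2 * r (m + 1)%nat N + r m N))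
        * INR (fact N)))).
    { pose proof (Iimp_plus _ _ _ _ (Iimp_scal (RtoC (/ 2)) _ _ (IA 0%nat))
        (Iimp_scal (RtoC (/ d ^ 2)) _ _ (Iimp_plus _ _ _ _ (Iimp_plus _ _ _ _ (Iimp_plus _ _ _ _
          (Iimp_scal (RtoC 2) _ _ (IA 2%nat)) (Iimp_scal (RtoC (-4)) _ _ (IA 1%nat)))
          (Iimp_plus _ _ _ _ (Iimp_scal (RtoC 2) _ _ (IA 0%nat)) (IA (m + 2)%nat)))
          (Iimp_plus _ _ _ _ (Iimp_scal (RtoC (-2)) _ _ (IA (m + 1)%nat)) (IA m))))) as I.
      rewrite -!(RtoC_mult, RtoC_plus) in I.
      match type of I with Iimp _ (RtoC ?v) => replace (_ * INR (fact N)) with v end.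
      - eapply Iimp_ext; [|exact I]. intros x Hx. cbv beta.
        rewrite -!(RtoC_mult, RtoC_plus). f_equal.
        unfold A, g. rewrite !pow_add. simpl. field. lra.
      - assert (r 0%nat N = 1).
        { unfold r. rewrite Nat.add_0_r. simpl. field. specialize (Hfact N). lra. }
        rewrite H. field. lra. }
    (* The vanishing of [Gamma (w + n)] enters here: it removes the contribution of [(x / n)^w], so
       the integral is that of the constant -1. *)
    assert (If : Iimp (fun x => RtoC (A 0%nat x) * (Rcpow (x / n) w - 1))%C (- RtoC (INR (fact N)))%C).
    { pose proof (Gamma_Iimp (w + RtoC (INR (S N)))%C) as I1. rewrite Hn in I1.
      specialize (I1 ltac:(pose proof (pos_INR (S N)); destruct w; simpl in *; lra)).
      apply (Iimp_scal (Rcpow n (- w))%C) in I1.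
      pose proof (Iimp_minus _ _ _ _ I1 (IA 0%nat)) as I2.
      replace (- RtoC (INR (fact N)))%C with (Rcpow n (- w) * 0 - RtoC (r 0%nat N * INR (fact N)))%C.
      2:{ replace (r 0%nat N * INR (fact N)) with (INR (fact N)); [ring|].
          unfold r. rewrite Nat.add_0_r. simpl. field. specialize (Hfact N). lra. }
      eapply Iimp_ext; [|exact I2]. intros x Hx. cbv beta. unfold A. simpl pow. rewrite Rmult_1_r.
      rewrite S_INR RtoC_plus. replace (w + (RtoC (INR N) + 1) - 1)%C with (w + RtoC (INR N))%C by ring.
      rewrite Rcpow_plus Rcpow_RtoC Rpower_pow // RtoC_mult.
      replace (Rcpow (x / n) w) with (Rcpow x w * Rcpow n (- w))%C; [ring|].
      unfold Rcpow. rewrite -Cexp_plus ln_div // RtoC_minus. f_equal. ring. }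
    assert (Hle : Cmod (- RtoC (INR (fact N)))%C <= (/ 2 + / d ^ 2 *
      (2 * r 2%nat N - 4 * r 1%nat N + 2 * r 0%nat N + r (m + 2)%nat N - 2 * r (m + 1)%nat N + r m N))
        * INR (fact N)).
    { apply (Iimp_le _ _ _ _ If Ig). intros x Hx. rewrite Cmod_mult Cmod_R.
      unfold A, g. simpl pow. rewrite Rmult_1_r.
      assert (Hp : 0 < x ^ N * exp (- x)) by (apply Rmult_lt_0_compat; [now apply pow_lt|apply exp_pos]).
      rewrite Rabs_pos_eq; [|lra]. apply Rmult_le_compat_l; [lra|].
      apply (Hpt (x / n)). now apply Rdiv_lt_0_compat. }
    rewrite Cmod_opp Cmod_R Rabs_pos_eq in Hle; [|left; apply Hfact].
    apply Rmult_le_reg_r with (INR (fact N)); [apply Hfact|]. lra. }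
  assert (Hlim : is_lim_seq (fun N => / 2 + / d ^ 2 *
     (2 * r 2%nat N - 4 * r 1%nat N + 2 * r 0%nat N + r (m + 2)%nat N - 2 * r (m + 1)%nat N + r m N))
     (/ 2 + / d ^ 2 * (2 * 1 - 4 * 1 + 2 * 1 + 1 - 2 * 1 + 1))).
  { apply is_lim_seq_plus'; [apply is_lim_seq_const|].
    assert (Hc : forall c j, is_lim_seq (fun N => c * r j N) (c * 1)).
    { intros c j. apply (is_lim_seq_mult' (fun _ => c) (r j) c 1); [apply is_lim_seq_const|apply Hr]. }
    apply (is_lim_seq_mult' (fun _ => / d ^ 2) _ (/ d ^ 2)); [apply is_lim_seq_const|].
    exact (is_lim_seq_plus' _ _ _ _ (is_lim_seq_minus' _ _ _ _ (is_lim_seq_plus' _ _ _ _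
      (is_lim_seq_plus' _ _ _ _ (is_lim_seq_minus' _ _ _ _ (Hc 2 2%nat) (Hc 4 1%nat)) (Hc 2 0%nat))
      (Hr (m + 2)%nat)) (Hc 2 (m + 1)%nat)) (Hr m)). }
  pose proof (is_lim_seq_le _ _ _ _ Hineq (is_lim_seq_const 1) Hlim) as H. simpl in H. lra.
Qed.

(** * The Stieltjes transform of a power *)

Definition off_ray (z : C) : Prop := exists d, 0 < d /\ forall x, 0 < x -> d <= Cmod (RtoC x - z)%C.

Lemma off_ray_linear z : off_ray z ->
  exists d, 0 < d /\ forall x, 0 < x -> d * (1 + x) <= Cmod (RtoC x - z)%C.
Proof.
  intros (d & Hd & H). pose proof (Cmod_ge_0 z) as Hz.
  set (k := (1 + Cmod z) / d + 1).
  assert (Hk : 0 < k) by (assert (0 < (1 + Cmod z) / d) by (apply Rdiv_lt_0_compat; lra); unfold k; lra).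
  exists (/ k). split; [now apply Rinv_0_lt_compat|]. intros x Hx. specialize (H x Hx).
  pose proof (Cmod_rev_triangle (RtoC x) z) as Ht. rewrite Cmod_R Rabs_pos_eq in Ht; [|lra].
  apply Rmult_le_reg_l with k; [exact Hk|]. rewrite -Rmult_assoc Rinv_r ?Rmult_1_l; [|lra].
  unfold k. rewrite Rmult_plus_distr_r Rmult_1_l.
  assert (1 + Cmod z <= (1 + Cmod z) / d * Cmod (RtoC x - z)%C).
  { replace (1 + Cmod z) with ((1 + Cmod z) / d * d) at 1 by (field; lra).
    apply Rmult_le_compat_l; [apply Rdiv_le_0_compat; lra|exact H]. }
  lra.
Qed.

Lemma off_ray_neq z x : off_ray z -> 0 < x -> (RtoC x - z)%C <> 0.
Proof. intros (d & Hd & H) Hx. apply Cmod_gt_0. specialize (H x Hx). lra. Qed.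

Lemma off_ray_exp zeta : Rabs (Im zeta) < PI -> off_ray (- Cexp zeta)%C.
Proof.
  intros H. assert (E : forall x, (RtoC x - - Cexp zeta)%C = (RtoC x + Cexp zeta)%C) by (intros; ring).
  destruct (Req_dec (Im (Cexp zeta)) 0) as [H0|H0].
  - assert (Hs : Im zeta = 0).
    { unfold Cexp in H0. simpl in H0. apply Rmult_integral in H0.
      destruct H0 as [H0|H0]; [pose proof (exp_pos (Re zeta)); unfold Re in *; lra|].
      apply Rabs_lt_between in H. apply NNPP. intros Hne.
      destruct (Rdichotomy _ _ Hne) as [Hlt|Hgt].
      - pose proof (sin_gt_0 (- Im zeta) ltac:(lra) ltac:(lra)) as K. rewrite sin_neg in K.
        unfold Im in *; lra.
      - pose proof (sin_gt_0 (Im zeta) ltac:(lra) ltac:(lra)) as K. unfold Im in *; lra. }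
    exists (exp (Re zeta)). split; [apply exp_pos|]. intros x Hx. rewrite E.
    eapply Rle_trans; [|apply re_le_Cmod]. eapply Rle_trans; [|apply Rle_abs].
    unfold Cexp. rewrite Hs cos_0. simpl. lra.
  - exists (Rabs (Im (Cexp zeta))). split; [now apply Rabs_pos_lt|]. intros x Hx. rewrite E.
    eapply Rle_trans; [|apply im_le_Cmod]. right. f_equal. simpl. ring.
Qed.

Section Stieltjes.
Variable s : C.
Hypothesis Hs : -1 < Re s < 0.

Definition stieltjes (z : C) : C := mellin (fun x => / (RtoC x - z))%C s.

Lemma cont0_resolvent z : off_ray z -> cont0 (fun x => / (RtoC x - z))%C.
Proof.
  intros Hz x Hx. apply clim_inv; [typeclasses eauto| |now apply off_ray_neq].
  apply clim_minus; [typeclasses eauto|apply RtoC_cont|apply clim_const; typeclasses eauto].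
Qed.

Lemma Cmod_laplace_kernel_0 x : 0 < x -> Cmod (laplace_kernel 0 x) = / (1 + x).
Proof.
  intros Hx. unfold laplace_kernel. rewrite Rmult_0_l Ropp_0 exp_0 Cmod_R Rabs_pos_eq.
  - unfold Rdiv; ring.
  - apply Rdiv_le_0_compat; lra.
Qed.

Lemma resolvent_bound z d x : 0 < d -> d * (1 + x) <= Cmod (RtoC x - z)%C -> 0 < x ->
  Cmod (/ (RtoC x - z))%C <= / d * / (1 + x).
Proof.
  intros Hd H Hx. assert (0 < d * (1 + x)) by nra.
  rewrite Cmod_inv; [|apply Cmod_gt_0; lra]. rewrite -Rinv_mult. now apply Rinv_le_contravar.
Qed.

Lemma dom_of_inv (f : R -> C) K : 0 <= K ->
  (forall x, 0 < x -> Cmod (f x) <= K * / (1 + x)) -> dom f (K * 1) 1 0.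
Proof.
  intros HK H. apply (dom_le _ _ _ _ _ _ (dom_laplace_kernel 0 (Rle_refl 0)) HK).
  intros x Hx. rewrite Cmod_laplace_kernel_0 //. now apply H.
Qed.

Lemma stieltjes_Iimp z : off_ray z ->
  Iimp (fun x => Rcpow x s * / (RtoC x - z))%C (stieltjes z).
Proof.
  intros Hz. destruct (off_ray_linear z Hz) as (d & Hd & H).
  apply (mellin_Iimp (fun x => / (RtoC x - z))%C (/ d * 1) 1 0); [now apply cont0_resolvent| |lra].
  apply dom_of_inv; [left; now apply Rinv_0_lt_compat|]. intros x Hx. apply resolvent_bound; auto.
Qed.

(** The derivative of [x^(s+1) / (x - z)] is [s x^s / (x - z) - z x^s / (x - z)^2]. Its integral is
    0, so the transform solves [z f' = s f], and no contour has to be moved. *)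
Lemma stieltjes_cdiff z : off_ray z -> z <> 0 -> cdiff stieltjes z (s * stieltjes z / z)%C.
Proof.
  intros Hz Hz0. destruct (off_ray_linear z Hz) as (d & Hd & H).
  assert (Hid : 0 < / d) by now apply Rinv_0_lt_compat.
  assert (I0 : Iimp (fun x => s * (Rcpow x s * / (RtoC x - z))
      - z * (Rcpow x s * (/ (RtoC x - z) * / (RtoC x - z))))%C 0).
  { apply (Iimp_derive_0 (fun x => Rcpow x (s + 1) * / (RtoC x - z))%C _ (/ d) (Re s + 1) (- Re s)); try lra.
    - intros x Hx. pose proof (off_ray_neq z x Hz Hx) as Hne.
      eapply diffg_eq; [|apply (diffg_mult _ RtoC_cont); [now apply rdiff_Rcpow|
        apply (diffg_inv _ RtoC_cont); [apply (diffg_minus _ RtoC_cont); [apply diffg_iota|apply diffg_const]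
          |exact Hne]]].
      cbv beta. replace (s + 1 - 1)%C with s by ring. rewrite Rcpow_plus Rcpow_1 //. field. exact Hne.
    - pose proof (cont0_resolvent z Hz).
      repeat first [assumption|apply cont0_minus|apply cont0_mult|apply cont0_const|apply cont0_Rcpow].
    - intros x Hx. rewrite Cmod_mult Cmod_Rcpow.
      replace (Re (s + 1)%C) with (Re s + 1) by (destruct s; simpl; ring).
      pose proof (resolvent_bound z d x Hd (H x Hx) Hx) as B.
      rewrite Ropp_involutive Rpower_plus Rpower_1 //.
      pose proof (Rpower_pos x (Re s)) as Hp.
      assert (Hx1 : x * / (1 + x) <= 1).
      { apply Rmult_le_reg_r with (1 + x); [lra|]. rewrite Rmult_assoc Rinv_l; lra. }
      assert (Hx2 : / (1 + x) <= 1).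
      { rewrite -Rinv_1. apply Rinv_le_contravar; lra. }
      assert (Hx3 : 0 < / (1 + x)) by (apply Rinv_0_lt_compat; lra).
      split.
      + rewrite (Rmult_comm (/ d)). apply Rmult_le_compat_l; [nra|]. nra.
      + rewrite (Rmult_comm (/ d)) Rmult_assoc. apply Rmult_le_compat_l; [lra|].
        apply Rle_trans with (x * (/ d * / (1 + x))); [apply Rmult_le_compat_l; lra|]. nra. }
  assert (Iq : Iimp (fun x => Rcpow x s * (/ (RtoC x - z) * / (RtoC x - z)))%C (s * stieltjes z / z)%C).
  { pose proof (Iimp_scal (/ z)%C _ _ (Iimp_minus _ _ _ _ (Iimp_scal s _ _ (stieltjes_Iimp z Hz)) I0)) as I.
    replace (s * stieltjes z / z)%C with (/ z * (s * stieltjes z - 0))%C by (field; exact Hz0).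
    eapply Iimp_ext; [|exact I]. intros x Hx. cbv beta. field. split; [now apply off_ray_neq|exact Hz0]. }
  apply (diffg_quad (X := C_UniformSpace) (fun w => w) cid_cont)
    with (2 * / d ^ 3 * 1 * (/ (1 + Re s) + / (0 - Re s))).
  assert (Hd2 : 0 < d / 2) by lra.
  generalize (locally_C z _ Hd2). apply filter_imp. intros w Hw.
  assert (Hwd : forall x, 0 < x -> d / 2 * (1 + x) <= Cmod (RtoC x - w)%C).
  { intros x Hx. specialize (H x Hx). pose proof (Cmod_sub_triangle (RtoC x) w z). nra. }
  assert (Hwr : off_ray w).
  { exists (d / 2). split; [exact Hd2|]. intros x Hx. specialize (Hwd x Hx). nra. }
  pose proof (Iimp_minus _ _ _ _ (Iimp_minus _ _ _ _ (stieltjes_Iimp w Hwr) (stieltjes_Iimp z Hz))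
    (Iimp_scal (w - z)%C _ _ Iq)) as I.
  replace (s * stieltjes z / z * (w - z))%C with ((w - z) * (s * stieltjes z / z))%C by ring.
  replace (2 * / d ^ 3 * 1 * (/ (1 + Re s) + / (0 - Re s)) * Cmod (w - z)%C ^ 2)
    with ((2 * / d ^ 3 * Cmod (w - z)%C ^ 2) * 1 * (/ (1 + Re s) + / (0 - Re s))) by ring.
  apply (Iimp_dom_bound _ _ _ _ _ I); [|lra|lra|].
  { pose proof (cont0_resolvent z Hz). pose proof (cont0_resolvent w Hwr).
    repeat first [assumption|apply cont0_minus|apply cont0_mult|apply cont0_const|apply cont0_Rcpow]. }
  assert (Hd3 : 0 < / d ^ 3) by (apply Rinv_0_lt_compat, pow_lt; lra).
  assert (Hdom : dom (fun x => / (RtoC x - w) - / (RtoC x - z)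
     - (w - z) * (/ (RtoC x - z) * / (RtoC x - z)))%C (2 * / d ^ 3 * Cmod (w - z)%C ^ 2 * 1) 1 0).
  { apply dom_of_inv; [pose proof (Cmod_ge_0 (w - z)%C); nra|]. intros x Hx.
    pose proof (off_ray_neq z x Hz Hx). pose proof (off_ray_neq w x Hwr Hx).
    replace (_ - _ - _)%C with ((w - z) * (w - z) * (/ (RtoC x - w) * (/ (RtoC x - z) * / (RtoC x - z))))%C
      by (field; auto).
    rewrite !Cmod_mult.
    pose proof (resolvent_bound z d x Hd (H x Hx) Hx) as B1.
    pose proof (resolvent_bound w (d / 2) x Hd2 (Hwd x Hx) Hx) as B2.
    set (k := Cmod (w - z)%C). set (y := / (1 + x)) in *.
    assert (Hy : 0 < y <= 1).
    { split; [apply Rinv_0_lt_compat; lra|]. unfold y. rewrite -Rinv_1. apply Rinv_le_contravar; lra. }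
    assert (Hk : 0 <= k) by apply Cmod_ge_0.
    replace (2 * / d ^ 3 * k ^ 2 * y) with (k * k * (/ (d / 2) * y * (/ d * 1 * (/ d * 1)))) by (field; lra).
    apply Rmult_le_compat_l; [nra|].
    assert (B3 : Cmod (/ (RtoC x - z))%C <= / d * 1) by nra.
    apply Rmult_le_compat; try apply Cmod_ge_0; auto.
    - apply Rmult_le_pos; apply Cmod_ge_0.
    - apply Rmult_le_compat; auto; apply Cmod_ge_0. }
  apply (dom_Rcpow _ _ _ _ s) in Hdom. intros x Hx. specialize (Hdom x Hx).
  replace (_ - _ - _)%C with (Rcpow x s * (/ (RtoC x - w) - / (RtoC x - z)
     - (w - z) * (/ (RtoC x - z) * / (RtoC x - z))))%C by ring. exact Hdom.
Qed.

(** Along [t -> - e^(t l)], which starts at -1 and avoids the positive axis, the differential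
    equation makes the product with [e^(- t s l)] constant; the value at -1 is [stieltjes_Gamma].
    Giving the point through its logarithm [l] fixes the branch of the power. *)
Lemma stieltjes_exp (l : C) : Rabs (Im l) < PI ->
  stieltjes (- Cexp l)%C = (Cexp (s * l) * (Gamma (s + 1) * Gamma (- s)))%C.
Proof.
  intros Hl.
  assert (Hoff : forall t, 0 <= t <= 1 -> off_ray (- Cexp (RtoC t * l))%C).
  { intros t Ht. apply off_ray_exp.
    replace (Im (RtoC t * l)%C) with (t * Im l) by (destruct l; simpl; ring).
    rewrite Rabs_mult Rabs_pos_eq; [|lra]. pose proof (Rabs_pos (Im l)). nra. }
  pose (g := fun t : R => (stieltjes (- Cexp (RtoC t * l)) * Cexp (RtoC t * (- (s * l))))%C).
  assert (Hg : g 1 = g 0).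
  { apply curve_const; [lra|]. intros t Ht.
    assert (Hne : (- Cexp (RtoC t * l))%C <> 0).
    { intros E. apply (Cexp_neq_0 (RtoC t * l)%C).
      transitivity (- - Cexp (RtoC t * l))%C; [ring|]. rewrite E. ring. }
    eapply diffg_eq; [|apply (diffg_mult _ RtoC_cont);
      [apply (diffg_comp _ RtoC_cont stieltjes (fun t => - Cexp (RtoC t * l))%C);
         [apply stieltjes_cdiff; auto|]|apply rdiff_Cexp_line]].
    2:{ apply (diffg_ext (X := R_UniformSpace) _ (fun t => - (1) * Cexp (RtoC t * l))%C);
        [intros; ring|]. apply (diffg_scal _ RtoC_cont), rdiff_Cexp_line. }
    cbv beta. field. intros E; apply Hne. rewrite E. ring. }
  unfold g in Hg. replace (RtoC 0 * l)%C with (RtoC 0) in Hg by ring.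
  replace (RtoC 0 * (- (s * l)))%C with (RtoC 0) in Hg by ring.
  replace (RtoC 1 * l)%C with l in Hg by ring.
  replace (RtoC 1 * (- (s * l)))%C with (- (s * l))%C in Hg by ring.
  rewrite !Cexp_0 Cexp_opp in Hg.
  assert (E1 : stieltjes (- (1))%C = (Gamma (s + 1) * Gamma (- s))%C).
  { apply CInt_0_infty_unique. eapply Iimp_ext; [|apply (stieltjes_Gamma s Hs)].
    intros x Hx. cbv beta. rewrite RtoC_inv; [|lra]. f_equal. f_equal. rewrite RtoC_plus. ring. }
  rewrite E1 in Hg. pose proof (Cexp_neq_0 (s * l)%C).
  transitivity (stieltjes (- Cexp l) * / Cexp (s * l) * Cexp (s * l))%C; [field; auto|].
  rewrite Hg. ring.
Qed.

End Stieltjes.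

(** * The zeros of [e^z - 1 - z] *)

Lemma PI_bounds : 3 < PI <= 4.
Proof. pose proof PI2_3_2. pose proof PI_4. lra. Qed.

Lemma derive_le (f f' : R -> R) a b : a <= b ->
  (forall t, a <= t <= b -> is_derive f t (f' t)) ->
  (forall t, a <= t <= b -> 0 <= f' t) -> f a <= f b.
Proof.
  intros Hab Hd Hp.
  destruct (MVT_gen f a b f') as [c [Hc1 Hc2]].
  - rewrite Rmin_left ?Rmax_right; try lra. intros x Hx. apply Hd; lra.
  - rewrite Rmin_left ?Rmax_right; try lra. intros x Hx. apply continuity_pt_filterlim, (ex_derive_continuous (V := R_NormedModule)).
    exists (f' x). now apply Hd.
  - rewrite Rmin_left ?Rmax_right in Hc1; try lra. pose proof (Hp c Hc1). nra.
Qed.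

Lemma derive_lt (f f' : R -> R) a b : a < b ->
  (forall t, a <= t <= b -> is_derive f t (f' t)) ->
  (forall t, a <= t <= b -> f' t < 0) -> f b < f a.
Proof.
  intros Hab Hd Hp.
  destruct (MVT_gen f a b f') as [c [Hc1 Hc2]].
  - rewrite Rmin_left ?Rmax_right; try lra. intros x Hx. apply Hd; lra.
  - rewrite Rmin_left ?Rmax_right; try lra. intros x Hx. apply continuity_pt_filterlim, (ex_derive_continuous (V := R_NormedModule)).
    exists (f' x). now apply Hd.
  - rewrite Rmin_left ?Rmax_right in Hc1; try lra. pose proof (Hp c Hc1). nra.
Qed.

Lemma exp_ge_taylor2 u : 0 <= u -> 1 + u + u ^ 2 / 2 <= exp u.
Proof.
  intros Hu. pose (f := fun t => exp t - 1 - t - t ^ 2 / 2).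
  assert (H : f 0 <= f u).
  { apply (derive_le f (fun t => exp t - 1 - t)); [exact Hu| |].
    - intros t _. unfold f. auto_derive; auto. field.
    - intros t Ht. pose proof (exp_ineq1_le t). lra. }
  unfold f in H. rewrite exp_0 in H. lra.
Qed.

(** On a zero [x + i y] of [e^z - 1 - z] one has [y^2 = |e^z|^2 - (1 + x)^2]. *)
Definition zero_ordinate2 (x : R) : R := exp (2 * x) - (1 + x) ^ 2.

Lemma zero_ordinate2_incr x1 x2 : 0 <= x1 <= x2 -> zero_ordinate2 x1 <= zero_ordinate2 x2.
Proof.
  intros Hx. apply (derive_le _ (fun t => 2 * exp (2 * t) - 2 * (1 + t))); [lra| |].
  - intros t _. unfold zero_ordinate2. auto_derive; auto. ring.
  - intros t Ht. pose proof (exp_ineq1_le (2 * t)). lra.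
Qed.

(** The quotient [zero_ordinate2 t / t^2] is increasing. At a zero [x + i y] it is [(y / x)^2], so
    zeros farther to the right have a larger argument. *)
Lemma zero_ordinate2_ratio x1 x2 : 0 < x1 <= x2 ->
  zero_ordinate2 x1 * x2 ^ 2 <= zero_ordinate2 x2 * x1 ^ 2.
Proof.
  intros Hx.
  assert (Hg : forall t, 0 <= t -> 0 <= (t - 1) * exp (2 * t) + 1 + t).
  { intros t Ht. pose (g := fun t => (t - 1) * exp (2 * t) + 1 + t).
    assert (H : g 0 <= g t).
    { apply (derive_le g (fun t => (2 * t - 1) * exp (2 * t) + 1)); [exact Ht| |].
      - intros u _. unfold g. auto_derive; auto. ring.
      - intros u Hu. pose proof (exp_ineq1_le (- (2 * u))) as H.
        pose proof (exp_pos (2 * u)) as Hp.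
        apply Rmult_le_compat_r with (r := exp (2 * u)) in H; [|lra].
        rewrite -exp_plus in H. replace (- (2 * u) + 2 * u) with 0 in H by ring.
        rewrite exp_0 in H. lra. }
    unfold g in H. rewrite Rmult_0_r exp_0 in H. lra. }
  assert (H : zero_ordinate2 x1 / x1 ^ 2 <= zero_ordinate2 x2 / x2 ^ 2).
  { apply (derive_le (fun t => zero_ordinate2 t / t ^ 2)
      (fun t => 2 * ((t - 1) * exp (2 * t) + 1 + t) / t ^ 3)); [lra| |].
    - intros t Ht. unfold zero_ordinate2. auto_derive.
      + nra.
      + field. lra.
    - intros t Ht. apply Rdiv_le_0_compat; [|apply pow_lt; lra]. pose proof (Hg t). lra. }
  apply Rmult_le_compat_r with (r := x1 ^ 2 * x2 ^ 2) in H; [|nra].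
  replace (zero_ordinate2 x1 / x1 ^ 2 * (x1 ^ 2 * x2 ^ 2)) with (zero_ordinate2 x1 * x2 ^ 2) in H by (field; lra).
  replace (zero_ordinate2 x2 / x2 ^ 2 * (x1 ^ 2 * x2 ^ 2)) with (zero_ordinate2 x2 * x1 ^ 2) in H by (field; lra).
  exact H.
Qed.

Lemma zero_ordinate2_ge x : 0 <= x -> x ^ 2 * (1 + x) + x ^ 4 / 4 <= zero_ordinate2 x.
Proof.
  intros Hx. unfold zero_ordinate2. pose proof (exp_ge_taylor2 x Hx) as H.
  replace (2 * x) with (x + x) by ring. rewrite exp_plus. nra.
Qed.

Lemma upper_zero_eqs z : upper_zero z ->
  0 < Im z /\ exp (Re z) * cos (Im z) = 1 + Re z /\ exp (Re z) * sin (Im z) = Im z.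
Proof.
  intros [Hy H]. split; [exact Hy|]. destruct z as [x y]. unfold Cexp in H. simpl in *.
  injection H. intros H1 H2. lra.
Qed.

(** At a zero [e^x = y / sin y], which exceeds 1 because [sin y < y]. *)
Lemma upper_zero_re z : upper_zero z -> 0 < Re z.
Proof.
  intros Hz. destruct (upper_zero_eqs z Hz) as (Hy & _ & Hs).
  apply Rnot_le_lt. intros Hx. pose proof (sin_lt_x (Im z) Hy).
  assert (exp (Re z) <= 1) by (rewrite -exp_0; now apply exp_le).
  pose proof (exp_pos (Re z)).
  assert (0 < sin (Im z)) by (apply Rmult_lt_reg_l with (exp (Re z)); lra). nra.
Qed.

Lemma upper_zero_im2 z : upper_zero z -> Im z ^ 2 = zero_ordinate2 (Re z).
Proof.
  intros Hz. destruct (upper_zero_eqs z Hz) as (Hy & Hc & Hs).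
  unfold zero_ordinate2. rewrite -Hc -{1}Hs. replace (2 * Re z) with (Re z + Re z) by ring.
  rewrite exp_plus. pose proof (sin2_cos2 (Im z)) as H. unfold Rsqr in H.
  transitivity (exp (Re z) * exp (Re z) * (sin (Im z) * sin (Im z) + cos (Im z) * cos (Im z))
     - (exp (Re z) * cos (Im z)) ^ 2); [ring|]. rewrite H. ring.
Qed.

(** Indeed [y^2 >= x^2 (1 + x)]. The zeros thus stay in a sector away from the positive axis, which
    later makes their distance to a point [t > 0] at least [t / 2]. *)
Lemma upper_zero_re_le_im z : upper_zero z -> Re z <= Im z.
Proof.
  intros Hz. pose proof (upper_zero_re z Hz). destruct (upper_zero_eqs z Hz) as (Hy & _).
  pose proof (zero_ordinate2_ge (Re z) ltac:(lra)). rewrite -upper_zero_im2 // in H0.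
  apply Rnot_lt_le. intros Hlt. assert (0 <= Re z ^ 4) by (apply pow_le; lra).
  assert (0 <= Re z ^ 3) by (apply pow_le; lra). nra.
Qed.

(** The ordinate of a zero increases with its real part, hence so does the modulus; a smaller
    modulus therefore means a smaller real part, and [zero_ordinate2_ratio] compares the
    cotangents. *)
Lemma upper_zero_angle z w : upper_zero z -> upper_zero w -> Cmod z <= Cmod w ->
  Re w / Im w <= Re z / Im z.
Proof.
  intros Hz Hw Hzw.
  pose proof (upper_zero_re z Hz) as Xz. pose proof (upper_zero_re w Hw) as Xw.
  destruct (upper_zero_eqs z Hz) as (Yz & _). destruct (upper_zero_eqs w Hw) as (Yw & _).
  assert (Hle : Re z <= Re w).
  { apply Rnot_lt_le. intros Hlt.
    pose proof (zero_ordinate2_incr (Re w) (Re z) ltac:(lra)) as H.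
    rewrite -!upper_zero_im2 // in H.
    assert (Cmod z ^ 2 <= Cmod w ^ 2) by (apply pow_incr; split; [apply Cmod_ge_0|exact Hzw]).
    rewrite !Cmod2_alt in H0. nra. }
  pose proof (zero_ordinate2_ratio (Re z) (Re w) ltac:(lra)) as H.
  rewrite -!upper_zero_im2 // in H.
  assert (H2 : Im z * Re w <= Im w * Re z).
  { apply Rnot_lt_le. intros Hlt.
    assert (0 < Im w * Re z) by nra. nra. }
  apply Rmult_le_reg_r with (Im w * Im z); [nra|].
  replace (Re w / Im w * (Im w * Im z)) with (Im z * Re w) by (field; lra).
  replace (Re z / Im z * (Im w * Im z)) with (Im w * Re z) by (field; lra). exact H2.
Qed.

(** The imaginary part of the equation gives [e^x = y / sin y]. Substituting this and its logarithm
    into the real part [e^x cos y - 1 - x] leaves one real equation for the ordinate. *)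
Definition zero_gap (y : R) : R := y * cos y / sin y - 1 - ln (y / sin y).

Lemma zero_gap_of_zero z : upper_zero z -> 0 < sin (Im z) /\ 0 < cos (Im z) /\ zero_gap (Im z) = 0.
Proof.
  intros Hz. pose proof (upper_zero_re z Hz) as Hx.
  destruct (upper_zero_eqs z Hz) as (Hy & Hc & Hs). pose proof (exp_pos (Re z)).
  assert (H1 : 0 < sin (Im z)) by (apply Rmult_lt_reg_l with (exp (Re z)); lra).
  assert (H2 : 0 < cos (Im z)) by (apply Rmult_lt_reg_l with (exp (Re z)); lra).
  split; [exact H1|]. split; [exact H2|]. unfold zero_gap.
  assert (E : Im z / sin (Im z) = exp (Re z)).
  { apply (Rmult_eq_reg_r (sin (Im z))); [|lra]. unfold Rdiv. rewrite Rmult_assoc Rinv_l; lra. }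
  replace (Im z * cos (Im z) / sin (Im z)) with (Im z / sin (Im z) * cos (Im z)) by (field; lra).
  rewrite E ln_exp. lra.
Qed.

Lemma zero_of_zero_gap y : 0 < y -> 0 < sin y -> zero_gap y = 0 ->
  upper_zero (ln (y / sin y), y).
Proof.
  intros Hy Hs H. unfold zero_gap in H. split; [exact Hy|].
  assert (Hq : 0 < y / sin y) by now apply Rdiv_lt_0_compat.
  unfold Cexp. apply C_eq; simpl; rewrite exp_ln //.
  - replace (y / sin y * cos y) with (y * cos y / sin y) by (field; lra). lra.
  - field. lra.
Qed.

(** With the numerator written as a sum of even powers the derivative is visibly negative, whence at
    most one zero in each interval where the sine is positive. *)
Lemma zero_gap_derive y : 0 < y -> 0 < sin y ->
  is_derive zero_gap y (- ((y - sin y * cos y) ^ 2 + sin y ^ 4) / (y * sin y ^ 2)).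
Proof.
  intros Hy Hs. unfold zero_gap.
  assert (0 < y / sin y) by now apply Rdiv_lt_0_compat.
  auto_derive; [repeat split; auto; lra|].
  assert (E : sin y ^ 4 = sin y ^ 2 * (1 - cos y ^ 2)).
  { pose proof (sin2_cos2 y) as E. unfold Rsqr in E. replace (1 - cos y ^ 2) with (sin y ^ 2) by (simpl; lra). ring. }
  rewrite E. field_simplify; [|lra|lra]. 
  assert (E2 : sin y ^ 2 = 1 - cos y ^ 2) by (pose proof (sin2_cos2 y) as E2; unfold Rsqr in E2; simpl; lra).
  replace (sin y ^ 3) with (sin y * (1 - cos y ^ 2)) by (rewrite -E2; ring).
  rewrite ?E2. field. split; [|lra].
  rewrite -E2. assert (0 < sin y ^ 2) by (apply pow_lt; lra). lra.
Qed.

Lemma sin_pos_interval y k : 2 * PI * INR k < y < 2 * PI * INR k + PI -> 0 < sin y.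
Proof.
  intros H. replace y with ((y - 2 * PI * INR k) + 2 * INR k * PI) by ring.
  rewrite sin_period. apply sin_gt_0; lra.
Qed.

Lemma upper_zero_interval z : upper_zero z ->
  exists k, 2 * PI * INR (S k) < Im z < 2 * PI * INR (S k) + PI / 2.
Proof.
  intros Hz. destruct (zero_gap_of_zero z Hz) as (Hs & Hc & _).
  pose proof (upper_zero_re z Hz) as Hx.
  destruct (upper_zero_eqs z Hz) as (Hy & Hc' & Hs'). pose proof PI_bounds as HPI.
  destruct (nfloor_ex (Im z / (2 * PI))) as [k [Hk1 Hk2]].
  { apply Rdiv_le_0_compat; lra. }
  assert (K1 : 2 * PI * INR k <= Im z).
  { apply Rmult_le_compat_l with (r := 2 * PI) in Hk1; [|lra].
    replace (2 * PI * (Im z / (2 * PI))) with (Im z) in Hk1 by (field; lra). exact Hk1. }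
  assert (K2 : Im z < 2 * PI * INR k + 2 * PI).
  { apply Rmult_lt_compat_l with (r := 2 * PI) in Hk2; [|lra].
    replace (2 * PI * (Im z / (2 * PI))) with (Im z) in Hk2 by (field; lra). lra. }
  set (del := Im z - 2 * PI * INR k).
  assert (E : Im z = del + 2 * INR k * PI) by (unfold del; ring).
  assert (Hsd : 0 < sin del) by (rewrite E sin_period in Hs; exact Hs).
  assert (Hcd : 0 < cos del) by (rewrite E cos_period in Hc; exact Hc).
  assert (Hd0 : 0 < del).
  { assert (0 <= del) by (unfold del; lra). destruct H as [H|H]; [exact H|].
    rewrite -H sin_0 in Hsd. lra. }
  assert (Hd1 : del < PI).
  { apply Rnot_le_lt. intros H. pose proof (sin_le_0 del H ltac:(unfold del; lra)). lra. }
  assert (Hd2 : del < PI / 2).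
  { apply Rnot_le_lt. intros H. pose proof (cos_le_0 del H ltac:(lra)). lra. }
  destruct k as [|k]; [|exists k; unfold del in *; lra].
  (* The first period holds no zero: there [y cos y <= sin y], and multiplication by [e^x] turns
     this into [y (1 + x) <= y], against [0 < x]. This is why the indices start at [S k]. *)
  exfalso. simpl in E. assert (E0 : Im z = del) by lra.
  assert (Htan : del * cos del <= sin del).
  { pose (f := fun t => sin t - t * cos t). assert (H : f 0 <= f del).
    { apply (derive_le f (fun t => t * sin t)); [lra| |].
      - intros t _. unfold f. auto_derive; auto. ring.
      - intros t Ht. apply Rmult_le_pos; [lra|]. apply sin_ge_0; lra. }
    unfold f in H. rewrite sin_0 in H. lra. }
  rewrite E0 in Hc', Hs'. pose proof (exp_pos (Re z)) as He.
  assert (exp (Re z) * (del * cos del) <= exp (Re z) * sin del) by (apply Rmult_le_compat_l; lra).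
  assert (exp (Re z) * (del * cos del) = del * (1 + Re z)) by (rewrite -Hc'; ring).
  nra.
Qed.

Lemma upper_zero_unique z w k : upper_zero z -> upper_zero w ->
  2 * PI * INR k < Im z < 2 * PI * INR k + PI / 2 ->
  2 * PI * INR k < Im w < 2 * PI * INR k + PI / 2 -> z = w.
Proof.
  assert (Hlt : forall a b, 2 * PI * INR k < a -> a < b -> b < 2 * PI * INR k + PI / 2 ->
     zero_gap b < zero_gap a).
  { intros a b Ha Hab Hb. pose proof PI_bounds.
    assert (Hk : 0 <= 2 * PI * INR k) by (pose proof (pos_INR k); nra).
    assert (Hs : forall t, a <= t <= b -> 0 < sin t) by (intros t Ht; apply sin_pos_interval with k; lra).
    apply (derive_lt zero_gap (fun y => - ((y - sin y * cos y) ^ 2 + sin y ^ 4) / (y * sin y ^ 2))); [lra| |].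
    - intros t Ht. apply zero_gap_derive; [lra|auto].
    - intros t Ht. specialize (Hs t Ht).
      assert (0 < sin t ^ 4) by now apply pow_lt. assert (0 < sin t ^ 2) by now apply pow_lt.
      pose proof (pow2_ge_0 (t - sin t * cos t)).
      assert (0 < ((t - sin t * cos t) ^ 2 + sin t ^ 4) / (t * sin t ^ 2)) by (apply Rdiv_lt_0_compat; nra).
      unfold Rdiv in *. lra. }
  intros Hz Hw Iz Iw.
  destruct (zero_gap_of_zero z Hz) as (Sz & _ & Gz). destruct (zero_gap_of_zero w Hw) as (_ & _ & Gw).
  assert (E : Im z = Im w).
  { apply NNPP. intros Hne. destruct (Rdichotomy _ _ Hne) as [H|H].
    - pose proof (Hlt _ _ (proj1 Iz) H (proj2 Iw)). lra.
    - pose proof (Hlt _ _ (proj1 Iw) H (proj2 Iz)). lra. }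
  apply C_eq; [|exact E].
  destruct (upper_zero_eqs z Hz) as (_ & _ & H1). destruct (upper_zero_eqs w Hw) as (_ & _ & H2).
  apply exp_inv. apply Rmult_eq_reg_r with (sin (Im z)); [|lra]. rewrite H1 E. now rewrite H2.
Qed.

(** [zero_gap] changes sign between [c + PI / 4], where it is [y - 1 - ln (y sqrt 2) > 0], and
    [c + PI / 2], where it is [- 1 - ln y < 0]. The right end is not a zero since a zero has a
    positive cosine. *)
Lemma upper_zero_exists k : exists z, upper_zero z /\
  2 * PI * INR (S k) < Im z < 2 * PI * INR (S k) + PI / 2.
Proof.
  pose proof PI_bounds as HPI. set (c := 2 * PI * INR (S k)).
  assert (Hc : 6 < c).
  { unfold c. rewrite S_INR. pose proof (pos_INR k). nra. }
  assert (Hsin : forall y, c < y < c + PI -> 0 < sin y) by (intros; now apply sin_pos_interval with (S k)).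
  assert (Hper : forall d, sin (c + d) = sin d /\ cos (c + d) = cos d).
  { intros d. unfold c. replace (2 * PI * INR (S k) + d) with (d + 2 * INR (S k) * PI) by ring.
    now rewrite sin_period cos_period. }
  destruct (IVT_interv (fun y => - zero_gap y) (c + PI / 4) (c + PI / 2)) as [y [Hy H0]].
  - intros a Ha. apply (continuity_pt_opp zero_gap a).
    apply continuity_pt_filterlim, (ex_derive_continuous (V := R_NormedModule)).
    eexists. apply zero_gap_derive; [lra|apply Hsin; lra].
  - lra.
  - unfold zero_gap. destruct (Hper (PI / 4)) as [-> ->]. rewrite sin_PI4 cos_PI4.
    set (y := c + PI / 4). assert (Hs2 : 1 < sqrt 2).
    { rewrite -sqrt_1. apply sqrt_lt_1; lra. }
    assert (Hy : 6 < y) by (unfold y; lra).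
    replace (y * (1 / sqrt 2) / (1 / sqrt 2)) with y by (field; lra).
    replace (y / (1 / sqrt 2)) with (y * sqrt 2) by (field; lra).
    (* The tangent to the logarithm at 3, with [ln 3 <= 2]; at [y > 6] this is precise enough. *)
    assert (Hln : ln (y * sqrt 2) <= y * sqrt 2 / 3 - 1 + 2).
    { assert (Hp : 0 < y * sqrt 2 / 3) by nra.
      pose proof (exp_ineq1_le (ln (y * sqrt 2 / 3))) as H. rewrite exp_ln // in H.
      assert (H3 : ln (y * sqrt 2) = ln (y * sqrt 2 / 3) + ln 3).
      { rewrite -ln_mult; [f_equal; field|exact Hp|lra]. }
      assert (ln 3 <= 2).
      { rewrite -(ln_exp 2). apply ln_le; [lra|]. pose proof (exp_ineq1_le 2). lra. }
      lra. }
    assert (sqrt 2 < 3 / 2).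
    { rewrite -(sqrt_pow2 (3 / 2)); [|lra]. apply sqrt_lt_1; lra. }
    nra.
  - unfold zero_gap. destruct (Hper (PI / 2)) as [-> ->]. rewrite sin_PI2 cos_PI2.
    rewrite Rmult_0_r /Rdiv Rinv_1 !Rmult_1_r.
    assert (0 < ln (c + PI * / 2)); [|lra]. rewrite -ln_1. apply ln_increasing; lra.
  - assert (Hs : 0 < sin y) by (apply Hsin; lra).
    assert (Hzero : upper_zero (ln (y / sin y), y)) by (apply zero_of_zero_gap; lra).
    exists (ln (y / sin y), y). split; [exact Hzero|]. simpl Im. split; [lra|].
    destruct (proj2 Hy) as [Hlt|Heq]; [exact Hlt|]. exfalso.
    destruct (zero_gap_of_zero _ Hzero) as (_ & Hcos & _). simpl Im in Hcos.
    rewrite Heq (proj2 (Hper (PI / 2))) cos_PI2 in Hcos. lra.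
Qed.

Lemma zero_sequence : exists zk : nat -> C,
  (forall k, upper_zero (zk k)) /\
  (forall k, 2 * PI * INR (S k) < Im (zk k) < 2 * PI * INR (S k) + PI / 2) /\
  (forall w, upper_zero w -> exists k, w = zk k).
Proof.
  destruct (choice _ upper_zero_exists) as [zk Hzk]. exists zk. split; [apply Hzk|].
  split; [apply Hzk|]. intros w Hw. destruct (upper_zero_interval w Hw) as [k Hk].
  exists k. apply (upper_zero_unique w (zk k) (S k)); auto; apply Hzk.
Qed.

(** The first zero has ordinate below [5 PI / 2 <= 10] and real part below 4, since
    [zero_ordinate2 4] is at least 144; and [16 + (5 PI / 2)^2 < (3 PI)^2]. *)
Lemma smallest_zero_modulus z : smallest_upper_zero z -> Cmod z < 3 * PI.
Proof.
  intros [_ Hmin]. destruct (upper_zero_exists 0) as [w [Hw Hi]].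
  apply Rle_lt_trans with (Cmod w); [now apply Hmin|]. simpl INR in Hi.
  pose proof PI_bounds. pose proof (upper_zero_re w Hw) as Hx.
  assert (Hx4 : Re w < 4).
  { apply Rnot_le_lt. intros H4. pose proof (zero_ordinate2_incr 4 (Re w) ltac:(lra)) as H1.
    rewrite -upper_zero_im2 // in H1. pose proof (zero_ordinate2_ge 4 ltac:(lra)). nra. }
  apply Rnot_le_lt. intros Hge.
  assert ((3 * PI) ^ 2 <= Cmod w ^ 2) by (apply pow_incr; lra).
  rewrite Cmod2_alt in H0. nra.
Qed.

(** * Partial fractions of [1 / (e^z - 1 - z)] *)

Definition expm1x (z : C) : C := (Cexp z - 1 - z)%C.

Lemma cdiff_expm1x z : cdiff expm1x z (Cexp z - 1)%C.
Proof.
  unfold expm1x. eapply diffg_eq; [|apply (diffg_minus _ cid_cont); [apply (diffg_minus _ cid_cont);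
    [apply cdiff_Cexp|apply diffg_const]|apply diffg_iota]]. ring.
Qed.

Lemma expm1x_disc p R : holo_disc expm1x p R.
Proof. intros z _. eexists. apply cdiff_expm1x. Qed.

Lemma expm1x_0 : expm1x 0 = 0.
Proof. unfold expm1x. rewrite Cexp_0. ring. Qed.

Lemma Cexp_conj z : Cexp (Cconj z) = Cconj (Cexp z).
Proof. destruct z as [x y]. unfold Cexp, Cconj. apply C_eq; simpl; rewrite ?cos_neg ?sin_neg; ring. Qed.

Lemma expm1x_conj z : expm1x (Cconj z) = Cconj (expm1x z).
Proof. unfold expm1x. rewrite Cexp_conj. apply C_eq; simpl; ring. Qed.

Lemma expm1x_zero_cases z : expm1x z = 0 -> z = 0 \/ upper_zero z \/ upper_zero (Cconj z).
Proof.
  intros H. destruct (Rtotal_order (Im z) 0) as [Hlt|[Heq|Hgt]].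
  - right; right. split; [destruct z; simpl in *; lra|].
    change (expm1x (Cconj z) = 0). rewrite expm1x_conj H. apply C_eq; simpl; ring.
  - left. destruct z as [x y]. simpl in Heq. subst y.
    change ((x, 0) : C) with (RtoC x) in *. unfold expm1x in H. rewrite Cexp_RtoC in H.
    destruct (Req_dec x 0) as [->|Hx]; [reflexivity|].
    pose proof (exp_ineq1 x Hx). injection H. lra.
  - right; left. split; [exact Hgt|exact H].
Qed.

(** At most a removable singularity. The equality is asked off [p] only, since at a zero of the
    denominator [h p] is a default value of division. *)
Definition regular (h : C -> C) (p : C) : Prop :=
  exists g r, 0 < r /\ holo_disc g p r /\ forall w, 0 < Cmod (w - p)%C < r -> h w = g w.

Lemma regular_plus h1 h2 p : regular h1 p -> regular h2 p -> regular (fun z => h1 z + h2 z)%C p.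
Proof.
  intros (g1 & r1 & Hr1 & H1 & E1) (g2 & r2 & Hr2 & H2 & E2).
  pose proof (Rmin_l r1 r2). pose proof (Rmin_r r1 r2).
  exists (fun z => g1 z + g2 z)%C, (Rmin r1 r2). split; [apply Rmin_pos; lra|]. split.
  - intros z Hz. destruct (H1 z) as [l1 L1]; [lra|]. destruct (H2 z) as [l2 L2]; [lra|].
    eexists. apply diffg_plus; eassumption.
  - intros w Hw. rewrite E1 ?E2 //; lra.
Qed.

Lemma regular_opp h p : regular h p -> regular (fun z => - h z)%C p.
Proof.
  intros (g & r & Hr & H & E). exists (fun z => - (1) * g z)%C, r. split; [exact Hr|]. split.
  - intros z Hz. destruct (H z Hz) as [l L]. eexists. apply (diffg_scal _ cid_cont). exact L.
  - intros w Hw. rewrite E //. ring.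
Qed.

Lemma regular_ext h1 h2 p : (forall z, h1 z = h2 z) -> regular h1 p -> regular h2 p.
Proof.
  intros He (g & r & Hr & H & E). exists g, r. repeat split; auto. intros w Hw. rewrite -He. auto.
Qed.

Lemma regular_holo h p r : 0 < r -> holo_disc h p r -> regular h p.
Proof. intros Hr H. exists h, r. auto. Qed.

Lemma inverse_holo_disc (e : C -> C) p R : 0 < R -> holo_disc e p R -> e p <> 0 ->
  exists r, 0 < r <= R /\ holo_disc (fun z => / e z)%C p r /\
    forall z, Cmod (z - p)%C < r -> e z <> 0.
Proof.
  intros HR He Hp. destruct (He p) as [l Hl]; [rewrite Cmod_self_sub; lra|].
  apply cdiff_cont in Hl. destruct (locally_C_inv _ _ (clim_away_0 _ _ _ Hl Hp)) as [d [Hd Ha]].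
  pose proof (Rmin_l d R). pose proof (Rmin_r d R).
  assert (Hne : forall z, Cmod (z - p)%C < Rmin d R -> e z <> 0).
  { intros z Hz. apply Cmod_gt_0. specialize (Ha z ltac:(lra)). apply Cmod_gt_0 in Hp. lra. }
  exists (Rmin d R). split; [split; [apply Rmin_pos; lra|lra]|]. split; [|exact Hne].
  intros z Hz. destruct (He z) as [m Hm]; [lra|]. eexists.
  apply (diffg_inv _ cid_cont); [exact Hm|now apply Hne].
Qed.

Definition simple_frac (a z : C) : C := (/ (a * (z - a)))%C.

Lemma simple_frac_cdiff (a z : C) : a <> 0 -> z <> a -> exists l, cdiff (simple_frac a) z l.
Proof.
  intros Ha Hz. eexists. unfold simple_frac. apply (diffg_inv _ cid_cont).
  - apply (diffg_scal _ cid_cont). apply (diffg_minus _ cid_cont); [apply diffg_iota|apply diffg_const].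
  - apply Cmult_neq_0; [exact Ha|now apply sub_neq_0].
Qed.

Lemma simple_frac_regular (a p : C) : a <> 0 -> p <> a -> regular (simple_frac a) p.
Proof.
  intros Ha Hp. apply (regular_holo _ _ (Cmod (p - a)%C)); [now apply Cmod_sub_pos|].
  intros z Hz. apply simple_frac_cdiff; [exact Ha|]. intros ->.
  rewrite Cmod_sub_sym in Hz. lra.
Qed.

(** The residue at a zero [a <> 0] is [1 / a] because [e^a - 1 = a] there. *)
Lemma inv_expm1x_regular_at_zero (a : C) : a <> 0 -> expm1x a = 0 ->
  regular (fun z => / expm1x z - simple_frac a z)%C a.
Proof.
  intros Ha H0.
  assert (Hd : cdiff expm1x a a).
  { eapply diffg_eq; [|apply cdiff_expm1x]. transitivity (expm1x a + a)%C; [unfold expm1x; ring|].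
    rewrite H0. ring. }
  pose proof (holo_disc_dquot _ a 1 a Hd (expm1x_disc a 1)) as He.
  destruct (inverse_holo_disc _ a 1 Rlt_0_1 He) as (r & [Hr _] & Hi & Hne).
  { now rewrite dquot_at. }
  destruct (Hi a) as [l Hl]; [rewrite Cmod_self_sub; lra|].
  exists (dquot (fun z => / dquot expm1x a a z)%C a l), r.
  split; [exact Hr|]. split; [now apply holo_disc_dquot|].
  intros w Hw. assert (Hwa : w <> a) by (intros ->; rewrite Cmod_self_sub in Hw; lra).
  specialize (Hne w ltac:(lra)). rewrite dquot_neq // in Hne.
  rewrite dquot_neq //. cbv beta. rewrite dquot_at dquot_neq // H0. rewrite H0 in Hne. unfold simple_frac.
  assert (Hwa' := sub_neq_0 _ _ Hwa).
  assert (Hew : expm1x w <> 0).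
  { intros E. apply Hne. rewrite E. unfold Cdiv. ring. }
  replace (expm1x w - 0)%C with (expm1x w) by ring. field. auto.
Qed.

(** Dividing by [z] twice writes [expm1x] as [z^2 e2] with [e2 0 <> 0]; the reciprocal of [e2] is
    then expanded to second order by the same division. The coefficients stay abstract, for they
    leave no trace in the series over the zeros. *)
Lemma inv_expm1x_at_0 : exists (c1 c2 : C) (g : C -> C) (r : R), 0 < r /\ holo_disc g 0 r /\
  forall w, 0 < Cmod w < r -> (/ expm1x w = c2 / (w * w) + c1 / w + g w)%C.
Proof.
  assert (Hd : cdiff expm1x 0 0).
  { eapply diffg_eq; [|apply cdiff_expm1x]. rewrite Cexp_0. ring. }
  pose proof (holo_disc_dquot _ 0 1 0 Hd (expm1x_disc 0 1)) as He1.
  set (e1 := dquot expm1x 0 0) in *.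
  destruct (He1 0) as [l Hl]; [rewrite Cmod_self_sub; lra|].
  pose proof (holo_disc_dquot e1 0 1 l Hl He1) as He2. set (e2 := dquot e1 0 l) in *.
  assert (E2 : forall w : C, w <> 0 -> e2 w = (expm1x w / (w * w))%C).
  { intros w Hw. unfold e2. rewrite dquot_neq //. unfold e1. rewrite dquot_at dquot_neq // expm1x_0.
    replace (w - 0)%C with w by ring. field. exact Hw. }
  assert (Hl0 : l <> 0).
  (* If [l = 0] then [e2 x < / 4] for small [x > 0], whereas the Taylor bound gives
     [e2 x >= / 2]. *)
  { intros El. pose proof (dquot_cont e1 0 l Hl (/ 4) ltac:(lra)) as K.
    destruct (locally_C_inv _ _ K) as [d [Hd0 Hk]].
    set (x := d / 2). assert (Hx : 0 < x) by (unfold x; lra).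
    assert (Hx0 : RtoC x <> 0) by (apply RtoC_neq_0; lra).
    specialize (Hk (RtoC x)). fold e2 in Hk. rewrite E2 // El in Hk.
    assert (K1 : Cmod (RtoC x - 0)%C < d).
    { replace (RtoC x - 0)%C with (RtoC x) by ring. rewrite Cmod_R Rabs_pos_eq; unfold x; lra. }
    specialize (Hk K1). unfold expm1x in Hk. rewrite Cexp_RtoC -!RtoC_minus -RtoC_mult -RtoC_div in Hk; [|nra].
    rewrite -RtoC_minus Cmod_R in Hk.
    pose proof (exp_ge_taylor2 x ltac:(lra)) as T.
    apply Rabs_lt_between in Hk. assert ((exp x - 1 - x) / (x * x) < / 4) by lra.
    apply Rmult_lt_compat_r with (r := x * x) in H; [|nra].
    replace ((exp x - 1 - x) / (x * x) * (x * x)) with (exp x - 1 - x) in H by (field; lra). nra. }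
  destruct (inverse_holo_disc e2 0 1 Rlt_0_1 He2) as (r & [Hr _] & Hi & Hne).
  { unfold e2. now rewrite dquot_at. }
  set (q := fun z => (/ e2 z)%C) in *.
  destruct (Hi 0) as [q1 Hq1]; [rewrite Cmod_self_sub; lra|].
  pose proof (holo_disc_dquot q 0 r q1 Hq1 Hi) as Hq. 
  destruct (Hq 0) as [q2 Hq2]; [rewrite Cmod_self_sub; lra|].
  pose proof (holo_disc_dquot _ 0 r q2 Hq2 Hq) as Hqq.
  exists q1, (q 0), (dquot (dquot q 0 q1) 0 q2), r. split; [exact Hr|]. split; [exact Hqq|].
  intros w Hw. assert (Hw0 : w <> 0) by (apply Cmod_gt_0; lra).
  assert (Hnw : e2 w <> 0) by (apply Hne; replace (w - 0)%C with w by ring; lra).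
  assert (Hew : expm1x w <> 0).
  { intros E. apply Hnw. rewrite E2 // E. unfold Cdiv. ring. }
  rewrite dquot_neq // dquot_at dquot_neq //.
  replace (/ expm1x w)%C with (q w / (w * w))%C.
  - field. replace (w - 0)%C with w by ring. auto.
  - unfold q. rewrite E2 //. field. auto.
Qed.

Fixpoint frac_sum (l : list C) (z : C) : C :=
  match l with nil => 0 | a :: l' => (simple_frac a z + frac_sum l' z)%C end.

Lemma frac_sum_cdiff l (z : C) : (forall a : C, In a l -> a <> 0 /\ z <> a) -> exists k, cdiff (frac_sum l) z k.
Proof.
  induction l as [|a l IH]; intros H.
  - exists (RtoC 0). apply (diffg_const (X := C_UniformSpace) (fun w => w) (RtoC 0) z).
  - destruct IH as [k1 H1]; [intros b Hb; apply H; now right|].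
    destruct (H a (or_introl eq_refl)) as [Ha Hz].
    destruct (simple_frac_cdiff a z Ha Hz) as [k2 H2].
    eexists. simpl. apply diffg_plus; eassumption.
Qed.

Lemma frac_sum_regular l (p : C) : (forall a : C, In a l -> a <> 0) -> ~ In p l -> regular (frac_sum l) p.
Proof.
  induction l as [|a l IH]; intros H Hp.
  - apply (regular_holo _ _ 1 Rlt_0_1). intros z _. exists (RtoC 0).
    apply (diffg_const (X := C_UniformSpace) (fun w => w) (RtoC 0) z).
  - simpl in *. apply regular_plus.
    + apply simple_frac_regular; [apply H; now left|]. intros E. apply Hp. now left.
    + apply IH; [intros b Hb; apply H; now right|]. intros E. apply Hp. now right.
Qed.

Lemma frac_sum_regular_at l (p : C) : (forall a : C, In a l -> a <> 0) -> NoDup l -> In p l ->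
  regular (fun z => frac_sum l z - simple_frac p z)%C p.
Proof.
  induction l as [|a l IH]; intros H Hnd Hp; [contradiction|].
  inversion Hnd as [|b l' Hnin Hnd']; subst. simpl in *.
  destruct (classic (a = p)) as [->|Hne].
  - apply regular_ext with (frac_sum l); [intros; ring|].
    apply frac_sum_regular; [intros b Hb; apply H; now right|exact Hnin].
  - apply regular_ext with (fun z => simple_frac a z + (frac_sum l z - simple_frac p z))%C; [intros; ring|].
    apply regular_plus.
    + apply simple_frac_regular; [apply H; now left|congruence].
    + apply IH; [intros b Hb; apply H; now right|exact Hnd'|]. destruct Hp; congruence.
Qed.

Section PartialFractions.
Variable zk : nat -> C.
Hypothesis Hzk : forall k, upper_zero (zk k).
Hypothesis Hzk_im : forall k, 2 * PI * INR (S k) < Im (zk k) < 2 * PI * INR (S k) + PI / 2.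
Hypothesis Hzk_all : forall w, upper_zero w -> exists k, w = zk k.

Fixpoint zero_list (m : nat) : list C :=
  match m with O => nil | S k => zk k :: Cconj (zk k) :: zero_list k end.

Lemma zk_im_ge k : INR (S k) <= Im (zk k).
Proof. pose proof PI_bounds. pose proof (Hzk_im k). pose proof (pos_INR (S k)). nra. Qed.

Lemma In_zero_list a m : In a (zero_list m) <->
  exists k, (k < m)%nat /\ (a = zk k \/ a = Cconj (zk k)).
Proof.
  induction m as [|m IH]; simpl.
  - split; [tauto|]. intros (k & Hk & _). lia.
  - split.
    + intros [<-|[<-|H]]; [exists m; auto|exists m; auto|].
      apply IH in H. destruct H as (k & Hk & H). exists k. split; [lia|exact H].
    + intros (k & Hk & H). destruct (Nat.eq_dec k m) as [->|Hne].
      * destruct H; auto.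
      * right; right. apply IH. exists k. split; [lia|exact H].
Qed.

Lemma zero_list_zero a m : In a (zero_list m) -> a <> 0 /\ expm1x a = 0.
Proof.
  intros H. apply In_zero_list in H. destruct H as (k & _ & H).
  pose proof (zk_im_ge k) as Hi. rewrite S_INR in Hi. pose proof (pos_INR k) as Hk0.
  destruct (Hzk k) as [_ H0]. change (expm1x (zk k) = 0) in H0. destruct H as [-> | ->]; split.
  - intros E. rewrite E in Hi. simpl in Hi. lra.
  - exact H0.
  - intros E. apply (f_equal Im) in E. destruct (zk k); simpl in *. lra.
  - rewrite expm1x_conj H0. apply C_eq; simpl; ring.
Qed.

Lemma zk_inj j k : zk j = zk k -> j = k.
Proof.
  intros E. pose proof (Hzk_im j) as Hj. pose proof (Hzk_im k) as Hk. rewrite E in Hj.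
  pose proof PI_bounds as HPI. rewrite !S_INR in Hj. rewrite !S_INR in Hk.
  destruct (Nat.lt_trichotomy j k) as [H|[H|H]]; [|exact H|].
  - apply lt_INR in H as H'. apply le_INR in H. rewrite S_INR in H. nra.
  - apply lt_INR in H as H'. apply le_INR in H. rewrite S_INR in H. nra.
Qed.

Lemma zk_neq_conj j k : zk j <> Cconj (zk k).
Proof.
  intros E. pose proof (zk_im_ge j) as Hj. pose proof (zk_im_ge k) as Hk.
  pose proof (pos_INR j). pose proof (pos_INR k). rewrite !S_INR in Hj. rewrite !S_INR in Hk.
  rewrite E in Hj. destruct (zk k); simpl in *. lra.
Qed.

Lemma Cconj_inj a b : Cconj a = Cconj b -> a = b.
Proof. intros E. rewrite -(Cconj_conj a) -(Cconj_conj b) E. reflexivity. Qed.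

Lemma zero_list_NoDup m : NoDup (zero_list m).
Proof.
  induction m as [|m IH]; simpl; [constructor|]. constructor.
  - intros [E|H].
    + now apply (zk_neq_conj m m).
    + apply In_zero_list in H. destruct H as (k & Hk & [E|E]).
      * apply zk_inj in E. lia.
      * now apply zk_neq_conj in E.
  - constructor; [|exact IH]. intros H. apply In_zero_list in H. destruct H as (k & Hk & [E|E]).
    + symmetry in E. now apply zk_neq_conj in E.
    + apply Cconj_inj, zk_inj in E. lia.
Qed.

Variables c1 c2 : C.
Definition pole0 (z : C) : C := (c2 / (z * z) + c1 / z)%C.
Definition remainder (m : nat) (z : C) : C := (/ expm1x z - pole0 z - frac_sum (zero_list m) z)%C.
Hypothesis Hpole0 : regular (fun z => / expm1x z - pole0 z)%C 0.

Lemma pole0_cdiff (z : C) : z <> 0 -> exists l, cdiff pole0 z l.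
Proof.
  intros Hz. eexists. unfold pole0. apply diffg_plus.
  - apply (diffg_div _ cid_cont); [apply diffg_const| |now apply Cmult_neq_0].
    apply (diffg_mult _ cid_cont); apply diffg_iota.
  - apply (diffg_div _ cid_cont); [apply diffg_const|apply diffg_iota|exact Hz].
Qed.

Lemma pole0_regular (p : C) : p <> 0 -> regular pole0 p.
Proof.
  intros Hp. apply (regular_holo _ _ (Cmod p)); [now apply Cmod_gt_0|].
  intros z Hz. apply pole0_cdiff. intros ->.
  replace (0 - p)%C with (- p)%C in Hz by ring. rewrite Cmod_opp in Hz. lra.
Qed.

Lemma remainder_cdiff m z : expm1x z <> 0 -> exists l, cdiff (remainder m) z l.
Proof.
  intros Hz. assert (Hz0 : z <> 0) by (intros ->; now rewrite expm1x_0 in Hz).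
  destruct (pole0_cdiff z Hz0) as [l1 L1].
  destruct (frac_sum_cdiff (zero_list m) z) as [l2 L2].
  { intros a Ha. apply zero_list_zero in Ha. split; [tauto|]. intros ->. tauto. }
  eexists. unfold remainder. apply (diffg_minus _ cid_cont); [apply (diffg_minus _ cid_cont)|exact L2].
  - apply (diffg_inv _ cid_cont); [apply cdiff_expm1x|exact Hz].
  - exact L1.
Qed.

(** The zeros missing from the list have ordinates beyond [2 PI (m + 1)] in absolute value, and each
    listed zero occurs exactly once, so its pole is cancelled by a single fraction. *)
Lemma remainder_regular m z : Rabs (Im z) < 2 * PI * INR (S m) -> regular (remainder m) z.
Proof.
  intros Hz. pose proof PI_bounds as HPI.
  assert (Hnz : forall a, In a (zero_list m) -> a <> 0) by (intros a Ha; now apply zero_list_zero in Ha).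
  destruct (classic (expm1x z = 0)) as [H0|Hne].
  - destruct (classic (z = 0)) as [->|Hz0].
    + apply regular_ext with (fun z => (/ expm1x z - pole0 z) + - frac_sum (zero_list m) z)%C;
        [intros; unfold remainder; ring|].
      apply regular_plus; [exact Hpole0|]. apply regular_opp, frac_sum_regular; [exact Hnz|].
      intros H. now apply Hnz in H.
    + assert (Hin : In z (zero_list m)).
      { apply In_zero_list. destruct (expm1x_zero_cases z H0) as [E|[U|U]]; [contradiction| |];
        destruct (Hzk_all _ U) as [k Ek]; exists k; pose proof (Hzk_im k) as Hk; rewrite -Ek in Hk.
        - split; [|now left]. apply Rabs_lt_between in Hz.
          assert (Hlt : INR (S k) < INR (S m)) by nra. apply INR_lt in Hlt. lia.
        - split; [|right; now rewrite -Ek Cconj_conj]. apply Rabs_lt_between in Hz.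
          replace (Im (Cconj z)) with (- Im z) in Hk by (destruct z; reflexivity).
          assert (Hlt : INR (S k) < INR (S m)) by nra. apply INR_lt in Hlt. lia. }
      apply regular_ext with (fun w => (/ expm1x w - simple_frac z w)
         + (- pole0 w + - (frac_sum (zero_list m) w - simple_frac z w)))%C;
        [intros; unfold remainder; ring|].
      apply regular_plus; [now apply inv_expm1x_regular_at_zero|].
      apply regular_plus; [now apply regular_opp, pole0_regular|].
      apply regular_opp. apply frac_sum_regular_at; auto. apply zero_list_NoDup.
  - destruct (inverse_holo_disc expm1x z 1 Rlt_0_1 (expm1x_disc z 1) Hne) as (r & [Hr _] & _ & Hr2).
    apply (regular_holo _ _ r Hr). intros w Hw. apply remainder_cdiff. now apply Hr2.
Qed.

(** Stated as a filter so that the calculus of [clim] applies to [|Re w|] tending to infinity within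
    a strip. *)
Definition strip_end (Y : R) (P : C -> Prop) : Prop :=
  exists X, forall w, X <= Rabs (Re w) -> Rabs (Im w) <= Y -> P w.

Global Instance strip_end_filter Y : Filter (strip_end Y).
Proof.
  constructor.
  - exists 0. auto.
  - intros P Q [X1 H1] [X2 H2]. exists (Rmax X1 X2). intros w Hw Hi.
    pose proof (Rmax_l X1 X2). pose proof (Rmax_r X1 X2). split; [apply H1|apply H2]; auto; lra.
  - intros P Q H [X HX]. exists X. auto.
Qed.

(** On the right the exponential dominates, on the left it is at most 1 and the linear term
    dominates. *)
Lemma expm1x_large Y w : 4 + 2 * Rabs Y <= Rabs (Re w) -> Rabs (Im w) <= Y ->
  Rabs (Re w) / 2 <= Cmod (expm1x w).
Proof.
  intros Hw Hi. pose proof (Rle_abs Y) as HY. pose proof (Rabs_pos (Im w)).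
  assert (HYp : 0 <= Y) by lra. rewrite (Rabs_pos_eq Y HYp) in Hw.
  unfold expm1x. destruct (Rle_lt_dec 0 (Re w)) as [Hr|Hr].
  - rewrite (Rabs_pos_eq _ Hr) in Hw. rewrite (Rabs_pos_eq _ Hr).
    pose proof (Cmod_rev_triangle (Cexp w) (1 + w)%C) as T.
    replace (Cexp w - (1 + w))%C with (Cexp w - 1 - w)%C in T by ring.
    pose proof (Cmod_triangle 1 w) as T2. rewrite Cmod_1 in T2.
    pose proof (Cmod_le_re_im w) as T3. rewrite (Rabs_pos_eq _ Hr) in T3.
    rewrite Cmod_Cexp in T. pose proof (exp_ge_taylor2 (Re w) Hr). nra.
  - rewrite (Rabs_left _ Hr) in Hw. rewrite (Rabs_left _ Hr).
    pose proof (Cmod_rev_triangle (1 + w)%C (Cexp w)) as T. rewrite Cmod_sub_sym in T.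
    replace (Cexp w - (1 + w))%C with (Cexp w - 1 - w)%C in T by ring.
    pose proof (re_le_Cmod (1 + w)%C) as T2. rewrite Cmod_Cexp in T.
    assert (exp (Re w) <= 1) by (rewrite -exp_0; apply exp_le; lra).
    replace (Re (1 + w)%C) with (1 + Re w) in T2 by (destruct w; simpl; ring).
    rewrite Rabs_left in T2; lra.
Qed.

Lemma clim_strip_end_inv Y (f : C -> C) k X0 : 0 < k ->
  (forall w, X0 <= Rabs (Re w) -> Rabs (Im w) <= Y -> k * Rabs (Re w) <= Cmod (f w)) ->
  clim (fun w => / f w)%C (strip_end Y) 0.
Proof.
  intros Hk H e He. exists (Rmax X0 (2 / (k * e))). intros w Hw Hi.
  pose proof (Rmax_l X0 (2 / (k * e))). pose proof (Rmax_r X0 (2 / (k * e))).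
  specialize (H w ltac:(lra) Hi).
  assert (Hke : 0 < 2 / (k * e)) by (apply Rdiv_lt_0_compat; nra).
  assert (Hf : 2 / e <= Cmod (f w)).
  { eapply Rle_trans; [|exact H]. replace (2 / e) with (k * (2 / (k * e))) by (field; lra).
    apply Rmult_le_compat_l; lra. }
  assert (H2e : 0 < 2 / e) by (apply Rdiv_lt_0_compat; lra).
  replace (/ f w - 0)%C with (/ f w)%C by ring.
  rewrite Cmod_inv; [|apply Cmod_gt_0; lra].
  apply Rle_lt_trans with (/ (2 / e)); [now apply Rinv_le_contravar|].
  replace (/ (2 / e)) with (e / 2) by (field; lra). lra.
Qed.

Lemma remainder_strip_end m Y : clim (remainder m) (strip_end Y) 0.
Proof.
  assert (Hlin : forall a, clim (fun w => / (w - a))%C (strip_end Y) 0).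
  { intros a. apply (clim_strip_end_inv Y _ (/ 2) (2 * Cmod a)); [lra|]. intros w Hw _.
    pose proof (Cmod_rev_triangle w a). pose proof (re_le_Cmod w). lra. }
  assert (H0 : clim (fun w => / w)%C (strip_end Y) 0).
  { apply clim_ext with (fun w => / (w - 0))%C; [typeclasses eauto| |apply Hlin].
    intros w. f_equal. ring. }
  unfold remainder. apply clim_eq with (0 - (c2 * (0 * 0) + c1 * 0) - 0)%C; [ring|].
  apply clim_minus; [typeclasses eauto|apply clim_minus; [typeclasses eauto| |]|].
  - apply (clim_strip_end_inv Y _ (/ 2) (4 + 2 * Rabs Y)); [lra|]. intros w Hw Hi.
    pose proof (expm1x_large Y w Hw Hi). lra.
  - apply clim_ext_loc with (fun w => c2 * (/ w * / w) + c1 * / w)%C; [typeclasses eauto| |].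
    + exists 1. intros w Hw _. unfold pole0.
      assert (w <> 0). { intros ->. simpl in Hw. rewrite Rabs_R0 in Hw. lra. }
      field. auto.
    + apply clim_plus; [typeclasses eauto| |]; apply clim_scal; try typeclasses eauto; auto.
      apply clim_mult; auto; typeclasses eauto.
  - assert (Hnz : forall a, In a (zero_list m) -> a <> 0) by (intros a Ha; now apply zero_list_zero in Ha).
    induction (zero_list m) as [|a l IH]; simpl.
    + apply clim_const; typeclasses eauto.
    + apply clim_eq with (/ a * 0 + 0)%C; [ring|].
      apply clim_plus; [typeclasses eauto| |apply IH; intros b Hb; apply Hnz; now right].
      apply clim_ext_loc with (fun w => / a * / (w - a))%C; [typeclasses eauto| |].
      * exists (Cmod a + 1). intros w Hw _. unfold simple_frac.
        assert (w <> a). { intros ->. pose proof (re_le_Cmod a). lra. }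
        field. split; [now apply sub_neq_0|]. apply Hnz. now left.
      * apply clim_scal; [typeclasses eauto|apply Hlin].
Qed.

(** At the ordinates [(2 m + 1) PI] the sine vanishes, so the imaginary part of [e^w - 1 - w] is
    exactly [- Im w]; these lines also pass between consecutive zeros. *)
Definition strip_height (m : nat) : R := 2 * PI * INR m + PI.

Lemma expm1x_on_line m w : Rabs (Im w) = strip_height m -> strip_height m <= Cmod (expm1x w).
Proof.
  intros Hw. pose proof PI_bounds. pose proof (pos_INR m).
  assert (Hs : sin (strip_height m) = 0).
  { unfold strip_height. replace (2 * PI * INR m + PI) with (PI + 2 * INR m * PI) by ring.
    rewrite sin_period. apply sin_PI. }
  assert (Hsin : sin (Im w) = 0).
  { revert Hw. unfold Rabs. destruct (Rcase_abs (Im w)) as [Hn|Hp]; intros E.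
    - replace (Im w) with (- strip_height m) by lra. rewrite sin_neg Hs. ring.
    - now rewrite E. }
  eapply Rle_trans; [|apply im_le_Cmod]. unfold expm1x, Cexp. simpl. unfold Im in *.
  rewrite Hsin Rmult_0_r. right. rewrite -Hw -Rabs_Ropp. f_equal. unfold Im. ring.
Qed.

Lemma inv_le_sqrt n : / (INR n + 1) <= 2 * (sqrt (INR n + 1) - sqrt (INR n)).
Proof.
  pose proof (pos_INR n). set (a := sqrt (INR n + 1)). set (b := sqrt (INR n)).
  assert (Ha : a * a = INR n + 1) by (apply sqrt_sqrt; lra).
  assert (Hb : b * b = INR n) by (apply sqrt_sqrt; lra).
  assert (Ha1 : 1 <= a). { unfold a. rewrite -{1}sqrt_1. apply sqrt_le_1; lra. }
  assert (Hb0 : 0 <= b) by apply sqrt_pos.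
  assert (Hba : b <= a) by (apply sqrt_le_1; lra).
  rewrite -Ha. apply Rmult_le_reg_r with (a * a); [nra|]. rewrite Rinv_l; [|nra]. 
  assert (E : (a - b) * (a + b) = 1) by nra. nra.
Qed.

(** [1 / ((j + 1)(m - j)) = (1 / (j + 1) + 1 / (m - j)) / (m + 1)], and both harmonic
    sums are dominated by telescoping square roots. *)
Lemma frac_sum_on_line m w j : Rabs (Im w) = strip_height m -> (j <= m)%nat ->
  Cmod (frac_sum (zero_list j) w) <=
    2 / (INR m + 1) * (2 * sqrt (INR j) + 2 * (sqrt (INR m) - sqrt (INR (m - j)))).
Proof.
  intros Hw. pose proof (pos_INR m) as Hm. pose proof PI_bounds as HPI.
  induction j as [|j IH]; intros Hj.
  - simpl. rewrite Cmod_0 Nat.sub_0_r sqrt_0. apply Req_le. field. lra.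
  - specialize (IH ltac:(lia)). simpl zero_list. simpl frac_sum.
    (* [a = j + 1] bounds from below the modulus of the [j]-th zero, and [b = m - j] its distance to
       the line. *)
    set (a := INR j + 1). set (b := INR (m - S j) + 1).
    assert (Hab : a + b = INR m + 1).
    { unfold a, b. rewrite minus_INR // S_INR. ring. }
    assert (Ha : 0 < a) by (pose proof (pos_INR j); unfold a; lra).
    assert (Hb : 0 < b) by (pose proof (pos_INR (m - S j)); unfold b; lra).
    pose proof (zk_im_ge j) as Hi1. rewrite S_INR in Hi1. fold a in Hi1.
    pose proof (Hzk_im j) as Hi2. rewrite S_INR in Hi2. fold a in Hi2.
    assert (Hgap : b <= strip_height m - Im (zk j)).
    { unfold strip_height. replace (INR m) with (a + b - 1) by lra.
      assert (Hb1 : 1 <= b) by (unfold b; pose proof (pos_INR (m - S j)); lra).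
      assert (0 <= (b - 1) * (2 * PI - 1)) by (apply Rmult_le_pos; lra). nra. }
    assert (Hone : forall z, Cmod z = Cmod (zk j) -> Rabs (Im z) = Im (zk j) ->
       Cmod (simple_frac z w) <= / (a * b)).
    { intros z Hz1 Hz2.
      assert (H1 : a <= Cmod z) by (pose proof (im_le_Cmod z); lra).
      assert (H2 : b <= Cmod (w - z)%C).
      { eapply Rle_trans; [|apply im_le_Cmod]. replace (Im (w - z)%C) with (Im w - Im z)
          by (destruct w, z; simpl; ring).
        pose proof (Rabs_triang_inv (Im w) (Im z)). lra. }
      unfold simple_frac. rewrite Cmod_inv.
      - rewrite Cmod_mult. apply Rinv_le_contravar; [nra|]. apply Rmult_le_compat; lra.
      - apply Cmult_neq_0; apply Cmod_gt_0; lra. }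
    assert (Hq : / (a * b) = / (INR m + 1) * (/ a + / b)) by (rewrite -Hab; field; lra).
    pose proof (inv_le_sqrt j) as S1. pose proof (inv_le_sqrt (m - S j)) as S2. fold a in S1. fold b in S2.
    assert (Ea : INR (S j) = a) by (rewrite S_INR; reflexivity).
    assert (Eb : INR (m - j) = b) by (unfold b; rewrite -S_INR; f_equal; lia).
    rewrite Ea. rewrite Eb in IH.
    pose proof (Hone (zk j) eq_refl) as F1. rewrite Rabs_pos_eq in F1; [|lra]. specialize (F1 eq_refl).
    pose proof (Hone (Cconj (zk j)) (Cmod_conj _)) as F2.
    replace (Rabs (Im (Cconj (zk j)))) with (Im (zk j)) in F2.
    2:{ destruct (zk j) as [u v]. simpl in *. rewrite Rabs_Ropp Rabs_pos_eq; lra. }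
    specialize (F2 eq_refl).
    pose proof (Cmod_triangle (simple_frac (zk j) w)
      (simple_frac (Cconj (zk j)) w + frac_sum (zero_list j) w)%C) as T1.
    pose proof (Cmod_triangle (simple_frac (Cconj (zk j)) w) (frac_sum (zero_list j) w)) as T2.
    apply Rle_trans with (2 * / (a * b) + 2 / (INR m + 1) * (2 * sqrt (INR j) + 2 * (sqrt (INR m) - sqrt b)));
      [lra|].
    rewrite Hq. unfold Rdiv.
    replace (2 * (/ (INR m + 1) * (/ a + / b)) + 2 * / (INR m + 1) * (2 * sqrt (INR j) + 2 * (sqrt (INR m) - sqrt b)))
      with (2 * / (INR m + 1) * (/ a + / b + (2 * sqrt (INR j) + 2 * (sqrt (INR m) - sqrt b)))) by ring.
    apply Rmult_le_compat_l; [|lra].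
    apply Rmult_le_pos; [lra|]. left; apply Rinv_0_lt_compat; lra.
Qed.

(** In the numerator, 1 accounts for [1 / expm1x], the two moduli for the polar part and 8 for the
    fractions; each piece is of order [(m + 1)^(-1/2)] on the edges. *)
Definition line_bound (m : nat) : R := (1 + Cmod c2 + Cmod c1 + 8) / sqrt (INR m + 1).

Lemma remainder_on_line m w : Rabs (Im w) = strip_height m -> Cmod (remainder m w) <= line_bound m.
Proof.
  intros Hw. pose proof (pos_INR m) as Hm. pose proof PI_bounds as HPI.
  pose proof (expm1x_on_line m w Hw) as H1. pose proof (frac_sum_on_line m w m Hw (le_n m)) as H2.
  set (q := sqrt (INR m + 1)).
  assert (Hqq : q * q = INR m + 1) by (apply sqrt_sqrt; lra).
  assert (Hq1 : 1 <= q). { unfold q. rewrite -{1}sqrt_1. apply sqrt_le_1; lra. }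
  assert (HY : q <= strip_height m) by (unfold strip_height; nra).
  pose proof (im_le_Cmod w) as Hwm. rewrite Hw in Hwm.
  rewrite Nat.sub_diag sqrt_0 in H2.
  assert (Hsm : sqrt (INR m) <= q) by (apply sqrt_le_1; lra).
  assert (B3 : Cmod (frac_sum (zero_list m) w) <= 8 / q).
  { eapply Rle_trans; [exact H2|]. rewrite -Hqq.
    replace (8 / q) with (2 / (q * q) * (4 * q)) by (field; lra).
    apply Rmult_le_compat_l; [apply Rdiv_le_0_compat; nra|lra]. }
  assert (Hiq : / q <= 1) by (rewrite -Rinv_1; apply Rinv_le_contravar; lra).
  assert (Hiq0 : 0 < / q) by (apply Rinv_0_lt_compat; lra).
  assert (B1 : Cmod (/ expm1x w)%C <= / q).
  { rewrite Cmod_inv; [|apply Cmod_gt_0; lra]. apply Rinv_le_contravar; lra. }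
  assert (Hw0 : w <> 0) by (apply Cmod_gt_0; lra).
  assert (B0 : Cmod (/ w)%C <= / q).
  { rewrite Cmod_inv //. apply Rinv_le_contravar; lra. }
  assert (B2 : Cmod (pole0 w) <= (Cmod c2 + Cmod c1) * / q).
  { unfold pole0. replace (c2 / (w * w) + c1 / w)%C with (c2 * (/ w * / w) + c1 * / w)%C by (field; auto).
    eapply Rle_trans; [apply Cmod_triangle|]. rewrite !Cmod_mult Rmult_plus_distr_r.
    pose proof (Cmod_ge_0 (/ w)%C). 
    apply Rplus_le_compat; apply Rmult_le_compat_l; try apply Cmod_ge_0; nra. }
  unfold remainder, line_bound. fold q.
  pose proof (Cmod_triangle_sub (/ expm1x w - pole0 w)%C (frac_sum (zero_list m) w)) as T1.
  pose proof (Cmod_triangle_sub (/ expm1x w)%C (pole0 w)) as T2.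
  unfold Rdiv in *. lra.
Qed.

(** The maximum principle is applied to the extension of the remainder across the zeros. The
    extension lives on the wider strip up to [2 PI (m + 1)], still free of unlisted zeros; the far
    ends of the strip are harmless because the remainder tends to 0 there. *)
Lemma remainder_bound m z : Rabs (Im z) <= strip_height m -> expm1x z <> 0 ->
  Cmod (remainder m z) <= line_bound m.
Proof.
  intros Hz Hne. pose proof (pos_INR m) as Hm. pose proof PI_bounds as HPI.
  destruct (removable_extension (fun z => Rabs (Im z) < 2 * PI * INR (S m)) (remainder m)) as (H & Hh & HE).
  - intros w Hw. exists (2 * PI * INR (S m) - Rabs (Im w)). split; [lra|]. intros v Hv.
    pose proof (im_le_Cmod (v - w)%C) as K. replace (Im (v - w)%C) with (Im v - Im w) in K
      by (destruct v, w; simpl; ring).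
    pose proof (Rabs_triang_inv (Im v) (Im w)). lra.
  - intros w Hw. apply remainder_regular. exact Hw.
  - assert (Heq : forall w, Rabs (Im w) <= strip_height m -> expm1x w <> 0 -> H w = remainder m w).
    { intros w Hw Hw0. apply HE.
      - unfold strip_height in Hw. rewrite S_INR. lra.
      - destruct (remainder_cdiff m w Hw0) as [l Hl]. now apply cdiff_cont with l. }
    rewrite -Heq //.
    assert (Hb0 : 0 < line_bound m).
    { apply Rdiv_lt_0_compat; [|apply sqrt_lt_R0; lra].
      pose proof (Cmod_ge_0 c1). pose proof (Cmod_ge_0 c2). lra. }
    assert (HY : 0 < strip_height m) by (unfold strip_height; nra).
    destruct (remainder_strip_end m (strip_height m) _ Hb0) as [X HX].
    pose proof (Rmax_l X (4 + 2 * Rabs (strip_height m))) as M1.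
    pose proof (Rmax_r X (4 + 2 * Rabs (strip_height m))) as M2.
    pose proof (Rabs_pos (strip_height m)).
    apply (strip_max H (strip_height m) (2 * PI * INR (S m)) (Rmax X (4 + 2 * Rabs (strip_height m)))); auto.
    + unfold strip_height in *. rewrite S_INR. lra.
    + lra.
    + intros w Hw. rewrite Heq.
      * now apply remainder_on_line.
      * lra.
      * apply Cmod_gt_0. pose proof (expm1x_on_line m w Hw). lra.
    + intros w Hw Hi. rewrite Heq //.
      * left. specialize (HX w ltac:(lra) Hi). cbv beta in HX.
        now replace (remainder m w - 0)%C with (remainder m w) in HX by ring.
      * apply Cmod_gt_0. pose proof (expm1x_large (strip_height m) w ltac:(lra) Hi). lra.
Qed.

Lemma line_bound_lim : is_lim_seq line_bound 0.
Proof.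
  set (k := 1 + Cmod c2 + Cmod c1 + 8).
  apply is_lim_seq_ext with (fun m => k * / sqrt (INR (S m))).
  { intros m. unfold line_bound, k. rewrite S_INR. reflexivity. }
  replace (Finite 0) with (Rbar_mult k 0) by (simpl; f_equal; ring).
  apply is_lim_seq_scal_l.
  apply is_lim_seq_incr_1 with (u := fun m => / sqrt (INR m)).
  apply (is_lim_seq_inv _ p_infty); [|discriminate].
  apply (filterlim_comp _ _ _ INR sqrt eventually (Rbar_locally p_infty) (Rbar_locally p_infty)).
  - apply is_lim_seq_INR.
  - apply filterlim_sqrt_p.
Qed.

Lemma partial_fractions z : expm1x z <> 0 ->
  clim (fun m => frac_sum (zero_list m) z) eventually (/ expm1x z - pole0 z)%C.
Proof.
  intros Hz e He. pose proof line_bound_lim as Hl. apply is_lim_seq_spec in Hl.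
  destruct (Hl (mkposreal e He)) as [N1 HN1]. simpl in HN1.
  destruct (INR_unbounded (Rabs (Im z))) as [N2 HN2].
  exists (N1 + N2)%nat. intros m Hm. rewrite Cmod_sub_sym.
  change (Cmod (remainder m z) < e). eapply Rle_lt_trans; [apply remainder_bound; [|exact Hz]|].
  - pose proof PI_bounds. unfold strip_height.
    assert (INR N2 <= INR m) by (apply le_INR; lia). pose proof (pos_INR m). nra.
  - specialize (HN1 m ltac:(lia)). rewrite Rminus_0_r in HN1. apply Rabs_lt_between in HN1. lra.
Qed.

End PartialFractions.

(** * The series over the zeros *)

(** The sum stops before index [m], to match [zero_list]; [sum_n] includes its last index. *)
Fixpoint psum (a : nat -> C) (m : nat) : C :=
  match m with O => 0 | S k => (psum a k + a k)%C end.

Definition csum (a : nat -> C) (l : C) : Prop := clim (psum a) eventually l.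

Lemma psum_sum_n a m : psum a (S m) = @sum_n C_R_NormedModule a m.
Proof.
  induction m as [|m IH].
  - rewrite sum_O. simpl. ring.
  - rewrite sum_Sn -IH. reflexivity.
Qed.

(** The mean value theorem for [t^(-c)]. The telescoping form gives the convergence of the zeta
    series and explicit tails for the partial fractions. *)
Lemma Rpower_telescope a c : 0 < a -> 0 < c ->
  Rpower (a + 1) (- (c + 1)) <= (Rpower a (- c) - Rpower (a + 1) (- c)) / c.
Proof.
  intros Ha Hc.
  destruct (MVT_gen (fun t => Rpower t (- c)) a (a + 1) (fun t => - c * Rpower t (- c - 1))) as [x [Hx E]].
  - rewrite Rmin_left ?Rmax_right; try lra. intros x Hx. apply is_derive_Rpower. lra.
  - rewrite Rmin_left ?Rmax_right; try lra. intros x Hx. apply continuity_pt_filterlim.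
    apply continuous_Rpower. lra.
  - rewrite Rmin_left ?Rmax_right in Hx; try lra.
    replace (Rpower a (- c) - Rpower (a + 1) (- c)) with (c * Rpower x (- c - 1)) by lra.
    replace (c * Rpower x (- c - 1) / c) with (Rpower x (- c - 1)) by (field; lra).
    replace (- (c + 1)) with (- c - 1) by ring. apply Rpower_anti; lra.
Qed.

(** With [c = - Re s] this is the general term of [zeta (1 - Re s)]. *)
Definition zeta_term (c : R) (k : nat) : R := Rpower (INR (S k)) (- (c + 1)).

Lemma zeta_term_pos c k : 0 < zeta_term c k.
Proof. apply Rpower_pos. Qed.

Lemma ex_series_zeta c : 0 < c -> ex_series (zeta_term c).
Proof.
  intros Hc.
  assert (Hb : forall n, sum_n (zeta_term c) n <= 1 + (1 - Rpower (INR (S n)) (- c)) / c).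
  { induction n as [|n IH].
    - rewrite sum_O. unfold zeta_term. simpl. rewrite !Rpower_base_1. unfold Rdiv. lra.
    - rewrite sum_Sn. change plus with Rplus. cbv beta.
      pose proof (Rpower_telescope (INR (S n)) c ltac:(apply lt_0_INR; lia) Hc) as T.
      rewrite -S_INR in T. change (Rpower (INR (S (S n))) (- (c + 1))) with (zeta_term c (S n)) in T.
      unfold Rdiv in *. lra. }
  apply ex_finite_lim_seq_incr with (1 + / c).
  - intros n. rewrite sum_Sn. change plus with Rplus. cbv beta. pose proof (zeta_term_pos c (S n)). lra.
  - intros n. eapply Rle_trans; [apply Hb|]. pose proof (Rpower_pos (INR (S n)) (- c)).
    pose proof (Rinv_0_lt_compat c Hc). unfold Rdiv. nra.
Qed.

Lemma sum_le_Series (b : nat -> R) n : (forall k, 0 <= b k) -> ex_series b -> sum_n b n <= Series b.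
Proof.
  intros Hb He. apply (is_lim_seq_incr_compare (sum_n b) (Series b)).
  - apply (Series_correct b He).
  - intros k. rewrite sum_Sn. change plus with Rplus. cbv beta. specialize (Hb (S k)). lra.
Qed.

Lemma psum_bound a b m : (forall k, Cmod (a k) <= b k) -> (forall k, 0 <= b k) -> ex_series b ->
  Cmod (psum a m) <= Series b.
Proof.
  intros Ha Hb He. assert (H : forall n, Cmod (psum a (S n)) <= sum_n b n).
  { induction n as [|n IH].
    - rewrite sum_O. simpl. rewrite Cplus_0_l. apply Ha.
    - rewrite sum_Sn. change plus with Rplus. cbv beta. simpl psum.
      eapply Rle_trans; [apply Cmod_triangle|]. apply Rplus_le_compat; [exact IH|apply Ha]. }
  destruct m as [|m].
  - simpl. rewrite Cmod_0. eapply Rle_trans; [|apply (sum_le_Series b 0 Hb He)]. rewrite sum_O. apply Hb.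
  - eapply Rle_trans; [apply H|]. now apply sum_le_Series.
Qed.

Lemma csum_ex a b : (forall k, Cmod (a k) <= b k) -> (forall k, 0 <= b k) -> ex_series b ->
  exists l, csum a l /\ Cmod l <= Series b.
Proof.
  intros Ha Hb He.
  destruct (@ex_series_le R_AbsRing C_R_CompleteNormedModule a b) as [l Hl].
  - intros n. specialize (Ha n). now rewrite Cmod_norm in Ha.
  - exact He.
  - assert (Hc : csum a l).
    { intros e He0. assert (K : clim (@sum_n C_R_NormedModule a) eventually l)
        by (apply clim_filterlim; [typeclasses eauto|exact Hl]).
      destruct (K e He0) as [N HN]. exists (S N). intros n Hn. destruct n as [|n]; [lia|].
      rewrite psum_sum_n. apply HN. lia. }
    exists l. split; [exact Hc|]. apply (clim_le eventually _ _ _ Hc).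
    exists O. intros n _. now apply psum_bound.
Qed.

Lemma csum_plus a b l m : csum a l -> csum b m -> csum (fun k => a k + b k)%C (l + m)%C.
Proof.
  intros Ha Hb. apply clim_ext with (fun n => psum a n + psum b n)%C; [typeclasses eauto| |].
  - induction x as [|n IH]; simpl; [ring|]. rewrite -IH. ring.
  - apply clim_plus; auto; typeclasses eauto.
Qed.

Lemma csum_scal c a l : csum a l -> csum (fun k => c * a k)%C (c * l)%C.
Proof.
  intros Ha. apply clim_ext with (fun n => c * psum a n)%C; [typeclasses eauto| |].
  - induction x as [|n IH]; simpl; [ring|]. rewrite -IH. ring.
  - apply clim_scal; auto; typeclasses eauto.
Qed.

Lemma csum_unique a l m : csum a l -> csum a m -> l = m.
Proof. intros H1 H2. apply (clim_unique eventually (psum a)); auto. Qed.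

(** The branch of [log (- z)] for [z] in the upper half-plane: the argument of
    [z] is [PI / 2 - atan (Re z / Im z)]. *)
Definition log_neg (z : C) : C := (ln (Cmod z), - (PI / 2 + atan (Re z / Im z))).

Lemma Cexp_log_neg z : 0 < Im z -> (- Cexp (log_neg z))%C = z.
Proof.
  intros Hy. assert (Hm : 0 < Cmod z).
  { pose proof (im_le_Cmod z). pose proof (Rle_abs (Im z)). lra. }
  unfold Cexp, log_neg. simpl. rewrite exp_ln // cos_neg sin_neg.
  set (q := Re z / Im z). replace (PI / 2 + atan q) with (atan q + PI / 2) by ring.
  rewrite cos_plus sin_plus cos_PI2 sin_PI2 sin_atan cos_atan.
  assert (E : Cmod z = Im z * sqrt (1 + q²)).
  { apply Rsqr_inj; [lra|apply Rmult_le_pos; [lra|apply sqrt_pos]|].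
    rewrite Rsqr_mult Rsqr_sqrt; [|unfold Rsqr; nra]. unfold Rsqr, q.
    replace (Cmod z * Cmod z) with (Cmod z ^ 2) by ring. rewrite Cmod2_alt. field. lra. }
  assert (Hq : 0 < sqrt (1 + q²)) by (apply sqrt_lt_R0; unfold Rsqr; nra).
  apply C_eq; simpl; rewrite E.
  - transitivity (q * Im z); [field; lra|unfold q; field; lra].
  - field. lra.
Qed.

Lemma Cexp_log_neg_conj z : 0 < Im z -> (- Cexp (Cconj (log_neg z)))%C = Cconj z.
Proof.
  intros Hy. rewrite Cexp_conj -{2}(Cexp_log_neg z Hy). apply C_eq; simpl; ring.
Qed.

Lemma log_neg_im z : Rabs (Im (log_neg z)) < PI.
Proof.
  unfold log_neg. simpl. rewrite Rabs_Ropp. pose proof (atan_bound (Re z / Im z)).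
  apply Rabs_lt_between. lra.
Qed.

(** The terms [(- a)^s / a] for [a = z] and for its conjugate. As [s] is not conjugated, the two are
    in general not conjugate to each other. *)
Definition zero_term (z s : C) : C :=
  (Cexp (s * log_neg z) / z + Cexp (s * Cconj (log_neg z)) / Cconj z)%C.

Definition zero_term' (z s : C) : C :=
  (log_neg z * (Cexp (s * log_neg z) / z) + Cconj (log_neg z) * (Cexp (s * Cconj (log_neg z)) / Cconj z))%C.

Lemma Cmod_Cexp_log z l s : 0 < Cmod z -> Re l = ln (Cmod z) -> 
  Cmod (Cexp (s * l) / z)%C = Rpower (Cmod z) (Re s - 1) * exp (- (Im s * Im l)).
Proof.
  intros Hz Hl. rewrite Cmod_div; [|now apply Cmod_gt_0]. rewrite Cmod_Cexp.
  replace (Re (s * l)%C) with (Re s * ln (Cmod z) + - (Im s * Im l))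
    by (rewrite -Hl; destruct s, l; simpl; ring).
  rewrite exp_plus. replace (Rpower (Cmod z) (Re s - 1)) with (exp (Re s * ln (Cmod z)) / Cmod z).
  - unfold Rdiv; ring.
  - unfold Rminus. rewrite Rpower_plus Rpower_Ropp Rpower_1 //.
Qed.

Lemma zero_term_bound z s : 0 < Im z ->
  Cmod (zero_term z s) <=
    2 * Rpower (Cmod z) (Re s - 1) * exp (Rabs (Im s) * (PI / 2 + atan (Re z / Im z))).
Proof.
  intros Hy. assert (Hm : 0 < Cmod z).
  { pose proof (im_le_Cmod z). pose proof (Rle_abs (Im z)). lra. }
  unfold zero_term. eapply Rle_trans; [apply Cmod_triangle|].
  rewrite (Cmod_Cexp_log z) //. rewrite (Cmod_Cexp_log (Cconj z)).
  2: now rewrite Cmod_conj.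
  2: now rewrite Cmod_conj.
  rewrite Cmod_conj. simpl.
  set (A := PI / 2 + atan (Re z / Im z)).
  assert (HA : 0 <= A) by (pose proof (atan_bound (Re z / Im z)); unfold A; lra).
  pose proof (Rpower_pos (Cmod z) (Re s - 1)) as Hp. unfold Im in *. fold A.
  pose proof (Rle_abs (snd s)). pose proof (Rle_abs (- snd s)). rewrite Rabs_Ropp in H0.
  assert (E1 : exp (- (snd s * - A)) <= exp (Rabs (snd s) * A)) by (apply exp_le; nra).
  assert (E2 : exp (- (snd s * - - A)) <= exp (Rabs (snd s) * A)) by (apply exp_le; nra).
  nra.
Qed.

Section ZeroSeries.
Variable zk : nat -> C.
Hypothesis Hzk : forall k, upper_zero (zk k).
Hypothesis Hzk_ge : forall k, INR (S k) <= Im (zk k).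

Lemma zk_mod_ge k : INR (S k) <= Cmod (zk k).
Proof.
  eapply Rle_trans; [apply Hzk_ge|]. eapply Rle_trans; [apply Rle_abs|apply im_le_Cmod].
Qed.

Lemma zk_im_pos k : 0 < Im (zk k).
Proof. apply (Hzk k). Qed.

Lemma zk_mod_ge_1 k : 1 <= Cmod (zk k).
Proof. pose proof (zk_mod_ge k) as H. rewrite S_INR in H. pose proof (pos_INR k). lra. Qed.

Lemma zk_power_le k c : 0 < c -> Rpower (Cmod (zk k)) (- (c + 1)) <= zeta_term c k.
Proof.
  intros Hc. apply Rpower_anti; [lra|]. split; [apply lt_0_INR; lia|apply zk_mod_ge].
Qed.

Lemma zero_series_ex s : Re s < 0 -> exists l, csum (fun k => zero_term (zk k) s) l.
Proof.
  intros Hs. set (M := 2 * exp (Rabs (Im s) * PI)).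
  destruct (csum_ex (fun k => zero_term (zk k) s) (fun k => M * zeta_term (- Re s) k)) as [l [Hl _]].
  - intros k. eapply Rle_trans; [apply zero_term_bound, zk_im_pos|].
    pose proof (zk_power_le k (- Re s) ltac:(lra)) as H1.
    replace (- (- Re s + 1)) with (Re s - 1) in H1 by ring.
    pose proof (atan_bound (Re (zk k) / Im (zk k))) as Ha.
    assert (H2 : exp (Rabs (Im s) * (PI / 2 + atan (Re (zk k) / Im (zk k)))) <= exp (Rabs (Im s) * PI)).
    { apply exp_le. apply Rmult_le_compat_l; [apply Rabs_pos|lra]. }
    pose proof (Rpower_pos (Cmod (zk k)) (Re s - 1)). pose proof (exp_pos (Rabs (Im s) * PI)).
    unfold M. rewrite !Rmult_assoc. apply Rmult_le_compat_l; [lra|].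
    rewrite (Rmult_comm (exp (Rabs (Im s) * PI))).
    apply Rmult_le_compat; try lra. left; apply exp_pos.
  - intros k. pose proof (zeta_term_pos (- Re s) k). unfold M. pose proof (exp_pos (Rabs (Im s) * PI)). nra.
  - apply (@ex_series_scal_l R_AbsRing). apply ex_series_zeta. lra.
  - now exists l.
Qed.

(** With [l] the logarithm of minus a zero, the remainder of [e^(w l)] around [s] costs
    [|l|^2 e^(del |l|)], which is at most a constant times [|z|^(2 del)]. Since [Re s = - 4 del],
    the exponent that remains is [- (2 del + 1)], still summable. *)
Lemma zero_series_cdiff (Sf : C -> C) s : Re s < 0 ->
  (forall w, Re w < 0 -> csum (fun k => zero_term (zk k) w) (Sf w)) -> exists l, cdiff Sf s l.
Proof.
  intros Hs HS. set (del := - Re s / 4). assert (Hdel : 0 < del) by (unfold del; lra).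
  (* The first factor bounds [e^(- Im s Im l)] since [|Im l| <= PI]; the second is the constant in
     the bound of [|l|^2 e^(del |l|)], where [|l| <= ln |z| + PI]. *)
  set (M := exp (Rabs (Im s) * PI) * (2 / del ^ 2 * exp (2 * del * PI))).
  assert (HM : 0 < M).
  { apply Rmult_lt_0_compat; [apply exp_pos|]. apply Rmult_lt_0_compat; [|apply exp_pos].
    apply Rdiv_lt_0_compat; [lra|]. apply pow_lt; lra. }
  set (b := fun k => 2 * M * zeta_term (2 * del) k).
  assert (Hb : ex_series b).
  { apply (@ex_series_scal_l R_AbsRing). apply ex_series_zeta. lra. }
  assert (Hb0 : forall k, 0 <= b k).
  { intros k. unfold b. pose proof (zeta_term_pos (2 * del) k). nra. }
  assert (Hone : forall k l z, Re l = ln (Cmod (zk k)) -> Rabs (Im l) <= PI -> Cmod z = Cmod (zk k) ->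
    Cmod (Cexp (s * l) / z)%C * (Cmod l ^ 2 * exp (del * Cmod l)) <= M * zeta_term (2 * del) k).
  { intros k l z Hl1 Hl2 Hz. pose proof (zk_mod_ge_1 k) as H1.
    rewrite (Cmod_Cexp_log z) Hz //; [|lra]. set (rk := Cmod (zk k)) in *.
    assert (Hln : 0 <= ln rk) by (rewrite -ln_1; apply ln_le; lra).
    assert (Hl : Cmod l <= ln rk + PI).
    { eapply Rle_trans; [apply Cmod_le_re_im|]. rewrite Hl1 Rabs_pos_eq; lra. }
    pose proof (Cmod_ge_0 l) as Hl0.
    assert (Q : Cmod l ^ 2 * exp (del * Cmod l) <= 2 / del ^ 2 * exp (2 * del * PI) * Rpower rk (2 * del)).
    { apply Rle_trans with (2 / del ^ 2 * exp (2 * (del * Cmod l))).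
      - pose proof (exp_ge_quad (del * Cmod l) ltac:(nra)) as K.
        replace (2 * (del * Cmod l)) with (del * Cmod l + del * Cmod l) by ring. rewrite exp_plus.
        rewrite -Rmult_assoc. apply Rmult_le_compat_r; [left; apply exp_pos|].
        apply Rmult_le_reg_l with (del ^ 2); [apply pow_lt; lra|].
        replace (del ^ 2 * (2 / del ^ 2 * exp (del * Cmod l))) with (2 * exp (del * Cmod l)) by (field; lra).
        lra.
      - rewrite Rmult_assoc. apply Rmult_le_compat_l.
        + left. apply Rdiv_lt_0_compat; [lra|apply pow_lt; lra].
        + unfold Rpower. rewrite -exp_plus. apply exp_le. nra. }
    assert (E : exp (- (Im s * Im l)) <= exp (Rabs (Im s) * PI)).
    { apply exp_le. eapply Rle_trans; [apply Rle_abs|]. rewrite Rabs_Ropp Rabs_mult.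
      apply Rmult_le_compat_l; [apply Rabs_pos|exact Hl2]. }
    pose proof (zk_power_le k (2 * del) ltac:(lra)) as P. fold rk in P.
    assert (Ep : Rpower rk (Re s - 1) * Rpower rk (2 * del) = Rpower rk (- (2 * del + 1))).
    { rewrite -Rpower_plus. f_equal. unfold del. field. }
    pose proof (Rpower_pos rk (Re s - 1)) as P1. pose proof (exp_pos (- (Im s * Im l))) as P2.
    pose proof (exp_pos (Rabs (Im s) * PI)) as P3.
    assert (0 <= Cmod l ^ 2 * exp (del * Cmod l)).
    { apply Rmult_le_pos; [apply pow_le; lra|left; apply exp_pos]. }
    apply Rle_trans with (Rpower rk (Re s - 1) * exp (Rabs (Im s) * PI) *
      (2 / del ^ 2 * exp (2 * del * PI) * Rpower rk (2 * del))).
    - apply Rmult_le_compat; try assumption; [nra|]. apply Rmult_le_compat_l; lra.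
    - replace (_ * _ * _) with (M * (Rpower rk (Re s - 1) * Rpower rk (2 * del))) by (unfold M; ring).
      rewrite Ep. apply Rmult_le_compat_l; lra. }
  assert (Hlog : forall k, Re (log_neg (zk k)) = ln (Cmod (zk k)) /\ Rabs (Im (log_neg (zk k))) <= PI
     /\ Re (Cconj (log_neg (zk k))) = ln (Cmod (zk k)) /\ Rabs (Im (Cconj (log_neg (zk k)))) <= PI).
  { intros k. pose proof (log_neg_im (zk k)). repeat split; try lra.
    destruct (log_neg (zk k)); simpl in *. rewrite Rabs_Ropp. lra. }
  assert (HD : exists l, csum (fun k => zero_term' (zk k) s) l).
  { set (M2 := 1 / del + 1).
    destruct (csum_ex (fun k => zero_term' (zk k) s) (fun k => M2 * (b k + 2 * exp (Rabs (Im s) * PI) * zeta_term (- Re s) k))) as [l [Hl _]].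
    - intros k. destruct (Hlog k) as (L1 & L2 & L3 & L4).
      pose proof (Hone k _ (zk k) L1 L2 eq_refl) as B1.
      pose proof (Hone k _ (Cconj (zk k)) L3 L4 (Cmod_conj _)) as B2.
      (* As [|l| <= |l|^2 + 1], the differentiated series is dominated by two series known to
         converge. *)
      assert (Hx : forall (l : C) q, 0 <= q -> Rabs (Im l) <= PI -> Cmod l * q <= M2 * (q * (Cmod l ^ 2 * exp (del * Cmod l)) + q)).
      { intros l q Hq _. pose proof (Cmod_ge_0 l). 
        assert (1 <= exp (del * Cmod l)) by (rewrite -exp_0; apply exp_le; nra).
        assert (HX : Cmod l <= Cmod l ^ 2 * exp (del * Cmod l) + 1).
        { assert (0 <= Cmod l ^ 2 * (exp (del * Cmod l) - 1)) by (apply Rmult_le_pos; [apply pow_le|]; lra). nra. }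
        assert (HM2 : 1 <= M2) by (unfold M2; pose proof (Rinv_0_lt_compat del Hdel); unfold Rdiv; lra).
        replace (q * (Cmod l ^ 2 * exp (del * Cmod l)) + q) with ((Cmod l ^ 2 * exp (del * Cmod l) + 1) * q) by ring.
        rewrite -(Rmult_1_l (Cmod l * q)). apply Rmult_le_compat; [lra|nra|lra|].
        apply Rmult_le_compat_r; lra. }
      unfold zero_term'. eapply Rle_trans; [apply Cmod_triangle|]. rewrite !(Cmod_mult (log_neg _)) !(Cmod_mult (Cconj _)).
      pose proof (Hx _ _ (Cmod_ge_0 (Cexp (s * log_neg (zk k)) / zk k)%C) L2) as X1.
      pose proof (Hx _ _ (Cmod_ge_0 (Cexp (s * Cconj (log_neg (zk k))) / Cconj (zk k))%C) L4) as X2.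
      assert (Hq : forall l z, Re l = ln (Cmod (zk k)) -> Rabs (Im l) <= PI -> Cmod z = Cmod (zk k) ->
         Cmod (Cexp (s * l) / z)%C <= exp (Rabs (Im s) * PI) * zeta_term (- Re s) k).
      { intros l z Hl1 Hl2 Hz. pose proof (zk_mod_ge_1 k). rewrite (Cmod_Cexp_log z) Hz //; [|lra].
        rewrite Rmult_comm. apply Rmult_le_compat; [left; apply exp_pos|left; apply Rpower_pos| |].
        - apply exp_le. eapply Rle_trans; [apply Rle_abs|]. rewrite Rabs_Ropp Rabs_mult.
          apply Rmult_le_compat_l; [apply Rabs_pos|exact Hl2].
        - pose proof (zk_power_le k (- Re s) ltac:(lra)) as P.
          replace (- (- Re s + 1)) with (Re s - 1) in P by ring. exact P. }
      pose proof (Hq _ (zk k) L1 L2 eq_refl) as Q1.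
      pose proof (Hq _ (Cconj (zk k)) L3 L4 (Cmod_conj _)) as Q2.
      assert (HM2 : 0 <= M2) by (unfold M2; pose proof (Rinv_0_lt_compat del Hdel); unfold Rdiv; lra).
      unfold b.
      eapply Rle_trans; [apply Rplus_le_compat; [exact X1|exact X2]|].
      rewrite -Rmult_plus_distr_l. apply Rmult_le_compat_l; [exact HM2|]. lra.
    - intros k. assert (0 <= M2) by (unfold M2; pose proof (Rinv_0_lt_compat del Hdel); unfold Rdiv; lra).
      pose proof (Hb0 k). pose proof (zeta_term_pos (- Re s) k). pose proof (exp_pos (Rabs (Im s) * PI)).
      apply Rmult_le_pos; [lra|]. nra.
    - apply (@ex_series_scal_l R_AbsRing). apply (@ex_series_plus R_AbsRing); [exact Hb|].
      apply (@ex_series_scal_l R_AbsRing). apply ex_series_zeta. lra.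
    - now exists l. }
  destruct HD as [D HD]. exists D.
  apply (diffg_quad (X := C_UniformSpace) (fun w => w) cid_cont) with (Series b).
  generalize (locally_C s del Hdel). apply filter_imp. intros w Hw.
  assert (Hw0 : Re w < 0).
  { pose proof (re_le_Cmod (w - s)%C) as H. destruct w, s. simpl in *.
    apply Rabs_le_between in H. unfold del in Hw. lra. }
  set (h := Cmod (w - s)%C) in *. assert (Hh : 0 <= h) by apply Cmod_ge_0.
  assert (Hquad : forall k l z, Re l = ln (Cmod (zk k)) -> Rabs (Im l) <= PI -> Cmod z = Cmod (zk k) ->
    Cmod (Cexp (w * l) / z - Cexp (s * l) / z - (w - s) * (l * (Cexp (s * l) / z)))%C
       <= h ^ 2 * (M * zeta_term (2 * del) k)).
  { intros k l z Hl1 Hl2 Hz. pose proof (zk_mod_ge_1 k).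
    assert (Hz0 : z <> 0) by (apply Cmod_gt_0; lra).
    replace (Cexp (w * l)) with (Cexp (s * l) * Cexp ((w - s) * l))%C
      by (rewrite -Cexp_plus; f_equal; ring).
    replace (_ - _ - _)%C with (Cexp (s * l) / z * (Cexp ((w - s) * l) - 1 - (w - s) * l))%C
      by (field; exact Hz0).
    rewrite (Cmod_mult (Cexp (s * l) / z)%C).
    eapply Rle_trans; [apply Rmult_le_compat_l; [apply Cmod_ge_0|apply Cexp_quad_bound]|].
    rewrite Cmod_mult. fold h.
    pose proof (Hone k l z Hl1 Hl2 Hz) as B. pose proof (Cmod_ge_0 l) as Hl0.
    apply Rle_trans with (h ^ 2 * (Cmod (Cexp (s * l) / z)%C * (Cmod l ^ 2 * exp (del * Cmod l)))).
    - replace ((h * Cmod l) ^ 2 * exp (h * Cmod l)) with (h ^ 2 * (Cmod l ^ 2 * exp (h * Cmod l))) by ring.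
      replace (h ^ 2 * (Cmod (Cexp (s * l) / z)%C * (Cmod l ^ 2 * exp (del * Cmod l))))
        with (Cmod (Cexp (s * l) / z)%C * (h ^ 2 * (Cmod l ^ 2 * exp (del * Cmod l)))) by ring.
      apply Rmult_le_compat_l; [apply Cmod_ge_0|]. apply Rmult_le_compat_l; [apply pow_le; lra|].
      apply Rmult_le_compat_l; [apply pow_le; lra|]. apply exp_le. apply Rmult_le_compat_r; lra.
    - apply Rmult_le_compat_l; [apply pow_le; lra|exact B]. }
  pose proof (csum_plus _ _ _ _ (csum_plus _ _ _ _ (HS w Hw0) (csum_scal (- (1))%C _ _ (HS s Hs)))
    (csum_scal (- (w - s))%C _ _ HD)) as Hsum.
  destruct (csum_ex (fun k => zero_term (zk k) w + - (1) * zero_term (zk k) s + - (w - s) * zero_term' (zk k) s)%C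
    (fun k => h ^ 2 * b k)) as [l [Hl Hlb]].
  - intros k. destruct (Hlog k) as (L1 & L2 & L3 & L4).
    pose proof (Hquad k _ (zk k) L1 L2 eq_refl) as B1.
    pose proof (Hquad k _ (Cconj (zk k)) L3 L4 (Cmod_conj _)) as B2.
    unfold zero_term, zero_term'.
    match type of B1 with Cmod ?x <= _ => match type of B2 with Cmod ?y <= _ =>
      replace (_ + _ + _)%C with (x + y)%C by ring end end.
    eapply Rle_trans; [apply Cmod_triangle|]. unfold b. lra.
  - intros k. apply Rmult_le_pos; [apply pow_le; lra|apply Hb0].
  - now apply (@ex_series_scal_l R_AbsRing).
  - rewrite Series_scal_l in Hlb. rewrite (csum_unique _ _ _ Hl Hsum) in Hlb. fold h.
    replace (Sf w - Sf s - D * (w - s))%C with (Sf w + - (1) * Sf s + - (w - s) * D)%C by ring.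
    lra.
Qed.

End ZeroSeries.

(** * Continuation of the Mellin transform of [1 / (e^x - 1 - x)] *)

Lemma dom_from_pieces f d M K b : 0 < d -> 0 < b ->
  (forall x, 0 < x < d -> Cmod (f x) <= M) ->
  (forall x, d <= x -> Cmod (f x) <= K * Rpower x (- b - 1)) ->
  exists L, dom f L 1 b.
Proof.
  intros Hd Hb H1 H2.
  assert (HM : 0 <= M) by (eapply Rle_trans; [apply Cmod_ge_0|apply (H1 (d / 2)); lra]).
  assert (HK : 0 <= K).
  { pose proof (H2 d (Rle_refl d)). pose proof (Cmod_ge_0 (f d)). pose proof (Rpower_pos d (- b - 1)). nra. }
  pose proof (Rpower_pos d (- b - 1)) as P. pose proof (Rpower_pos d (b + 1)) as Q.
  assert (PQ : Rpower d (- b - 1) * Rpower d (b + 1) = 1).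
  { rewrite -Rpower_plus. replace (- b - 1 + (b + 1)) with 0 by ring. now apply Rpower_O. }
  exists (M + M * Rpower d (b + 1) + K + K * Rpower d (- b - 1)). intros x Hx.
  replace (1 - 1) with 0 by ring. rewrite Rpower_O // Rmult_1_r.
  pose proof (Rpower_pos x (- b - 1)) as R0.
  assert (M1 : 0 <= M * Rpower d (b + 1)) by nra. assert (K1 : 0 <= K * Rpower d (- b - 1)) by nra.
  destruct (Rlt_le_dec x d) as [Hxd|Hxd].
  - specialize (H1 x ltac:(lra)).
    pose proof (Rpower_anti x d (- b - 1) ltac:(lra) ltac:(lra)) as A.
    split; [lra|]. apply Rle_trans with (M * Rpower d (b + 1) * Rpower x (- b - 1)); [|nra].
    apply Rle_trans with (M * (Rpower d (- b - 1) * Rpower d (b + 1))); [rewrite PQ; lra|].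
    rewrite (Rmult_comm (Rpower d (- b - 1))) Rmult_assoc.
    apply Rmult_le_compat_l; [exact HM|]. apply Rmult_le_compat_l; lra.
  - specialize (H2 x Hxd). pose proof (Rpower_anti d x (- b - 1) ltac:(lra) ltac:(lra)) as A.
    split; [|nra]. apply Rle_trans with (K * Rpower d (- b - 1)); [|lra].
    eapply Rle_trans; [exact H2|]. now apply Rmult_le_compat_l.
Qed.

Lemma expm1x_real (x : R) : expm1x (RtoC x) = RtoC (exp x - 1 - x).
Proof. unfold expm1x. now rewrite Cexp_RtoC -!RtoC_minus. Qed.

Lemma expm1x_real_neq_0 (x : R) : 0 < x -> expm1x (RtoC x) <> 0.
Proof.
  intros Hx. rewrite expm1x_real. apply RtoC_neq_0. pose proof (exp_ineq1 x ltac:(lra)). lra.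
Qed.

(** Divided by [e^x] the right side is [1 - (1 + x) e^(-x)], which increases with [x]; [c] is its
    value at [d]. *)
Lemma expm1x_real_lower d : 0 < d -> exists c, 0 < c /\ forall x, d <= x -> c * exp x <= exp x - 1 - x.
Proof.
  intros Hd. exists (1 - (1 + d) * exp (- d)).
  assert (E : forall t, exp t * exp (- t) = 1) by (intros t; rewrite -exp_plus Rplus_opp_r; apply exp_0).
  split.
  - pose proof (exp_ineq1 d ltac:(lra)). pose proof (exp_pos (- d)). pose proof (E d). nra.
  - intros x Hx.
    assert (H : - ((1 + d) * exp (- d)) <= - ((1 + x) * exp (- x))).
    { apply (derive_le (fun t => - ((1 + t) * exp (- t))) (fun t => t * exp (- t))); [exact Hx| |].
      - intros t _. auto_derive; auto. ring.
      - intros t Ht. apply Rmult_le_pos; [lra|left; apply exp_pos]. }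
    pose proof (exp_pos x). pose proof (E x).
    assert (exp x * ((1 + x) * exp (- x)) = 1 + x) by nra. nra.
Qed.

Section Continuation.
Variable zk : nat -> C.
Hypothesis Hzk : forall k, upper_zero (zk k).
Hypothesis Hzk_im : forall k, 2 * PI * INR (S k) < Im (zk k) < 2 * PI * INR (S k) + PI / 2.
Hypothesis Hzk_all : forall w, upper_zero w -> exists k, w = zk k.
Variables c1 c2 : C.
Hypothesis Hpole0 : regular (fun z => / expm1x z - pole0 c1 c2 z)%C 0.

(** The polar part damped at infinity. As [(1 + x) e^(-x) = 1 + O(x^2)], damping the double pole
    does not disturb the coefficient of [1 / x]. The next definition is this minus the true polar
    part, which is bounded near 0. *)
Definition tail_part (x : R) : C :=
  (c2 * RtoC ((1 + x) * exp (- x) / x ^ 2) + c1 * RtoC (exp (- x) / x))%C.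
Definition head_part (x : R) : C :=
  (c2 * RtoC (((1 + x) * exp (- x) - 1) / x ^ 2) + c1 * RtoC ((exp (- x) - 1) / x))%C.
Definition regular_part (x : R) : C := (/ expm1x (RtoC x) - tail_part x)%C.
(** The meromorphic continuation of the defining integral to [-1 < Re s], with its polar terms at 0
    and 1 made explicit. *)
Definition kernel_mellin (s : C) : C :=
  (mellin regular_part s + Gamma (s + 1) * (c2 / (s - 1) + c1 / s))%C.

Lemma pole0_split x : 0 < x -> pole0 c1 c2 (RtoC x) = (tail_part x - head_part x)%C.
Proof.
  intros Hx. unfold pole0, tail_part, head_part.
  assert (Hx0 : RtoC x <> 0) by (apply RtoC_neq_0; lra).
  replace (RtoC ((1 + x) * exp (- x) / x ^ 2)) with (RtoC (((1 + x) * exp (- x) - 1) / x ^ 2) + / (RtoC x * RtoC x))%C.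
  2:{ rewrite -RtoC_mult -RtoC_inv; [|nra]. rewrite -RtoC_plus. f_equal. field. lra. }
  replace (RtoC (exp (- x) / x)) with (RtoC ((exp (- x) - 1) / x) + / RtoC x)%C.
  2:{ rewrite -RtoC_inv; [|lra]. rewrite -RtoC_plus. f_equal. field. lra. }
  field. exact Hx0.
Qed.

Lemma head_part_bound x : 0 < x -> Cmod (head_part x) <= Cmod c2 + Cmod c1.
Proof.
  intros Hx. unfold head_part. eapply Rle_trans; [apply Cmod_triangle|].
  rewrite !Cmod_mult !Cmod_R.
  pose proof (exp_pos (- x)) as P. pose proof (exp_opp_lower x) as L. pose proof (exp_ineq1_le x) as L2.
  assert (E : exp x * exp (- x) = 1) by (rewrite -exp_plus Rplus_opp_r; apply exp_0).
  assert (U : (1 + x) * exp (- x) <= 1) by nra.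
  assert (U1 : exp (- x) <= 1) by nra.
  rewrite -(Rmult_1_r (Cmod c2)) -(Rmult_1_r (Cmod c1)) !Rmult_assoc !Rmult_1_l.
  apply Rplus_le_compat; apply Rmult_le_compat_l; try apply Cmod_ge_0.
  - rewrite Rabs_div; [|apply pow_nonzero; lra]. rewrite (Rabs_pos_eq (x ^ 2)); [|nra].
    apply Rmult_le_reg_r with (x ^ 2); [nra|]. unfold Rdiv. rewrite Rmult_assoc Rinv_l; [|nra].
    rewrite Rabs_left1; nra.
  - rewrite Rabs_div; [|lra]. rewrite (Rabs_pos_eq x); [|lra].
    apply Rmult_le_reg_r with x; [lra|]. unfold Rdiv. rewrite Rmult_assoc Rinv_l; [|lra].
    rewrite Rabs_left1; nra.
Qed.

Lemma cont0_inv_expm1x : cont0 (fun x => / expm1x (RtoC x))%C.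
Proof.
  intros x Hx. apply clim_inv; [typeclasses eauto| |now apply expm1x_real_neq_0].
  apply (clim_comp_C _ RtoC expm1x (RtoC x)); [apply RtoC_cont|].
  eapply cdiff_cont. apply cdiff_expm1x.
Qed.

Lemma cont0_real_frac (f g : R -> R) : (forall x, ex_derive f x) -> (forall x, ex_derive g x) ->
  (forall x, 0 < x -> g x <> 0) -> cont0 (fun x => RtoC (f x / g x)).
Proof.
  intros Hf Hg H0. apply (cont0_RtoC (fun x => f x / g x)). intros x Hx.
  apply (ex_derive_continuous (V := R_NormedModule)). apply ex_derive_div; auto.
Qed.

Lemma cont0_tail_part : cont0 tail_part.
Proof.
  apply cont0_plus; (apply cont0_mult; [apply cont0_const|]).
  - apply (cont0_real_frac (fun x => (1 + x) * exp (- x)) (fun x => x ^ 2));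
      [intros; auto_derive; auto|intros; auto_derive; auto|intros; apply pow_nonzero; lra].
  - apply (cont0_real_frac (fun x => exp (- x)) (fun x => x));
      [intros; auto_derive; auto|intros; auto_derive; auto|intros; lra].
Qed.

Lemma cont0_regular_part : cont0 regular_part.
Proof. apply cont0_minus; [apply cont0_inv_expm1x|apply cont0_tail_part]. Qed.

(** Near 0 the function is a removable remainder minus [head_part], both bounded; away from 0 both
    of its terms decay like [e^(-x)], hence faster than any power. *)
Lemma dom_regular_part b : 0 < b -> exists K, dom regular_part K 1 b.
Proof.
  intros Hb. destruct Hpole0 as (g & r & Hr & Hg & Eg).
  destruct (Hg 0) as [l Hl]; [rewrite Cmod_self_sub; lra|]. apply cdiff_cont in Hl.
  apply clim_bounded in Hl; [|typeclasses eauto].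
  destruct (locally_C_inv _ _ Hl) as [d0 [Hd0 Hgb]].
  set (d := Rmin d0 r). assert (Hd : 0 < d) by (apply Rmin_pos; lra).
  assert (Hd1 : d <= d0) by apply Rmin_l. assert (Hd2 : d <= r) by apply Rmin_r.
  destruct (expm1x_real_lower d Hd) as (c & Hc & Hlow).
  destruct (exp_power_bound (b + 1)) as (K0 & HK0 & HKb); [lra|].
  set (T := / c + (Cmod c2 * ((1 + d) / d ^ 2) + Cmod c1 / d)).
  apply (dom_from_pieces _ d (Cmod (g 0) + 1 + (Cmod c2 + Cmod c1)) (T * K0) b Hd Hb).
  - intros x Hx.
    assert (Ex : Cmod (RtoC x - 0)%C = x).
    { replace (RtoC x - 0)%C with (RtoC x) by ring. rewrite Cmod_R Rabs_pos_eq; lra. }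
    replace (regular_part x) with (g (RtoC x) - head_part x)%C.
    + eapply Rle_trans; [apply Cmod_triangle_sub|]. apply Rplus_le_compat.
      * apply Hgb. lra.
      * apply head_part_bound. lra.
    + rewrite -Eg; [|lra]. rewrite pole0_split; [|lra]. unfold regular_part. ring.
  - intros x Hx. assert (Hx0 : 0 < x) by lra. pose proof (exp_pos x) as Px. pose proof (exp_pos (- x)) as Pnx.
    specialize (HKb 1 x Rlt_0_1 Hx0). rewrite Rmult_1_l Rpower_base_1 Rmult_1_r in HKb.
    replace (- (b + 1)) with (- b - 1) in HKb by ring.
    assert (HT : 0 <= T).
    { unfold T. pose proof (Cmod_ge_0 c1). pose proof (Cmod_ge_0 c2).
      assert (0 < / c) by now apply Rinv_0_lt_compat.
      assert (0 < (1 + d) / d ^ 2) by (apply Rdiv_lt_0_compat; nra).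
      assert (0 <= Cmod c1 / d) by (apply Rdiv_le_0_compat; lra). nra. }
    apply Rle_trans with (T * exp (- x)).
    2:{ rewrite Rmult_assoc. now apply Rmult_le_compat_l. }
    unfold regular_part. eapply Rle_trans; [apply Cmod_triangle_sub|].
    unfold T. rewrite Rmult_plus_distr_r. apply Rplus_le_compat.
    + specialize (Hlow x Hx). rewrite expm1x_real Cmod_inv; [|apply RtoC_neq_0; nra].
      rewrite Cmod_R Rabs_pos_eq; [|nra]. rewrite exp_Ropp -Rinv_mult.
      apply Rinv_le_contravar; nra.
    + unfold tail_part. eapply Rle_trans; [apply Cmod_triangle|].
      rewrite !Cmod_mult !Cmod_R (Rmult_plus_distr_r (Cmod c2 * _)).
      rewrite (Rabs_pos_eq (_ / x ^ 2)); [|apply Rdiv_le_0_compat; nra].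
      rewrite (Rabs_pos_eq (_ / x)); [|apply Rdiv_le_0_compat; lra].
      assert (I1 : / x <= / d) by (apply Rinv_le_contravar; lra).
      assert (I0 : 0 < / x) by now apply Rinv_0_lt_compat.
      apply Rplus_le_compat.
      * rewrite Rmult_assoc. apply Rmult_le_compat_l; [apply Cmod_ge_0|].
        replace ((1 + x) * exp (- x) / x ^ 2) with ((/ x * / x + / x) * exp (- x)) by (field; lra).
        replace ((1 + d) / d ^ 2) with (/ d * / d + / d) by (field; lra).
        apply Rmult_le_compat_r; nra.
      * unfold Rdiv. rewrite Rmult_assoc. apply Rmult_le_compat_l; [apply Cmod_ge_0|]. nra.
Qed.

Lemma regular_part_Iimp s : -1 < Re s ->
  Iimp (fun x => Rcpow x s * regular_part x)%C (mellin regular_part s).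
Proof.
  intros Hs. pose proof (Rle_abs (Re s)). pose proof (Rabs_pos (Re s)).
  destruct (dom_regular_part (Rabs (Re s) + 1)) as [K HK]; [lra|].
  apply (mellin_Iimp regular_part K 1 (Rabs (Re s) + 1)); [apply cont0_regular_part|exact HK|lra].
Qed.

Lemma regular_part_cdiff s : -1 < Re s -> exists l, cdiff (mellin regular_part) s l.
Proof.
  intros Hs. pose proof (Rle_abs (Re s)). pose proof (Rabs_pos (Re s)).
  destruct (dom_regular_part (Rabs (Re s) + 1)) as [K HK]; [lra|].
  apply (mellin_cdiff regular_part K 1 (Rabs (Re s) + 1)); [apply cont0_regular_part|exact HK|lra].
Qed.

Lemma kernel_mellin_right s : 1 < Re s ->
  CInt_0_infty (fun x => Rcpow x s / RtoC (exp x - 1 - x))%C = kernel_mellin s.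
Proof.
  intros Hs. apply CInt_0_infty_unique.
  eapply Iimp_ext; [|apply (Iimp_plus _ _ _ _ (regular_part_Iimp s ltac:(lra)) (Iimp_power_tail s c1 c2 Hs))].
  intros x Hx. cbv beta. rewrite -expm1x_real. unfold regular_part, tail_part, Cdiv. ring.
Qed.

(** On this strip the integral of the head has the value that the tail has for [1 < Re s], so
    [kernel_mellin] becomes the transform of the kernel with its polar part removed, to which the
    partial fractions apply. *)
Lemma kernel_mellin_strip s : -1 < Re s < 0 ->
  Iimp (fun x => Rcpow x s * (/ expm1x (RtoC x) - pole0 c1 c2 (RtoC x)))%C (kernel_mellin s).
Proof.
  intros Hs.
  eapply Iimp_ext; [|apply (Iimp_plus _ _ _ _ (regular_part_Iimp s ltac:(lra)) (Iimp_power_head s c1 c2 Hs))].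
  intros x Hx. cbv beta. rewrite pole0_split //. unfold regular_part.
  change (c2 * RtoC (((1 + x) * exp (- x) - 1) / x ^ 2) + c1 * RtoC ((exp (- x) - 1) / x))%C
    with (head_part x). ring.
Qed.

Lemma zk_ge k : INR (S k) <= Im (zk k).
Proof. apply zk_im_ge. exact Hzk_im. Qed.

Lemma simple_frac_Iimp s l a : -1 < Re s < 0 -> Rabs (Im l) < PI -> (- Cexp l)%C = a -> a <> 0 ->
  Iimp (fun x => Rcpow x s * simple_frac a (RtoC x))%C (Gamma (s + 1) * Gamma (- s) * (Cexp (s * l) / a))%C.
Proof.
  intros Hs Hl Ha Ha0. pose proof (off_ray_exp l Hl) as Hoff.
  pose proof (Iimp_scal (/ a)%C _ _ (stieltjes_Iimp s Hs _ Hoff)) as I.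
  rewrite (stieltjes_exp s Hs l Hl) Ha in I. rewrite Ha in Hoff.
  replace (Gamma (s + 1) * Gamma (- s) * (Cexp (s * l) / a))%C
    with (/ a * (Cexp (s * l) * (Gamma (s + 1) * Gamma (- s))))%C by (field; exact Ha0).
  eapply Iimp_ext; [|exact I]. intros x Hx. cbv beta. unfold simple_frac.
  pose proof (off_ray_neq a x Hoff Hx). field. auto.
Qed.

Lemma frac_sum_Iimp s m : -1 < Re s < 0 ->
  Iimp (fun x => Rcpow x s * frac_sum (zero_list zk m) (RtoC x))%C
    (Gamma (s + 1) * Gamma (- s) * psum (fun k => zero_term (zk k) s) m)%C.
Proof.
  intros Hs. induction m as [|m IH].
  - simpl. apply Iimp_ext with (fun x => 0 * (Rcpow x s * RtoC (/ (1 + x))))%C; [intros; ring|].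
    pose proof (Iimp_scal 0 _ _ (stieltjes_Gamma s Hs)) as I.
    replace (Gamma (s + 1) * Gamma (- s) * 0)%C with (0 * (Gamma (s + 1) * Gamma (- s)))%C by ring. exact I.
  - simpl zero_list. simpl frac_sum. simpl psum.
    pose proof (zk_ge m) as Hi. rewrite S_INR in Hi. pose proof (pos_INR m) as Hm0.
    assert (Hy : 0 < Im (zk m)) by lra.
    assert (Hz : zk m <> 0) by (intros E; rewrite E in Hy; simpl in Hy; lra).
    assert (Hz' : Cconj (zk m) <> 0).
    { intros E. apply (f_equal Im) in E. destruct (zk m); simpl in *; lra. }
    pose proof (log_neg_im (zk m)) as Hl.
    pose proof (simple_frac_Iimp s _ _ Hs Hl (Cexp_log_neg _ Hy) Hz) as I1.
    assert (Hl' : Rabs (Im (Cconj (log_neg (zk m)))) < PI).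
    { destruct (log_neg (zk m)); simpl in *. rewrite Rabs_Ropp. exact Hl. }
    pose proof (simple_frac_Iimp s _ _ Hs Hl' (Cexp_log_neg_conj _ Hy) Hz') as I2.
    pose proof (Iimp_plus _ _ _ _ I1 (Iimp_plus _ _ _ _ I2 IH)) as I.
    match type of I with Iimp _ ?v => replace (Gamma (s + 1) * _ * _)%C with v end.
    + eapply Iimp_ext; [|exact I]. intros x Hx. cbv beta. ring.
    + unfold zero_term. ring.
Qed.

(** The distance from [x > 0] to a zero [a] is at least both [x / 2] and [k + 1]; a geometric
    mean of the two bounds is summable in [k] and integrable in [x]. *)
Lemma simple_frac_dom k a eta : a = zk k \/ a = Cconj (zk k) -> 0 < eta < 1 ->
  dom (fun x => simple_frac a (RtoC x)) (2 * zeta_term eta k) 1 (- eta).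
Proof.
  intros Ha Heta x Hx. pose proof (upper_zero_re _ (Hzk k)) as Hre.
  pose proof (upper_zero_re_le_im _ (Hzk k)) as Hri. pose proof (zk_ge k) as Hi.
  set (n := INR (S k)) in *.
  assert (Hn : 1 <= n) by (unfold n; rewrite S_INR; pose proof (pos_INR k); lra).
  assert (Hai : Rabs (Im a) = Im (zk k) /\ Re a = Re (zk k)).
  { destruct Ha as [-> | ->]; destruct (zk k); simpl in *; rewrite ?Rabs_Ropp; rewrite Rabs_pos_eq; lra. }
  destruct Hai as [Hai Har].
  assert (H1 : n <= Cmod a) by (pose proof (im_le_Cmod a); lra).
  assert (H2 : Im (zk k) <= Cmod (RtoC x - a)%C).
  { eapply Rle_trans; [|apply im_le_Cmod]. rewrite -Hai. right. rewrite -Rabs_Ropp. f_equal.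
    destruct a; simpl; ring. }
  assert (H3 : x / 2 <= Cmod (RtoC x - a)%C).
  { destruct (Rle_lt_dec x (2 * Re (zk k))) as [H|H]; [lra|].
    eapply Rle_trans; [|apply re_le_Cmod]. eapply Rle_trans; [|apply Rle_abs].
    replace (Re (RtoC x - a)%C) with (x - Re a) by (destruct a; simpl; ring). lra. }
  set (M := Cmod (RtoC x - a)%C) in *.
  assert (E : Cmod (simple_frac a (RtoC x)) = / Cmod a * / M).
  { unfold simple_frac. rewrite Cmod_inv; [|apply Cmult_neq_0; apply Cmod_gt_0; fold M; lra].
    rewrite Cmod_mult. apply Rinv_mult. }
  assert (Ia : / Cmod a <= / n) by (apply Rinv_le_contravar; lra).
  assert (Ia0 : 0 < / Cmod a) by (apply Rinv_0_lt_compat; lra).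
  assert (IM0 : 0 < / M) by (apply Rinv_0_lt_compat; lra).
  assert (Ez : zeta_term eta k = / n * Rpower n (- eta)).
  { unfold zeta_term. fold n. replace (- (eta + 1)) with (- (1) + - eta) by ring.
    rewrite Rpower_plus (Rpower_Ropp n 1) Rpower_1 //. lra. }
  pose proof (Rpower_pos n (- eta)) as Pn. assert (In : 0 < / n) by (apply Rinv_0_lt_compat; lra).
  rewrite E Ez. split.
  - replace (1 - 1) with 0 by ring. rewrite Rpower_O // Rmult_1_r.
    assert (/ M <= / n) by (apply Rinv_le_contravar; lra).
    assert (/ n <= Rpower n (- eta)).
    { rewrite -{1}(Rpower_1 n); [|lra]. rewrite -Rpower_Ropp. apply Rle_Rpower; lra. }
    apply Rle_trans with (/ n * Rpower n (- eta)); [|nra]. apply Rmult_le_compat; lra.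
  - replace (- - eta - 1) with (- (1 - eta)) by ring.
    assert (EM : / M = Rpower M (- (1 - eta)) * Rpower M (- eta)).
    { rewrite -Rpower_plus. replace (- (1 - eta) + - eta) with (- (1)) by ring.
      rewrite Rpower_Ropp Rpower_1 //. lra. }
    assert (B1 : Rpower M (- (1 - eta)) <= Rpower (x / 2) (- (1 - eta))) by (apply Rpower_anti; lra).
    assert (B2 : Rpower M (- eta) <= Rpower n (- eta)) by (apply Rpower_anti; lra).
    assert (B3 : Rpower (x / 2) (- (1 - eta)) <= 2 * Rpower x (- (1 - eta))).
    { unfold Rdiv. rewrite -Rpower_mult_distr //; [|lra]. rewrite Rmult_comm.
      apply Rmult_le_compat_r; [left; apply Rpower_pos|].
      unfold Rpower. rewrite ln_Rinv; [|lra]. replace (- (1 - eta) * - ln 2) with ((1 - eta) * ln 2) by ring.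
      rewrite -{2}(exp_ln 2); [|lra]. apply exp_le.
      assert (0 <= ln 2) by (rewrite -ln_1; apply ln_le; lra). nra. }
    pose proof (Rpower_pos M (- (1 - eta))). pose proof (Rpower_pos M (- eta)). pose proof (Rpower_pos x (- (1 - eta))).
    rewrite EM.
    replace (2 * (/ n * Rpower n (- eta)) * Rpower x (- (1 - eta)))
      with (/ n * (2 * Rpower x (- (1 - eta)) * Rpower n (- eta))) by ring.
    apply Rmult_le_compat; [lra|nra|exact Ia|]. apply Rmult_le_compat; lra.
Qed.

(** Each conjugate pair contributes [4 * zeta_term eta], which [Rpower_telescope] turns into a
    difference divided by [eta]. The telescoped form is inductive in [N] and bounded uniformly in
    it. *)
Lemma frac_sum_tail_dom eta m N : 0 < eta < 1 -> (0 < m)%nat ->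
  dom (fun x => frac_sum (zero_list zk (m + N)) (RtoC x) - frac_sum (zero_list zk m) (RtoC x))%C
    (4 / eta * (Rpower (INR m) (- eta) - Rpower (INR (m + N)) (- eta))) 1 (- eta).
Proof.
  intros Heta Hm. induction N as [|N IH].
  - rewrite Nat.add_0_r. intros x Hx.
    replace (_ - _)%C with (RtoC 0) by ring. rewrite Cmod_0. split; right; ring.
  - rewrite Nat.add_succ_r. simpl zero_list.
    assert (Hmn : 0 < INR (m + N)) by (apply lt_0_INR; lia).
    pose proof (Rpower_telescope (INR (m + N)) eta Hmn (proj1 Heta)) as T.
    rewrite -S_INR in T. change (Rpower (INR (S (m + N))) (- (eta + 1))) with (zeta_term eta (m + N)) in T.
    pose proof (dom_plus _ _ _ _ _ _ (simple_frac_dom (m + N) (zk (m + N)) eta (or_introl eq_refl) Heta)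
      (dom_plus _ _ _ _ _ _ (simple_frac_dom (m + N) (Cconj (zk (m + N))) eta (or_intror eq_refl) Heta) IH)) as D.
    intros x Hx. destruct (D x Hx) as [D1 D2]. simpl frac_sum.
    replace (simple_frac (zk (m + N)) (RtoC x) + (simple_frac (Cconj (zk (m + N))) (RtoC x)
        + frac_sum (zero_list zk (m + N)) (RtoC x)) - frac_sum (zero_list zk m) (RtoC x))%C
      with (simple_frac (zk (m + N)) (RtoC x) + (simple_frac (Cconj (zk (m + N))) (RtoC x)
        + (frac_sum (zero_list zk (m + N)) (RtoC x) - frac_sum (zero_list zk m) (RtoC x))))%C by ring.
    assert (HK : 2 * zeta_term eta (m + N) + (2 * zeta_term eta (m + N) +
        4 / eta * (Rpower (INR m) (- eta) - Rpower (INR (m + N)) (- eta)))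
      <= 4 / eta * (Rpower (INR m) (- eta) - Rpower (INR (S (m + N))) (- eta))) by (unfold Rdiv in *; lra).
    split; [eapply Rle_trans; [exact D1|]|eapply Rle_trans; [exact D2|]];
      (apply Rmult_le_compat_r; [left; apply Rpower_pos|exact HK]).
Qed.

Lemma partial_fractions_real x : 0 < x -> clim (fun m => frac_sum (zero_list zk m) (RtoC x)) eventually
  (/ expm1x (RtoC x) - pole0 c1 c2 (RtoC x))%C.
Proof.
  intros Hx. apply partial_fractions; auto. now apply expm1x_real_neq_0.
Qed.

(** The previous bound passes to the limit pointwise in [x]. As its constant tends to 0 with growing
    [m], termwise integration follows without any convergence theorem for integrals. *)
Lemma remainder_dom eta m : 0 < eta < 1 -> (0 < m)%nat ->
  dom (fun x => / expm1x (RtoC x) - pole0 c1 c2 (RtoC x) - frac_sum (zero_list zk m) (RtoC x))%C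
    (4 / eta * Rpower (INR m) (- eta)) 1 (- eta).
Proof.
  intros Heta Hm x Hx.
  assert (Hl : clim (fun N => frac_sum (zero_list zk N) (RtoC x) - frac_sum (zero_list zk m) (RtoC x))%C eventually
     (/ expm1x (RtoC x) - pole0 c1 c2 (RtoC x) - frac_sum (zero_list zk m) (RtoC x))%C).
  { apply clim_minus; [typeclasses eauto|now apply partial_fractions_real|apply clim_const; typeclasses eauto]. }
  assert (Hb : forall y, 0 <= y -> forall N, (m <= N)%nat ->
     4 / eta * (Rpower (INR m) (- eta) - Rpower (INR N) (- eta)) * y <= 4 / eta * Rpower (INR m) (- eta) * y).
  { intros y Hy N HN. apply Rmult_le_compat_r; [exact Hy|]. apply Rmult_le_compat_l.
    - apply Rdiv_le_0_compat; lra.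
    - pose proof (Rpower_pos (INR N) (- eta)). lra. }
  split; apply (clim_le eventually _ _ _ Hl); exists m; intros N HN;
    destruct (frac_sum_tail_dom eta m (N - m) Heta Hm x Hx) as [D1 D2];
    (replace (m + (N - m))%nat with N in D1, D2 by lia).
  - eapply Rle_trans; [exact D1|]. apply Hb; [left; apply Rpower_pos|exact HN].
  - eapply Rle_trans; [exact D2|]. apply Hb; [left; apply Rpower_pos|exact HN].
Qed.

Lemma kernel_mellin_series s S : -1 < Re s < 0 -> csum (fun k => zero_term (zk k) s) S ->
  kernel_mellin s = (Gamma (s + 1) * Gamma (- s) * S)%C.
Proof.
  intros Hs HS. set (eta := - Re s / 2). assert (Heta : 0 < eta < 1) by (unfold eta; lra).
  assert (H1 : clim (fun m => Gamma (s + 1) * Gamma (- s) * psum (fun k => zero_term (zk k) s) m)%C eventually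
    (Gamma (s + 1) * Gamma (- s) * S)%C) by (apply clim_scal; [typeclasses eauto|exact HS]).
  apply (clim_unique eventually _ _ _) with (2 := H1).
  set (B := / (1 + Re s) + / (- eta - Re s)).
  apply clim_squeeze with (fun m => 4 / eta * Rpower (INR m) (- eta) * B); [typeclasses eauto| |].
  - exists 1%nat. intros m Hm. rewrite Cmod_sub_sym.
    apply (Iimp_dom_bound _ _ _ _ _ (Iimp_minus _ _ _ _ (kernel_mellin_strip s Hs) (frac_sum_Iimp s m Hs)));
      [|lra|unfold eta; lra|].
    + apply cont0_minus; (apply cont0_mult; [apply cont0_Rcpow|]).
      * apply cont0_minus; [apply cont0_inv_expm1x|]. intros x Hx.
        apply (clim_comp_C _ RtoC (pole0 c1 c2) (RtoC x)); [apply RtoC_cont|].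
        destruct (pole0_cdiff c1 c2 (RtoC x)) as [l Hl]; [apply RtoC_neq_0; lra|].
        now apply cdiff_cont with l.
      * intros x Hx. apply (clim_comp_C _ RtoC (frac_sum (zero_list zk m)) (RtoC x)); [apply RtoC_cont|].
        destruct (frac_sum_cdiff (zero_list zk m) (RtoC x)) as [l Hl].
        { intros a Ha. pose proof (zero_list_zero zk Hzk Hzk_im a m Ha) as [Ha0 Ha1].
          split; [exact Ha0|]. intros E. subst a. now apply (expm1x_real_neq_0 x Hx). }
        now apply cdiff_cont with l.
    + pose proof (dom_Rcpow _ _ _ _ s (remainder_dom eta m Heta ltac:(lia))) as D.
      intros x Hx. specialize (D x Hx).
      replace (Rcpow x s * (/ expm1x (RtoC x) - pole0 c1 c2 (RtoC x)) - Rcpow x s * frac_sum (zero_list zk m) (RtoC x))%C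
        with (Rcpow x s * (/ expm1x (RtoC x) - pole0 c1 c2 (RtoC x) - frac_sum (zero_list zk m) (RtoC x)))%C by ring.
      exact D.
  - intros e He.
    assert (HB : 0 < B).
    { apply Rplus_lt_0_compat; apply Rinv_0_lt_compat; unfold eta; lra. }
    assert (H4 : 0 < 4 / eta) by (apply Rdiv_lt_0_compat; lra).
    destruct (Rpower_large eta (e / (4 / eta * B)) (proj1 Heta)) as (M & HM0 & HM).
    { apply Rdiv_lt_0_compat; [exact He|nra]. }
    destruct (INR_unbounded M) as [N HN]. exists N. intros n Hn.
    assert (Hn2 : INR N <= INR n) by now apply le_INR.
    pose proof (Rpower_anti M (INR n) (- eta) ltac:(lra) ltac:(lra)) as A.
    replace (4 / eta * Rpower (INR n) (- eta) * B) with ((4 / eta * B) * Rpower (INR n) (- eta)) by ring.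
    apply Rle_lt_trans with ((4 / eta * B) * Rpower M (- eta)); [apply Rmult_le_compat_l; nra|].
    apply Rlt_le_trans with ((4 / eta * B) * (e / (4 / eta * B))); [|right; field; split; lra].
    apply Rmult_lt_compat_l; [nra|exact HM].
Qed.

End Continuation.

(** * The bound *)

Lemma mero_ext h1 h2 p : (forall z, h1 z = h2 z) -> mero_at h1 p -> mero_at h2 p.
Proof.
  intros E (n & g & R & HR & Hg & H). exists n, g, R. repeat split; auto.
  intros z Hz. rewrite -E. auto.
Qed.

Lemma mero_simple_pole c a p : mero_at (fun z => c / (z - a))%C p.
Proof.
  destruct (classic (p = a)) as [->|Hne].
  - exists 1%nat, (fun _ => c), 1. split; [lra|]. split.
    + intros z _. exists (RtoC 0). apply (diffg_const (X := C_UniformSpace) (fun w => w) c z).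
    + intros z Hz. simpl. f_equal. ring.
  - apply (holo_mero _ _ (Cmod (p - a)%C)); [now apply Cmod_sub_pos|]. intros z Hz.
    eexists. apply (diffg_div _ cid_cont); [apply diffg_const| |].
    + apply (diffg_minus _ cid_cont); [apply diffg_iota|apply diffg_const].
    + apply sub_neq_0. intros ->. rewrite Cmod_sub_sym in Hz. lra.
Qed.

Lemma re_disc (p z : C) r : Cmod (z - p)%C < r -> Re p - r < Re z < Re p + r.
Proof.
  intros H. pose proof (re_le_Cmod (z - p)%C) as K. destruct z, p. simpl in *.
  apply Rabs_le_between in K. lra.
Qed.

Lemma re_segment (a b : C) t : Re (a + RtoC t * (b - a))%C = (1 - t) * Re a + t * Re b.
Proof. destruct a, b; simpl. ring. Qed.

(** The identity theorem only compares the functions off [s], and the value of [f] at a pole would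
    be arbitrary. A pole is excluded because [g w = W w (w - s)^n] would tend to 0, against
    [g s <> 0]. *)
Lemma eq_of_zero_near (f W : C -> C) s l :
  holomorphic_at f s \/ pole_at f s -> cdiff W s l -> zero_near (fun z => f z - W z)%C s -> f s = W s.
Proof.
  intros Hf HW (d & Hd & H0). apply cdiff_cont in HW.
  assert (E : forall z, 0 < Cmod (z - s)%C < d -> f z = W z).
  { intros z Hz. specialize (H0 z Hz). transitivity (f z - W z + W z)%C; [ring|]. rewrite H0. ring. }
  assert (Hpunct : forall (h : C -> C) (v : C), clim h (@locally C_UniformSpace s) v ->
    clim h (@locally' C_UniformSpace s) v).
  { intros h v Hh e He. change (@locally C_UniformSpace s (fun w => w <> s -> Cmod (h w - v)%C < e)).
    generalize (Hh e He). apply filter_imp. auto. }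
  assert (Hnear : forall r, 0 < r -> @locally' C_UniformSpace s (fun w => 0 < Cmod (w - s)%C < r)).
  { intros r Hr. change (@locally C_UniformSpace s (fun w => w <> s -> 0 < Cmod (w - s)%C < r)).
    generalize (locally_C s r Hr). apply filter_imp. intros w Hw Hne. split; [now apply Cmod_sub_pos|exact Hw]. }
  destruct Hf as [Hf|Hf].
  - destruct (holomorphic_at_disc _ _ Hf) as (r & Hr & Hfd).
    destruct (Hfd s) as [m Hm]; [rewrite Cmod_self_sub; lra|]. apply cdiff_cont in Hm.
    apply (clim_unique (FF := locally'_C_proper s) (@locally' C_UniformSpace s) f); [now apply Hpunct|].
    apply clim_ext_loc with W; [typeclasses eauto| |now apply Hpunct].
    generalize (Hnear d Hd). apply filter_imp. intros w Hw. symmetry. now apply E.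
  - exfalso. destruct Hf as (n & g & r & Hn & Hr & Hg & Hg0 & Ep).
    destruct (holomorphic_at_disc _ _ Hg) as (r' & Hr' & Hgd).
    destruct (Hgd s) as [m Hm]; [rewrite Cmod_self_sub; lra|]. apply cdiff_cont in Hm.
    apply Hg0. apply (clim_unique (FF := locally'_C_proper s) (@locally' C_UniformSpace s) g); [now apply Hpunct|].
    destruct n as [|n]; [lia|].
    destruct (cdiff_pow_line s (S n) s) as [k Hk]. apply cdiff_cont in Hk.
    assert (HP : clim (fun w => W w * (w - s) ^ S n)%C (@locally C_UniformSpace s) (W s * (s - s) ^ S n)%C)
      by (apply clim_mult; [typeclasses eauto|exact HW|exact Hk]).
    apply clim_eq with (W s * (s - s) ^ S n)%C; [simpl; ring|].
    apply clim_ext_loc with (fun w => W w * (w - s) ^ S n)%C; [typeclasses eauto| |now apply Hpunct].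
    assert (Hdr : 0 < Rmin d r) by (apply Rmin_pos; lra).
    generalize (Hnear _ Hdr). apply filter_imp. intros w Hw.
    pose proof (Rmin_l d r). pose proof (Rmin_r d r).
    rewrite -E; [|lra]. rewrite Ep; [|lra]. field. apply Cpow_nz, sub_pos_neq. lra.
Qed.

(** The [k]-th zero has modulus at least [ceil (k / 2) r1], which costs the factor [2]
    with respect to the zeta series; the second zero gives the strict inequality. *)
Lemma zero_power_sum (zk : nat -> C) r1 c : 0 < c -> 0 < r1 < 3 * PI ->
  (forall k, 2 * PI * INR (S k) < Im (zk k)) -> (forall k, r1 <= Cmod (zk k)) ->
  exists gap, 0 < gap /\ forall m,
    sum_n (fun k => Rpower (Cmod (zk k)) (- (c + 1))) (S (2 * m)) <=
      2 * Rpower r1 (- (c + 1)) * sum_n (zeta_term c) m - gap.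
Proof.
  intros Hc Hr Hi Hge. pose proof PI_bounds as HPI.
  set (b := fun k => Rpower (Cmod (zk k)) (- (c + 1))). set (q := Rpower r1 (- (c + 1))).
  assert (Hmod : forall k, 2 * PI * INR (S k) <= Cmod (zk k)).
  { intros k. left. eapply Rlt_le_trans; [apply Hi|]. eapply Rle_trans; [apply Rle_abs|apply im_le_Cmod]. }
  assert (Hterm : forall k j, INR (S j) * r1 <= Cmod (zk k) -> b k <= q * zeta_term c j).
  { intros k j H. unfold q, zeta_term. assert (Hj : 0 < INR (S j)) by (apply lt_0_INR; lia).
    rewrite Rpower_mult_distr //; [|lra]. apply Rpower_anti; [lra|]. rewrite (Rmult_comm r1). nra. }
  (* The zeros of indices 0 and 1 are both compared with the first zeta term; the latter has modulus
     above [4 PI > r1], which gains a fixed positive amount. *)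
  exists (q - b 1%nat). split.
  - unfold q, b, Rpower. apply Rlt_0_minus, exp_increasing.
    assert (Hm1 := Hmod 1%nat). simpl INR in Hm1.
    assert (ln r1 < ln (Cmod (zk 1%nat))) by (apply ln_increasing; lra). nra.
  - induction m as [|m IH].
    + replace (S (2 * 0)) with 1%nat by lia. rewrite sum_Sn !sum_O. change plus with Rplus. cbv beta.
      assert (b 0%nat <= q * zeta_term c 0) by (apply Hterm; simpl; rewrite Rmult_1_l; apply Hge).
      assert (E0 : zeta_term c 0 = 1) by (unfold zeta_term; simpl; apply Rpower_base_1).
      rewrite E0 in H. rewrite E0. fold (b 0%nat) (b 1%nat). lra.
    + replace (S (2 * S m)) with (S (S (S (2 * m)))) by lia.
      rewrite !(sum_Sn _ (S _)) (sum_Sn (zeta_term c) m). change plus with Rplus. cbv beta.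
      assert (Hm2 := Hmod (S (S (2 * m)))). assert (Hm3 := Hmod (S (S (S (2 * m))))).
      assert (E1 : INR (S (S (S (2 * m)))) = 2 * INR m + 3) by (rewrite !S_INR mult_INR; simpl; ring).
      assert (E2 : INR (S (S (S (S (2 * m))))) = 2 * INR m + 4) by (rewrite S_INR E1; ring).
      assert (E3 : INR (S (S m)) = INR m + 2) by (rewrite !S_INR; ring).
      rewrite E1 in Hm2. rewrite E2 in Hm3. pose proof (pos_INR m) as Hm0.
      (* At [m = 0] this reads [2 r1 <= 6 PI]: the bound [3 PI] on [r1] is just what the third zero
         requires. *)
      assert (b (S (S (2 * m))) <= q * zeta_term c (S m)) by (apply Hterm; rewrite E3; nra).
      assert (b (S (S (S (2 * m)))) <= q * zeta_term c (S m)) by (apply Hterm; rewrite E3; nra).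
      fold (b (S (S (2 * m)))) (b (S (S (S (2 * m))))). lra.
Qed.

Lemma sum_n_le_double (b : nat -> R) n k : (forall k, 0 <= b k) -> sum_n b n <= sum_n b (n + k).
Proof.
  intros Hb. induction k as [|k IH]; [rewrite Nat.add_0_r; lra|].
  rewrite Nat.add_succ_r sum_Sn. change plus with Rplus. cbv beta. specialize (Hb (S (n + k))). lra.
Qed.

Theorem theorem4p3 (zeta2 : C -> C) (z1 : C) (r1 theta1 : R)
    (Hzeta2 : is_zeta2 zeta2)
    (Hr1 : 0 < r1) (Htheta1 : 0 < theta1 < PI)
    (Hpolar : z1 = (RtoC r1 * Cexp (Ci * RtoC theta1))%C)
    (Hz1 : smallest_upper_zero z1) :
  forall s : C, Re s < 0 ->
    Cmod (zeta2 s) <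
      4 * Rpower r1 (Re s - 1) * Cmod (Gamma (- s)%C)
        * exp (Rabs (Im s) * (PI - theta1)) * Rzeta (1 - Re s).
Proof.
  intros s Hs. destruct Hzeta2 as [Hmero Hright].
  destruct zero_sequence as (zk & Hzk & Hzk_im & Hzk_all).
  pose proof (zk_im_ge zk Hzk_im) as Hge.
  destruct inv_expm1x_at_0 as (c1 & c2 & g0 & r0 & Hr0 & Hg0 & E0).
  assert (Hpole0 : regular (fun z => / expm1x z - pole0 c1 c2 z)%C 0).
  { exists g0, r0. split; [exact Hr0|]. split; [exact Hg0|]. intros w Hw.
    replace (w - 0)%C with w in Hw by ring. rewrite E0 //. unfold pole0. ring. }
  assert (HSf : forall w, exists l, Re w < 0 -> csum (fun k => zero_term (zk k) w) l).
  { intros w. destruct (Rlt_dec (Re w) 0) as [Hw|Hw].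
    - destruct (zero_series_ex zk Hzk Hge w Hw) as [l Hl]. now exists l.
    - exists (RtoC 0). tauto. }
  apply choice in HSf. destruct HSf as [Sf HSf].
  assert (Hopp : forall w : C, Re (- w)%C = - Re w) by (intros w; destruct w; reflexivity).
  assert (Hadd : forall w : C, Re (w + 1)%C = Re w + 1) by (intros w; destruct w; reflexivity).
  set (W := fun w => (Gamma (- w) * Sf w)%C).
  assert (HW : forall w, Re w < 0 -> exists l, cdiff W w l).
  { intros w Hw. destruct (zero_series_cdiff zk Hge Sf w Hw HSf) as [l1 L1].
    destruct (Gamma_cdiff (- w)%C) as [l2 L2]; [rewrite Hopp; lra|].
    eexists. apply (diffg_mult _ cid_cont); [|exact L1].
    apply (diffg_comp (X := C_UniformSpace) _ cid_cont Gamma (fun z => - z)%C); [exact L2|].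
    apply (diffg_ext (X := C_UniformSpace) _ (fun z => - (1) * z)%C); [intros; ring|].
    apply (diffg_scal _ cid_cont), diffg_iota. }
  assert (HG1 : forall p, -1 < Re p -> mero_at (fun z => Gamma (z + 1))%C p).
  { intros p Hp. apply (holo_mero _ _ (Re p + 1)); [lra|]. intros z Hz. apply re_disc in Hz.
    destruct (Gamma_cdiff (z + 1)%C) as [l L]; [rewrite Hadd; lra|]. eexists.
    apply (diffg_comp (X := C_UniformSpace) _ cid_cont Gamma (fun z => z + 1)%C); [exact L|].
    apply diffg_plus; [apply diffg_iota|apply diffg_const]. }
  (* Clearing the denominator [Gamma (z + 1)] gives a function meromorphic on [-1 < Re z], where
     Euler's integral for [Gamma (z + 1)] is holomorphic. *)
  set (h1 := fun z => (zeta2 z * Gamma (z + 1) - kernel_mellin c1 c2 z)%C).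
  assert (Hm1 : forall p, -1 < Re p -> mero_at h1 p).
  { intros p Hp. apply mero_ext with (fun z => (zeta2 z * Gamma (z + 1) - mellin (regular_part c1 c2) z)
      - Gamma (z + 1) * (c2 / (z - 1) - (- c1) / (z - 0)))%C.
    { intros z. unfold h1, kernel_mellin. replace (z - 0)%C with z by ring. unfold Cdiv. ring. }
    apply mero_minus; [apply mero_minus|].
    - apply mero_mult; [apply holomorphic_or_pole_mero, Hmero|now apply HG1].
    - apply (holo_mero _ _ (Re p + 1)); [lra|]. intros z Hz. apply re_disc in Hz.
      apply regular_part_cdiff; [exact Hpole0|lra].
    - apply mero_mult; [now apply HG1|]. apply mero_minus; apply mero_simple_pole. }
  (* The unit disc around 2 lies in [1 < Re z], where the defining integral is available. *)
  assert (Hz2 : zero_near h1 2).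
  { exists 1. split; [lra|]. intros z [_ Hz]. apply re_disc in Hz. simpl in Hz. unfold h1.
    rewrite Hright; [|lra]. unfold zeta2_half_plane.
    rewrite (kernel_mellin_right c1 c2 Hpole0); [|lra].
    pose proof (Gamma_neq_0 (z + 1)%C ltac:(rewrite Hadd; lra)). field. auto. }
  (* The point [- 1 / 2] lies both in the half-plane [-1 < Re z] of [h1] and in the half-plane
     [Re z < 0] of [W]: the identity theorem is used once in each. *)
  assert (Hhalf : zero_near h1 (RtoC (- / 2))).
  { apply identity_segment with (RtoC 2); [|exact Hz2]. intros t Ht. apply Hm1.
    rewrite re_segment. simpl. lra. }
  assert (Hm2 : forall p, Re p < 0 -> mero_at (fun z => zeta2 z - W z)%C p).
  { intros p Hp. apply mero_minus; [apply holomorphic_or_pole_mero, Hmero|].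
    apply (holo_mero _ _ (- Re p)); [lra|]. intros z Hz. apply re_disc in Hz. apply HW. lra. }
  assert (Hhalf2 : zero_near (fun z => zeta2 z - W z)%C (RtoC (- / 2))).
  { destruct Hhalf as (d & Hd & H). pose proof (Rmin_l d (/ 2)). pose proof (Rmin_r d (/ 2)).
    exists (Rmin d (/ 2)). split; [apply Rmin_pos; lra|]. intros z Hz.
    specialize (H z ltac:(lra)). assert (Hz' : Cmod (z - RtoC (- / 2))%C < / 2) by lra.
    apply re_disc in Hz'. simpl in Hz'.
    unfold h1 in H.
    rewrite (kernel_mellin_series zk Hzk Hzk_im Hzk_all c1 c2 Hpole0 z (Sf z) ltac:(lra) (HSf z ltac:(lra))) in H.
    pose proof (Gamma_neq_0 (z + 1)%C ltac:(rewrite Hadd; lra)) as HG.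
    unfold W. transitivity ((zeta2 z * Gamma (z + 1) - Gamma (z + 1) * Gamma (- z) * Sf z) / Gamma (z + 1))%C;
      [field; exact HG|]. rewrite H. unfold Cdiv. ring. }
  assert (Hs2 : zero_near (fun z => zeta2 z - W z)%C s).
  { apply identity_segment with (RtoC (- / 2)); [|exact Hhalf2]. intros t Ht. apply Hm2.
    rewrite re_segment. simpl. nra. }
  destruct (HW s Hs) as [l Hl].
  rewrite (eq_of_zero_near zeta2 W s l (Hmero s) Hl Hs2). unfold W. rewrite Cmod_mult.
  pose proof (Gamma_neq_0 (- s)%C ltac:(rewrite Hopp; lra)) as HGs. apply Cmod_gt_0 in HGs.
  assert (Ez1 : z1 = ((r1 * cos theta1)%R, (r1 * sin theta1)%R)).
  { rewrite Hpolar. unfold Cexp. apply C_eq; simpl;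
    replace (0 * theta1 - 1 * 0) with 0 by ring; replace (0 * 0 + 1 * theta1) with theta1 by ring;
    rewrite exp_0; ring. }
  assert (Hsin : 0 < sin theta1) by (apply sin_gt_0; lra).
  assert (Er1 : Cmod z1 = r1).
  { rewrite Hpolar Cmod_mult Cmod_Cexp Cmod_R Rabs_pos_eq; [|lra]. simpl.
    replace (0 * theta1 - 1 * 0) with 0 by ring. rewrite exp_0. ring. }
  assert (Hr13 : r1 < 3 * PI) by (rewrite -Er1; now apply smallest_zero_modulus).
  destruct Hz1 as [Hz1u Hz1min].
  assert (Hmin : forall k, r1 <= Cmod (zk k)) by (intros k; rewrite -Er1; now apply Hz1min).
  (* The quotient [Re z1 / Im z1] is the cotangent of [theta1], and [PI / 2 + atan (Re z / Im z)] is
     [PI] minus the argument of [z]. *)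
  assert (Hangle : forall k, PI / 2 + atan (Re (zk k) / Im (zk k)) <= PI - theta1).
  { intros k. assert (Ht : Re z1 / Im z1 = tan (PI / 2 - theta1)).
    { rewrite Ez1. simpl. unfold tan. rewrite sin_shift cos_shift. field. lra. }
    pose proof (upper_zero_angle z1 (zk k) Hz1u (Hzk k) (Hz1min _ (Hzk k))) as H. rewrite Ht in H.
    assert (atan (Re (zk k) / Im (zk k)) <= PI / 2 - theta1); [|lra].
    rewrite -(atan_tan (PI / 2 - theta1)); [|lra].
    destruct H as [H|H]; [left; now apply atan_increasing|right; now rewrite H]. }
  set (c := - Re s). assert (Hc : 0 < c) by (unfold c; lra).
  replace (Re s - 1) with (- (c + 1)) by (unfold c; ring).
  assert (EZ : Rzeta (1 - Re s) = Series (zeta_term c)).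
  { apply Series_ext. intros n. unfold zeta_term. rewrite -Rpower_Ropp. f_equal. unfold c. ring. }
  rewrite EZ.
  destruct (zero_power_sum zk r1 c Hc ltac:(lra) (fun k => proj1 (Hzk_im k)) Hmin) as (gap & Hgap & Hsum).
  set (X := exp (Rabs (Im s) * (PI - theta1))). set (q := Rpower r1 (- (c + 1))) in *.
  set (b := fun k => Rpower (Cmod (zk k)) (- (c + 1))) in *.
  assert (HX : 0 < X) by apply exp_pos. assert (Hq : 0 < q) by apply Rpower_pos.
  assert (Hb0 : forall k, 0 <= b k) by (intros k; left; apply Rpower_pos).
  assert (Hterm : forall k, Cmod (zero_term (zk k) s) <= 2 * X * b k).
  { intros k. eapply Rle_trans; [apply zero_term_bound; apply (Hzk k)|].
    replace (Re s - 1) with (- (c + 1)) by (unfold c; ring). fold (b k).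
    rewrite (Rmult_comm _ (b k)) !Rmult_assoc (Rmult_comm (b k)) -!Rmult_assoc.
    apply Rmult_le_compat_r; [apply Hb0|]. apply Rmult_le_compat_l; [lra|].
    apply exp_le. apply Rmult_le_compat_l; [apply Rabs_pos|apply Hangle]. }
  assert (HZ : forall m, sum_n (zeta_term c) m <= Series (zeta_term c)).
  { intros m. apply sum_le_Series; [intros k; left; apply zeta_term_pos|now apply ex_series_zeta]. }
  assert (Hpart : forall n, Cmod (psum (fun k => zero_term (zk k) s) (S n)) <= 2 * X * sum_n b n).
  { induction n as [|n IH].
    - rewrite sum_O. simpl. rewrite Cplus_0_l. apply Hterm.
    - rewrite sum_Sn. change plus with Rplus. cbv beta.
      change (psum (fun k => zero_term (zk k) s) (S (S n)))
        with (psum (fun k => zero_term (zk k) s) (S n) + zero_term (zk (S n)) s)%C.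
      eapply Rle_trans; [apply Cmod_triangle|]. rewrite Rmult_plus_distr_l.
      apply Rplus_le_compat; [exact IH|apply Hterm]. }
  assert (HSs : Cmod (Sf s) <= 2 * X * (2 * q * Series (zeta_term c) - gap)).
  { apply (clim_le eventually _ _ _ (HSf s Hs)). exists 1%nat. intros n Hn.
    destruct n as [|n]; [lia|]. eapply Rle_trans; [apply Hpart|].
    apply Rmult_le_compat_l; [lra|].
    (* The partial sum is prolonged to the index [n + S n = S (2 * n)], an even number of terms,
       where the pairing of zeros applies. *)
    eapply Rle_trans; [apply (sum_n_le_double b n (S n) Hb0)|].
    replace (n + S n)%nat with (S (2 * n)) by lia.
    eapply Rle_trans; [apply Hsum|]. specialize (HZ n). nra. }
  (* The positive [gap], uniform in the partial sums, survives the limit and makes the inequality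
     strict. *)
  assert (Hfin : Cmod (Sf s) < 4 * X * q * Series (zeta_term c)) by nra.
  replace (4 * q * Cmod (Gamma (- s)%C) * X * Series (zeta_term c))
    with (Cmod (Gamma (- s)%C) * (4 * X * q * Series (zeta_term c))) by ring.
  now apply Rmult_lt_compat_l.
Qed.
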